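(* Let $p>1$ and $T>0$, and let $(M_t)_{t\in[0,T]}$ be an $L^p$-martingale such that $M_t$ is $\sigma(X_t)$-measurable for all $t\in[0,T]$ (i.e. $M_t=g(t,X_t)$ for some function $g$). For $\alpha\in\mathbb{N}^d$ define $$b_\alpha:=\frac{E[M_tH_\alpha(t,X_t)]}{\|H_\alpha(t,X_t)\|_2^2}=\frac{E[M_tH_\alpha(t,X_t)]}{\alpha!\,t^{|\alpha|}},\qquad t\in(0,T]$$ (a quantity not depending on $t$). Then the function $f:\mathbb{C}^d\to\mathbb{C}$, $f(z):=\sum_{\alpha\in\mathbb{N}^d}b_\alpha z^\alpha$, is well defined, is analytic of order $2$, and can be represented for all $z\in\mathbb{C}^d$ and $t\in(0,T]$ as $$f(z)=E\left[M_t\exp\left(\frac1t\left(z\cdot X_t-\frac{z^Tz}{2}\right)\right)\right].$$ Moreover, let $0 \le S<(p\vee p^\ast)^{-1}T$, where $p^\ast=\frac{p}{p-1}$ is the conjugate exponent of $p$. Then $(f(Z_s))_{s\in[0,S]}$ is an $L^p$-martingale such that $$\big(f(Z_s)\big)^{\mathcal{P}^X}=M_s,\qquad s\in[0,S].$$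
   Context: $(\Omega,\mathcal{F},P)$ is a complete probability space; $X,Y$ are two independent $d$-dimensional Brownian motions on it (started at $0$); $Z=X+iY$. $\mathbb{F}=(\mathcal{F}_t)$ is the augmented filtration generated by $Z$; martingales are with respect to $\mathbb{F}$. $\mathbb{F}^X$ is the filtration generated by $X$, augmented by the $P$-nullsets from $\mathbb{F}$. An $L^p$-martingale is a martingale with $M_t\in L^p=L^p(\Omega,\mathcal{F},P)$ for each $t$ in the index set; $\|\cdot\|_p$ is the norm of $L^p$. $\mathbb{N}$ includes $0$; for $\alpha\in\mathbb{N}^d$, $|\alpha|=\sum_i\alpha_i$, $\alpha!=\prod_i\alpha_i!$, $z^\alpha=\prod_i z_i^{\alpha_i}$. For $z\in\mathbb{C}^d$, $x\in\mathbb{R}^d$: $z\cdot x=\sum_iz_ix_i$ and $z^Tz=\sum_iz_i^2$. $H_\alpha(t,x)=\prod_{i=1}^dH_{\alpha_i}(t,x_i)$, where $\exp\left(\lambda x-\tfrac12\lambda^2t\right)=\sum_{n\ge0}\frac{\lambda^n}{n!}H_n(t,x)$. ''Analytic of order $2$'' means: $f$ is entire on $\mathbb{C}^d$ and there are constants $C,c>0$ with $|f(z)|\le C e^{c|z|^2}$ for all $z\in\mathbb{C}^d$. Predictable projection: for a filtration $\mathbb{G}=(\mathcal{G}_t)$ and a measurable process $L$ (positive or bounded), the predictable projection of $L$ on $\mathbb{G}$ is the unique (up to evanescent sets) process $\widetilde L$, measurable with respect to the predictable $\sigma$-field of $\mathbb{G}$, such that $E[L_\tau\mid\mathcal{G}_{\tau-}]=\widetilde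 L_\tau$ $P$-a.s. on $\{\tau<\infty\}$ for every predictable $\mathbb{G}$-stopping time $\tau$. For other (possibly unbounded, complex-valued) processes the same defining property is used. $L^{\mathcal{P}^X}$ denotes the predictable projection of $L$ on $\mathbb{F}^X$, $(L_s)^{\mathcal{P}^X}$ its value at time $s$; the equality $(f(Z_s))^{\mathcal{P}^X}=M_s$ is understood $P$-a.s. for each $s$. *)

(* Defs.v *)
From HB Require Import structures.
From mathcomp Require Import all_boot all_order all_algebra.
From mathcomp Require Import complex.
From mathcomp Require Import all_classical all_reals all_analysis.
From mathcomp Require Import summability.

Set Implicit Arguments.
Unset Strict Implicit.
Unset Printing Implicit Defensive.

Import Order.TTheory GRing.Theory Num.Theory ComplexField.Normc.
Import numFieldNormedType.Exports.

Local Open Scope classical_set_scope.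
Local Open Scope ring_scope.
Local Open Scope complex_scope.

(* For K = R[i] this is complex (Frechet) differentiability everywhere. *)
Definition entire (K : numFieldType) d (f : 'rV[K]_d -> K) : Prop :=
  forall z : 'rV[K]_d, differentiable f z.

(* limit of the partial sums along the net of finite subsets of I *)
Definition sums_to (K : numFieldType) (I : choiceType) (a : I -> K) (s : K) :
    Prop :=
  partial_sum a @ totally --> s.

Section complex_vectors.
Context {R : realType}.

Definition cexp (z : R[i]) : R[i] :=
  (expR (complex.Re z))%:C * (cos (complex.Im z) +i* sin (complex.Im z)).

Definition cvec d (x y : 'rV[R]_d) : 'rV[R[i]]_d :=
  \row_i (x ord0 i +i* y ord0 i).

(* C^d as R^(d+d). *)
Definition realify d (z : 'rV[R[i]]_d) : 'rV[R]_(d + d) :=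
  row_mx (map_mx (@complex.Re R) z) (map_mx (@complex.Im R) z).

Definition cdot d (z : 'rV[R[i]]_d) (x : 'rV[R]_d) : R[i] :=
  \sum_(i < d) z ord0 i * (x ord0 i)%:C.

(* z^T z, without conjugation *)
Definition csqr d (z : 'rV[R[i]]_d) : R[i] := \sum_(i < d) z ord0 i ^+ 2.

Definition multi_index d := {ffun 'I_d -> nat}.
Definition mabs d (a : multi_index d) : nat := (\sum_(i < d) a i)%N.
Definition mfact d (a : multi_index d) : nat := (\prod_(i < d) (a i)`!)%N.
Definition mpow d (z : 'rV[R[i]]_d) (a : multi_index d) : R[i] :=
  \prod_(i < d) z ord0 i ^+ a i.

Definition has_sum (I : choiceType) (a : I -> R[i]) (s : R[i]) : Prop :=
  esum.summable [set: I] (fun i => (normc (a i))%:E) /\ sums_to a s.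

Definition analytic_of_order2 d (f : 'rV[R[i]]_d -> R[i]) : Prop :=
  entire f /\
  exists C c : R, [/\ 0 < C, 0 < c & forall z : 'rV[R[i]]_d,
    normc (f z) <= C * expR (c * \sum_(i < d) normc (z ord0 i) ^+ 2)].

(* The Hermite polynomials are the coefficients of their generating function;
   uniqueness of power series coefficients makes this determine H. *)
Definition hermite_family (H : nat -> R -> R -> R) : Prop :=
  forall t x l : R,
    series (fun n => l ^+ n / (n`!)%:R * H n t x) @ \oo -->
      expR (l * x - l ^+ 2 * t / 2).

Definition mhermite (H : nat -> R -> R -> R) d (a : multi_index d)
    (t : R) (x : 'rV[R]_d) : R := \prod_(i < d) H (a i) t (x ord0 i).

End complex_vectors.

Section sigma_fields.
Context {R : realType} {T : Type}.

(* Measurability, on D, with respect to a sigma-field G given as a set of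
   sets, for the Borel sigma-field of the complex plane. *)
Definition cmeasurable (D : set T) (G : set (set T)) (f : T -> R[i]) : Prop :=
  preimage_set_system D (fun x => complex.Re (f x)) measurable `<=` G /\
  preimage_set_system D (fun x => complex.Im (f x)) measurable `<=` G.

Definition history d (U : R -> T -> 'rV[R]_d) (D : set R) : set (set T) :=
  \bigcup_(t in D) \bigcup_(i in [set: 'I_d])
    preimage_set_system setT (fun w => U t w ord0 i) measurable.

Definition sigma_of d (U : R -> T -> 'rV[R]_d) (D : set R) : set (set T) :=
  <<s history U D >>.

End sigma_fields.

Section probability.
Context {R : realType} {disp : measure_display} {Omega : measurableType disp}.
Variable P : probability Omega R.

Definition independent (I : finType) (G : I -> set (set Omega)) : Prop :=
  forall (J : {set I}) (A : I -> set Omega), (forall i, i \in J -> G i (A i)) ->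
    P (\bigcap_(i in [set` J]) A i) = (\prod_(i in J) P (A i))%E.

(* One-dimensional standard Brownian motion on the time set [0, +oo[; the
   values at negative times are irrelevant. *)
Definition brownian_motion1 (W : R -> Omega -> R) : Prop :=
  [/\ forall t, 0 <= t -> measurable_fun setT (W t),
      {ae P, forall w, W 0 w = 0 /\
        {within `[0, +oo[, continuous (fun t => W t w)}},
      forall s t, 0 <= s -> s < t -> forall B : set R, measurable B ->
        P ((fun w => W t w - W s w) @^-1` B) =
        normal_prob 0 (Num.sqrt (t - s)) B
    & forall (m : nat) (t : nat -> R), 0 <= t 0%N ->
        {homo t : i j / (i <= j)%N >-> i <= j} ->
        independent (fun k : 'I_m => preimage_set_system setT
          (fun w => W (t k.+1) w - W (t k) w) measurable)].

Definition brownian_motion d (X : R -> Omega -> 'rV[R]_d) : Prop :=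
  (forall i, brownian_motion1 (fun t w => X t w ord0 i)) /\
  independent (fun i : 'I_d =>
    sigma_of (fun t w => (X t w ord0 i)%:M : 'rV[R]_1) `[0, +oo[).

Definition independent_processes d e (X : R -> Omega -> 'rV[R]_d)
    (Y : R -> Omega -> 'rV[R]_e) : Prop :=
  independent (fun k : bool =>
    if k then sigma_of X `[0, +oo[ else sigma_of Y `[0, +oo[).

Definition augmented_filtration d (U : R -> Omega -> 'rV[R]_d) (t : R) :
    set (set Omega) :=
  <<s history U `[0, t] `|` P.-negligible >>.

Definition cintegrable (f : Omega -> R[i]) : Prop :=
  P.-integrable setT (fun w => (complex.Re (f w))%:E) /\
  P.-integrable setT (fun w => (complex.Im (f w))%:E).

Definition cexpectation (f : Omega -> R[i]) : R[i] :=
  fine ('E_P[fun w => complex.Re (f w)])%E +i*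
  fine ('E_P[fun w => complex.Im (f w)])%E.

Definition is_cond_expectation (G : set (set Omega)) (f V : Omega -> R[i]) :
    Prop :=
  [/\ cintegrable f, cintegrable V, cmeasurable setT G V
    & forall A, G A ->
      (\int[P]_(w in A) (complex.Re (V w))%:E =
       \int[P]_(w in A) (complex.Re (f w))%:E)%E /\
      (\int[P]_(w in A) (complex.Im (V w))%:E =
       \int[P]_(w in A) (complex.Im (f w))%:E)%E].

Definition in_Lp (p : R) (f : Omega -> R[i]) : Prop :=
  cmeasurable setT measurable f /\ (fun w => normc (f w)) \in Lfun P p%:E.

(* L^p-martingale on the time set [0, S] *)
Definition Lp_martingale (F : R -> set (set Omega)) (p S : R)
    (M : R -> Omega -> R[i]) : Prop :=
  [/\ forall t, 0 <= t <= S -> cmeasurable setT (F t) (M t),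
      forall t, 0 <= t <= S -> in_Lp p (M t)
    & forall s t, 0 <= s -> s <= t -> t <= S ->
        is_cond_expectation (F s) (M t) (M s)].

(* Here the time set is [0, S]: the predictable sigma-field lives on
   [0, S] x Omega, and random times have values in [0, S] or are +oo. *)
Section predictable.
Variables (S : R) (G : R -> set (set Omega)).

Definition predictable_sigma : set (set (R * Omega)) :=
  <<s `[0, S] `*` setT,
    [set [set 0] `*` A | A in G 0] `|`
    [set B | exists s t A,
      [/\ 0 <= s, s < t, t <= S, G s A & B = `]s, t] `*` A]] >>.

(* tau is predictable when the stochastic interval [[tau, S]] is; this implies
   that tau is a stopping time. *)
Definition predictable_time (tau : Omega -> \bar R) : Prop :=
  (forall w, (0 <= tau w <= S%:E)%E \/ tau w = +oo%E) /\
  predictable_sigma [set x | 0 <= x.1 <= S /\ (tau x.2 <= x.1%:E)%E].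

(* G_{tau-}, with the convention G_{0-} = G_0 *)
Definition sigma_before (tau : Omega -> \bar R) : set (set Omega) :=
  <<s G 0 `|` [set B | exists t A,
      [/\ 0 <= t, t <= S, G t A & B = A `&` [set w | (t%:E < tau w)%E]]] >>.

Definition is_predictable_projection (L N : R -> Omega -> R[i]) : Prop :=
  cmeasurable (`[0, S] `*` setT) predictable_sigma (fun x => N x.1 x.2) /\
  forall tau, predictable_time tau ->
    exists2 V, is_cond_expectation (sigma_before tau)
        (fun w => if (tau w < +oo)%E then L (fine (tau w)) w else 0) V
      & {ae P, forall w, (tau w < +oo)%E -> V w = N (fine (tau w)) w}.

End predictable.

End probability.

(* Main.v *)
Require Import Defs.
From HB Require Import structures.
From mathcomp Require Import all_boot all_order all_algebra.
From mathcomp Require Import complex finmap.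
From mathcomp Require Import all_classical all_reals all_analysis.
From mathcomp Require Import summability.
From mathcomp Require Import measurable_realfun ring lra.

Set Implicit Arguments.
Unset Strict Implicit.
Unset Printing Implicit Defensive.

Import Order.TTheory GRing.Theory Num.Theory ComplexField.Normc.
Import numFieldNormedType.Exports.

Local Open Scope classical_set_scope.
Local Open Scope ring_scope.
Local Open Scope complex_scope.

(** The idea. Write xi = M_T, which is a function of X_T. For 0 <= s < T the conditional law
of X_s given X_T = u has density [pbridge T s x u] with respect to the law N(0, s) of X_s, and
the same expression, as a function of u, is the density of the law of X_T given X_s = x with
respect to N(0, T). Averaging xi against it gives [bridge_transform s x], and [terminal_bridge]
says that M_s = bridge_transform s X_s almost surely. At s = 0 the density is
exp((x.u - x^T x / 2) / T), whose analytic continuation in x is [pkernel T z u]. So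
f(z) = E[xi * pkernel T z X_T] ([transform], [f_of]) is the entire function of the theorem.

Everything then follows from pointwise identities in u, integrated against xi by Fubini.
- For fixed u, pkernel T Z_t u is a martingale, since the generator of X + iY kills holomorphic
  functions ([kernel_martingale], proved by averaging the increments of Y and then those of X);
  hence f(Z_t) is a martingale ([f_martingale]).
- Averaging Y alone out of pkernel T (X_s + i Y_s) u gives pbridge T s X_s u ([kernel_bridge]);
  hence E[f(Z_s) | F^X_s] = M_s ([bridge_X_projection]).
- Expanding the kernel in Hermite polynomials gives the power series of f
  ([transform_has_sum]), and the kernel pbridge maps the Hermite polynomials at time s to those
  at time T ([pbridge_hermite]), so that the coefficients do not depend on t ([transform_eq]).
- Hoelder's inequality with the exact Gaussian norms of the kernel bounds |f(x + iy)| by a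
  multiple of exp((q - 1) x^2 / 2T + y^2 / 2T), q the conjugate exponent of p ([normc_transform_le]). This is growth of order
  2, and the bound for |f(Z_s)|^p is integrable for s max(p, q) < T.

The Gaussian identities for complex arguments are reduced to real exponential integrals: both
sides are entire power series in the argument, with the Hermite polynomials as coefficients,
and uniqueness of the coefficients transfers the real identity ([gaussian_hermite]).

For the predictable projection, the process bridge_transform t X_t has continuous paths, hence
is predictable as the limit of its samples at left grid points. A predictable time tau is a
stopping time, because sections of predictable sets are adapted. Optional sampling at tau,
first for f(Z) and then for bridge_transform t X_t, reduces the defining equation of the
projection to the deterministic time S ([sampled_projection]). Applied to constant times, the
almost sure uniqueness of conditional expectations identifies any projection with M
([projection_value]). *)

(** * Complex numbers and power series *)

Section complex_numbers.
Context {R : realType}.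
Implicit Types z w : R[i].

Lemma ReD z w : complex.Re (z + w) = complex.Re z + complex.Re w.
Proof. by case: z w => ? ? []. Qed.
Lemma ImD z w : complex.Im (z + w) = complex.Im z + complex.Im w.
Proof. by case: z w => ? ? []. Qed.
Lemma ReN z : complex.Re (- z) = - complex.Re z.
Proof. by case: z. Qed.
Lemma ImN z : complex.Im (- z) = - complex.Im z.
Proof. by case: z. Qed.
Lemma ReM z w : complex.Re (z * w) =
  complex.Re z * complex.Re w - complex.Im z * complex.Im w.
Proof. by case: z w => ? ? []. Qed.
Lemma ImM z w : complex.Im (z * w) =
  complex.Re z * complex.Im w + complex.Im z * complex.Re w.
Proof. by case: z w => ? ? []. Qed.
Lemma Re_sum (I : Type) (r : seq I) (Q : pred I) (F : I -> R[i]) :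
  complex.Re (\sum_(i <- r | Q i) F i) = \sum_(i <- r | Q i) complex.Re (F i).
Proof. by apply: (big_morph _ ReD). Qed.
Lemma Im_sum (I : Type) (r : seq I) (Q : pred I) (F : I -> R[i]) :
  complex.Im (\sum_(i <- r | Q i) F i) = \sum_(i <- r | Q i) complex.Im (F i).
Proof. by apply: (big_morph _ ImD). Qed.

Lemma complexP z w : complex.Re z = complex.Re w ->
  complex.Im z = complex.Im w -> z = w.
Proof. by case: z w => a b [c d] /= -> ->. Qed.

Lemma normcE2 z : normc z = Num.sqrt (complex.Re z ^+ 2 + complex.Im z ^+ 2).
Proof. by case: z. Qed.
Lemma normc_ge0 z : 0 <= normc z.
Proof. by rewrite normcE2 sqrtr_ge0. Qed.
Lemma normc_real (a : R) : normc a%:C = `|a|.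
Proof. by rewrite normcE2 /= expr0n /= addr0 sqrtr_sqr. Qed.
Lemma normcD z w : normc (z + w) <= normc z + normc w.
Proof. exact: le_normcD. Qed.
Lemma normcX z n : normc (z ^+ n) = normc z ^+ n.
Proof. by elim: n => [|n IH]; rewrite ?expr0 ?normc1 // !exprS normcM IH. Qed.
Lemma normc_sum (I : Type) (r : seq I) (Q : pred I) (F : I -> R[i]) :
  normc (\sum_(i <- r | Q i) F i) <= \sum_(i <- r | Q i) normc (F i).
Proof.
elim/big_ind2: _ => [|a b c e ab ce|//]; first by rewrite normc0.
exact: (le_trans (normcD _ _) (lerD ab ce)).
Qed.
Lemma normc_prod (I : Type) (r : seq I) (Q : pred I) (F : I -> R[i]) :
  normc (\prod_(i <- r | Q i) F i) = \prod_(i <- r | Q i) normc (F i).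
Proof. by apply: (big_morph _ (@normcM R)); rewrite normc1. Qed.
Lemma norm_Re z : `|complex.Re z| <= normc z.
Proof. by rewrite normcE2 -sqrtr_sqr ler_wsqrtr // lerDl sqr_ge0. Qed.
Lemma norm_Im z : `|complex.Im z| <= normc z.
Proof. by rewrite normcE2 -sqrtr_sqr ler_wsqrtr // lerDr sqr_ge0. Qed.
Lemma normc_le_ReIm z : normc z <= `|complex.Re z| + `|complex.Im z|.
Proof.
rewrite normcE2 -(@ler_pXn2r _ 2) ?nnegrE ?sqrtr_ge0 ?addr_ge0 //.
rewrite sqr_sqrtr ?addr_ge0 ?sqr_ge0 // sqrrD !real_normK ?num_real //.
by rewrite lerD2r lerDl mulrn_wge0 // mulr_ge0.
Qed.
Lemma normr_normc z : `|z| = (normc z)%:C.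
Proof. by rewrite normc_def normcE2. Qed.

Lemma normc_cexp z : normc (cexp z) = expR (complex.Re z).
Proof.
rewrite /cexp normcM normc_real ger0_norm ?expR_ge0 // normcE2 /=.
by rewrite cos2Dsin2 sqrtr1 mulr1.
Qed.
Lemma cexpD z w : cexp (z + w) = cexp z * cexp w.
Proof.
rewrite /cexp ReD ImD expRD cosD sinD; apply: complexP;
  rewrite !(ReM, ImM) /=; ring.
Qed.
Lemma cexp_real (a : R) : cexp a%:C = (expR a)%:C.
Proof. by rewrite /cexp /= cos0 sin0; apply: complexP; rewrite !(ReM, ImM) /=; ring. Qed.
Lemma cexp0 : cexp (0 : R[i]) = 1.
Proof. by rewrite (cexp_real 0) expR0. Qed.
Lemma cexp_sum (I : Type) (r : seq I) (Q : pred I) (F : I -> R[i]) :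
  cexp (\sum_(i <- r | Q i) F i) = \prod_(i <- r | Q i) cexp (F i).
Proof. by apply: (big_morph _ cexpD); rewrite cexp0. Qed.

(** Componentwise convergence: it spares the topology of the complex plane. *)
Definition ccvg (u : nat -> R[i]) (l : R[i]) :=
  (fun n => complex.Re (u n)) @ \oo --> complex.Re l /\
  (fun n => complex.Im (u n)) @ \oo --> complex.Im l.

Lemma ccvg_unique u l l' : ccvg u l -> ccvg u l' -> l = l'.
Proof.
move=> [a b] [c e]; apply: complexP.
  exact: (cvg_unique _ a c).
exact: (cvg_unique _ b e).
Qed.
Lemma ccvg_cst l : ccvg (fun=> l) l.
Proof. by split; exact: cvg_cst. Qed.
Lemma ccvgD u v l m : ccvg u l -> ccvg v m -> ccvg (fun n => u n + v n) (l + m).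
Proof.
move=> [a b] [c e]; split.
  by under eq_fun do rewrite ReD; rewrite ReD; exact: cvgD.
by under eq_fun do rewrite ImD; rewrite ImD; exact: cvgD.
Qed.
Lemma ccvgM u v l m : ccvg u l -> ccvg v m -> ccvg (fun n => u n * v n) (l * m).
Proof.
move=> [a b] [c e]; split.
  by under eq_fun do rewrite ReM; rewrite ReM; apply: cvgB; exact: cvgM.
by under eq_fun do rewrite ImM; rewrite ImM; apply: cvgD; exact: cvgM.
Qed.
Lemma ccvg_prod (I : Type) (r : seq I) (u : I -> nat -> R[i]) l :
  (forall i, ccvg (u i) (l i)) ->
  ccvg (fun n => \prod_(i <- r) u i n) (\prod_(i <- r) l i).
Proof.
move=> H; elim: r => [|i r IH].
  by under eq_fun do rewrite big_nil; rewrite big_nil; exact: ccvg_cst.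
by under eq_fun do rewrite big_cons; rewrite big_cons; exact: ccvgM.
Qed.
Lemma normc_cvg_le u l (c : R) : ccvg u l -> (forall n, normc (u n) <= c) ->
  normc l <= c.
Proof.
move=> [a b] ub.
have c0 : 0 <= c := le_trans (normc_ge0 _) (ub 0%N).
rewrite normcE2 -(@ler_pXn2r _ 2) ?nnegrE ?sqrtr_ge0 //.
rewrite sqr_sqrtr ?addr_ge0 ?sqr_ge0 //.
have : (fun n => complex.Re (u n) ^+ 2 + complex.Im (u n) ^+ 2) @ \oo -->
    complex.Re l ^+ 2 + complex.Im l ^+ 2 by apply: cvgD; apply: cvgM.
move=> cv; rewrite -(cvg_lim _ cv) //; apply: limr_le; first exact: cvgP cv.
near=> n; have := ub n.
by rewrite normcE2 -(@ler_pXn2r _ 2) ?nnegrE ?sqrtr_ge0 // sqr_sqrtr // addr_ge0 ?sqr_ge0.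
Unshelve. all: by end_near. Qed.
End complex_numbers.

Section power_series.
Context {R : realType}.
Implicit Types (a : nat -> R).

(** Coefficients of an entire power series. *)
Definition entire_coeff a := forall r, 0 <= r -> exists C, forall n, `|a n| * r ^+ n <= C.

Lemma entire_coeff_cvg a x : entire_coeff a -> cvgn (pseries a x).
Proof.
move=> /(_ (2 * `|x|)) [|C HC]; first by rewrite mulr_ge0.
apply: normed_cvg.
apply: (@series_le_cvg _ _ (fun n => C * (2^-1) ^+ n)).
- by move=> n; rewrite normr_ge0.
- move=> n; rewrite mulr_ge0 ?exprn_ge0 ?invr_ge0 //.
  exact: le_trans (HC 0%N); rewrite mulr_ge0.
- move=> n /=; rewrite normrM normrX.
  have -> : `|a n| * `|x| ^+ n = (`|a n| * (2 * `|x|) ^+ n) * 2^-1 ^+ n.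
    rewrite exprMn mulrA -!mulrA; congr (_ * _).
    by rewrite mulrC -mulrA -exprMn mulVf ?pnatr_eq0 // expr1n mulr1.
  by rewrite ler_wpM2r ?exprn_ge0 ?invr_ge0.
- by apply: is_cvg_geometric_series; rewrite ger0_norm ?invr_ge0 // invf_lt1 // ltr1n.
Qed.

Lemma entire_coeff_diffs a : entire_coeff a -> entire_coeff (pseries_diffs a).
Proof.
move=> H r r0; have [|C HC] := H (2 * (r + 1)); first by rewrite mulr_ge0 ?addr_ge0.
exists C => n; apply: le_trans (HC n.+1); rewrite /pseries_diffs.
rewrite normrM ger0_norm // [n.+1%:R * _]mulrC -mulrA ler_wpM2l //.
rewrite exprMn ler_pM ?exprn_ge0 ?ler0n //.
  by rewrite -natrX ler_nat ltnW // ltn_expl.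
rewrite exprSr -[leLHS]mulr1 ler_pM ?exprn_ge0 //; last by rewrite lerDr.
by rewrite lerXn2r ?nnegrE ?addr_ge0 // lerDl.
Qed.

Lemma is_derive_entire a x : entire_coeff a ->
  is_derive x (1 : R) (fun x => limn (pseries a x)) (limn (pseries (pseries_diffs a) x)).
Proof.
move=> H; apply: (@pseries_snd_diffs _ _ (`|x| + 1)).
- exact: entire_coeff_cvg.
- by apply: entire_coeff_cvg; exact: entire_coeff_diffs.
- by apply: entire_coeff_cvg; do 2 apply: entire_coeff_diffs.
- by rewrite [ltRHS]ger0_norm ?ltrDl // addr_ge0.
Qed.

(** An entire power series vanishing identically has zero coefficients: it is
    its own derivative's primitive, and evaluation at 0 reads off the constant
    coefficient. *)
Lemma entire_coeff_eq0 a : entire_coeff a ->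
  (forall x, pseries a x @ \oo --> (0 : R)) -> forall n, a n = 0.
Proof.
move=> Ha H n; elim: n a Ha H => [|n IH] a Ha H.
  have := H 0; have : pseries a (0 : R) @ \oo --> a 0%N.
    rewrite -(cvg_shiftS _) /=; apply: cvg_near_cst; near=> k.
    rewrite /pseries /series /= big_nat_recl // expr0 mulr1 big1 ?addr0 // => i _.
    by rewrite exprS mul0r mulr0.
  by move=> /cvg_unique /[apply]; apply.
have := IH (pseries_diffs a) (entire_coeff_diffs Ha) _; rewrite /pseries_diffs.
move=> H1; apply/eqP; have /eqP : n.+1%:R * a n.+1 = 0.
  apply: H1 => x.
  have d1 := is_derive_entire x Ha.
  have d0 : is_derive x (1 : R) (fun x => limn (pseries a x)) 0.
    have -> : (fun x => limn (pseries a x)) = cst 0.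
      by apply/funext => y; apply/cvg_lim => //; exact: H.
    exact: is_derive_cst.
  have E : limn (pseries (pseries_diffs a) x) = 0.
    by case: d1 => _ <-; case: d0 => _ <-.
  by rewrite -[X in _ --> X]E; exact: (entire_coeff_cvg (entire_coeff_diffs Ha)).
by rewrite mulf_eq0 pnatr_eq0.
Unshelve. all: by end_near. Qed.

Lemma entire_coeffB a b : entire_coeff a -> entire_coeff b -> entire_coeff (fun n => a n - b n).
Proof.
move=> Ha Hb r r0; have [C HC] := Ha r r0; have [D HD] := Hb r r0.
exists (C + D) => n; apply: le_trans (lerD (HC n) (HD n)).
by rewrite -mulrDl ler_wpM2r ?exprn_ge0 // ler_normB.
Qed.

Lemma pseries_unique a b (f : R -> R) : entire_coeff a -> entire_coeff b ->
  (forall x, pseries a x @ \oo --> f x) -> (forall x, pseries b x @ \oo --> f x) ->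
  a = b.
Proof.
move=> Ha Hb Fa Fb; apply/funext => n; apply/eqP; rewrite -subr_eq0; apply/eqP.
apply: (entire_coeff_eq0 (entire_coeffB Ha Hb)) => x.
rewrite -(subrr (f x)).
have -> : pseries (fun n => a n - b n) x = (fun n => pseries a x n - pseries b x n).
  apply/funext => k; rewrite /pseries /series /= -sumrB; apply: eq_bigr => i _.
  by rewrite mulrBl.
exact: cvgB.
Qed.

(** A power series converging on the whole line has entire coefficients, since
    the terms of a convergent series are bounded. *)
Lemma cvg_entire_coeff a : (forall x, cvgn (pseries a x)) -> entire_coeff a.
Proof.
move=> H r r0; have /cvg_series_cvg_0 := H r.
move=> h; have /cvg_seq_bounded := cvgP _ h; move=> [C [_ HC]].
have C1 : C < C + 1 by rewrite ltrDl.
exists (C + 1) => n; have := HC (C + 1) C1 n I => /=.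
by rewrite normrM normrX (ger0_norm r0).
Qed.
End power_series.

(** * Hermite polynomials *)

(** hermite_pair t x n is the pair of the normalised Hermite polynomials
    H_(n-1)(t, x) / (n-1)! and H_n(t, x) / n!. *)
Fixpoint hermite_pair {R : realType} (t x : R) (n : nat) : R * R :=
  if n is m.+1 then
    let: (a, b) := hermite_pair t x m in (b, (x * b - t * a) / n%:R)
  else (0, 1).

Definition hermite_coeff {R : realType} (t x : R) n := (hermite_pair t x n).2.

Section hermite.
Context {R : realType}.
Implicit Types (t x r : R) (z : R[i]).
Local Notation hc := hermite_coeff.

Lemma hermite_coeff0 t x : hc t x 0 = 1. Proof. by []. Qed.

Lemma hermite_coeff1 t x : hc t x 1 = x.
Proof. by rewrite /hermite_coeff /= divr1 mulr1 mulr0 subr0. Qed.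

Lemma hermite_pair1 t x n : (hermite_pair t x n.+1).1 = hc t x n.
Proof. by rewrite /hermite_coeff /=; case: hermite_pair. Qed.

Lemma hermite_coeffSS t x n :
  hc t x n.+2 = (x * hc t x n.+1 - t * hc t x n) / n.+2%:R.
Proof.
rewrite -(hermite_pair1 t x n) /hermite_coeff; move: n.+1 => m /=.
by case: hermite_pair.
Qed.

Lemma hermite_coeff_ge0 t x n : t <= 0 -> 0 <= x -> 0 <= hc t x n.
Proof.
move=> t0 x0; suff [//] : 0 <= hc t x n /\ 0 <= hc t x n.+1.
elim: n => [|n [h0 h1]]; first by rewrite hermite_coeff1.
split=> //; rewrite hermite_coeffSS mulr_ge0 ?invr_ge0 // subr_ge0.
by rewrite (@le_trans _ _ 0) ?mulr_le0_ge0 ?mulr_ge0.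
Qed.

Lemma norm_hermite_coeff t x n : `|hc t x n| <= hc (- `|t|) `|x| n.
Proof.
suff [//] : `|hc t x n| <= hc (- `|t|) `|x| n /\
            `|hc t x n.+1| <= hc (- `|t|) `|x| n.+1.
elim: n => [|n [h0 h1]]; first by rewrite !hermite_coeff0 !hermite_coeff1 normr1.
split=> //; rewrite !hermite_coeffSS normrM normfV (ger0_norm (ler0n _ _)) //.
rewrite ler_wpM2r ?invr_ge0 // mulNr opprK.
by rewrite (le_trans (ler_normB _ _)) // !normrM lerD // ler_wpM2l.
Qed.

Lemma hermite_entire_coeff t x : entire_coeff (hc t x).
Proof.
move=> r r0; set B := fun n => hc (- `|t|) `|x| n * r ^+ n.
have B0 n : 0 <= B n.
  by rewrite mulr_ge0 ?exprn_ge0 ?hermite_coeff_ge0 ?oppr_le0.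
suff [C HC] : exists C, forall n, B n <= C.
  exists C => n; apply: le_trans (HC n).
  by rewrite ler_wpM2r ?exprn_ge0 ?norm_hermite_coeff.
have BSS n : B n.+2 = (`|x| * r * B n.+1 + `|t| * r ^+ 2 * B n) / n.+2%:R.
  by rewrite /B hermite_coeffSS mulNr opprK !exprS; ring.
pose s := `|x| * r + `|t| * r ^+ 2.
have s0 : 0 <= s by rewrite addr_ge0 ?mulr_ge0 ?exprn_ge0.
pose N := (Num.bound s).
(* past N the recursion contracts, so the maximum over the first terms is a bound *)
pose C := \sum_(i < N.+2) B i.
have C0 k : (k < N.+2)%N -> B k <= C.
  move=> kN; rewrite /C (bigD1 (Ordinal kN)) //= lerDl sumr_ge0 //.
exists C => n; have [|Nn] := ltnP n N.+2; first exact: C0.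
suff H : forall k, B (N + k)%N <= C /\ B (N + k).+1 <= C.
  by have := (H (n - N)%N).1; rewrite subnKC // (leq_trans _ Nn) // ltnW.
elim => [|k [h0 h1]]; first by rewrite addn0; split; apply: C0.
rewrite addnS; split => //; rewrite BSS ler_pdivrMr ?ltr0n //.
apply: (@le_trans _ _ (s * C)).
  by rewrite /s mulrDl lerD // ler_wpM2l ?mulr_ge0 ?exprn_ge0.
rewrite mulrC ler_wpM2l ?(le_trans (B0 0%N)) ?C0 //.
apply: (le_trans (ltW (archi_boundP s0))); rewrite ler_nat -/N.
by rewrite -!addnS leq_addr.
Qed.

End hermite.
Section generating_function.
Context {R : realType}.
Variables (t x : R) (z : R[i]).
Local Notation a := (hermite_coeff t x).
Implicit Types (w : R[i]) (r : R).

Let p w n := a n * complex.Re (w * z ^+ n).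
Let P w r := limn (pseries (p w) r).

Let p_entire w : entire_coeff (p w).
Proof.
have Ha : entire_coeff (fun n => normc w * a n).
  move=> r r0; have [C HC] := hermite_entire_coeff t x r0.
  exists (normc w * C) => n; rewrite normrM -mulrA ger0_norm ?normc_ge0 //.
  by rewrite ler_wpM2l // normc_ge0.
move=> r r0; have [|C HC] := Ha (normc z * r); first by rewrite mulr_ge0 ?normc_ge0.
exists C => n; apply: le_trans (HC n); rewrite /p !normrM exprMn mulrA.
rewrite ler_wpM2r ?exprn_ge0 // [ `|normc w|]ger0_norm ?normc_ge0 //.
rewrite [normc w * _]mulrC -mulrA ler_wpM2l //.
by rewrite (le_trans (norm_Re _)) // normcM normcX.
Qed.

Let P_cvg w r : pseries (p w) r @ \oo --> P w r.
Proof. exact: (entire_coeff_cvg (p_entire w)). Qed.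

Let diffsP w r :
  limn (pseries (pseries_diffs (p w)) r) = x * P (w * z) r - t * r * P (w * z ^+ 2) r.
Proof.
apply/cvg_lim => //.
rewrite -(cvg_shiftS _) /=.
have -> : (fun n => pseries (pseries_diffs (p w)) r n.+1) =
   (fun n => x * pseries (p (w * z)) r n.+1 - t * r * pseries (p (w * z ^+ 2)) r n).
  apply/funext; elim => [|n IH].
    rewrite /pseries /series /= !big_nat1 big_geq // /pseries_diffs /p.
    by rewrite hermite_coeff1 hermite_coeff0 !expr0 expr1 !mulr1 mulr0 subr0 !mul1r.
  rewrite /pseries /series /= in IH *.
  rewrite big_nat_recr //= IH [in RHS]big_nat_recr //= [X in _ = _ - _ * _ * X]big_nat_recr //=.
  rewrite /pseries_diffs /p hermite_coeffSS.
  have -> : w * z * z ^+ n.+1 = w * z ^+ n.+2 by rewrite -mulrA -exprS.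
  have -> : w * z ^+ 2 * z ^+ n = w * z ^+ n.+2 by rewrite -mulrA -exprD.
  rewrite [in LHS]mulrA (mulrC n.+2%:R) divfK ?pnatr_eq0 // !exprS; ring.
apply: cvgB; first by apply: cvgMr; rewrite (cvg_shiftS (pseries _ _)); exact: P_cvg.
by apply: cvgMr; exact: P_cvg.
Qed.

Let P_lin w r : P w r = complex.Re w * P 1 r - complex.Im w * P (- 'i) r.
Proof.
apply/cvg_lim => //.
have -> : pseries (p w) r = (fun n => complex.Re w * pseries (p 1) r n
    - complex.Im w * pseries (p (- 'i)) r n).
  apply/funext => n; rewrite /pseries /series /= !mulr_sumr -sumrB.
  by apply: eq_bigr => i _; rewrite /p !ReM /=; ring.
by apply: cvgB; apply: cvgMr; exact: P_cvg.
Qed.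

Let P0 w : P w 0 = complex.Re w.
Proof.
apply/cvg_lim => //; rewrite -(cvg_shiftS _) /=; apply: cvg_near_cst; near=> k.
rewrite /pseries /series /= big_nat_recl // big1 ?addr0.
  by rewrite /p hermite_coeff0 !expr0 !mulr1 mul1r.
by move=> i _; rewrite exprS mul0r mulr0.
Unshelve. all: by end_near. Qed.

Let g1 r := r * (x * complex.Re z) - r ^+ 2 * (t / 2 * complex.Re (z ^+ 2)).
Let g2 r := r * (x * complex.Im z) - r ^+ 2 * (t / 2 * complex.Im (z ^+ 2)).

Let dquad (u v r : R) :
  is_derive r (1 : R) (fun r => r * u - r ^+ 2 * v) (u - 2 * r * v).
Proof.
have -> : (fun r => r * u - r ^+ 2 * v) = (u *: id - v *: (@GRing.exp R ^~ 2%N)) :> (R -> R).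
  by apply/funext => y; rewrite !fctE /GRing.scale /=; ring.
apply: is_derive_eq; rewrite /GRing.scale /=; ring.
Qed.

Let dP w r : is_derive r (1 : R) (P w)
   (x * P (w * z) r - t * r * P (w * z ^+ 2) r).
Proof. by rewrite -diffsP; exact: is_derive_entire. Qed.

(* the logarithmic derivative of the series along the ray is that of the
   exponential, so their quotient is constant *)
Let quot_cst w r :
  expR (- g1 r) * (P w r * cos (g2 r) + P (w * - 'i) r * sin (g2 r)) = complex.Re w.
Proof.
pose D r := expR (- g1 r) * (P w r * cos (g2 r) + P (w * - 'i) r * sin (g2 r)).
have DD : forall r', is_derive r' (1 : R) D 0.
  move=> {}r; have d1 : is_derive r (1:R) g1 _ := dquad _ _ _.
  have d2 : is_derive r (1:R) g2 _ := dquad _ _ _.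
  have de := is_derive1_comp (is_derive_expR _) (is_deriveN d1).
  have dc := is_derive1_comp (is_derive_cos _) d2.
  have ds := is_derive1_comp (is_derive_sin _) d2.
  have dD : is_derive r (1:R) D _ := is_deriveM de (is_deriveD (is_deriveM (dP w r) dc) (is_deriveM (dP (w * - 'i) r) ds)).
  apply: (is_derive_eq dD); rewrite /GRing.scale /= !fctE /=.
  rewrite ![P (_ * _) _]P_lin [P w _]P_lin !(ReM, ImM, ReN, ImN) /=.
  set E := expR _; set c := cos _; set s := sin _.
  by field.
rewrite -/(D r) (is_derive_0_is_cst r 0 DD) /D /g1 /g2 !mul0r expr0n /= !mul0r subrr oppr0 expR0 cos0 sin0.
by rewrite !P0 mulr0 addr0 mulr1 mul1r.
Qed.

Theorem hermite_generating :
  ccvg (fun N => \sum_(n < N) z ^+ n * (a n)%:C) (cexp (z * x%:C - z ^+ 2 * (t / 2)%:C)).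
Proof.
have c1 : complex.Re 1 = 1 :> R by [].
have e1 := quot_cst 1 1.
have e2 := quot_cst (- 'i) 1.
rewrite mul1r /= in e1; rewrite mulrNN -expr2 sqr_i [P (-1) _]P_lin [complex.Re (- 'i)]oppr0 in e2.
rewrite [complex.Re (-1)]/= [complex.Im (-1)]/= oppr0 mul0r subr0 mulN1r in e2.
have cs := cos2Dsin2 (g2 1).
have g0 : expR (- g1 1) != 0 by rewrite gt_eqF ?expR_gt0.
have eE : expR (- g1 1) * expR (g1 1) = 1 by rewrite mulrC expRxMexpNx_1.
move: (expR (- g1 1)) g0 eE e1 e2 => E g0 eE e1 e2.
have E1 : P 1 1 = expR (g1 1) * cos (g2 1).
  apply: (mulfI g0); rewrite mulrA eE mul1r.
  transitivity (cos (g2 1) * (E * (P 1 1 * cos (g2 1) + P (- 'i) 1 * sin (g2 1)))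
    - sin (g2 1) * (E * (P (- 'i) 1 * cos (g2 1) + - P 1 1 * sin (g2 1)))).
    by rewrite -[LHS]mulr1 -[X in _ * X = _]cs; ring.
  by rewrite e1 e2; ring.
have E2 : P (- 'i) 1 = expR (g1 1) * sin (g2 1).
  apply: (mulfI g0); rewrite mulrA eE mul1r.
  transitivity (sin (g2 1) * (E * (P 1 1 * cos (g2 1) + P (- 'i) 1 * sin (g2 1)))
    + cos (g2 1) * (E * (P (- 'i) 1 * cos (g2 1) + - P 1 1 * sin (g2 1)))).
    by rewrite -[LHS]mulr1 -[X in _ * X = _]cs; ring.
  by rewrite e1 e2; ring.
have G1 : g1 1 = complex.Re (z * x%:C - z ^+ 2 * (t / 2)%:C).
  by rewrite /g1 expr1n; move: (z ^+ 2) => u; rewrite ReD ReN !ReM /=; ring.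
have G2 : g2 1 = complex.Im (z * x%:C - z ^+ 2 * (t / 2)%:C).
  by rewrite /g2 expr1n; move: (z ^+ 2) => u; rewrite ImD ImN !ImM /=; ring.
split.
  have -> : (fun N => complex.Re (\sum_(n < N) z ^+ n * (a n)%:C)) = pseries (p 1) 1.
    apply/funext => N; rewrite Re_sum /pseries /series /= big_mkord.
    by apply: eq_bigr => i _; rewrite /p mul1r expr1n ReM /=; ring.
  have -> : complex.Re (cexp (z * x%:C - z ^+ 2 * (t / 2)%:C)) = P 1 1; last exact: P_cvg.
  by rewrite E1 G1 G2 /cexp ReM /= mul0r subr0.
have -> : (fun N => complex.Im (\sum_(n < N) z ^+ n * (a n)%:C)) = pseries (p (- 'i)) 1.
  apply/funext => N; rewrite Im_sum /pseries /series /= big_mkord.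
  by apply: eq_bigr => i _; rewrite /p expr1n !(ReM, ImM) /=; ring.
have -> : complex.Im (cexp (z * x%:C - z ^+ 2 * (t / 2)%:C)) = P (- 'i) 1; last exact: P_cvg.
by rewrite E2 G1 G2 /cexp ImM /= mul0r addr0.
Qed.
End generating_function.

Section hermite_consequences.
Context {R : realType}.
Implicit Types (t x r : R) (z : R[i]).
Local Notation hc := hermite_coeff.

Lemma hermite_generating_real t x r :
  pseries (hc t x) r @ \oo --> expR (r * x - r ^+ 2 * (t / 2)).
Proof.
have [+ _] := hermite_generating t x r%:C.
have -> : cexp (r%:C * x%:C - r%:C ^+ 2 * (t / 2)%:C) = (expR (r * x - r ^+ 2 * (t / 2)))%:C.
  by rewrite -cexp_real !(rmorphB, rmorphM, rmorphXn) /=.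
move=> h; have -> // : pseries (hc t x) r =
   (fun n => complex.Re (\sum_(k < n) r%:C ^+ k * (hc t x k)%:C)).
apply/funext => n; rewrite Re_sum /pseries /series /= big_mkord; apply: eq_bigr => i _.
by rewrite -rmorphXn -rmorphM /= mulrC.
Qed.

Lemma hermite_partial_sum_le t x r n : 0 <= r ->
  \sum_(k < n) r ^+ k * `|hc t x k| <= expR (r * `|x| + r ^+ 2 * (`|t| / 2)).
Proof.
move=> r0.
have cv := @hermite_generating_real (- `|t|) `|x| r.
rewrite mulNr mulrN opprK in cv.
rewrite -(cvg_lim _ cv) //.
apply: (@le_trans _ _ (pseries (hc (- `|t|) `|x|) r n)).
  rewrite /pseries /series /= big_mkord; apply: ler_sum => i _.
  by rewrite mulrC ler_wpM2r ?exprn_ge0 // norm_hermite_coeff.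
apply: nondecreasing_cvgn_le; last exact: cvgP cv.
apply/nondecreasing_seqP => k; rewrite /pseries /series /= big_nat_recr //= lerDl.
by rewrite mulr_ge0 ?exprn_ge0 // hermite_coeff_ge0 ?oppr_le0.
Qed.

Lemma norm_hermite_coeff_le t x r n : 0 <= r ->
  r ^+ n * `|hc t x n| <= expR (r * `|x| + r ^+ 2 * (`|t| / 2)).
Proof.
move=> r0; apply: le_trans (hermite_partial_sum_le t x n.+1 r0).
rewrite big_ord_recr /= lerDr sumr_ge0 // => i _.
by rewrite mulr_ge0 ?exprn_ge0.
Qed.

(** The generating function determines the Hermite polynomials. *)
Lemma hermite_familyE H : hermite_family H ->
  forall n t x, H n t x = (n`!)%:R * hc t x n.
Proof.
move=> HH n t x.
pose b k := H k t x / (k`!)%:R.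
have cb r : pseries b r @ \oo --> expR (r * x - r ^+ 2 * (t / 2)).
  rewrite mulrA; have := HH t x r.
  rewrite /pseries.
  have -> // : (fun n => r ^+ n / (n`!)%:R * H n t x) = (fun i => b i * r ^+ i).
  by apply/funext => k; rewrite /b; ring.
have -> : hc t x = b.
  apply: (pseries_unique (hermite_entire_coeff t x) _ (@hermite_generating_real t x) cb).
  by apply: cvg_entire_coeff => r; apply: cvgP (cb r).
by rewrite /b mulrC divfK // pnatr_eq0 -lt0n fact_gt0.
Qed.

(** Exponential series: the case t = 0, x = 1. *)
Lemma hermite_coeff_exp n : hc 0 1 n = (n`!%:R)^-1 :> R.
Proof.
suff [//] : hc 0 1 n = (n`!%:R)^-1 :> R /\ hc 0 1 n.+1 = (n.+1`!%:R)^-1 :> R.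
elim: n => [|n [h0 h1]]; first by rewrite hermite_coeff0 hermite_coeff1 invr1.
by split => //; rewrite hermite_coeffSS mul1r mul0r subr0 h1 -invfM -natrM mulnC -factS.
Qed.

Lemma cexp_taylor2 z : normc (cexp z - 1 - z) <= normc z ^+ 2 * expR (normc z).
Proof.
have := hermite_generating 0 1 z.
rewrite mul0r mulr0 subr0 mulr1 => g.
have {}g : ccvg (fun N => \sum_(n < N) z ^+ n.+2 * (hc 0 1 n.+2 : R)%:C) (cexp z - 1 - z).
  have -> : (fun N => \sum_(n < N) z ^+ n.+2 * (hc 0 1 n.+2 : R)%:C) =
    (fun N => \sum_(n < N.+2) z ^+ n * (hc 0 1 n : R)%:C + (- 1 - z)).
    apply/funext => N; rewrite 2!big_ord_recl /= hermite_coeff1 hermite_coeff0 expr0 expr1.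
    rewrite !(rmorph1 (real_complex R)) !mulr1; set S := \sum_(i < N) _; by ring.
  rewrite -addrA; apply: ccvgD; last exact: ccvg_cst.
  case: g => h1 h2; split.
    by move: h1; rewrite -(cvg_shiftn 2); under eq_fun do rewrite addn2.
  by move: h2; rewrite -(cvg_shiftn 2); under eq_fun do rewrite addn2.
apply: (normc_cvg_le g) => N; apply: (le_trans (normc_sum _ _ _)).
have := @hermite_partial_sum_le 0 1 (normc z) N (normc_ge0 z).
rewrite normr0 mul0r mulr0 addr0 normr1 mulr1 => /(ler_wpM2l (exprn_ge0 2 (normc_ge0 z))).
apply: le_trans; rewrite mulr_sumr; apply: ler_sum => i _.
rewrite normcM normcX normc_real mulrA -exprD add2n ler_wpM2l ?exprn_ge0 ?normc_ge0 //.
rewrite !hermite_coeff_exp !ger0_norm ?invr_ge0 // lef_pV2 ?posrE ?ltr0n ?fact_gt0 //.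
by rewrite ler_nat !factS mulnA leq_pmull.
Qed.
End hermite_consequences.

(** * Complex random variables *)

Section complex_measurability.
Context {d} {T : measurableType d} {R : realType}.
Implicit Types f g : T -> R[i].

Definition cmfun f := measurable_fun setT (fun x => complex.Re (f x)) /\
  measurable_fun setT (fun x => complex.Im (f x)).

Lemma cmfun_real (f : T -> R) : measurable_fun setT f -> cmfun (fun x => (f x)%:C).
Proof. by move=> mf; split => //=; exact: measurable_cst. Qed.
Lemma cmfun_cst (c : R[i]) : cmfun (fun=> c).
Proof. by split; exact: measurable_cst. Qed.
Lemma cmfun_complex (f g : T -> R) : measurable_fun setT f -> measurable_fun setT g ->
  cmfun (fun x => f x +i* g x).
Proof. by []. Qed.
Lemma cmfunD f g : cmfun f -> cmfun g -> cmfun (fun x => f x + g x).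
Proof.
move=> [a b] [c e]; split.
  by under eq_fun do rewrite ReD; exact: measurable_funD.
by under eq_fun do rewrite ImD; exact: measurable_funD.
Qed.
Lemma cmfunM f g : cmfun f -> cmfun g -> cmfun (fun x => f x * g x).
Proof.
move=> [a b] [c e]; split.
  by under eq_fun do rewrite ReM; apply: measurable_funB; exact: measurable_funM.
by under eq_fun do rewrite ImM; apply: measurable_funD; exact: measurable_funM.
Qed.
Lemma cmfunN f : cmfun f -> cmfun (fun x => - f x).
Proof.
move=> mf; under eq_fun do rewrite -mulN1r.
by apply: cmfunM => //; exact: cmfun_cst.
Qed.
Lemma cmfunB f g : cmfun f -> cmfun g -> cmfun (fun x => f x - g x).
Proof. by move=> mf mg; apply: cmfunD => //; exact: cmfunN. Qed.
Lemma cmfunX f n : cmfun f -> cmfun (fun x => f x ^+ n).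
Proof.
move=> mf; elim: n => [|n IH]; first by under eq_fun do rewrite expr0; exact: cmfun_cst.
by under eq_fun do rewrite exprS; exact: cmfunM.
Qed.
Lemma cmfun_sum (I : Type) (r : seq I) (F : I -> T -> R[i]) :
  (forall i, cmfun (F i)) -> cmfun (fun x => \sum_(i <- r) F i x).
Proof.
move=> mF; elim: r => [|i r IH]; first by under eq_fun do rewrite big_nil; exact: cmfun_cst.
by under eq_fun do rewrite big_cons; exact: cmfunD.
Qed.
Lemma cmfun_prod (I : Type) (r : seq I) (F : I -> T -> R[i]) :
  (forall i, cmfun (F i)) -> cmfun (fun x => \prod_(i <- r) F i x).
Proof.
move=> mF; elim: r => [|i r IH]; first by under eq_fun do rewrite big_nil; exact: cmfun_cst.
by under eq_fun do rewrite big_cons; exact: cmfunM.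
Qed.
Lemma measurable_sin_comp (g : T -> R) : measurable_fun setT g ->
  measurable_fun setT (fun x => sin (g x)).
Proof.
move=> mg; apply: (@measurableT_comp _ _ _ _ _ _ (@sin R)) => //.
by apply: continuous_measurable_fun; exact: continuous_sin.
Qed.
Lemma measurable_cos_comp (g : T -> R) : measurable_fun setT g ->
  measurable_fun setT (fun x => cos (g x)).
Proof.
move=> mg; apply: (@measurableT_comp _ _ _ _ _ _ (@cos R)) => //.
by apply: continuous_measurable_fun; exact: continuous_cos.
Qed.
Lemma cmfun_cexp f : cmfun f -> cmfun (fun x => cexp (f x)).
Proof.
move=> [a b]; apply: cmfunM.
  by apply: cmfun_real; apply: measurableT_comp.
by split => /=; [exact: measurable_cos_comp|exact: measurable_sin_comp].
Qed.
Lemma measurable_normc f : cmfun f -> measurable_fun setT (fun x => normc (f x)).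
Proof.
move=> [a b]; under eq_fun do rewrite normcE2.
apply: (@measurableT_comp _ _ _ _ _ _ (@Num.sqrt R)).
  by apply: continuous_measurable_fun; exact: sqrt_continuous.
by apply: measurable_funD; exact: measurable_funX.
Qed.
Lemma cmfun_cvg (F : nat -> T -> R[i]) f : (forall n, cmfun (F n)) ->
  (forall x, ccvg (fun n => F n x) (f x)) -> cmfun f.
Proof.
move=> mF Ff; split.
  apply: (@measurable_fun_cvg _ _ _ _ (fun n x => complex.Re (F n x))).
    by move=> n; exact: (mF n).1.
  by move=> x _; exact: (Ff x).1.
apply: (@measurable_fun_cvg _ _ _ _ (fun n x => complex.Im (F n x))).
  by move=> n; exact: (mF n).2.
by move=> x _; exact: (Ff x).2.
Qed.
Lemma cmfun_indic (A : set T) : measurable A -> cmfun (fun x => (\1_A x : R)%:C).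
Proof. by move=> mA; apply: cmfun_real; exact: measurable_indic. Qed.
End complex_measurability.

Lemma cmfun_comp d d' (T : measurableType d) (T' : measurableType d') (R : realType)
  (f : T' -> R[i]) (h : T -> T') :
  measurable_fun setT h -> cmfun f -> cmfun (fun x => f (h x)).
Proof. by move=> mh [a b]; split; [exact: (measurableT_comp a)|exact: (measurableT_comp b)]. Qed.

Section real_integrable.
Context {R : realType} {d} {T : measurableType d} (mu : {measure set T -> \bar R}).
Implicit Types f g : T -> R.

Lemma rintegrableZ k f : mu.-integrable setT (EFin \o f) ->
  mu.-integrable setT (EFin \o (fun w => k * f w)).
Proof. by move=> h; have := integrableZl measurableT k h. Qed.
Lemma rintegrableD f g : mu.-integrable setT (EFin \o f) ->
  mu.-integrable setT (EFin \o g) -> mu.-integrable setT (EFin \o (fun w => f w + g w)).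
Proof. by move=> h h'; have := integrableD measurableT h h'. Qed.
Lemma rintegrableB f g : mu.-integrable setT (EFin \o f) ->
  mu.-integrable setT (EFin \o g) -> mu.-integrable setT (EFin \o (fun w => f w - g w)).
Proof. by move=> h h'; have := integrableB measurableT h h'. Qed.

Lemma Rintegral_dominated (F : nat -> T -> R) f g :
  (forall n, measurable_fun setT (F n)) -> (forall w, (fun n => F n w) @ \oo --> f w) ->
  mu.-integrable setT (EFin \o g) -> (forall n w, `|F n w| <= g w) ->
  (fun n => \int[mu]_w F n w)%R @ \oo --> (\int[mu]_w f w)%R.
Proof.
move=> mF Ff ig Fg.
have mf : measurable_fun setT f by apply: (@measurable_fun_cvg _ _ _ _ F) => // w _; exact: Ff.
have If : mu.-integrable setT (EFin \o f).
  apply: (le_integrable _ _ _ ig) => //=; first exact/measurable_EFinP.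
  move=> w _; rewrite lee_fin (le_trans _ (ler_norm _)) //.
  rewrite -(cvg_lim _ (cvg_norm (Ff w))) //; apply: limr_le; first exact: cvgP (cvg_norm (Ff w)).
  by apply: nearW => n; exact: Fg.
apply: fine_cvg; rewrite /Rintegral fineK; last exact: integrable_fin_num.
apply: (@dominated_cvg _ _ _ _ _ _ _ _ (EFin \o g)) => //=.
- by move=> n; exact/measurable_EFinP.
- by move=> w _; apply: cvg_EFin; [exact: nearW|exact: Ff].
- by move=> n w _; rewrite lee_fin.
Qed.
End real_integrable.

Section complex_expectation.
Context {R : realType} {disp : measure_display} {Omega : measurableType disp}.
Variable P : probability Omega R.
Implicit Types f g : Omega -> R[i].
Local Notation cE := (cexpectation P).

Lemma cexpectationE f : cE f =
  (\int[P]_w complex.Re (f w))%R +i* (\int[P]_w complex.Im (f w))%R.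
Proof. by rewrite /cexpectation unlock. Qed.
Lemma Re_cE f : complex.Re (cE f) = (\int[P]_w complex.Re (f w))%R.
Proof. by rewrite cexpectationE. Qed.
Lemma Im_cE f : complex.Im (cE f) = (\int[P]_w complex.Im (f w))%R.
Proof. by rewrite cexpectationE. Qed.

Lemma cintegrable_cmfun f : cintegrable P f -> cmfun f.
Proof.
by move=> [a b]; split; apply/measurable_EFinP; [exact: measurable_int a|exact: measurable_int b].
Qed.

Lemma cintegrable_le f (g : Omega -> R) : cmfun f -> P.-integrable setT (EFin \o g) ->
  (forall w, normc (f w) <= g w) -> cintegrable P f.
Proof.
move=> [a b] ig fg; split; apply: (le_integrable _ _ _ ig) => //=.
- exact/measurable_EFinP.
- move=> w _; rewrite lee_fin (le_trans (norm_Re _)) // (le_trans (fg w)) // ler_norm //.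
- exact/measurable_EFinP.
- move=> w _; rewrite lee_fin (le_trans (norm_Im _)) // (le_trans (fg w)) // ler_norm //.
Qed.

Lemma cintegrable_normc f : cintegrable P f ->
  P.-integrable setT (EFin \o (fun w => normc (f w))).
Proof.
move=> cf; have [mf [ia ib]] := (cintegrable_cmfun cf, cf).
have := integrableD measurableT (integrable_norm ia) (integrable_norm ib).
apply: le_integrable => //=; first by apply/measurable_EFinP; exact: measurable_normc.
move=> w _; rewrite lee_fin ger0_norm ?normc_ge0 //.
by rewrite ger0_norm ?addr_ge0 ?normr_ge0 // normc_le_ReIm.
Qed.

Lemma cintegrableP f : cmfun f -> (\int[P]_w (normc (f w))%:E < +oo)%E -> cintegrable P f.
Proof.
move=> mf h; apply: (@cintegrable_le f (fun w => normc (f w))) => //.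
apply/integrableP; split; first by apply/measurable_EFinP; exact: measurable_normc.
by under eq_integral do rewrite /= ger0_norm ?normc_ge0 //.
Qed.

Lemma cintegrable_lty f : cintegrable P f -> (\int[P]_w (normc (f w))%:E < +oo)%E.
Proof. by move=> /cintegrable_normc /integrable_lty; exact. Qed.

Lemma cintegrable_cst c : cintegrable P (fun=> c).
Proof. by split; exact: finite_measure_integrable_cst. Qed.
Lemma cintegrableD f g : cintegrable P f -> cintegrable P g -> cintegrable P (fun w => f w + g w).
Proof.
move=> [a b] [c e]; split.
  by under eq_fun do rewrite ReD EFinD; exact: integrableD.
by under eq_fun do rewrite ImD EFinD; exact: integrableD.
Qed.
Lemma cintegrableZ c f : cintegrable P f -> cintegrable P (fun w => c * f w).
Proof.
move=> cf; apply: (@cintegrable_le _ (fun w => normc c * normc (f w))).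
- by apply: cmfunM; [exact: cmfun_cst|exact: cintegrable_cmfun].
- by have := integrableZl measurableT (normc c) (cintegrable_normc cf).
- by move=> w; rewrite normcM.
Qed.
Lemma cintegrableB f g : cintegrable P f -> cintegrable P g -> cintegrable P (fun w => f w - g w).
Proof.
move=> cf cg; apply: cintegrableD => //; under eq_fun do rewrite -mulN1r.
exact: cintegrableZ.
Qed.
Lemma cintegrable_indic f A : measurable A -> cintegrable P f ->
  cintegrable P (fun w => (\1_A w : R)%:C * f w).
Proof.
move=> mA cf; apply: (@cintegrable_le _ (fun w => normc (f w))).
- by apply: cmfunM; [exact: cmfun_indic|exact: cintegrable_cmfun].
- exact: cintegrable_normc.
- move=> w; rewrite normcM normc_real indicE; case: (w \in A); first by rewrite normr1 mul1r.
  by rewrite normr0 mul0r normc_ge0.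
Qed.

Lemma cE_cst c : cE (fun=> c) = c.
Proof.
by rewrite /cexpectation !expectation_cst; case: c.
Qed.
Lemma cED f g : cintegrable P f -> cintegrable P g -> cE (fun w => f w + g w) = cE f + cE g.
Proof.
move=> [a b] [c e]; rewrite !cexpectationE; apply: complexP => /=.
  by under eq_Rintegral do rewrite ReD; exact: RintegralD.
by under eq_Rintegral do rewrite ImD; exact: RintegralD.
Qed.
Lemma cEZ c f : cintegrable P f -> cE (fun w => c * f w) = c * cE f.
Proof.
move=> [a b]; rewrite !cexpectationE; apply: complexP => /=.
  under eq_Rintegral do rewrite ReM.
  by rewrite ReM /= RintegralB ?RintegralZl //; exact: rintegrableZ.
under eq_Rintegral do rewrite ImM.
by rewrite ImM /= RintegralD ?RintegralZl //; exact: rintegrableZ.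
Qed.
Lemma cEB f g : cintegrable P f -> cintegrable P g -> cE (fun w => f w - g w) = cE f - cE g.
Proof.
move=> cf cg; rewrite -mulN1r -(cEZ (-1)) // -cED //; last exact: cintegrableZ.
by congr cexpectation; apply/funext => w; rewrite mulN1r.
Qed.
Lemma eq_cE f g : f =1 g -> cE f = cE g.
Proof. by move=> /funext ->. Qed.
Lemma cE_real (f : Omega -> R) : cE (fun w => (f w)%:C) = ((\int[P]_w f w)%R)%:C.
Proof.
by rewrite cexpectationE; apply: complexP => //=; rewrite Rintegral_cst // mul0r.
Qed.

(** The modulus bound comes from rotating the expectation onto the real axis. *)
Lemma normc_cE_le f : cintegrable P f -> normc (cE f) <= (\int[P]_w normc (f w))%R.
Proof.
move=> cf; have [->|e0] := eqVneq (cE f) 0.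
  by rewrite normc0; apply: Rintegral_ge0 => w _; exact: normc_ge0.
have n0 : normc (cE f) != 0 by apply: contraNneq e0 => /eq0_normc ->.
pose u := (cE f)^*%C / (normc (cE f))%:C.
have nu : normc u = 1.
  rewrite normcM normcV normc_real ger0_norm ?normc_ge0 //.
  suff -> : normc (cE f)^*%C = normc (cE f) by rewrite mulfV.
  by case: (cE f) => x y /=; rewrite sqrrN.
have E : u * cE f = (normc (cE f))%:C.
  rewrite /u mulrAC [_^*%C * _]mulrC -sqr_normc normr_normc expr2 mulfK //.
  by rewrite (inj_eq (@complexI R) _ 0).
have -> : normc (cE f) = complex.Re (cE (fun w => u * f w)) by rewrite cEZ // E.
rewrite Re_cE; have [uf _] := cintegrableZ u cf; apply: le_Rintegral => //.
  exact: cintegrable_normc.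
move=> w _; rewrite (le_trans (ler_norm _)) // (le_trans (norm_Re _)) //.
by rewrite normcM nu mul1r.
Qed.

Lemma cE_dominated (F : nat -> Omega -> R[i]) f (g : Omega -> R) :
  (forall n, cmfun (F n)) -> (forall w, ccvg (fun n => F n w) (f w)) ->
  P.-integrable setT (EFin \o g) -> (forall n w, normc (F n w) <= g w) ->
  cintegrable P f /\ ccvg (fun n => cE (F n)) (cE f).
Proof.
move=> mF Ff ig Fg; have mf := cmfun_cvg mF Ff.
have cf : cintegrable P f.
  by apply: (cintegrable_le mf ig) => w; exact: (normc_cvg_le (Ff w)).
have iF n : cintegrable P (F n) by apply: (cintegrable_le (mF n) ig).
split=> //; split.
- under eq_fun do rewrite Re_cE; rewrite Re_cE.
  apply: (Rintegral_dominated _ _ ig) => [n|w|n w]; first exact: (mF n).1.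
    exact: (Ff w).1.
  exact: le_trans (norm_Re _) (Fg n w).
- under eq_fun do rewrite Im_cE; rewrite Im_cE.
  apply: (Rintegral_dominated _ _ ig) => [n|w|n w]; first exact: (mF n).2.
    exact: (Ff w).2.
  exact: le_trans (norm_Im _) (Fg n w).
Qed.

Lemma ae_eq_cE f g : cmfun f -> cmfun g -> {ae P, forall w, f w = g w} -> cE f = cE g.
Proof.
move=> [a b] [c e] fg; rewrite !cexpectationE; apply: complexP => /=; congr fine;
  apply: ae_eq_integral => //; try exact/measurable_EFinP;
  by apply: filterS fg => w -> _.
Qed.
End complex_expectation.

Section sub_sigma_field.
Context {disp : measure_display} {Omega : measurableType disp}.
Implicit Types G : set (set Omega).

Lemma measurable_sub_id G : <<s G >> `<=` measurable ->
  measurable_fun setT (id : Omega -> g_sigma_algebraType G).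
Proof. by move=> GM _ B mB; rewrite setTI; exact: GM. Qed.

Lemma measurable_sub_fun d' (T' : measurableType d') G (f : Omega -> T') :
  <<s G >> `<=` measurable ->
  measurable_fun setT (f : g_sigma_algebraType G -> T') -> measurable_fun setT f.
Proof. by move=> GM mf; exact: (measurableT_comp mf (measurable_sub_id GM)). Qed.

Lemma sub_measurable_mono d' (T' : measurableType d') G G' (f : Omega -> T') :
  <<s G >> `<=` <<s G' >> ->
  measurable_fun setT (f : g_sigma_algebraType G -> T') ->
  measurable_fun setT (f : g_sigma_algebraType G' -> T').
Proof.
by move=> GG' mf _ B mB; apply: GG'; exact: mf.
Qed.
End sub_sigma_field.

(** * Decoupling independent randomness *)

Section decoupling.
Context {R : realType} {disp : measure_display} {Omega : measurableType disp}.
Variable P : probability Omega R.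
Context {d1 d2 : measure_display} {T1 : measurableType d1} {T2 : measurableType d2}.
Variables (U1 : Omega -> T1) (U2 : Omega -> T2).
Hypotheses (mU1 : measurable_fun setT U1) (mU2 : measurable_fun setT U2).
Hypothesis U12 : forall A B, measurable A -> measurable B ->
  P (U1 @^-1` A `&` U2 @^-1` B) = (P (U1 @^-1` A) * P (U2 @^-1` B))%E.

Let mix1 := isMeasurableFun.Build _ _ _ _ _ mU1.
Let X1 : {mfun Omega >-> T1} := HB.pack U1 mix1.
Let mix2 := isMeasurableFun.Build _ _ _ _ _ mU2.
Let X2 : {mfun Omega >-> T2} := HB.pack U2 mix2.
Let U w := (U1 w, U2 w).
Let mU : measurable_fun setT U. Proof. exact: measurable_fun_pair. Qed.
Let mix := isMeasurableFun.Build _ _ _ _ _ mU.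
Let X : {mfun Omega >-> (T1 * T2)%type} := HB.pack U mix.

Let joint_law (A : set (T1 * T2)) : measurable A ->
  (distribution P X1 \x distribution P X2)%E A = distribution P X A.
Proof.
apply: product_measure_unique => B C mB mC.
by rewrite /distribution /pushforward /= -U12.
Qed.

Lemma decouple_ge0 (F : T1 * T2 -> \bar R) : measurable_fun setT F ->
  (forall x, 0 <= F x)%E ->
  (\int[P]_w F (U1 w, U2 w) = \int[P]_w \int[P]_v F (U1 w, U2 v))%E.
Proof.
move=> mF F0.
transitivity (\int[distribution P X]_x F x)%E; first by rewrite ge0_integral_distribution.
transitivity (\int[(distribution P X1 \x distribution P X2)%E]_x F x)%E.
  by apply: eq_measure_integral => A mA _; first [exact: joint_law|exact/esym/joint_law].
rewrite fubini_tonelli1 // ge0_integral_distribution.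
- apply: eq_integral => w _; rewrite /fubini_F /= ge0_integral_distribution //.
  exact: measurableT_comp (measurable_pair1 _).
- exact: measurable_fun_fubini_tonelli_F.
- by move=> y; apply: integral_ge0.
Qed.

Lemma decouple_real (F : T1 * T2 -> R) : measurable_fun setT F ->
  (\int[P]_w \int[P]_v `|F (U1 w, U2 v)|%:E < +oo)%E ->
  (forall x, P.-integrable setT (fun v => (F (x, U2 v))%:E)) ->
  [/\ P.-integrable setT (fun w => (F (U1 w, U2 w))%:E),
      P.-integrable setT (fun w => (\int[P]_v F (U1 w, U2 v))%R%:E) &
      (\int[P]_w F (U1 w, U2 w))%R = (\int[P]_w (\int[P]_v F (U1 w, U2 v)))%R].
Proof.
move=> mF Fint Fsec.
have mF' : measurable_fun setT (EFin \o F) by exact/measurable_EFinP.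
have iF : (distribution P X1 \x distribution P X2)%E.-integrable setT (EFin \o F).
  apply/integrable12ltyP => //; apply: le_lt_trans Fint.
  rewrite le_eqVlt; apply/orP; left; apply/eqP.
  have mn : measurable_fun setT (fun z => `|(EFin \o F) z|%E) by exact: measurableT_comp.
  rewrite ge0_integral_distribution.
  - apply: eq_integral => w _; rewrite /= ge0_integral_distribution //.
    exact: measurableT_comp mn (measurable_pair1 _).
  - exact: (measurable_fun_fubini_tonelli_F (fun z => `|(EFin \o F) z|%E) mn (fun=> abse_ge0 _)).
  - by move=> y; exact: integral_ge0.
have iU : P.-integrable setT (fun w => (F (U1 w, U2 w))%:E).
  apply/integrableP; split; first exact: (measurableT_comp mF' mU).
  have := decouple_ge0 (F := fun z => `|F z|%:E) _ _ => /= -> //.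
  by apply/measurable_EFinP; apply: (measurableT_comp _ mF); exact: normr_measurable.
have sec x : (\int[distribution P X2]_y (F (x, y))%:E = (\int[P]_v F (x, U2 v))%:E)%E.
  rewrite integral_distribution.
  - by rewrite /Rintegral fineK //; apply: integrable_fin_num => //; exact: Fsec.
  - exact: measurableT_comp mF' (measurable_pair1 _).
  - exact: Fsec.
have iF1 := integrable_fubini_F iF.
have E1 : fubini_F (distribution P X2) (EFin \o F) = (fun x => (\int[P]_v F (x, U2 v))%:E).
  by apply/funext => x; rewrite /fubini_F /= sec.
have mF1 : measurable_fun setT (fun x => (\int[P]_v F (x, U2 v))%:E).
  by rewrite -E1; exact: measurable_int iF1.
have i1 : P.-integrable setT (fun w => (\int[P]_v F (U1 w, U2 v))%R%:E).
  apply/integrableP; split; first exact: (measurableT_comp mF1 mU1).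
  move/integrableP: iF1 => [_]; rewrite ge0_integral_distribution //=.
    by rewrite E1.
  by rewrite E1; exact: measurableT_comp.
split => //; rewrite /Rintegral; congr fine.
transitivity (\int[distribution P X]_x (F x)%:E)%E.
  by rewrite integral_distribution.
transitivity (\int[(distribution P X1 \x distribution P X2)%E]_x (F x)%:E)%E.
  by apply: eq_measure_integral => A mA _; first [exact: joint_law|exact/esym/joint_law].
rewrite -integral12_prod_meas1 // E1.
by rewrite integral_distribution.
Qed.

Lemma decouple (F : T1 * T2 -> R[i]) : cmfun F ->
  (\int[P]_w \int[P]_v (normc (F (U1 w, U2 v)))%:E < +oo)%E ->
  (forall x, cintegrable P (fun v => F (x, U2 v))) ->
  [/\ cintegrable P (fun w => F (U1 w, U2 w)),
      cintegrable P (fun w => cexpectation P (fun v => F (U1 w, U2 v))) &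
      cexpectation P (fun w => F (U1 w, U2 w)) =
      cexpectation P (fun w => cexpectation P (fun v => F (U1 w, U2 v)))].
Proof.
move=> mF Fint Fsec.
have bnd (g : R[i] -> R) : (forall z, `|g z| <= normc z) ->
    measurable_fun setT (fun x => g (F x)) ->
    (\int[P]_w \int[P]_v `|g (F (U1 w, U2 v))|%:E < +oo)%E.
  move=> gn mg; apply: le_lt_trans Fint.
  have mgF : measurable_fun setT (fun x => `|g (F x)|%:E).
    by apply/measurable_EFinP; apply: (measurableT_comp _ mg); exact: normr_measurable.
  have mnF : measurable_fun setT (fun x => (normc (F x))%:E).
    by apply/measurable_EFinP; exact: measurable_normc.
  have mo (h : T1 * T2 -> \bar R) : measurable_fun setT h -> (forall x, 0 <= h x)%E ->
      measurable_fun setT (fun w => \int[P]_v h (U1 w, U2 v))%E.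
    move=> mh h0; have := measurable_fun_fubini_tonelli_F (m2 := distribution P X2) h mh h0.
    move=> mfF; have := measurableT_comp mfF mU1; apply: eq_measurable_fun => w _ /=.
    rewrite /fubini_F ge0_integral_distribution //.
    exact: measurableT_comp mh (measurable_pair1 _).
  apply: ge0_le_integral => //.
  - by move=> w _; apply: integral_ge0 => v _; rewrite lee_fin.
  - by apply: (mo (fun x => `|g (F x)|%:E)) => // x; rewrite lee_fin.
  - by apply: (mo (fun x => (normc (F x))%:E)) => // x; rewrite lee_fin normc_ge0.
  - move=> w _; apply: ge0_le_integral => //.
    + exact: measurableT_comp mgF (measurableT_comp (measurable_pair1 _) mU2).
    + exact: measurableT_comp mnF (measurableT_comp (measurable_pair1 _) mU2).
    + by move=> v _; rewrite lee_fin.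
have [a1 b1 e1] := decouple_real mF.1 (bnd _ norm_Re mF.1) (fun x => (Fsec x).1).
have [a2 b2 e2] := decouple_real mF.2 (bnd _ norm_Im mF.2) (fun x => (Fsec x).2).
split => //.
  split; first by under eq_fun do rewrite Re_cE.
  by under eq_fun do rewrite Im_cE.
apply: complexP.
  by rewrite !Re_cE e1; apply: eq_Rintegral => w _; rewrite Re_cE.
by rewrite !Im_cE e2; apply: eq_Rintegral => w _; rewrite Im_cE.
Qed.

Lemma decouple_prod (f : T1 -> R[i]) (g : T2 -> R[i]) : cmfun f -> cmfun g ->
  cintegrable P (fun w => f (U1 w)) -> cintegrable P (fun w => g (U2 w)) ->
  cintegrable P (fun w => f (U1 w) * g (U2 w)) /\
  cexpectation P (fun w => f (U1 w) * g (U2 w)) =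
  cexpectation P (fun w => f (U1 w)) * cexpectation P (fun w => g (U2 w)).
Proof.
move=> mf mg cf cg.
have mF : cmfun (fun z : T1 * T2 => f z.1 * g z.2).
  by apply: cmfunM; [exact: (cmfun_comp measurable_fst)|exact: (cmfun_comp measurable_snd)].
have lty : (\int[P]_w \int[P]_v (normc (f (U1 w) * g (U2 v)))%:E < +oo)%E.
  have ig := cintegrable_normc cg.
  have -> : (fun w => \int[P]_v (normc (f (U1 w) * g (U2 v)))%:E)%E =
      (fun w => ((\int[P]_v normc (g (U2 v)))%R * normc (f (U1 w)))%:E).
    apply/funext => w; under eq_integral do rewrite normcM EFinM.
    rewrite integralZl // EFinM muleC /Rintegral fineK //; exact: integrable_fin_num.
  by have /integrable_lty -> := rintegrableZ (\int[P]_v normc (g (U2 v)))%R (cintegrable_normc cf).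
have [] := decouple mF lty (fun x => cintegrableZ (f x) cg).
move=> a _ e; split => //; rewrite e /=.
transitivity (cexpectation P (fun w => cexpectation P (fun w => g (U2 w)) * f (U1 w))).
  by apply: eq_cE => w; rewrite cEZ // mulrC.
by rewrite cEZ // mulrC.
Qed.
End decoupling.

Section fubini.
Context {R : realType} {d1 d2 : measure_display}.
Context {T1 : measurableType d1} {T2 : measurableType d2}.
Variables (P1 : probability T1 R) (P2 : probability T2 R).

Lemma fubini_swap_real (F : T1 * T2 -> R) : measurable_fun setT F ->
  (\int[P1]_x \int[P2]_y `|F (x, y)|%:E < +oo)%E ->
  (forall x, P2.-integrable setT (fun y => (F (x, y))%:E)) ->
  (forall y, P1.-integrable setT (fun x => (F (x, y))%:E)) ->
  [/\ P1.-integrable setT (fun x => (\int[P2]_y F (x, y))%R%:E),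
      P2.-integrable setT (fun y => (\int[P1]_x F (x, y))%R%:E) &
  (\int[P1]_x (\int[P2]_y F (x, y)))%R = (\int[P2]_y (\int[P1]_x F (x, y)))%R].
Proof.
move=> mF Fint F2 F1.
have iF : (P1 \x P2)%E.-integrable setT (EFin \o F).
  by apply/integrable12ltyP => //; exact/measurable_EFinP.
have E2 : fubini_F P2 (EFin \o F) = (fun x => (\int[P2]_y F (x, y))%R%:E).
  apply/funext => x; rewrite /fubini_F /Rintegral /= fineK //.
  by apply: integrable_fin_num => //; exact: F2.
have E1 : fubini_G P1 (EFin \o F) = (fun y => (\int[P1]_x F (x, y))%R%:E).
  apply/funext => y; rewrite /fubini_G /Rintegral /= fineK //.
  by apply: integrable_fin_num => //; exact: F1.
split.
- by rewrite -E2; exact: integrable_fubini_F.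
- have iF' : (P2 \x P1)%E.-integrable setT (EFin \o (fun z => F (z.2, z.1))).
    have mF' : measurable_fun setT (fun z : T2 * T1 => F (z.2, z.1)).
      by apply: (measurableT_comp mF); exact: measurable_fun_pair measurable_snd measurable_fst.
    apply/integrable12ltyP; first exact/measurable_EFinP.
    move: Fint; rewrite (fubini_tonelli (fun z => `|F z|%:E)) //.
      by apply/measurable_EFinP; apply: (measurableT_comp _ mF); exact: normr_measurable.
  rewrite -E1; exact: (integrable_fubini_F iF').
- rewrite /Rintegral; congr fine.
  have := Fubini iF; rewrite -/(fubini_F P2 (EFin \o F)) -/(fubini_G P1 (EFin \o F)).
  have -> : (\int[P1]_x \int[P2]_y (EFin \o F) (x, y) = \int[P1]_x fubini_F P2 (EFin \o F) x)%E by [].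
  have -> : (\int[P2]_y \int[P1]_x (EFin \o F) (x, y) = \int[P2]_y fubini_G P1 (EFin \o F) y)%E by [].
  by rewrite E1 E2.
Qed.

Lemma fubini_swap (F : T1 * T2 -> R[i]) : cmfun F ->
  (\int[P1]_x \int[P2]_y (normc (F (x, y)))%:E < +oo)%E ->
  (forall x, cintegrable P2 (fun y => F (x, y))) ->
  (forall y, cintegrable P1 (fun x => F (x, y))) ->
  [/\ cintegrable P1 (fun x => cexpectation P2 (fun y => F (x, y))),
      cintegrable P2 (fun y => cexpectation P1 (fun x => F (x, y))) &
  cexpectation P1 (fun x => cexpectation P2 (fun y => F (x, y))) =
  cexpectation P2 (fun y => cexpectation P1 (fun x => F (x, y)))].
Proof.
move=> mF Fint F2 F1.
have bnd (g : R[i] -> R) : (forall z, `|g z| <= normc z) ->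
    measurable_fun setT (fun x => g (F x)) ->
    (\int[P1]_x \int[P2]_y `|g (F (x, y))|%:E < +oo)%E.
  move=> gn mg; apply: le_lt_trans Fint.
  have mgF : measurable_fun setT (fun x => `|g (F x)|%:E).
    by apply/measurable_EFinP; apply: (measurableT_comp _ mg); exact: normr_measurable.
  have mnF : measurable_fun setT (fun x => (normc (F x))%:E).
    by apply/measurable_EFinP; exact: measurable_normc.
  apply: ge0_le_integral => //.
  - by move=> w _; apply: integral_ge0 => v _; rewrite lee_fin.
  - by apply: (measurable_fun_fubini_tonelli_F (m2 := P2) (fun x => `|g (F x)|%:E)) => // x; rewrite lee_fin.
  - by apply: (measurable_fun_fubini_tonelli_F (m2 := P2) (fun x => (normc (F x))%:E)) => // x; rewrite lee_fin normc_ge0.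
  - move=> w _; apply: ge0_le_integral => //.
    + exact: measurableT_comp mgF (measurable_pair1 _).
    + exact: measurableT_comp mnF (measurable_pair1 _).
    + by move=> v _; rewrite lee_fin.
have [a1 b1 e1] := fubini_swap_real mF.1 (bnd _ norm_Re mF.1) (fun x => (F2 x).1) (fun x => (F1 x).1).
have [a2 b2 e2] := fubini_swap_real mF.2 (bnd _ norm_Im mF.2) (fun x => (F2 x).2) (fun x => (F1 x).2).
split.
- by split; [under eq_fun do rewrite Re_cE|under eq_fun do rewrite Im_cE].
- by split; [under eq_fun do rewrite Re_cE|under eq_fun do rewrite Im_cE].
apply: complexP.
  rewrite !Re_cE; transitivity (\int[P1]_x (\int[P2]_y complex.Re (F (x, y))))%R.
    by apply: eq_Rintegral => w _; rewrite Re_cE.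
  by rewrite e1; apply: eq_Rintegral => w _; rewrite Re_cE.
rewrite !Im_cE; transitivity (\int[P1]_x (\int[P2]_y complex.Im (F (x, y))))%R.
  by apply: eq_Rintegral => w _; rewrite Im_cE.
by rewrite e2; apply: eq_Rintegral => w _; rewrite Im_cE.
Qed.
End fubini.

(** * Products of independent random variables *)

Section independent_product.
Context {R : realType} {disp : measure_display} {Omega : measurableType disp}.
Variable P : probability Omega R.

Definition indep2 (G1 G2 : set (set Omega)) :=
  forall A B, G1 A -> G2 B -> P (A `&` B) = (P A * P B)%E.

Definition lower_union d (G : 'I_d -> set (set Omega)) (k : nat) : set (set Omega) :=
  \bigcup_(j in [set j : 'I_d | (j < k)%N]) G j.

Lemma cE_prod_independent d (G : 'I_d -> set (set Omega)) (z : 'I_d -> Omega -> R[i]) :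
  (forall i, G i `<=` measurable) ->
  (forall i : 'I_d, indep2 <<s lower_union G i >> <<s G i >>) ->
  (forall i, cmfun (z i : g_sigma_algebraType (G i) -> R[i])) ->
  (forall i, cintegrable P (z i)) ->
  cintegrable P (fun w => \prod_(i < d) z i w) /\
  cexpectation P (fun w => \prod_(i < d) z i w) = \prod_(i < d) cexpectation P (z i).
Proof.
move=> GM ind mz iz.
have sM (G' : set (set Omega)) : G' `<=` measurable -> <<s G' >> `<=` measurable.
  by move=> h; apply: smallest_sub; [exact: sigma_algebra_measurable|exact: h].
suff H k : (k <= d)%N ->
    cintegrable P (fun w => \prod_(i < d | (i < k)%N) z i w) /\
    cexpectation P (fun w => \prod_(i < d | (i < k)%N) z i w) =
    \prod_(i < d | (i < k)%N) cexpectation P (z i).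
  have [] := H d (leqnn _).
  have E (T : comSemiRingType) (F : 'I_d -> T) : \prod_(i < d | (i < d)%N) F i = \prod_(i < d) F i.
    by apply: eq_bigl => i; rewrite ltn_ord.
  by under eq_fun do rewrite E; rewrite E.
elim: k => [|k IH] kd.
  under eq_fun do rewrite big_pred0 //; rewrite big_pred0 //; split.
    exact: cintegrable_cst.
  exact: cE_cst.
have [ck Ek] := IH (ltnW kd); pose o := Ordinal kd.
have E (T : comSemiRingType) (F : 'I_d -> T) :
    \prod_(i < d | (i < k.+1)%N) F i = (\prod_(i < d | (i < k)%N) F i) * F o.
  rewrite (bigD1 o) //= mulrC; congr (_ * _); apply: eq_bigl => i.
  by rewrite ltnS ltn_neqAle andbC.
under eq_fun do rewrite E; rewrite E -Ek.
have LM : lower_union G o `<=` measurable by move=> A [j _]; exact: GM.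
apply: (@decouple_prod _ _ _ P _ _ (g_sigma_algebraType (lower_union G o))
  (g_sigma_algebraType (G o)) id id _ _ _
  (fun w => \prod_(i < d | (i < k)%N) z i w) (z o)) => //.
- by apply: measurable_sub_id; exact: sM.
- by apply: measurable_sub_id; apply: sM; exact: GM.
- move=> A B mA mB. exact: (ind o A B mA mB).
have -> : (fun w => \prod_(i < d | (i < k)%N) z i w) =
    (fun w => \prod_(i < d) (if (i < k)%N then z i w else 1)).
  by apply/funext => w; rewrite big_mkcond.
pose F (i : 'I_d) : g_sigma_algebraType (lower_union G o) -> R[i] :=
  fun w => if (i < k)%N then z i w else 1.
suff mF i : cmfun (F i) by exact: (cmfun_prod (index_enum 'I_d) mF).
rewrite /F; case ik: (i < k)%N; last exact: cmfun_cst.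
have sub : <<s G i >> `<=` <<s lower_union G o >>.
  by apply: sub_sigma_algebra2 => A GA; exists i.
by have [a b] := mz i; split; apply: sub_measurable_mono sub _.
Qed.
End independent_product.

(** * Integrating against bounds on a sub-sigma-field *)

Import HBNNSimple.

Section pull_out.
Context {R : realType} {disp : measure_display} {Omega : measurableType disp}.
Variable P : probability Omega R.
Implicit Types G : set (set Omega).

Lemma Rintegral_indicM (f : Omega -> R) A : measurable A -> P.-integrable setT (EFin \o f) ->
  (\int[P]_(w in A) (f w)%:E)%E = ((\int[P]_w (\1_A w * f w))%R)%:E.
Proof.
move=> mA If; rewrite integral_mkcond /Rintegral.
have E : ((fun w => (f w)%:E) \_ A)%E = (fun w => (\1_A w * f w)%:E).
  apply/funext => w; rewrite /patch indicE; case: (w \in A); first by rewrite mul1r.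
  by rewrite mul0r.
rewrite E fineK //; apply: integrable_fin_num => //; rewrite -E.
by apply/(integrable_mkcond _ _).1 => //; exact: integrableS If.
Qed.

Lemma integrable_indicM (f : Omega -> R) A : measurable A -> P.-integrable setT (EFin \o f) ->
  P.-integrable setT (EFin \o (fun w => \1_A w * f w)).
Proof.
move=> mA If; apply: (le_integrable measurableT _ _ If).
  apply/measurable_EFinP; apply: measurable_funM; first exact: measurable_indic.
  by apply/measurable_EFinP; exact: measurable_int If.
move=> w _; rewrite /= lee_fin normrM indicE; case: (w \in A); rewrite ?normr1 ?mul1r //.
by rewrite normr0 mul0r.
Qed.

(** A variable orthogonal to the indicators of a sub-sigma-field is orthogonal
    to all its measurable functions. *)
Lemma orthogonal_sub_sigma G (dl psi : Omega -> R) : <<s G >> `<=` measurable ->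
  P.-integrable setT (EFin \o dl) ->
  (forall C, <<s G >> C -> (\int[P]_w (\1_C w * dl w))%R = 0) ->
  measurable_fun setT (psi : g_sigma_algebraType G -> R) ->
  P.-integrable setT (EFin \o (fun w => psi w * dl w)) ->
  (\int[P]_w (psi w * dl w))%R = 0.
Proof.
move=> GM Idl Hdl.
have mdl : measurable_fun setT dl by apply/measurable_EFinP; exact: measurable_int Idl.
suff pos psi' : (forall w, 0 <= psi' w) ->
    measurable_fun setT (psi' : g_sigma_algebraType G -> R) ->
    P.-integrable setT (EFin \o (fun w => psi' w * dl w)) ->
    (\int[P]_w (psi' w * dl w))%R = 0.
  move=> mpsi Ipsi.
  have mp : measurable_fun setT (psi^\+ : g_sigma_algebraType G -> R) by exact: measurable_funrpos.
  have mn : measurable_fun setT (psi^\- : g_sigma_algebraType G -> R) by exact: measurable_funrneg.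
  have Ip : P.-integrable setT (EFin \o (fun w => psi^\+ w * dl w)).
    apply: (le_integrable measurableT _ _ Ipsi).
      apply/measurable_EFinP/measurable_funM => //; exact: measurable_sub_fun GM mp.
    move=> w _; rewrite /= lee_fin !normrM ler_wpM2r // /funrpos.
    by case: (lerP 0 (psi w)) => h; rewrite ?normr0 //.
  have In : P.-integrable setT (EFin \o (fun w => psi^\- w * dl w)).
    apply: (le_integrable measurableT _ _ Ipsi).
      apply/measurable_EFinP/measurable_funM => //; exact: measurable_sub_fun GM mn.
    move=> w _; rewrite /= lee_fin !normrM ler_wpM2r // /funrneg.
    by case: (lerP 0 (- psi w)) => h; rewrite ?normr0 ?normrN //.
  have -> : (\int[P]_w (psi w * dl w))%R =
      (\int[P]_w (psi^\+ w * dl w - psi^\- w * dl w))%R.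
    by apply: eq_Rintegral => w _; rewrite -mulrBl -[psi in LHS]funrposBneg.
  by rewrite RintegralB // (pos psi^\+) ?(pos psi^\-) ?subr0.
move=> psi0 mpsi Ipsi.
have mE : measurable_fun setT (EFin \o psi' : g_sigma_algebraType G -> \bar R).
  exact/measurable_EFinP.
pose g := nnsfun_approx measurableT mE.
have gcv w : (fun n => g n w) @ \oo --> psi' w.
  have := cvg_nnsfun_approx measurableT mE (fun x _ => psi0 x) (I : setT w).
  by move=> /fine_cvgP [_].
have gle n w : g n w <= psi' w.
  rewrite -(cvg_lim _ (gcv w)) //; apply: (@nondecreasing_cvgn_le _ (fun n => g n w)).
    by move=> m k mk; exact/lefP/nd_nnsfun_approx.
  exact: cvgP (gcv w).
have mg n : measurable_fun setT (g n : Omega -> R).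
  by apply: (measurable_sub_fun GM); exact: measurable_funP.
have H n : (\int[P]_w (g n w * dl w))%R = 0.
  have gE w : g n w * dl w = \sum_(i < #|` fset_set (g n @` setT)|)
      ((fset_set (g n @` setT))`_i) *
      (\1_(g n @^-1` [set (fset_set (g n @` setT))`_i]) w * dl w).
    by rewrite fimfunEord mulr_suml; apply: eq_bigr => i _; rewrite mulrA.
  under eq_Rintegral do rewrite gE.
  have mgy y : <<s G >> (g n @^-1` [set y]) by exact: (measurable_funPTI (g n)).
  move: (finmap.enum_fset _) (#|` _|) => s N.
  pose S n' w := \sum_(i < n') s`_i * (\1_(g n @^-1` [set s`_i]) w * dl w).
  suff [] : P.-integrable setT (EFin \o S N) /\ (\int[P]_w S N w)%R = 0 by [].
  elim: N => [|N [IH1 IH2]].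
    have -> : S 0 = cst 0 by apply/funext => w; rewrite /S big_ord0.
    by split; [exact: integrable0|rewrite Rintegral_cst // mul0r].
  have Iy : P.-integrable setT (EFin \o (fun w => s`_N * (\1_(g n @^-1` [set s`_N]) w * dl w))).
    by apply: rintegrableZ; apply: integrable_indicM => //; exact: GM.
  have e : S N.+1 = (fun w => S N w + s`_N * (\1_(g n @^-1` [set s`_N]) w * dl w)).
    by apply/funext => w; rewrite /S big_ord_recr.
  rewrite e; split; first exact: rintegrableD.
  rewrite RintegralD // IH2 add0r RintegralZl //; last by apply: integrable_indicM => //; exact: GM.
  by rewrite Hdl ?mulr0.
have cv : (fun n => \int[P]_w (g n w * dl w))%R @ \oo --> (\int[P]_w (psi' w * dl w))%R.
  apply: (@Rintegral_dominated _ _ _ P (fun n w => g n w * dl w) (fun w => psi' w * dl w)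
    (fun w => `|psi' w * dl w|)).
  - by move=> n; exact: measurable_funM.
  - by move=> w; apply: cvgMl; exact: gcv.
  - exact: integrable_norm Ipsi.
  - move=> n w; rewrite !normrM ler_wpM2r // ger0_norm //.
    by rewrite ger0_norm ?psi0.
have HE : (fun n => \int[P]_w (g n w * dl w))%R = cst 0 by apply/funext => n; exact: H.
rewrite HE in cv; exact: (cvg_unique _ cv (cvg_cst _)).
Qed.
End pull_out.

(** * Gaussian integrals *)

Import HBNNSimple.

Section density.
Local Open Scope ereal_scope.
Context {d} {T : measurableType d} {R : realType}.
Variables (mu nu : {measure set T -> \bar R}) (p : T -> R).
Hypotheses (mp : measurable_fun setT p) (p0 : forall x, (0 <= p x)%R).
Hypothesis nuE : forall A, measurable A -> nu A = \int[mu]_(x in A) (p x)%:E.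

Let density_indic A : measurable A ->
  \int[nu]_x (\1_A x)%:E = \int[mu]_x ((\1_A x)%:E * (p x)%:E).
Proof.
move=> mA; rewrite integral_indic // setIT nuE // integral_mkcond.
apply: eq_integral => x _; rewrite /patch indicE.
by case: ifPn => xA; rewrite ?mul1e ?mul0e.
Qed.

Let density_nnsfun (f : {nnsfun T >-> R}) :
  \int[nu]_x (f x)%:E = \int[mu]_x ((f x)%:E * (p x)%:E).
Proof.
under [LHS]eq_integral do rewrite fimfunE -fsumEFin//.
rewrite [LHS]ge0_integral_fsum//; last 2 first.
  - by move=> r; exact/measurable_EFinP/measurableT_comp.
  - by move=> n x _; rewrite EFinM nnfun_muleindic_ge0.
under [RHS]eq_integral.
  move=> x xD; rewrite fimfunE -fsumEFin// muleC ge0_mule_fsumr; last first.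
    by move=> r; rewrite EFinM nnfun_muleindic_ge0.
  over.
rewrite [RHS]ge0_integral_fsum//; last 2 first.
  - move=> r; apply: emeasurable_funM; first exact/measurable_EFinP.
    by apply/measurable_EFinP; apply/measurableT_comp => //.
  - move=> n x _; rewrite EFinM mule_ge0//; first by rewrite lee_fin.
    by rewrite nnfun_muleindic_ge0.
apply: eq_fsbigr => r rf.
have r0 : (0 <= r)%R by case/set_mem: rf => x _ <-.
under eq_integral do rewrite EFinM.
rewrite ge0_integralZl_EFin //; last first.
  exact/measurable_EFinP/measurable_indic.
rewrite density_indic //.
under [RHS]eq_integral do rewrite EFinM muleCA [(p _)%:E * _]muleC.
rewrite ge0_integralZl_EFin //.
- by move=> x _; rewrite mule_ge0 // lee_fin.
- by apply: emeasurable_funM; apply/measurable_EFinP.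
Qed.

Lemma integral_density (f : T -> \bar R) : measurable_fun setT f -> (forall x, 0 <= f x) ->
  \int[nu]_x f x = \int[mu]_x (f x * (p x)%:E).
Proof.
move=> mf f0; pose f_ := nnsfun_approx measurableT mf.
have mpE : measurable_fun setT (EFin \o p) by exact/measurable_EFinP.
transitivity (limn (fun n => \int[nu]_x (f_ n x)%:E)).
  rewrite -monotone_convergence//=.
  - apply: eq_integral => ? _; apply/esym/cvg_lim => //=; exact: cvg_nnsfun_approx.
  - by move=> n; exact/measurable_EFinP/measurable_funTS.
  - by move=> n ? _; rewrite lee_fin.
  - by move=> ? _ ? ? mn; rewrite lee_fin; exact/lefP/nd_nnsfun_approx.
under eq_fun do rewrite density_nnsfun.
rewrite -monotone_convergence//=.
- apply: eq_integral => x _; apply/cvg_lim => //=; apply: cvgeZr => //.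
  exact: cvg_nnsfun_approx.
- by move=> n; apply: emeasurable_funM => //; exact/measurable_EFinP/measurable_funTS.
- by move=> n ? _; rewrite mule_ge0 // lee_fin.
- move=> x _ ? ? mn; rewrite lee_wpmul2r ?lee_fin //; exact/lefP/nd_nnsfun_approx.
Qed.
End density.

Section gaussian_integral.
Context {R : realType}.
Local Notation mu := (@lebesgue_measure R).

Lemma lebesgue_measure_shift (m : R) (A : set R) : measurable A ->
  pushforward mu ((fun x => x + m) : _ -> measurableTypeR R) A = mu A.
Proof.
have mf : measurable_fun setT ((fun x => x + m) : measurableTypeR R -> measurableTypeR R).
  by apply: measurable_funD.
move=> mA; apply/esym.
apply: (@lebesgue_measure_unique R (pushforward mu ((fun x => x + m) : _ -> measurableTypeR R))) => //= _ [[a b]] _ <-.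
rewrite /pushforward.
have -> : (fun x => x + m) @^-1` [set` `]a, b]] = [set` `]a - m, b - m]].
  by apply/seteqP; split => x /=; rewrite !in_itv /= ltrBlDr lerBrDr.
rewrite !lebesgue_measure_itv/= !lte_fin ltrD2r; case: ifPn => // _.
by rewrite -!EFinB; congr EFin; ring.
Qed.

Lemma integral_shift (m : R) (f : R -> \bar R) : measurable_fun setT f -> (forall x, 0 <= f x)%E ->
  (\int[mu]_x f (x + m)%R = \int[mu]_x f x)%E.
Proof.
have mg : measurable_fun setT ((fun x => x + m) : measurableTypeR R -> measurableTypeR R).
  by apply: measurable_funD.
move=> mf f0.
have := ge0_integral_pushforward mg mu measurableT mf (fun y _ => f0 y).
rewrite preimage_setT => <-.
by apply: eq_measure_integral => A mA _; exact: lebesgue_measure_shift.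
Qed.

(** Expectation under N(0, v), which is the Dirac mass at 0 when v = 0. *)
Definition gaussian_int (v : R) (h : R -> \bar R) : \bar R :=
  if v == 0 then h 0 else (\int[mu]_x (h x * (normal_pdf 0 (Num.sqrt v) x)%:E))%E.

Lemma gaussian_int1 v : gaussian_int v (fun=> 1%E) = 1%E.
Proof.
rewrite /gaussian_int; case: ifPn => // _.
under eq_integral do rewrite mul1e; exact: integral_normal_pdf.
Qed.

Definition gaussian_tilt (a b v : R) : R :=
  (Num.sqrt (1 - 2 * b * v))^-1 * expR (a ^+ 2 * (v / (1 - 2 * b * v)) / 2).

Lemma gaussian_tilt_ge0 a b v : 0 <= gaussian_tilt a b v.
Proof. by rewrite mulr_ge0 ?expR_ge0 // invr_ge0 sqrtr_ge0. Qed.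

(** Completing the square: an exponential quadratic weight turns N(0, v) into
    a multiple of N(a v', v') with v' = v / (1 - 2 b v). *)
Lemma normal_pdf_tilt a b v x : 0 < v -> 0 < 1 - 2 * b * v ->
  normal_pdf 0 (Num.sqrt v) x * expR (a * x + b * x ^+ 2) =
  gaussian_tilt a b v * normal_pdf 0 (Num.sqrt (v / (1 - 2 * b * v)))
     (x - a * (v / (1 - 2 * b * v))).
Proof.
move=> v0 k0; set k := 1 - 2 * b * v in k0 *.
have vk0 : 0 < v / k by rewrite divr_gt0.
rewrite !normal_pdfE ?gt_eqF ?sqrtr_gt0 // /normal_peak /normal_fun !subr0.
rewrite !sqr_sqrtr ?ltW // /gaussian_tilt -/k.
have -> : v * pi *+ 2 = k * (v / k * pi *+ 2).
  by rewrite -mulrnAr -[in RHS]mulrnAr mulrA [k * (v / k)]mulrC divfK // gt_eqF.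
rewrite sqrtrM ?ltW // invfM -!mulrA; congr (_ * _).
rewrite [RHS]mulrCA; congr (_ * _).
rewrite -!expRD; congr expR.
have kn : k != 0 by rewrite gt_eqF.
have vn : v != 0 by rewrite gt_eqF.
have -> : b = (1 - k) / (2 * v) by rewrite /k; field; rewrite vn.
by field; rewrite kn vn.
Qed.

Lemma gaussian_int_tilt a b v (h : R -> \bar R) : 0 <= v -> 0 < 1 - 2 * b * v ->
  measurable_fun setT h -> (forall x, 0 <= h x)%E ->
  (gaussian_int v (fun x => h x * (expR (a * x + b * x ^+ 2))%:E) =
   (gaussian_tilt a b v)%:E * gaussian_int (v / (1 - 2 * b * v))
      (fun x => h (x + a * (v / (1 - 2 * b * v)))%R))%E.
Proof.
move=> v0 k0 mh h0; rewrite /gaussian_int.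
have [vE|vn] := eqVneq v 0.
  rewrite vE /gaussian_tilt expr0n /=.
  by rewrite !(mul0r, mulr0, subr0, addr0, eqxx, sqrtr1, invr1, expR0, mulr1, mul1r, mule1, mul1e).
have v1 : 0 < v by rewrite lt_neqAle eq_sym vn.
have vk0 : 0 < v / (1 - 2 * b * v) by rewrite divr_gt0.
rewrite (gt_eqF vk0); set v' := v / (1 - 2 * b * v).
have mpdf (s : R) : measurable_fun setT (fun x : R => (normal_pdf 0 s x)%:E : \bar R).
  by apply/measurable_EFinP; exact: measurable_normal_pdf.
have mpdf' (s m : R) : measurable_fun setT (fun x : R => (normal_pdf 0 s (x - m))%:E : \bar R).
  apply: (measurableT_comp (mpdf s)); exact: measurable_funB.
transitivity (\int[mu]_x ((gaussian_tilt a b v)%:E *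
    (h x * (normal_pdf 0 (Num.sqrt v') (x - a * v'))%:E)))%E.
  apply: eq_integral => x _.
  by rewrite muleCA -muleA -!EFinM [expR _ * _]mulrC normal_pdf_tilt.
have q0 x : (0 <= h x * (normal_pdf 0 (Num.sqrt v') (x - a * v'))%:E)%E.
  by rewrite mule_ge0 // lee_fin normal_pdf_ge0.
have mq : measurable_fun setT (fun x => h x * (normal_pdf 0 (Num.sqrt v') (x - a * v'))%:E)%E.
  exact: emeasurable_funM.
have E := @ge0_integralZl_EFin _ (measurableTypeR R) R mu setT measurableT _ (fun x _ => q0 x) mq _
  (gaussian_tilt_ge0 a b v).
transitivity ((gaussian_tilt a b v)%:E * \int[mu]_x (h x * (normal_pdf 0 (Num.sqrt v') (x - a * v'))%:E))%E.
  exact: E.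
apply: (congr1 (fun y => (gaussian_tilt a b v)%:E * y)%E).
rewrite -(integral_shift (a * v') mq q0).
by apply: eq_integral => x _; rewrite addrK.
Qed.
End gaussian_integral.

Section gaussian_variable.
Context {R : realType} {disp : measure_display} {Omega : measurableType disp}.
Variable P : probability Omega R.
Local Notation hc := hermite_coeff.

Definition gaussian (V : Omega -> R) (v : R) := [/\ 0 <= v, measurable_fun setT V &
  if v == 0 then {ae P, forall w, V w = 0}
  else forall B, measurable B -> P (V @^-1` B) = normal_prob 0 (Num.sqrt v) B].

Lemma gaussian_integralE V v (h : R -> \bar R) : gaussian V v ->
  measurable_fun setT h -> (forall x, 0 <= h x)%E ->
  (\int[P]_w h (V w) = gaussian_int v h)%E.
Proof.
move=> [v0 mV HV] mh h0; rewrite /gaussian_int; case: ifPn HV => vE HV.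
  transitivity (\int[P]_w (h 0%R))%E; last by rewrite integral_cst // [X in (_ * X)%E](probability_setT P) mule1.
  apply: ge0_ae_eq_integral => //; first exact: (measurableT_comp mh mV).
  by apply: filterS HV => w -> _.
pose m := isMeasurableFun.Build _ _ Omega (measurableTypeR R) V mV.
pose X : {mfun Omega >-> measurableTypeR R} := HB.pack V m.
transitivity (\int[distribution P X]_x h x)%E.
  by rewrite (ge0_integral_distribution X mh).
transitivity (\int[normal_prob 0 (Num.sqrt v)]_x h x)%E.
  by apply: eq_measure_integral => A mA _; first [exact: HV|exact/esym/HV].
apply: integral_density => //; first exact: measurable_normal_pdf.
by move=> x; exact: normal_pdf_ge0.
Qed.

Lemma gaussian_measurable V v : gaussian V v -> measurable_fun setT V.
Proof. by case. Qed.

Lemma gaussian_exp V v a b : gaussian V v -> 0 < 1 - 2 * b * v ->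
  (\int[P]_w (expR (a * V w + b * V w ^+ 2))%:E = (gaussian_tilt a b v)%:E)%E.
Proof.
move=> HV k0; have [v0 mV _] := HV.
have mh : measurable_fun setT (fun x : R => (expR (a * x + b * x ^+ 2))%:E).
  apply/measurable_EFinP; apply: measurableT_comp => //; apply: measurable_funD.
    exact: measurable_funM.
  by apply: measurable_funM => //; exact: measurable_funX.
rewrite (gaussian_integralE (h := fun x => (expR (a * x + b * x ^+ 2))%:E) HV) //.
have := gaussian_int_tilt a v0 k0 (measurable_cst (1%:E : \bar R)) (fun=> lee01).
rewrite gaussian_int1 mule1 => <-; rewrite /gaussian_int.
by case: ifPn => _; [rewrite mul1e|apply: eq_integral => x _; rewrite mul1e].
Qed.

Lemma measurable_quadratic (V : Omega -> R) (a b : R) : measurable_fun setT V ->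
  measurable_fun setT (fun w => a * V w + b * V w ^+ 2).
Proof.
move=> mV; apply: measurable_funD; first exact: measurable_funM.
by apply: measurable_funM => //; exact: measurable_funX.
Qed.

Lemma gaussian_exp_integrable V v a b : gaussian V v -> 0 < 1 - 2 * b * v ->
  P.-integrable setT (EFin \o (fun w => expR (a * V w + b * V w ^+ 2))).
Proof.
move=> HV k0; have [v0 mV _] := HV; apply/integrableP; split.
  by apply/measurable_EFinP; apply: measurableT_comp => //; exact: measurable_quadratic.
under eq_integral do rewrite /= ger0_norm ?expR_ge0 //.
by rewrite (gaussian_exp _ HV) // ltry.
Qed.

Lemma gaussian_expR V v a b : gaussian V v -> 0 < 1 - 2 * b * v ->
  (\int[P]_w expR (a * V w + b * V w ^+ 2))%R = gaussian_tilt a b v.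
Proof. by move=> HV k0; rewrite /Rintegral (gaussian_exp _ HV). Qed.

Lemma gaussian_expabs_integrable V v r a b : gaussian V v -> 0 < 1 - 2 * b * v ->
  P.-integrable setT (EFin \o (fun w => expR (r * `|V w|) * expR (a * V w + b * V w ^+ 2))).
Proof.
move=> HV k0; have [v0 mV _] := HV.
have I1 := gaussian_exp_integrable (a + r) HV k0.
have I2 := gaussian_exp_integrable (a - r) HV k0.
apply: (le_integrable measurableT _ _ (rintegrableD I1 I2)).
  apply/measurable_EFinP; apply: measurable_funM; apply: measurableT_comp => //.
    by apply: measurable_funM => //; apply: measurableT_comp => //; exact: normr_measurable.
  exact: measurable_quadratic.
move=> w _ /=; rewrite lee_fin (ger0_norm (mulr_ge0 (expR_ge0 _) (expR_ge0 _))).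
rewrite (ger0_norm (addr_ge0 (expR_ge0 _) (expR_ge0 _))) -expRD; case: (leP 0 (V w)) => h.
  rewrite (ger0_norm h).
  have -> : r * V w + (a * V w + b * V w ^+ 2) = (a + r) * V w + b * V w ^+ 2 by ring.
  by rewrite lerDl expR_ge0.
rewrite (ltr0_norm h).
have -> : r * - V w + (a * V w + b * V w ^+ 2) = (a - r) * V w + b * V w ^+ 2 by ring.
by rewrite lerDr expR_ge0.
Qed.

Lemma cintegrable_real (f : Omega -> R) : P.-integrable setT (EFin \o f) ->
  cintegrable P (fun w => (f w)%:C).
Proof.
move=> If; have mf : measurable_fun setT f by apply/measurable_EFinP; exact: measurable_int If.
by apply: (cintegrable_le (cmfun_real mf) (integrable_norm If)) => w; rewrite normc_real.
Qed.

(** Expectation of a power series with random coefficients; the dominating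
    variables make the expected series entire, so an identity for real
    parameters extends to complex ones. *)
Lemma cE_power_series (c : nat -> Omega -> R) (S : R[i] -> Omega -> R[i]) (g : R -> Omega -> R) :
  (forall n, measurable_fun setT (c n)) ->
  (forall z w, ccvg (fun N => \sum_(n < N) z ^+ n * (c n w)%:C) (S z w)) ->
  (forall r, 0 <= r -> P.-integrable setT (EFin \o g r)) ->
  (forall r w N, 0 <= r -> \sum_(n < N) r ^+ n * `|c n w| <= g r w) ->
  [/\ forall n, P.-integrable setT (EFin \o c n),
      entire_coeff (fun n => \int[P]_w c n w)%R,
      forall z, cintegrable P (S z) &
      forall z, ccvg (fun N => \sum_(n < N) z ^+ n * ((\int[P]_w c n w)%R)%:C)
                     (cexpectation P (S z))].
Proof.
move=> mc cS Ig cg.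
have term r n w : 0 <= r -> r ^+ n * `|c n w| <= g r w.
  move=> r0; apply: le_trans (cg r w n.+1 r0); rewrite big_ord_recr /= lerDr sumr_ge0 // => i _.
  by rewrite mulr_ge0 ?exprn_ge0.
have Ic n : P.-integrable setT (EFin \o c n).
  apply: (le_integrable measurableT _ _ (Ig 1 ler01)); first exact/measurable_EFinP.
  move=> w _; rewrite /= lee_fin (le_trans _ (ler_norm _)) //.
  by have := term 1 n w ler01; rewrite expr1n mul1r.
have dom z := @cE_dominated _ _ _ P (fun N w => \sum_(n < N) z ^+ n * (c n w)%:C) (S z) (g (normc z)) _ (cS z) (Ig _ (normc_ge0 z)) _.
have mP z N : cmfun (fun w => \sum_(n < N) z ^+ n * (c n w)%:C).
  apply: cmfun_sum => n; apply: cmfunM; first exact: cmfun_cst.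
  exact: cmfun_real.
have bP z N w : normc (\sum_(n < N) z ^+ n * (c n w)%:C) <= g (normc z) w.
  apply: (le_trans (normc_sum _ _ _)); apply: le_trans (cg (normc z) w N (normc_ge0 z)).
  by apply: ler_sum => n _; rewrite normcM normcX normc_real.
split => //.
- move=> r r0; exists (\int[P]_w g r w)%R => n.
  rewrite mulrC -[X in X * _](ger0_norm (exprn_ge0 n r0)) -normrM -RintegralZl //.
  apply: (le_trans (le_normr_Rintegral _ _)) => //; first exact: rintegrableZ.
  apply: le_Rintegral => //; first by apply: integrable_norm; exact: rintegrableZ.
    exact: Ig.
  by move=> w _; rewrite normrM (ger0_norm (exprn_ge0 n r0)); exact: term.
- by move=> z; have [] := dom mP bP z.
move=> z; have [_ +] := dom mP bP z.
suff -> : (fun n => cexpectation P (fun w => \sum_(n0 < n) z ^+ n0 * (c n0 w)%:C)) =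
  (fun N => \sum_(n < N) z ^+ n * ((\int[P]_w c n w)%R)%:C) by [].
apply/funext => N.
have Icc n : cintegrable P (fun w => (c n w)%:C).
  exact: cintegrable_real.
suff [] : cintegrable P (fun w => \sum_(n0 < N) z ^+ n0 * (c n0 w)%:C) /\
   cexpectation P (fun w => \sum_(n0 < N) z ^+ n0 * (c n0 w)%:C) =
   \sum_(n < N) z ^+ n * ((\int[P]_w c n w)%R)%:C by [].
elim: N => [|N [IH1 IH2]].
  have -> : (fun w => \sum_(n0 < 0) z ^+ n0 * (c n0 w)%:C) = (fun=> 0).
    by apply/funext => w; rewrite big_ord0.
  by rewrite big_ord0; split; [exact: cintegrable_cst|exact: cE_cst].
have -> : (fun w => \sum_(n0 < N.+1) z ^+ n0 * (c n0 w)%:C) =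
   (fun w => \sum_(n0 < N) z ^+ n0 * (c n0 w)%:C + z ^+ N * (c N w)%:C).
  by apply/funext => w; rewrite big_ord_recr.
split; first by apply: cintegrableD => //; exact: cintegrableZ.
rewrite cED //; last exact: cintegrableZ.
by rewrite IH2 cEZ // cE_real big_ord_recr.
Qed.

Lemma measurable_hermite (V : Omega -> R) t n : measurable_fun setT V ->
  measurable_fun setT (fun w => hc t (V w) n).
Proof.
move=> mV; suff [] : measurable_fun setT (fun w => hc t (V w) n) /\
  measurable_fun setT (fun w => hc t (V w) n.+1) by [].
elim: n => [|n [h0 h1]].
  by split; [exact: measurable_cst|under eq_fun do rewrite hermite_coeff1].
split=> //; under eq_fun do rewrite hermite_coeffSS.
apply: measurable_funM; last exact: measurable_cst.
by apply: measurable_funB; apply: measurable_funM => //; exact: measurable_cst.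
Qed.

(** Tilted Gaussian expectation of Hermite polynomials and of their generating
    function; the real exponential identity determines the coefficients, hence
    also the complex exponential one. *)
Theorem gaussian_hermite V v t a b : gaussian V v -> 0 < 1 - 2 * b * v ->
  let v' := v / (1 - 2 * b * v) in
  (forall n, P.-integrable setT (EFin \o (fun w => hc t (V w) n * expR (a * V w + b * V w ^+ 2))) /\
     (\int[P]_w (hc t (V w) n * expR (a * V w + b * V w ^+ 2)))%R =
     gaussian_tilt a b v * hc (t - v') (a * v') n) /\
  (forall z : R[i],
     cintegrable P (fun w => cexp (z * (V w)%:C - z ^+ 2 * (t / 2)%:C) *
         (expR (a * V w + b * V w ^+ 2))%:C) /\
     cexpectation P (fun w => cexp (z * (V w)%:C - z ^+ 2 * (t / 2)%:C) *
         (expR (a * V w + b * V w ^+ 2))%:C) =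
     (gaussian_tilt a b v)%:C * cexp (z * (a * v')%:C - z ^+ 2 * ((t - v') / 2)%:C)).
Proof.
move=> HV k0 v'; have [v0 mV _] := HV.
pose rho w := expR (a * V w + b * V w ^+ 2).
have mrho : measurable_fun setT rho by apply: measurableT_comp => //; exact: measurable_quadratic.
pose c n w := hc t (V w) n * rho w.
pose S (z : R[i]) w := cexp (z * (V w)%:C - z ^+ 2 * (t / 2)%:C) * (rho w)%:C.
pose g r w := expR (r ^+ 2 * (`|t| / 2)) * (expR (r * `|V w|) * rho w).
have [||||Ic mE IS SE] := @cE_power_series c S g.
- by move=> n; apply: measurable_funM => //; exact: measurable_hermite.
- move=> z w.
  have -> : (fun N => \sum_(n < N) z ^+ n * (c n w)%:C) =
      (fun N => (\sum_(n < N) z ^+ n * (hc t (V w) n)%:C) * (rho w)%:C).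
    by apply/funext => N; rewrite mulr_suml; apply: eq_bigr => n _; rewrite /c rmorphM /= mulrA.
  by apply: ccvgM; [exact: hermite_generating|exact: ccvg_cst].
- by move=> r r0; apply: rintegrableZ; exact: gaussian_expabs_integrable HV k0.
- move=> r w N r0.
  have -> : \sum_(n < N) r ^+ n * `|c n w| = (\sum_(n < N) r ^+ n * `|hc t (V w) n|) * rho w.
    rewrite mulr_suml; apply: eq_bigr => n _.
    by rewrite /c normrM (ger0_norm (expR_ge0 _)) mulrA.
  rewrite /g mulrA -expRD addrC ler_wpM2r ?expR_ge0 //; exact: hermite_partial_sum_le.
have mC : (fun n => \int[P]_w c n w)%R = (fun n => gaussian_tilt a b v * hc (t - v') (a * v') n).
  apply: (@pseries_unique _ _ _ (fun r => gaussian_tilt a b v *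
     expR (r * (a * v') - r ^+ 2 * ((t - v') / 2)))) => //.
  - move=> r r0; have [C HC] := hermite_entire_coeff (t - v') (a * v') r0.
    exists (gaussian_tilt a b v * C) => n; rewrite normrM ger0_norm ?gaussian_tilt_ge0 //.
    by rewrite -mulrA ler_wpM2l ?gaussian_tilt_ge0.
  - move=> r; have [+ _] := SE r%:C.
    have -> : (fun n => complex.Re (\sum_(n0 < n) r%:C ^+ n0 * ((\int[P]_w c n0 w)%R)%:C)) =
        pseries (fun n => \int[P]_w c n w)%R r.
      apply/funext => n; rewrite Re_sum /pseries /series /= big_mkord; apply: eq_bigr => i _.
      by rewrite -rmorphXn -rmorphM /= mulrC.
    rewrite Re_cE.
    suff -> : (\int[P]_w complex.Re (S r%:C w))%R =
      gaussian_tilt a b v * expR (r * (a * v') - r ^+ 2 * ((t - v') / 2)) by [].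
    have -> : (\int[P]_w complex.Re (S r%:C w))%R =
       (\int[P]_w (expR (- (r ^+ 2 * (t / 2))) * expR ((a + r) * V w + b * V w ^+ 2)))%R.
      apply: eq_Rintegral => w _; rewrite /S.
      rewrite -!rmorphXn -!rmorphM -rmorphB cexp_real -rmorphM /= /rho -!expRD.
      by congr expR; ring.
    rewrite RintegralZl //; last exact: gaussian_exp_integrable HV k0.
    rewrite (gaussian_expR _ HV) // /gaussian_tilt -/v' mulrCA -[RHS]mulrA -!expRD.
    by congr (_ * expR _); field.
  - move=> r.
    have -> : pseries (fun n => gaussian_tilt a b v * hc (t - v') (a * v') n) r =
       (fun n => gaussian_tilt a b v * pseries (hc (t - v') (a * v')) r n).
      apply/funext => n; rewrite /pseries /series /= mulr_sumr.
      by apply: eq_bigr => i _; rewrite mulrA.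
    by apply: cvgMr; exact: hermite_generating_real.
have mCn n : (\int[P]_w c n w)%R = gaussian_tilt a b v * hc (t - v') (a * v') n.
  exact: (congr1 (fun f : nat -> R => f n) mC).
split=> [n|z]; first by split; [exact: Ic|exact: mCn].
split; first exact: IS.
apply: (ccvg_unique (SE z)).
have -> : (fun N => \sum_(n < N) z ^+ n * ((\int[P]_w c n w)%R)%:C) =
   (fun N => (gaussian_tilt a b v)%:C * \sum_(n < N) z ^+ n * (hc (t - v') (a * v') n)%:C).
  apply/funext => N; rewrite mulr_sumr; apply: eq_bigr => n _.
  by rewrite mCn rmorphM /= mulrCA.
by apply: ccvgM; [exact: ccvg_cst|exact: hermite_generating].
Qed.
End gaussian_variable.

(** * The transform kernel and the bridge kernel *)

Section kernels.
Context {R : realType}.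
Implicit Types (T s u x : R) (z : R[i]).

Definition kernel1 T z u : R[i] := cexp ((T^-1)%:C * (z * u%:C - z ^+ 2 / 2%:R)).

(** For real z = x this is the density of X_s at x given X_T = u, divided by
    the density of X_s at x. *)
Definition cbridge1 T s z u : R[i] :=
  ((Num.sqrt (1 - s / T))^-1)%:C *
  cexp ((u ^+ 2 / (2 * T))%:C - (u%:C - z) ^+ 2 * ((2 * (T - s))^-1)%:C).

Definition bridge1 T s x u : R := (Num.sqrt (1 - s / T))^-1 *
  expR (u ^+ 2 / (2 * T) - (u - x) ^+ 2 / (2 * (T - s))).

Lemma cbridge1_real T s x u : cbridge1 T s x%:C u = (bridge1 T s x u)%:C.
Proof. by rewrite /cbridge1 /bridge1 -!rmorphB -!rmorphXn -!rmorphM -rmorphB cexp_real -rmorphM. Qed.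

Lemma bridge1_ge0 T s x u : 0 <= bridge1 T s x u.
Proof. by rewrite mulr_ge0 ?expR_ge0 // invr_ge0 sqrtr_ge0. Qed.

Lemma complex2 : (2%:R : R[i]) = (2 : R)%:C.
Proof. by rewrite rmorph_nat. Qed.

Lemma kernel1E T z u : kernel1 T z u = cexp (z * (u / T)%:C - z ^+ 2 * (T^-1 / 2)%:C).
Proof.
rewrite /kernel1 complex2; congr cexp.
by rewrite -fmorphV !rmorphM /=; ring.
Qed.

Lemma normc_kernel1 T x y u :
  normc (kernel1 T (x +i* y) u) = expR ((x * u - (x ^+ 2 - y ^+ 2) / 2) / T).
Proof.
rewrite kernel1E normc_cexp; congr expR.
by rewrite expr2 !(ReD, ReN, ReM, ImM) /=; ring.
Qed.

Lemma normc_kernel1_le T z u : 0 < T ->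
  normc (kernel1 T z u) <= expR (normc z / T * `|u| + normc z ^+ 2 / (2 * T)).
Proof.
move=> T0; rewrite kernel1E normc_cexp ler_expR ReD ReN.
rewrite lerD //.
  apply: (le_trans (ler_norm _)); apply: (le_trans (norm_Re _)).
  by rewrite normcM normc_real normrM normfV (gtr0_norm T0) mulrA mulrAC.
apply: (le_trans (ler_norm _)); rewrite normrN; apply: (le_trans (norm_Re _)).
rewrite normcM normcX normc_real ger0_norm; last by rewrite divr_ge0 ?invr_ge0 ?(ltW T0).
by rewrite invfM [2^-1 * _]mulrC.
Qed.

Lemma sqrt_bridge T s : 0 <= s < T ->
  Num.sqrt (1 - s / T) * Num.sqrt (T / (T - s)) = 1.
Proof.
case/andP=> s0 sT; have T0 : 0 < T by apply: le_lt_trans sT.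
have Ts : 0 < T - s by rewrite subr_gt0.
rewrite -sqrtrM; last by rewrite subr_ge0 ler_pdivrMr // mul1r ltW.
have -> : (1 - s / T) * (T / (T - s)) = 1.
  by field; rewrite !gt_eqF.
by rewrite sqrtr1.
Qed.

Lemma bridge1_quadratic T s x u : 0 <= s < T -> bridge1 T s x u =
  (Num.sqrt (1 - s / T))^-1 * expR (- x ^+ 2 / (2 * (T - s))) *
  expR (x / (T - s) * u + (1 / (2 * T) - 1 / (2 * (T - s))) * u ^+ 2).
Proof.
case/andP=> s0 sT; have T0 : 0 < T by apply: le_lt_trans sT.
have Ts : 0 < T - s by rewrite subr_gt0.
rewrite /bridge1 -mulrA -expRD; congr (_ * expR _).
by field; rewrite !gt_eqF.
Qed.

Lemma bridge1_quadratic_x T s x u : 0 <= s < T -> bridge1 T s x u =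
  (Num.sqrt (1 - s / T))^-1 * expR (u ^+ 2 * (1 / (2 * T) - 1 / (2 * (T - s)))) *
  expR (u / (T - s) * x + (- (1 / (2 * (T - s)))) * x ^+ 2).
Proof.
case/andP=> s0 sT; have T0 : 0 < T by apply: le_lt_trans sT.
have Ts : 0 < T - s by rewrite subr_gt0.
rewrite /bridge1 -mulrA -expRD; congr (_ * expR _).
by field; rewrite !gt_eqF.
Qed.

Lemma bridge1_le T S s x u B : 0 <= s <= S -> S < T -> `|x| <= B ->
  bridge1 T s x u <= (Num.sqrt (1 - S / T))^-1 * expR (B / (T - S) * `|u|).
Proof.
case/andP=> s0 sS ST xB; have T0 : 0 < T by apply: le_lt_trans ST; apply: le_trans sS.
have TS : 0 < T - S by rewrite subr_gt0.
have Ts : 0 < T - s by rewrite subr_gt0 (le_lt_trans sS).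
have B0 : 0 <= B := le_trans (normr_ge0 _) xB.
rewrite /bridge1 ler_pM ?invr_ge0 ?sqrtr_ge0 ?expR_ge0 //.
  have k0 : 0 < 1 - S / T by rewrite subr_gt0 ltr_pdivrMr // mul1r.
  rewrite lef_pV2 ?posrE ?sqrtr_gt0 //.
    by rewrite ler_wsqrtr // lerB // ler_pM2r ?invr_gt0.
  by rewrite (lt_le_trans k0) // lerB // ler_pM2r ?invr_gt0.
rewrite ler_expR.
have -> : u ^+ 2 / (2 * T) - (u - x) ^+ 2 / (2 * (T - s)) =
   u * x / (T - s) - (u ^+ 2 * (s / (2 * T * (T - s))) + x ^+ 2 / (2 * (T - s))).
  by field; rewrite !gt_eqF.
have c0 : 0 <= u ^+ 2 * (s / (2 * T * (T - s))) + x ^+ 2 / (2 * (T - s)).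
  by rewrite addr_ge0 // mulr_ge0 ?sqr_ge0 // ?divr_ge0 ?invr_ge0 ?mulr_ge0 ?(ltW T0) ?(ltW Ts).
rewrite lerBlDr; apply: (@le_trans _ _ (B / (T - S) * `|u|)); last by rewrite lerDl.
apply: (le_trans (ler_norm _)); rewrite !normrM normfV (gtr0_norm Ts).
rewrite -mulrA mulrC ler_wpM2r // ler_pM ?invr_ge0 ?(ltW Ts) //.
by rewrite lef_pV2 ?posrE // lerB.
Qed.

Lemma hermite_coeff_homogeneous (l t x : R) n :
  hermite_coeff (l ^+ 2 * t) (l * x) n = l ^+ n * hermite_coeff t x n.
Proof.
suff [] : hermite_coeff (l ^+ 2 * t) (l * x) n = l ^+ n * hermite_coeff t x n /\
   hermite_coeff (l ^+ 2 * t) (l * x) n.+1 = l ^+ n.+1 * hermite_coeff t x n.+1 by [].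
elim: n => [|n [h0 h1]]; first by rewrite !hermite_coeff0 !hermite_coeff1 expr0 expr1 mulr1.
by split => //; rewrite !hermite_coeffSS h0 h1 !exprS; ring.
Qed.

(* 1 - 2 b v for the two quadratic coefficients below *)
Lemma tilt_bridge T s : 0 <= s < T -> 1 - 2 * (- (1 / (2 * (T - s)))) * s = T / (T - s).
Proof. by case/andP=> s0 sT; field; rewrite gt_eqF // subr_gt0. Qed.

Lemma tilt_bridge_T T s : 0 <= s < T ->
  1 - 2 * (1 / (2 * T) - 1 / (2 * (T - s))) * T = T / (T - s).
Proof.
case/andP=> s0 sT; have T0 : 0 < T by apply: le_lt_trans sT.
by field; rewrite !gt_eqF // subr_gt0.
Qed.

Lemma tilt_kernel T s : 0 <= s < T -> 1 - 2 * (1 / (2 * T)) * s = 1 - s / T.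
Proof.
case/andP=> s0 sT; have T0 : 0 < T by apply: le_lt_trans sT.
by field; rewrite !gt_eqF.
Qed.
End kernels.

Section gaussian_kernels.
Context {R : realType} {disp : measure_display} {Omega : measurableType disp}.
Variable P : probability Omega R.
Implicit Types (T s u x : R) (z : R[i]) (V W : Omega -> R).
Local Notation hc := hermite_coeff.

Let i2 : 'i * 'i = -1 :> R[i]. Proof. by rewrite -expr2 sqr_i. Qed.
Let half2 : (2^-1 : R)%:C + (2^-1 : R)%:C = 1.
Proof. by rewrite -rmorphD -(rmorph1 (real_complex R)); congr (_%:C); field. Qed.
Let rdiv (a b : R) : (a / b)%:C = a%:C * (b^-1)%:C. Proof. exact: rmorphM. Qed.

(** Integrating the imaginary part out of the kernel gives the bridge kernel. *)
Lemma cE_kernel1_imaginary V T s z u : gaussian P V s -> 0 <= s < T ->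
  cintegrable P (fun w => kernel1 T (z + 'i * (V w)%:C) u) /\
  cexpectation P (fun w => kernel1 T (z + 'i * (V w)%:C) u) = cbridge1 T s z u.
Proof.
move=> HV sT; have [s0 s1] := andP sT; have T0 : 0 < T by apply: le_lt_trans s1.
have Ts : 0 < T - s by rewrite subr_gt0.
have k0 : 0 < 1 - 2 * (1 / (2 * T)) * s.
  by rewrite tilt_kernel // subr_gt0 ltr_pdivrMr // mul1r.
have [_ H] := gaussian_hermite 0 0 HV k0.
have [H1 H2] := H ('i * (u%:C - z) * (T^-1)%:C).
have -> : (fun w => kernel1 T (z + 'i * (V w)%:C) u) =
  (fun w => cexp (z * (u / T)%:C - z ^+ 2 * (T^-1 / 2)%:C) * (cexp ('i * (u%:C - z) * (T^-1)%:C * (V w)%:C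
       - ('i * (u%:C - z) * (T^-1)%:C) ^+ 2 * (0 / 2)%:C) *
     (expR (0 * V w + 1 / (2 * T) * V w ^+ 2))%:C)).
  apply/funext => w; rewrite kernel1E -cexp_real -!cexpD; congr cexp.
  have -> : 0 * V w + 1 / (2 * T) * V w ^+ 2 = T^-1 / 2 * V w ^+ 2 by field; rewrite gt_eqF.
  rewrite (rmorphM _ (T^-1 / 2)) rmorphXn !rdiv mul0r mulr0 subr0 /=.
  move: half2; set h := (2^-1)%:C; set t := (T^-1)%:C; set v := (V w)%:C; set U := u%:C => hh.
  apply/eqP; rewrite -subr_eq0; apply/eqP.
  transitivity ('i * z * t * v * (1 - (h + h)) - ('i * 'i + 1) * v ^+ 2 * t * h); first by ring.
  by rewrite hh i2; ring.
split; first exact: cintegrableZ.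
rewrite cEZ // H2 /cbridge1 mul0r sub0r /gaussian_tilt tilt_kernel // mulrCA.
rewrite expr0n /= !mul0r expR0 mulr1; congr (_ * _); rewrite -cexpD; congr cexp.
set a := (- (s / (1 - s / T)) / 2)%:C.
have -> : ((2 * (T - s))^-1)%:C = (T^-1)%:C * (2^-1)%:C - (T^-1)%:C ^+ 2 * a.
  rewrite -!rmorphXn -!rmorphM -rmorphB; congr (_%:C).
  field; rewrite !gt_eqF //= (_ : T + _ = T - s) ?gt_eqF //.
have -> : (u ^+ 2 / (2 * T))%:C = u%:C ^+ 2 * (T^-1)%:C * (2^-1)%:C.
  by rewrite -!rmorphXn -!rmorphM; congr (_%:C); field; rewrite gt_eqF.
rewrite !rdiv mulr0 sub0r -/a.
move: half2; set h := (2^-1)%:C; set t := (T^-1)%:C; set U := u%:C => hh.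
apply/eqP; rewrite -subr_eq0; apply/eqP.
transitivity (z * U * t * (1 - (h + h)) - ('i * 'i + 1) * (U - z) ^+ 2 * t ^+ 2 * a); first by ring.
by rewrite hh i2; ring.
Qed.

Lemma cE_cbridge1_real V T s z u : gaussian P V s -> 0 <= s < T ->
  cintegrable P (fun w => cbridge1 T s (z + (V w)%:C) u) /\
  cexpectation P (fun w => cbridge1 T s (z + (V w)%:C) u) = kernel1 T z u.
Proof.
move=> HV sT; have [s0 s1] := andP sT; have T0 : 0 < T by apply: le_lt_trans s1.
have Ts : 0 < T - s by rewrite subr_gt0.
have k0 : 0 < 1 - 2 * (- (1 / (2 * (T - s)))) * s by rewrite tilt_bridge // divr_gt0.
have [_ H] := gaussian_hermite 0 0 HV k0.
have [H1 H2] := H ((u%:C - z) * ((T - s)^-1)%:C).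
pose c0 := ((Num.sqrt (1 - s / T))^-1)%:C *
  cexp ((u ^+ 2 / (2 * T))%:C - (u%:C - z) ^+ 2 * ((2 * (T - s))^-1)%:C).
have -> : (fun w => cbridge1 T s (z + (V w)%:C) u) =
  (fun w => c0 * (cexp ((u%:C - z) * ((T - s)^-1)%:C * (V w)%:C
       - ((u%:C - z) * ((T - s)^-1)%:C) ^+ 2 * (0 / 2)%:C) *
     (expR (0 * V w + - (1 / (2 * (T - s))) * V w ^+ 2))%:C)).
  apply/funext => w; rewrite /cbridge1 /c0 -mulrA -cexp_real -!cexpD; congr (_ * cexp _).
  rewrite !mul0r add0r mulr0 subr0 mulNr mul1r rmorphN (rmorphM _ _ (V w ^+ 2)) rmorphXn.
  have -> : ((T - s)^-1)%:C = ((2 * (T - s))^-1)%:C + ((2 * (T - s))^-1)%:C.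
    by rewrite -rmorphD; congr (_%:C); field; rewrite gt_eqF.
  by ring.
split; first exact: cintegrableZ.
rewrite cEZ // H2 /c0 mul0r sub0r /gaussian_tilt tilt_bridge // expr0n /= !mul0r expR0 mulr1.
have cc : ((Num.sqrt (1 - s / T))^-1)%:C * ((Num.sqrt (T / (T - s)))^-1)%:C = 1 :> R[i].
  by rewrite -rmorphM -invfM sqrt_bridge // invr1 rmorph1.
rewrite mulrACA cc mul1r kernel1E -cexpD; congr cexp.
set a := (- (s / (T / (T - s))) / 2)%:C.
have E : (((T - s)^-1)%:C) ^+ 2 * a = (T^-1)%:C * (2^-1)%:C - ((2 * (T - s))^-1)%:C.
  rewrite -!rmorphXn -!rmorphM -rmorphB; congr (_%:C).
  by field; rewrite !gt_eqF.
have -> : (u ^+ 2 / (2 * T))%:C = u%:C ^+ 2 * (T^-1)%:C * (2^-1)%:C.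
  by rewrite -!rmorphXn -!rmorphM; congr (_%:C); field; rewrite gt_eqF.
rewrite !rdiv mulr0 sub0r -/a exprMn -(mulrA ((u%:C - z) ^+ 2)) E.
move: half2; set h := (2^-1)%:C; set t := (T^-1)%:C; set U := u%:C => hh.
apply/eqP; rewrite -subr_eq0; apply/eqP.
transitivity (z * U * t * (h + h - 1)); first by ring.
by rewrite hh; ring.
Qed.

Lemma bridge_hermite V T s u n : gaussian P V s -> 0 <= s < T ->
  P.-integrable setT (EFin \o (fun w => hc s (V w) n * bridge1 T s (V w) u)) /\
  (\int[P]_w (hc s (V w) n * bridge1 T s (V w) u))%R = (s / T) ^+ n * hc T u n.
Proof.
move=> HV sT; have [s0 s1] := andP sT; have T0 : 0 < T by apply: le_lt_trans s1.
have Ts : 0 < T - s by rewrite subr_gt0.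
have k0 : 0 < 1 - 2 * (- (1 / (2 * (T - s)))) * s by rewrite tilt_bridge // divr_gt0.
have [H _] := gaussian_hermite s (u / (T - s)) HV k0.
have [H1 H2] := H n.
pose c0 := (Num.sqrt (1 - s / T))^-1 * expR (u ^+ 2 * (1 / (2 * T) - 1 / (2 * (T - s)))).
have -> : (fun w => hc s (V w) n * bridge1 T s (V w) u) = (fun w => c0 * (hc s (V w) n *
    expR (u / (T - s) * V w + - (1 / (2 * (T - s))) * V w ^+ 2))).
  by apply/funext => w; rewrite bridge1_quadratic_x // mulrCA.
split; first exact: rintegrableZ.
rewrite RintegralZl // H2 /c0 /gaussian_tilt tilt_bridge //.
have -> : s - s / (T / (T - s)) = (s / T) ^+ 2 * T by field; rewrite !gt_eqF.
have -> : u / (T - s) * (s / (T / (T - s))) = (s / T) * u by field; rewrite !gt_eqF.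
rewrite hermite_coeff_homogeneous mulrA; set k := (X in X * _ = _).
suff -> : k = 1 by rewrite mul1r.
rewrite /k mulrACA -invfM sqrt_bridge // invr1 [LHS]mul1r -expRD -[RHS]expR0; congr expR.
by field; rewrite !gt_eqF.
Qed.

Lemma bridge_expectation V T s u : gaussian P V s -> 0 <= s < T ->
  P.-integrable setT (EFin \o (fun w => bridge1 T s (V w) u)) /\
  (\int[P]_w bridge1 T s (V w) u)%R = 1.
Proof.
move=> HV sT; have := bridge_hermite u 0 HV sT.
rewrite expr0 hermite_coeff0 mulr1.
have -> // : (fun w => hc s (V w) 0 * bridge1 T s (V w) u) = (fun w => bridge1 T s (V w) u).
by apply/funext => w; rewrite hermite_coeff0 mul1r.
Qed.

(** The bridge kernel reweights N(0, T) into N(x, T - s). *)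
Lemma bridge_transition V W T s x (B : set R) : gaussian P V T -> gaussian P W (T - s) ->
  0 <= s < T -> measurable B ->
  (\int[P]_w ((\1_B (V w) * bridge1 T s x (V w))%:E) = P [set w | B (x + W w)%R])%E.
Proof.
move=> HV HW sT mB; have [s0 s1] := andP sT; have T0 : 0 < T by apply: le_lt_trans s1.
have Ts : 0 < T - s by rewrite subr_gt0.
have k0 : 0 < 1 - 2 * (1 / (2 * T) - 1 / (2 * (T - s))) * T.
  by rewrite tilt_bridge_T // divr_gt0.
pose c0 := (Num.sqrt (1 - s / T))^-1 * expR (- x ^+ 2 / (2 * (T - s))).
have mi : measurable_fun setT (\1_B : R -> R) by exact: measurable_indic.
have c00 : 0 <= c0 by rewrite mulr_ge0 ?expR_ge0 ?invr_ge0 ?sqrtr_ge0.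
have mh : measurable_fun setT (fun y : R => (c0 * \1_B y)%:E).
  by apply/measurable_EFinP; apply: measurable_funM => //; exact: measurable_indic.
have h0 y : (0 <= (c0 * \1_B y)%:E)%E by rewrite lee_fin mulr_ge0 // indicE.
have mexp : measurable_fun setT (fun y : R =>
    (expR (x / (T - s) * y + (1 / (2 * T) - 1 / (2 * (T - s))) * y ^+ 2))%:E).
  by apply/measurable_EFinP; apply: measurableT_comp => //; exact: measurable_quadratic.
transitivity (gaussian_int T (fun y => (c0 * \1_B y)%:E *
   (expR (x / (T - s) * y + (1 / (2 * T) - 1 / (2 * (T - s))) * y ^+ 2))%:E)%E).
  rewrite -(gaussian_integralE HV); last 2 first.
  - by apply: emeasurable_funM.
  - by move=> y; rewrite mule_ge0 // lee_fin expR_ge0.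
  apply: eq_integral => w _; rewrite -EFinM; congr EFin.
  by rewrite bridge1_quadratic // -/c0 mulrA [\1_B _ * _]mulrC.
rewrite gaussian_int_tilt //; last exact: ltW.
rewrite /gaussian_tilt tilt_bridge_T //.
have -> : T / (T / (T - s)) = T - s by field; rewrite !gt_eqF.
rewrite divfK ?gt_eqF //.
have HX : P [set w | B (x + W w)] = (\int[P]_w (\1_B (x + W w)%R)%:E)%E.
  have mW : measurable_fun setT (fun w => x + W w).
    by apply: measurable_funD => //; exact: gaussian_measurable HW.
  have mBW : measurable [set w | B (x + W w)] by rewrite -[X in measurable X]setTI; exact: mW.
  transitivity (\int[P]_w (\1_[set w | B (x + W w)] w)%:E)%E.
    by rewrite integral_indic // setIT.
  by apply: eq_integral => w _; rewrite !indicE.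
rewrite HX (gaussian_integralE (h := fun y => (\1_B (x + y)%R)%:E) HW); last 2 first.
- apply/measurable_EFinP; apply: (measurableT_comp mi).
  exact: measurable_funD.
- by move=> y; rewrite lee_fin indicE.
rewrite /gaussian_int gt_eqF //.
set k := (_ * expR _)%R.
have kc : k * c0 = 1.
  rewrite /k /c0 mulrACA -invfM mulrC [Num.sqrt (T / _) * _]mulrC sqrt_bridge // invr1 mulr1.
  by rewrite -expRD -[RHS]expR0; congr expR; field; rewrite !gt_eqF.
have mB' : measurable_fun setT (fun y : R => (\1_B (x + y)%R)%:E * (normal_pdf 0 (Num.sqrt (T - s)) y)%:E)%E.
  apply: emeasurable_funM; last by apply/measurable_EFinP; exact: measurable_normal_pdf.
  apply/measurable_EFinP; apply: (measurableT_comp mi); exact: measurable_funD.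
have k0' : 0 <= k by rewrite /k mulr_ge0 ?expR_ge0 ?invr_ge0 ?sqrtr_ge0.
have n0 y : (0 <= (\1_B (x + y)%R)%:E * (normal_pdf 0 (Num.sqrt (T - s)) y)%:E)%E.
  by rewrite mule_ge0 // lee_fin ?normal_pdf_ge0 // indicE.
have E := @ge0_integralZl_EFin _ (measurableTypeR R) R lebesgue_measure setT measurableT _
  (fun y _ => n0 y) mB' _ c00.
transitivity (k%:E * (c0%:E * \int[lebesgue_measure]_y
   ((\1_B (x + y)%R)%:E * (normal_pdf 0 (Num.sqrt (T - s)) y)%:E)))%E.
  apply: (congr1 (fun y => k%:E * y)%E); rewrite -[RHS]E; apply: eq_integral => y _.
  by rewrite EFinM muleA [y + x]addrC.
by rewrite muleA -EFinM kc mul1e.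
Qed.

(** Orthogonality of the Hermite polynomials: expand the expectation of the
    product with the generating function in two ways. *)
Lemma hermite_orthogonal V t n : gaussian P V t ->
  P.-integrable setT (EFin \o (fun w => hc t (V w) n ^+ 2)) /\
  (\int[P]_w (hc t (V w) n ^+ 2))%R = t ^+ n / n`!%:R.
Proof.
move=> HV; have [t0 mV _] := HV.
have k0 : 0 < 1 - 2 * 0 * t :> R by rewrite mulr0 mul0r subr0.
pose c m w := hc t (V w) m * hc t (V w) n.
pose S (z : R[i]) w := cexp (z * (V w)%:C - z ^+ 2 * (t / 2)%:C) * (hc t (V w) n)%:C.
pose g (r : R) w := expR (r ^+ 2 * (`|t| / 2)) * (expR (r * `|V w|) *
   (expR (`|t| / 2) * expR (1 * `|V w|))).
have [||||Ic mE IS SE] := @cE_power_series _ _ _ P c S g.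
- by move=> m; apply: measurable_funM; exact: measurable_hermite.
- move=> z w.
  have -> : (fun N => \sum_(m < N) z ^+ m * (c m w)%:C) =
      (fun N => (\sum_(m < N) z ^+ m * (hc t (V w) m)%:C) * (hc t (V w) n)%:C).
    by apply/funext => N; rewrite mulr_suml; apply: eq_bigr => m _; rewrite /c rmorphM /= mulrA.
  by apply: ccvgM; [exact: hermite_generating|exact: ccvg_cst].
- move=> r r0.
  have -> : g r = (fun w => expR (r ^+ 2 * (`|t| / 2)) * expR (`|t| / 2) *
      (expR ((r + 1) * `|V w|) * expR (0 * V w + 0 * V w ^+ 2))).
    apply/funext => w; rewrite /g !mul0r addr0 expR0 mulr1 -!expRD; congr expR; ring.
  by apply: rintegrableZ; exact: gaussian_expabs_integrable HV k0.
- move=> r w N r0.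
  have -> : \sum_(m < N) r ^+ m * `|c m w| = (\sum_(m < N) r ^+ m * `|hc t (V w) m|) * `|hc t (V w) n|.
    by rewrite mulr_suml; apply: eq_bigr => m _; rewrite /c normrM mulrA.
  rewrite /g mulrA ler_pM ?sumr_ge0 //.
  + by move=> i _; rewrite mulr_ge0 ?exprn_ge0.
  + by rewrite -expRD addrC; exact: hermite_partial_sum_le.
  have := norm_hermite_coeff_le t (V w) n ler01.
  by rewrite !expr1n !mul1r expRD mulrC.
have [Hh _] := gaussian_hermite t 0 HV k0.
suff mC : (fun m => \int[P]_w c m w)%R = (fun m => (m == n)%:R * (t ^+ n / n`!%:R)).
  have cn : (fun w => hc t (V w) n ^+ 2) = c n by apply/funext => w; rewrite expr2.
  split; first by rewrite cn; exact: Ic.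
  have := congr1 (fun f : nat -> R => f n) mC; rewrite eqxx mul1r => <-.
  by apply: eq_Rintegral => w _; rewrite /c expr2.
apply: (@pseries_unique _ _ _ (fun r => r ^+ n * (t ^+ n / n`!%:R))) => //.
- move=> r r0; exists (`|t ^+ n / n`!%:R| * r ^+ n) => m; rewrite normrM.
  case: eqP => [->|_]; first by rewrite normr1 mul1r.
  by rewrite normr0 !mul0r mulr_ge0 ?exprn_ge0.
- move=> r; have [+ _] := SE r%:C.
  have -> : (fun N => complex.Re (\sum_(m < N) r%:C ^+ m * ((\int[P]_w c m w)%R)%:C)) =
      pseries (fun m => \int[P]_w c m w)%R r.
    apply/funext => N; rewrite Re_sum /pseries /series /= big_mkord; apply: eq_bigr => i _.
    by rewrite -rmorphXn -rmorphM /= mulrC.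
  rewrite Re_cE; suff -> : (\int[P]_w complex.Re (S r%:C w))%R = r ^+ n * (t ^+ n / n`!%:R) by [].
  have [Hr _] := gaussian_hermite t r HV k0; have [Hr1 Hr2] := Hr n.
  transitivity (\int[P]_w (expR (- (r ^+ 2 * (t / 2))) *
      (hc t (V w) n * expR (r * V w + 0 * V w ^+ 2))))%R.
    apply: eq_Rintegral => w _; rewrite /S -!rmorphXn -!rmorphM -rmorphB cexp_real -rmorphM /=.
    by rewrite [RHS]mulrCA -expRD [LHS]mulrC; congr (_ * expR _); ring.
  rewrite RintegralZl // Hr2 /gaussian_tilt mulr0 mul0r subr0 divr1 sqrtr1 invr1 mul1r subrr.
  rewrite mulrA -expRD (_ : _ + _ = 0); last by ring.
  have := hermite_coeff_homogeneous (r * t) 0 1 n.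
  by rewrite mulr0 mulr1 => ->; rewrite expR0 mul1r hermite_coeff_exp exprMn mulrA.
- move=> r; rewrite -(cvg_shiftn n.+1) /=.
  apply: cvg_near_cst; apply: nearW => N.
  rewrite /pseries /series /= big_mkord.
  have nN : (n < N + n.+1)%N by rewrite addnS ltnS leq_addl.
  rewrite (bigD1 (Ordinal nN)) //= eqxx mul1r big1 ?addr0 1?mulrC // => i.
  by rewrite -val_eqE /= => /negbTE ->; rewrite !mul0r.
Qed.
End gaussian_kernels.

(** * Independence of sigma-fields *)

Section independence.
Context {R : realType} {disp : measure_display} {Omega : measurableType disp}.
Variable P : probability Omega R.
Implicit Types G H : set (set Omega).

Lemma g_sigma_measurable G : G `<=` measurable -> <<s G >> `<=` measurable.
Proof. by move=> h; apply: smallest_sub; [exact: sigma_algebra_measurable|exact: h]. Qed.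

Lemma ae_eq_probability (A B : set Omega) : measurable A -> measurable B ->
  {ae P, forall w, A w <-> B w} -> P A = P B.
Proof.
move=> mA mB AB; have e C : measurable C -> P C = (\int[P]_w (\1_C w)%:E)%E.
  by move=> mC; rewrite integral_indic // setIT.
rewrite (e A mA) (e B mB); apply: ge0_ae_eq_integral => //.
- by apply/measurable_EFinP; exact: measurable_indic.
- by apply/measurable_EFinP; exact: measurable_indic.
by apply: filterS AB => w h _; rewrite !indicE; congr ((nat_of_bool _)%:R%:E); apply/idP/idP; rewrite !inE => /h.
Qed.

Lemma indep2_sym G H : indep2 P G H -> indep2 P H G.
Proof. by move=> h A B HA GB; rewrite setIC h // muleC. Qed.

Lemma indep2S G G' H H' : G' `<=` G -> H' `<=` H -> indep2 P G H -> indep2 P G' H'.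
Proof. by move=> GG HH h A B /GG GA /HH HB; exact: h. Qed.

Lemma indep2_sigma_l G H : G `<=` measurable -> H `<=` measurable ->
  setI_closed G -> G setT -> indep2 P G H -> indep2 P <<s G >> H.
Proof.
move=> GM HM GI GT ind A B sA HB.
have mB : measurable B := HM _ HB.
pose r : {nonneg R} := NngNum (fine_ge0 (measure_ge0 P B)).
have PB : P B = r%:num%:E by rewrite /= fineK // fin_num_measure.
suff : mrestr P mB A = mscale r P A by rewrite /mrestr /mscale /= PB muleC.
apply: (@g_sigma_algebra_measure_unique _ _ _ G GM (fun=> setT) _ _ _ _ GI) => //.
- by rewrite bigcup_const //; exists 0%N.
- by move=> C GC; rewrite -[LHS]/(P (C `&` B)) ind // PB muleC.
- by move=> k; change (P (setT `&` B) < +oo)%E; rewrite setTI PB ltry.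
Qed.

Lemma indep2_sigma G H : G `<=` measurable -> H `<=` measurable ->
  setI_closed G -> G setT -> setI_closed H -> H setT ->
  indep2 P G H -> indep2 P <<s G >> <<s H >>.
Proof.
move=> GM HM GI GT HI HT ind.
apply: indep2_sigma_l => //; first exact: g_sigma_measurable.
by apply: indep2_sym; apply: indep2_sigma_l => //; exact: indep2_sym.
Qed.

(** Completing a sigma-field by null sets changes its sets on null sets only. *)
Lemma augmented_ae G A : <<s G `|` P.-negligible >> A ->
  exists2 A', <<s G >> A' & {ae P, forall w, A w <-> A' w}.
Proof.
move: A; apply: smallest_sub.
  split.
  - by exists set0; [exact: sigma_algebra0|apply: aeW].
  - move=> A [A' sA' AA']; exists (~` A'); first exact: sigma_algebraC.
    apply: filterS AA' => w [h1 h2]; split => /=; first by move=> [_ nA] /h2.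
    by move=> nA; split => // /h1.
  - move=> F HF; pose A' n := sval (cid2 (HF n)).
    exists (\bigcup_k A' k).
      by apply: sigma_algebra_bigcup => k; rewrite /A'; case: cid2.
    have : {ae P, forall w, forall k, F k w <-> A' k w}.
      by apply/ae_foralln => k; rewrite /A'; case: cid2.
    apply: filterS => w h; split=> -[k _ hk]; exists k => //; exact/h.
move=> A [GA|NA]; first by exists A; [exact: sub_sigma_algebra|apply: aeW].
exists set0; first exact: sigma_algebra0.
by move: NA; apply: negligibleS => w /= h; apply: contrapT => nA; apply: h.
Qed.

Lemma indep2_augmented G H : G `<=` measurable -> H `<=` measurable ->
  P.-negligible `<=` measurable ->
  indep2 P <<s G >> H -> indep2 P <<s G `|` P.-negligible >> H.
Proof.
move=> GM HM NM ind A B sA HB; have mB : measurable B by exact: HM.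
have mA : measurable A.
  by apply: g_sigma_measurable sA => C [/GM|/NM].
have [A' sA' AA'] := augmented_ae sA.
have mA' : measurable A' by exact: g_sigma_measurable sA'.
rewrite (ae_eq_probability mA mA' AA') -ind //; apply: ae_eq_probability.
- exact: measurableI.
- exact: measurableI.
- by apply: filterS AA' => w h; split => -[/h].
Qed.

Section grouping.
Variables (C : finType) (G : C -> set (set Omega)).
Hypotheses (GM : forall c, G c `<=` measurable) (GI : forall c, setI_closed (G c)).
Hypotheses (GT : forall c, G c setT) (Gind : independent P G).

Let pi_sys (J : {set C}) : set (set Omega) :=
  [set A | exists2 a : C -> set Omega, forall c, c \in J -> G c (a c) &
     A = \bigcap_(c in [set` J]) a c].

Let pi_M J : pi_sys J `<=` measurable.
Proof.
move=> _ [a Ga ->]; apply: fin_bigcap_measurable; first exact: finite_finset.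
by move=> c /= cJ; apply: GM; exact: Ga.
Qed.

Let pi_I J : setI_closed (pi_sys J).
Proof.
move=> _ _ [a Ga ->] [b Gb ->]; exists (fun c => a c `&` b c).
  by move=> c cJ; apply: GI; [exact: Ga|exact: Gb].
by rewrite bigcapI.
Qed.

Let pi_T J : pi_sys J setT.
Proof. by exists (fun=> setT); [move=> c _; exact: GT|rewrite bigcapT]. Qed.

Let pi_G (J : {set C}) : \bigcup_(c in [set` J]) G c `<=` pi_sys J.
Proof.
move=> A [c /= cJ GA]; exists (fun c' => if c' == c then A else setT).
  by move=> c' _; case: eqP => [->//|_]; exact: GT.
apply/seteqP; split=> w.
  by move=> Aw c' _ /=; case: eqP.
by move=> /(_ c cJ); rewrite eqxx.
Qed.

(** Disjoint groups of independent sigma-fields generate independent ones. *)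
Lemma grouping_indep2 (J1 J2 : {set C}) : (forall c, c \in J1 -> c \notin J2) ->
  indep2 P <<s \bigcup_(c in [set` J1]) G c >> <<s \bigcup_(c in [set` J2]) G c >>.
Proof.
move=> J12; apply: (@indep2S <<s pi_sys J1 >> _ <<s pi_sys J2 >>).
- exact: sub_sigma_algebra2 (@pi_G J1).
- exact: sub_sigma_algebra2 (@pi_G J2).
apply: indep2_sigma => //; try exact: pi_M; try exact: pi_I; try exact: pi_T.
move=> _ _ [a Ga ->] [b Gb ->].
pose e c := if c \in J1 then a c else b c.
have e1 : \bigcap_(c in [set` J1]) a c = \bigcap_(c in [set` J1]) e c.
  by apply: eq_bigcapr => c /= cJ; rewrite /e cJ.
have nJ c : c \in J2 -> c \notin J1.
  by move=> cJ2; apply/negP => cJ1; have := J12 c cJ1; rewrite cJ2.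
have e2 : \bigcap_(c in [set` J2]) b c = \bigcap_(c in [set` J2]) e c.
  by apply: eq_bigcapr => c /= cJ; rewrite /e (negbTE (nJ _ cJ)).
have Ge c : c \in (finset.setU J1 J2) -> G c (e c).
  rewrite finset.in_setU /e; case: ifPn => [cJ _|_ /= cJ]; [exact: Ga|exact: Gb].
have -> : \bigcap_(c in [set` J1]) a c `&` \bigcap_(c in [set` J2]) b c =
    \bigcap_(c in [set` (finset.setU J1 J2)]) e c.
  rewrite e1 e2 -bigcap_setU; congr (\bigcap_(_ in _) _).
  by apply/seteqP; split => c /=; rewrite finset.in_setU => /orP.
rewrite e1 e2 !Gind //.
- rewrite (eq_bigl (predU (mem J1) (mem J2))) ?bigU //; last by move=> c; rewrite finset.in_setU.
  by rewrite disjoint_subset; apply/fintype.subsetP => c cJ; rewrite inE J12.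
- by move=> c cJ; apply: Ge; rewrite finset.in_setU cJ orbT.
- by move=> c cJ; apply: Ge; rewrite finset.in_setU cJ.
Qed.
End grouping.
End independence.

(** * Brownian motion *)

Section brownian1.
Context {R : realType} {disp : measure_display} {Omega : measurableType disp}.
Variable P : probability Omega R.

Definition past (W : R -> Omega -> R) (D : set R) : set (set Omega) :=
  \bigcup_(t in D) preimage_set_system setT (W t) measurable.
Definition increment (W : R -> Omega -> R) (s t : R) : set (set Omega) :=
  preimage_set_system setT (fun w => W t w - W s w) measurable.

Variable W : R -> Omega -> R.
Hypothesis W_BM : brownian_motion1 P W.

Lemma brownian_measurable t : 0 <= t -> measurable_fun setT (W t).
Proof. by case: W_BM => + _ _ _; exact. Qed.

Lemma brownian_start : {ae P, forall w, W 0 w = 0}.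
Proof. by case: W_BM => _ + _ _; apply: filterS => w []. Qed.

Lemma increment_gaussian s t : 0 <= s <= t -> gaussian P (fun w => W t w - W s w) (t - s).
Proof.
move=> /andP[s0 st]; split; first by rewrite subr_ge0.
  by apply: measurable_funB; apply: brownian_measurable => //; exact: le_trans st.
case: eqP => [/eqP|/eqP].
  by rewrite subr_eq0 => /eqP ->; apply: aeW => w; rewrite subrr.
rewrite subr_eq0 => ts B mB; case: W_BM => _ _ + _; apply => //.
by rewrite lt_neqAle eq_sym ts.
Qed.

Lemma brownian_gaussian t : 0 <= t -> gaussian P (W t) t.
Proof.
move=> t0; have [_ m H] := increment_gaussian (introT andP (conj (lexx 0) t0)).
split; [exact: t0|exact: brownian_measurable|].
rewrite subr0 in H; case: ifPn H => [/eqP t00 _|tn H B mB].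
  by rewrite t00; exact: brownian_start.
rewrite -H //; apply: ae_eq_probability.
- by rewrite -[X in measurable X]setTI; exact: brownian_measurable.
- by rewrite -[X in measurable X]setTI; exact: m.
by apply: filterS brownian_start => w /= ->; rewrite subr0.
Qed.

Lemma past_measurable D : D `<=` [set t | 0 <= t] -> past W D `<=` measurable.
Proof.
move=> D0 _ [t Dt [B mB <-]]; apply: brownian_measurable => //; exact: D0.
Qed.

Lemma preimage_system_measurable (V : Omega -> R) : measurable_fun setT V ->
  preimage_set_system setT V measurable `<=` measurable.
Proof. by move=> mV _ [B mB <-]; exact: mV. Qed.

Lemma preimage_system_setI (V : Omega -> R) :
  setI_closed (preimage_set_system setT V measurable).
Proof.
move=> _ _ [B mB <-] [B' mB' <-]; exists (B `&` B'); first exact: measurableI.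
by rewrite !setTI preimage_setI.
Qed.

Lemma preimage_system_setT (V : Omega -> R) :
  preimage_set_system setT V measurable setT.
Proof. by exists setT => //; rewrite setTI preimage_setT. Qed.

Let cylinder (s : R) : set (set Omega) :=
  [set A | exists L : seq R, exists2 B : R -> set R,
     (forall r, r \in L -> 0 <= r <= s) /\ (forall r, measurable (B r)) &
     A = \bigcap_(r in [set` L]) (W r @^-1` B r)].

Let cylinder_setI s : setI_closed (cylinder s).
Proof.
move=> _ _ [L [B [L0 mB] ->]] [L' [B' [L0' mB'] ->]].
exists (L ++ L'); exists (fun r => (if r \in L then B r else setT) `&`
    (if r \in L' then B' r else setT)).
  split=> r; first by rewrite mem_cat => /orP[/L0|/L0'].
  by apply: measurableI; case: ifP.
apply/seteqP; split => w.
  move=> [h1 h2] r /= _; split.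
    by case: ifP => // rL; exact: h1.
  by case: ifP => // rL; exact: h2.
move=> h; split => r /= rL.
  by have := h r; rewrite /= mem_cat rL /= => /(_ isT) [].
by have := h r; rewrite /= mem_cat rL orbT /= => /(_ isT) [_].
Qed.

(** The increment after s is independent of the past of s: a cylinder event at
    sorted times is, up to the null event W_0 <> 0, an event of the increments
    between these times. *)
Lemma past_increment_indep s t : 0 <= s -> s <= t ->
  indep2 P <<s past W `[0, s] >> (increment W s t).
Proof.
move=> s0 st; have t0 := le_trans s0 st.
have pastM : past W `[0, s] `<=` measurable.
  by apply: past_measurable => r /=; rewrite in_itv /= => /andP[].
have incM : increment W s t `<=` measurable.
  by apply: preimage_system_measurable; exact: (gaussian_measurable (increment_gaussian (introT andP (conj s0 st)))).
have cylM : cylinder s `<=` measurable.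
  move=> _ [L [B [L0 mB] ->]]; apply: fin_bigcap_measurable; first exact: finite_seq.
  move=> r /= rL; rewrite -[X in measurable X]setTI; apply: brownian_measurable => //.
  by have /andP[] := L0 r rL.
apply: (@indep2S _ _ _ _ <<s cylinder s >> _ (increment W s t)) => //.
  apply: sub_sigma_algebra2 => _ [r + [B mB <-]]; rewrite /= in_itv /= => rs.
  exists [:: r]; exists (fun=> B).
    by split => // r'; rewrite inE => /eqP ->.
  apply/seteqP; split => w; first by move=> [_ h] r' /=; rewrite inE => /eqP ->.
  by move=> h; split => //; apply: (h r); rewrite /= inE.
apply: indep2_sigma_l => //.
  by exists [::]; exists (fun=> setT); [split|apply/seteqP; split].
move=> A D [L [B [L0 mB] ->]] HD.
pose l := sort <=%R (0 :: L); pose n := size l.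
have lP r : r \in l -> 0 <= r <= s.
  by rewrite mem_sort inE => /orP[/eqP ->|/L0 //]; rewrite lexx.
have n0 : (0 < n)%N by rewrite /n size_sort.
have lsort : sorted <=%R l by apply: sort_sorted; exact: le_total.
pose tt k := if (k < n)%N then nth 0 l k else if k == n then s else t.
have tt0 : tt 0%N = 0.
  rewrite /tt n0; apply/eqP; rewrite eq_le (andP (lP _ (mem_nth _ n0))).1 andbT.
  have z : 0 \in l by rewrite mem_sort inE eqxx.
  rewrite -[leRHS](nth_index 0 z); apply: (sorted_leq_nth (@le_trans _ _) (@lexx _ _)) => //.
  by rewrite inE index_mem.
have ttm : {homo tt : i j / (i <= j)%N >-> i <= j}.
  move=> i j ij; rewrite /tt; case: (ltnP j n) => jn.
    rewrite (leq_ltn_trans ij jn); apply: (sorted_leq_nth (@le_trans _ _) (@lexx _ _)) => //.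
    by rewrite inE (leq_ltn_trans ij jn).
  case: (ltnP i n) => iN.
    have /andP[_ h] := lP _ (mem_nth 0 iN).
    by case: eqP => // _; exact: le_trans st.
  case: (eqVneq i n) => [_|ni]; first by case: eqP.
  case: (eqVneq j n) => // jn'; move: ni; rewrite eqn_leq iN -jn' ij; by [].
have [_ _ _ Wind] := W_BM.
have t00 : 0 <= tt 0%N by rewrite tt0.
have ind := Wind n.+1 tt t00 ttm.
pose Dk (k : nat) w := W (tt k.+1) w - W (tt k) w.
have mt k : 0 <= tt k by rewrite -tt0; exact: ttm.
have mDk k : measurable_fun setT (Dk k).
  by apply: measurable_funB; exact: brownian_measurable.
pose G (k : 'I_n.+1) := preimage_set_system setT (Dk k) measurable.
pose J1 : {set 'I_n.+1} := finset.finset (fun k : 'I_n.+1 => (k < n)%N).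
pose J2 : {set 'I_n.+1} := finset.set1 ord_max.
have gind : indep2 P <<s \bigcup_(c in [set` J1]) G c >> <<s \bigcup_(c in [set` J2]) G c >>.
  apply: grouping_indep2 => //.
  - by move=> k; exact: preimage_system_measurable.
  - by move=> k; exact: preimage_system_setI.
  - by move=> k; exact: preimage_system_setT.
  - by move=> k; rewrite finset.in_set1 finset.in_set => kn; rewrite -val_eqE /= ltn_eqF.
pose A' := \bigcap_(r in [set` L])
  ((fun w => \sum_(k < n.+1 | (k < index r l)%N) Dk k w) @^-1` B r).
have A'G : <<s \bigcup_(c in [set` J1]) G c >> A'.
  pose T := g_sigma_algebraType (\bigcup_(c in [set` J1]) G c).
  apply: (@fin_bigcap_measurable _ T); first exact: finite_seq.
  move=> r /= rL.
  have rn : (index r l <= n)%N by exact: index_size.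
  suff mS : measurable_fun setT ((fun w => \sum_(k < n.+1 | (k < index r l)%N) Dk k w) : T -> R).
    by rewrite -[X in measurable X]setTI; exact: mS.
  have -> : (fun w => \sum_(k < n.+1 | (k < index r l)%N) Dk k w) =
      (fun w => \sum_(k < n.+1) (if (k < index r l)%N then Dk k w else 0)).
    by apply/funext => w; rewrite big_mkcond.
  apply: (@measurable_sum _ T) => k; case kr: (k < index r l)%N; last exact: measurable_cst.
  move=> _ C mC; apply: sub_sigma_algebra; exists k.
    by rewrite /= finset.in_set (leq_trans kr).
  by exists C.
have DG : <<s \bigcup_(c in [set` J2]) G c >> D.
  apply: sub_sigma_algebra; exists ord_max; first by rewrite /= finset.in_set1.
  by move: HD; rewrite /G /Dk /= /tt !ltnNge leqnSn leqnn /= eqxx gtn_eqF //=; exact.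
have AA' : {ae P, forall w, (\bigcap_(r in [set` L]) (W r @^-1` B r)) w <-> A' w}.
  apply: filterS brownian_start => w W0.
  have S j : (j <= n.+1)%N -> \sum_(k < n.+1 | (k < j)%N) Dk k w = W (tt j) w.
    move=> jn; rewrite -(big_ord_widen_cond n.+1 xpredT (fun k => Dk k w) jn) /=.
    rewrite -(big_mkord xpredT (fun k => Dk k w)) telescope_sumr //.
    by rewrite tt0 W0 subr0.
  have E r : r \in L -> \sum_(k < n.+1 | (k < index r l)%N) Dk k w = W r w.
    move=> rL; have rl : r \in l by rewrite mem_sort inE rL orbT.
    have rn : (index r l < n)%N by rewrite index_mem.
    rewrite S; last exact: leqW (ltnW rn).
    by rewrite /tt rn nth_index.
  by split=> h r /= rL; have := h r rL; rewrite /= E.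
have mA := cylM _ (ex_intro _ L (ex_intro2 _ _ B (conj L0 mB) erefl)).
have mD : measurable D := incM _ HD.
have mA' : measurable A'.
  apply: g_sigma_measurable A'G => C [k _]; exact: preimage_system_measurable.
rewrite (ae_eq_probability mA mA' AA') -gind //; apply: ae_eq_probability.
- exact: measurableI.
- exact: measurableI.
- by apply: filterS AA' => w h; split => -[/h].
Qed.
End brownian1.

Section brownian_pair.
Context {R : realType} {disp : measure_display} {Omega : measurableType disp}.
Variable P : probability Omega R.
Variables (d : nat) (X Y : R -> Omega -> 'rV[R]_d).
Hypotheses (X_BM : brownian_motion P X) (Y_BM : brownian_motion P Y).
Hypothesis XY_indep : independent_processes P X Y.
Implicit Types (c : ('I_d * bool)%type) (s t : R).

Definition coord c (t : R) (w : Omega) : R :=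
  if c.2 then X t w ord0 c.1 else Y t w ord0 c.1.

Lemma coord_BM c : brownian_motion1 P (coord c).
Proof. by case: c => i [] /=; [exact: X_BM.1|exact: Y_BM.1]. Qed.

Let nnegM : [set` `[0, +oo[%R] `<=` [set t : R | 0 <= t].
Proof. by move=> t /=; rewrite in_itv /= andbT. Qed.

Let pastM c : past (coord c) `[0, +oo[ `<=` measurable.
Proof. exact: (past_measurable (coord_BM c) nnegM). Qed.

Let scalar1 (U : R -> Omega -> 'rV[R]_d) i t w : ((U t w ord0 i)%:M : 'rV[R]_1) ord0 ord0 = U t w ord0 i.
Proof. by rewrite mxE eqxx mulr1n. Qed.

Let past_sigma_of (U : R -> Omega -> 'rV[R]_d) i :
  <<s past (fun t w => U t w ord0 i) `[0, +oo[ >> `<=`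
  sigma_of (fun t w => (U t w ord0 i)%:M : 'rV[R]_1) `[0, +oo[.
Proof.
apply: sub_sigma_algebra2 => _ [t Dt [B mB <-]]; exists t => //; exists ord0 => //.
exists B => //; apply/seteqP; split=> w /=; by rewrite scalar1.
Qed.

Let past_sigma_vec (U : R -> Omega -> 'rV[R]_d) i :
  <<s past (fun t w => U t w ord0 i) `[0, +oo[ >> `<=` sigma_of U `[0, +oo[.
Proof.
by apply: sub_sigma_algebra2 => _ [t Dt [B mB <-]]; exists t => //; exists i => //; exists B.
Qed.

Let indepX (A : 'I_d -> set Omega) :
  (forall i, <<s past (fun t w => X t w ord0 i) `[0, +oo[ >> (A i)) ->
  P (\bigcap_i A i) = (\prod_i P (A i))%E.
Proof.
move=> HA; have := X_BM.2 (finset.setTfor 'I_d) A (fun i _ => past_sigma_of (HA i)).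
rewrite (eq_bigl xpredT) => [<-|i]; last by rewrite finset.in_setT.
by congr (P _); apply/seteqP; split => w h i _; apply: h => //=; rewrite finset.in_setT.
Qed.

Let indepY (A : 'I_d -> set Omega) :
  (forall i, <<s past (fun t w => Y t w ord0 i) `[0, +oo[ >> (A i)) ->
  P (\bigcap_i A i) = (\prod_i P (A i))%E.
Proof.
move=> HA; have := Y_BM.2 (finset.setTfor 'I_d) A (fun i _ => past_sigma_of (HA i)).
rewrite (eq_bigl xpredT) => [<-|i]; last by rewrite finset.in_setT.
by congr (P _); apply/seteqP; split => w h i _; apply: h => //=; rewrite finset.in_setT.
Qed.

Lemma XY_indep2 : indep2 P (sigma_of X `[0, +oo[) (sigma_of Y `[0, +oo[).
Proof.
move=> A B HA HB.
have := XY_indep (J := finset.setTfor bool) (A := fun b => if b then A else B) _.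
rewrite (eq_bigl xpredT) => [h|b]; last by rewrite finset.in_setT.
rewrite big_bool /= in h; rewrite -h; last by case.
congr (P _); apply/seteqP; split => w.
  by move=> [Aw Bw] [].
move=> h'; split; [apply: (h' true)|apply: (h' false)] => /=; by rewrite finset.in_setT.
Qed.

Lemma coord_independent : independent P (fun c => <<s past (coord c) `[0, +oo[ >>).
Proof.
move=> J A HA; pose A' c := if c \in J then A c else setT.
have HA' c : <<s past (coord c) `[0, +oo[ >> (A' c).
  by rewrite /A'; case: ifPn => [|_]; [exact: HA|exact: (@measurableT _ (g_sigma_algebraType (past (coord c) `[0, +oo[)))].
have -> : \bigcap_(c in [set` J]) A c =
   (\bigcap_i A' (i, true)) `&` (\bigcap_i A' (i, false)).
  apply/seteqP; split => w.
    by move=> h; split=> i _; rewrite /A'; case: ifPn => // cJ; exact: h.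
  by move=> [h1 h2] [i []] /= cJ; [have := h1 i I|have := h2 i I]; rewrite /A' cJ.
rewrite XY_indep2.
- rewrite indepX; last by move=> i; exact: (HA' (i, true)).
  rewrite indepY; last by move=> i; exact: (HA' (i, false)).
  rewrite -big_split /= [RHS]big_mkcond /=.
  transitivity (\prod_(i : 'I_d) \prod_(b : bool) P (A' (i, b)))%E.
    by apply: eq_bigr => i _; rewrite big_bool.
  rewrite pair_bigA /=; apply: eq_bigr => -[i b] _ /=; rewrite /A'.
  by case: ifPn => // _; exact: probability_setT.
- apply: (@fin_bigcap_measurable _ (g_sigma_algebraType (history X `[0, +oo[))); first exact: finite_finset.
  by move=> i _; apply: past_sigma_vec; exact: (HA' (i, true)).
- apply: (@fin_bigcap_measurable _ (g_sigma_algebraType (history Y `[0, +oo[))); first exact: finite_finset.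
  by move=> i _; apply: past_sigma_vec; exact: (HA' (i, false)).
Qed.

Let groupC := fun J1 J2 h => @grouping_indep2 _ _ _ P _ (fun c => <<s past (coord c) `[0, +oo[ >>)
  (fun c => g_sigma_measurable (@pastM c))
  (fun c => @measurableI _ (g_sigma_algebraType (past (coord c) `[0, +oo[)))
  (fun c => @measurableT _ (g_sigma_algebraType (past (coord c) `[0, +oo[)))
  coord_independent J1 J2 h.

Definition coord_events (i : 'I_d) : set (set Omega) :=
  past (coord (i, true)) `[0, +oo[ `|` past (coord (i, false)) `[0, +oo[.

Lemma coord_events_measurable i : coord_events i `<=` measurable.
Proof. by move=> A [] /pastM. Qed.

Lemma coord_events_indep (i : 'I_d) :
  indep2 P <<s lower_union coord_events i >> <<s coord_events i >>.
Proof.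
pose J1 : {set 'I_d * bool} := finset.finset (fun c : 'I_d * bool => (c.1 < i)%N).
pose J2 : {set 'I_d * bool} := finset.finset (fun c : 'I_d * bool => c.1 == i).
have J12 c : c \in J1 -> c \notin J2.
  by rewrite !finset.in_set => ci; rewrite -val_eqE /= ltn_eqF.
apply: indep2S (groupC J12); apply: sub_sigma_algebra2.
  move=> A [j /= ji [HA|HA]]; [exists (j, true)|exists (j, false)];
    by [rewrite /= finset.in_set|exact: sub_sigma_algebra].
move=> A [HA|HA]; [exists (i, true)|exists (i, false)];
  by [rewrite /= finset.in_set|exact: sub_sigma_algebra].
Qed.

Lemma coord_xy_indep (i : 'I_d) :
  indep2 P <<s past (coord (i, true)) `[0, +oo[ >> <<s past (coord (i, false)) `[0, +oo[ >>.
Proof.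
have J12 c : c \in finset.set1 (i, true) -> c \notin finset.set1 (i, false).
  by rewrite !finset.in_set1 => /eqP ->; rewrite xpair_eqE andbF.
apply: indep2S (groupC J12); apply: sub_sigma_algebra2 => A HA.
  by exists (i, true); [rewrite /= finset.in_set1|exact: sub_sigma_algebra].
by exists (i, false); [rewrite /= finset.in_set1|exact: sub_sigma_algebra].
Qed.

Definition all_past s : set (set Omega) := \bigcup_c past (coord c) `[0, s].
Definition all_increments s t : set (set Omega) := \bigcup_c increment (coord c) s t.

Lemma all_past_measurable s : all_past s `<=` measurable.
Proof.
move=> A [c _]; apply: (past_measurable (coord_BM c)) => t /=.
by rewrite in_itv /= => /andP[].
Qed.

Lemma all_increments_measurable s t : 0 <= s <= t -> all_increments s t `<=` measurable.
Proof.
move=> st A [c _]; apply: preimage_system_measurable.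
exact: (gaussian_measurable (increment_gaussian (coord_BM c) st)).
Qed.

Lemma past_all_increments_indep s t : 0 <= s <= t ->
  indep2 P <<s all_past s >> <<s all_increments s t >>.
Proof.
move=> st; have [s0 sT] := andP st.
pose G (e : ('I_d * bool) * bool) : set (set Omega) :=
  if e.2 then <<s past (coord e.1) `[0, s] >> else increment (coord e.1) s t.
have GM e : G e `<=` measurable.
  case: e => c [] /=; rewrite /G /=.
    by apply: g_sigma_measurable => A HA; apply: (@all_past_measurable s); exists c.
  by move=> A HA; apply: (all_increments_measurable st); exists c.
have Gfull e : G e `<=` <<s past (coord e.1) `[0, +oo[ >>.
  case: e => c [] /=; rewrite /G /=.
    apply: sub_sigma_algebra2 => A [r + HA]; rewrite /= in_itv /= => /andP[r0 _].
    by exists r => //; rewrite /= in_itv /= r0.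
  have m r : 0 <= r -> measurable_fun setT (coord c r : g_sigma_algebraType (past (coord c) `[0, +oo[) -> R).
    move=> r0 _ B mB; apply: sub_sigma_algebra; exists r; first by rewrite /= in_itv /= r0.
    by exists B.
  move=> _ [B mB <-].
  by have := measurable_funB (m t (le_trans s0 sT)) (m s s0); apply.
have GI e : setI_closed (G e).
  case: e => c [] /=; rewrite /G /=; last exact: preimage_system_setI.
  exact: (@measurableI _ (g_sigma_algebraType (past (coord c) `[0, s]))).
have GT e : G e setT.
  case: e => c [] /=; rewrite /G /=; last exact: preimage_system_setT.
  exact: (@measurableT _ (g_sigma_algebraType (past (coord c) `[0, s]))).
have Gind : independent P G.
  move=> J A HA; pose A' e := if e \in J then A e else setT.
  have HA' e : G e (A' e) by rewrite /A'; case: ifPn => // /HA.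
  have E1 : \bigcap_(e in [set` J]) A e =
      \bigcap_(c in [set` finset.setTfor ('I_d * bool)%type]) (A' (c, true) `&` A' (c, false)).
    apply/seteqP; split => w.
      by move=> h c _; split; rewrite /A'; case: ifPn => // eJ; exact: h.
    move=> h [c b] eJ; have := h c; rewrite /= finset.in_setT => /(_ isT) [].
    by rewrite /A'; case: b eJ => /= ->.
  rewrite E1 coord_independent; last first.
    move=> c _; apply: (@measurableI _ (g_sigma_algebraType (past (coord c) `[0, +oo[))).
      exact: (@Gfull (c, true)).
    exact: (@Gfull (c, false)).
  rewrite (eq_bigl xpredT); last by move=> c; rewrite finset.in_setT.
  rewrite [RHS]big_mkcond /=.
  transitivity (\prod_(c : 'I_d * bool) \prod_(b : bool) P (A' (c, b)))%E.
    apply: eq_bigr => c _; rewrite big_bool /=.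
    apply: (past_increment_indep (coord_BM c) s0 sT).
      exact: (HA' (c, true)).
    exact: (HA' (c, false)).
  rewrite pair_bigA /=; apply: eq_bigr => -[c b] _ /=; rewrite /A'.
  by case: ifPn => // _; exact: probability_setT.
pose J1 : {set ('I_d * bool) * bool} := finset.finset (fun e => e.2).
pose J2 : {set ('I_d * bool) * bool} := finset.finset (fun e => ~~ e.2).
have J12 e : e \in J1 -> e \notin J2 by rewrite !finset.in_set negbK.
apply: indep2S (grouping_indep2 GM GI GT Gind J12); apply: sub_sigma_algebra2.
  move=> A [c _ HA]; exists (c, true); first by rewrite /= finset.in_set.
  by rewrite /G /=; exact: sub_sigma_algebra.
by move=> A [c _ HA]; exists (c, false); first by rewrite /= finset.in_set.
Qed.

Hypothesis P_complete : measure_is_complete P.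

Let Z t w := cvec (X t w) (Y t w).

Lemma history_all_past s :
  history (fun t w => realify (Z t w)) `[0, s] `<=` <<s all_past s >>.
Proof.
move=> _ [t ts [k _ [B mB <-]]]; apply: sub_sigma_algebra.
case: (splitP k) => j kj.
  exists (j, true) => //; exists t => //; exists B => //.
  apply/seteqP; split => w /= [_ h]; split => //; move: h;
    have -> : k = lshift d j by apply/val_inj.
    by rewrite row_mxEl !mxE.
  by rewrite row_mxEl !mxE.
exists (j, false) => //; exists t => //; exists B => //.
apply/seteqP; split => w /= [_ h]; split => //; move: h;
  have -> : k = rshift d j by apply/val_inj.
  by rewrite row_mxEr !mxE.
by rewrite row_mxEr !mxE.
Qed.

Lemma all_past_history s : all_past s `<=` history (fun t w => realify (Z t w)) `[0, s].
Proof.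
move=> _ [[i b] _ [t ts [B mB <-]]]; exists t => //.
exists (if b then lshift d i else rshift d i) => //; exists B => //.
apply/seteqP; split => w /= [_ h]; split => //; move: h; rewrite /coord /=;
  by case: b; rewrite ?row_mxEl ?row_mxEr !mxE.
Qed.

Lemma filtration_increments_indep s t : 0 <= s <= t ->
  indep2 P (augmented_filtration P (fun t w => realify (Z t w)) s) <<s all_increments s t >>.
Proof.
move=> st; have ind : indep2 P <<s all_past s `|` P.-negligible >> <<s all_increments s t >>.
  apply: indep2_augmented.
  - exact: all_past_measurable.
  - by apply: g_sigma_measurable; exact: all_increments_measurable.
  - by move=> A; exact: P_complete.
  - exact: past_all_increments_indep.
apply: indep2S ind => //; apply: smallest_sub; first exact: smallest_sigma_algebra.
move=> A [HA|NA]; last by apply: sub_sigma_algebra; right.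
by have := history_all_past HA; apply: sub_sigma_algebra2 => B HB; left.
Qed.
End brownian_pair.

(** * The transform of a terminal value *)

Section holder.
Context {R : realType} {disp : measure_display} {Omega : measurableType disp}.
Variable P : probability Omega R.

Definition Lp_norm (p : R) (xi : Omega -> R[i]) : R :=
  fine ('N[P]_p%:E[EFin \o (fun w => normc (xi w))])%E.

Lemma Lp_norm_ge0 p xi : 0 <= Lp_norm p xi.
Proof. by rewrite fine_ge0 // Lnorm_ge0. Qed.

Lemma holder_normc (p q : R) (xi : Omega -> R[i]) (G : Omega -> R) :
  0 < p -> 0 < q -> p^-1 + q^-1 = 1 -> in_Lp P p xi ->
  measurable_fun setT G -> (forall w, 0 <= G w) ->
  P.-integrable setT (EFin \o (fun w => G w `^ q)) ->
  P.-integrable setT (EFin \o (fun w => normc (xi w) * G w)) /\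
  (\int[P]_w (normc (xi w) * G w))%R <= Lp_norm p xi * (\int[P]_w (G w `^ q))%R `^ q^-1.
Proof.
move=> p0 q0 pq [mxi Lxi] mG G0 IG.
have {}mxi : cmfun xi.
  by split=> _ B mB; [apply: mxi.1|apply: mxi.2]; exists B.
have mn := measurable_normc mxi.
have fn : ('N[P]_p%:E[EFin \o (fun w => normc (xi w))] < +oo)%E.
  by move: Lxi; rewrite inE => /andP[_]; rewrite inE.
have Nq : ('N[P]_q%:E[EFin \o G] = ((\int[P]_w (G w `^ q))%R `^ q^-1)%:E)%E.
  rewrite unlock -poweR_EFin; congr (_ `^ _)%E.
  rewrite /Rintegral fineK; last exact: integrable_fin_num.
  by apply: eq_integral => w _; rewrite /= ger0_norm.
have Np : ('N[P]_p%:E[EFin \o (fun w => normc (xi w))] = (Lp_norm p xi)%:E)%E.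
  by rewrite /Lp_norm fineK // ge0_fin_numE ?Lnorm_ge0.
have H := hoelder P mn mG p0 q0 pq.
rewrite Np Nq Lnorm1 -EFinM in H.
have e : (\int[P]_x `|(EFin \o ((fun w => normc (xi w)) \* G)%R) x| =
   \int[P]_x (normc (xi x) * G x)%:E)%E.
  by apply: eq_integral => w _; rewrite /= ger0_norm // mulr_ge0 ?normc_ge0.
rewrite e in H.
have I : P.-integrable setT (EFin \o (fun w => normc (xi w) * G w)).
  apply/integrableP; split; first by apply/measurable_EFinP; exact: measurable_funM.
  apply: le_lt_trans (ltry _); apply: le_trans H; rewrite le_eqVlt -e; apply/orP; left; apply/eqP.
  by apply: eq_integral.
split=> //; rewrite -lee_fin /Rintegral fineK //; exact: integrable_fin_num.
Qed.
End holder.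

Section transform.
Context {R : realType} {disp : measure_display} {Omega : measurableType disp}.
Variable P : probability Omega R.
Variables (d : nat) (T : R) (U : Omega -> 'rV[R]_d).
Hypothesis T_gt0 : 0 < T.
Hypothesis UG : forall i, gaussian P (fun w => U w ord0 i) T.
Hypothesis Uprod : forall h : 'I_d -> R -> R[i], (forall i, cmfun (h i)) ->
  (forall i, cintegrable P (fun w => h i (U w ord0 i))) ->
  cintegrable P (fun w => \prod_(i < d) h i (U w ord0 i)) /\
  cexpectation P (fun w => \prod_(i < d) h i (U w ord0 i)) =
  \prod_(i < d) cexpectation P (fun w => h i (U w ord0 i)).
Variables (p : R) (xi : Omega -> R[i]).
Hypotheses (p_gt1 : 1 < p) (xi_Lp : in_Lp P p xi).
Local Notation hc := hermite_coeff.
Implicit Types (z h : 'rV[R[i]]_d).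

Let q := p / (p - 1).
Let p0 : 0 < p. Proof. exact: lt_trans p_gt1. Qed.
Let p1 : 0 < p - 1. Proof. by rewrite subr_gt0. Qed.
Let q0 : 0 < q. Proof. by rewrite divr_gt0. Qed.
Let pq : p^-1 + q^-1 = 1.
Proof. by rewrite /q; field; rewrite !gt_eqF. Qed.

Let mU i : measurable_fun setT (fun w => U w ord0 i).
Proof. exact: gaussian_measurable (UG i). Qed.

Lemma in_Lp_cmfun : cmfun xi.
Proof. by have [m _] := xi_Lp; split=> _ B mB; [apply: m.1|apply: m.2]; exists B. Qed.

Lemma Rintegral_prod_coord (g : 'I_d -> R -> R) :
  (forall i, measurable_fun setT (g i)) ->
  (forall i, P.-integrable setT (EFin \o (fun w => g i (U w ord0 i)))) ->
  P.-integrable setT (EFin \o (fun w => \prod_(i < d) g i (U w ord0 i))) /\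
  (\int[P]_w (\prod_(i < d) g i (U w ord0 i)))%R =
  \prod_(i < d) (\int[P]_w g i (U w ord0 i))%R.
Proof.
move=> mg Ig.
have [c E] := Uprod (fun i => cmfun_real (mg i)) (fun i => cintegrable_real (Ig i)).
have e : (fun w => \prod_(i < d) (g i (U w ord0 i))%:C) =
    (fun w => (\prod_(i < d) g i (U w ord0 i))%:C).
  by apply/funext => w; rewrite rmorph_prod.
rewrite e in c; split; first exact: c.1.
apply: (@complexI R); rewrite -cE_real -e E rmorph_prod; apply: eq_bigr => i _.
exact: cE_real.
Qed.

(** Exponentials of the moduli of the coordinates dominate everything below. *)
Definition dominator (a c : 'I_d -> R) w : R :=
  \prod_(i < d) expR (a i * `|U w ord0 i| + c i).

Lemma measurable_dominator a c : measurable_fun setT (dominator a c).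
Proof.
rewrite /dominator; apply: measurable_prod => i _; apply: measurableT_comp => //.
apply: measurable_funD => //; apply: measurable_funM => //.
by apply: (measurableT_comp _ (mU i)); exact: normr_measurable.
Qed.

Lemma dominator_ge0 a c w : 0 <= dominator a c w.
Proof. by apply: prodr_ge0 => i _; exact: expR_ge0. Qed.

Lemma xi_dominator_integrable a c :
  P.-integrable setT (EFin \o (fun w => normc (xi w) * dominator a c w)).
Proof.
apply: (holder_normc p0 q0 pq xi_Lp (measurable_dominator a c) (dominator_ge0 a c) _).1.
have e w : dominator a c w `^ q = \prod_(i < d) (expR (q * c i) * expR (q * a i * `|U w ord0 i|)).
  rewrite /dominator -expR_sum -expRM mulr_suml expR_sum.
  by apply: eq_bigr => i _; rewrite -expRD; congr expR; ring.
have -> : (fun w => dominator a c w `^ q) =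
  (fun w => \prod_(i < d) (expR (q * c i) * expR (q * a i * `|U w ord0 i|))).
  exact/funext.
apply: (@Rintegral_prod_coord (fun i u => expR (q * c i) * expR (q * a i * `|u|)) _ _).1.
  move=> i; apply: measurable_funM => //; apply: measurableT_comp => //.
  by apply: measurable_funM => //; exact: normr_measurable.
move=> i; apply: rintegrableZ.
have k0 : 0 < 1 - 2 * 0 * T by rewrite mulr0 mul0r subr0.
have := gaussian_expabs_integrable (q * a i) 0 (UG i) k0.
by under eq_fun do rewrite /= !mul0r addr0 expR0 mulr1.
Qed.

Definition kernel z (w : Omega) : R[i] := \prod_(i < d) kernel1 T (z ord0 i) (U w ord0 i).

Lemma kernelE z w : kernel z w = cexp ((T^-1)%:C * (cdot z (U w) - csqr z / 2%:R)).
Proof.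
rewrite /kernel -cexp_sum; congr cexp.
by rewrite -mulr_sumr sumrB; congr (_ * (_ - _)); rewrite /csqr mulr_suml.
Qed.

Lemma cmfun_kernel1 (V : Omega -> R) (z : R[i]) : measurable_fun setT V -> cmfun (fun w => kernel1 T z (V w)).
Proof.
move=> mV; apply: cmfun_cexp; apply: cmfunM; first exact: cmfun_cst.
by apply: cmfunB; [apply: cmfunM; [exact: cmfun_cst|exact: cmfun_real]|exact: cmfun_cst].
Qed.

Lemma cmfun_kernel z : cmfun (kernel z).
Proof. by apply: cmfun_prod => i; exact: cmfun_kernel1. Qed.

Lemma kernel_dominated z w : normc (kernel z w) <=
  dominator (fun i => normc (z ord0 i) / T) (fun i => normc (z ord0 i) ^+ 2 / (2 * T)) w.
Proof.
rewrite normc_prod; apply: ler_prod => i _.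
by rewrite normc_ge0 normc_kernel1_le.
Qed.

Lemma xi_dominated (kap : Omega -> R[i]) a c : cmfun kap ->
  (forall w, normc (kap w) <= dominator a c w) -> cintegrable P (fun w => xi w * kap w).
Proof.
move=> mk kd; apply: (cintegrable_le (cmfunM in_Lp_cmfun mk) (xi_dominator_integrable a c)) => w.
by rewrite normcM ler_wpM2l ?normc_ge0.
Qed.

Lemma xi_kernel_integrable z : cintegrable P (fun w => xi w * kernel z w).
Proof. exact: xi_dominated (cmfun_kernel z) (kernel_dominated z). Qed.

Definition transform z : R[i] := cexpectation P (fun w => xi w * kernel z w).

Lemma transform_dominated (kap : nat -> Omega -> R[i]) kl a c : (forall n, cmfun (kap n)) ->
  (forall w, ccvg (fun n => kap n w) (kl w)) -> (forall n w, normc (kap n w) <= dominator a c w) ->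
  ccvg (fun n => cexpectation P (fun w => xi w * kap n w)) (cexpectation P (fun w => xi w * kl w)).
Proof.
move=> mk kk kd.
apply: (cE_dominated _ _ (xi_dominator_integrable a c) _).2.
- by move=> n; exact: (cmfunM in_Lp_cmfun).
- by move=> w; apply: ccvgM => //; exact: ccvg_cst.
- by move=> n w; rewrite normcM ler_wpM2l ?normc_ge0.
Qed.

Definition growth z : R :=
  \sum_(i < d) ((q - 1) * complex.Re (z ord0 i) ^+ 2 / (2 * T) +
                complex.Im (z ord0 i) ^+ 2 / (2 * T)).

(** Hoelder's inequality with the exact Gaussian norm of the kernel. *)
Lemma kernel_holder z :
  (\int[P]_w (normc (xi w) * normc (kernel z w)))%R <= Lp_norm P p xi * expR (growth z).
Proof.
pose a i := complex.Re (z ord0 i); pose b i := complex.Im (z ord0 i).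
pose g i u := expR (q * (a i / T) * u + 0 * u ^+ 2).
pose cc := \sum_(i < d) (- (q * ((a i ^+ 2 - b i ^+ 2) / (2 * T)))).
have e w : normc (kernel z w) `^ q = expR cc * \prod_(i < d) g i (U w ord0 i).
  rewrite normc_prod (eq_bigr (fun i => expR ((a i * U w ord0 i - (a i ^+ 2 - b i ^+ 2) / 2) / T))).
    rewrite -expR_sum -expRM mulr_suml /g -expR_sum -expRD; congr expR.
    rewrite -big_split /=; apply: eq_bigr => i _.
    by move: (q) (a i) (b i) (U w ord0 i) => Q A B u; field; rewrite gt_eqF.
  by move=> i _; rewrite /a /b; case: (z ord0 i) => x y; rewrite normc_kernel1.
have k0 : 0 < 1 - 2 * 0 * T by rewrite mulr0 mul0r subr0.
have mg i : measurable_fun setT (g i).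
  apply: measurableT_comp => //; apply: measurable_funD; first exact: measurable_funM.
  by apply: measurable_funM => //; exact: measurable_funX.
have [I E] := Rintegral_prod_coord mg (fun i => gaussian_exp_integrable (q * (a i / T)) (UG i) k0).
have [_ H] := holder_normc p0 q0 pq xi_Lp (measurable_normc (cmfun_kernel z)) (fun w => normc_ge0 _)
  (eq_ind_r (fun f => P.-integrable setT (EFin \o f)) (rintegrableZ (expR cc) I) (funext e)).
apply: (le_trans H); rewrite ler_wpM2l ?Lp_norm_ge0 //.
under eq_Rintegral do rewrite e.
rewrite RintegralZl // E.
rewrite (eq_bigr (fun i => expR ((q * (a i / T)) ^+ 2 * T / 2))); last first.
  by move=> i _; rewrite (gaussian_expR _ (UG i)) // /gaussian_tilt mulr0 mul0r subr0 divr1 sqrtr1 invr1 mul1r.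
rewrite -expR_sum -expRD -expRM ler_expR le_eqVlt; apply/orP; left; apply/eqP.
rewrite mulrDl !mulr_suml -big_split /=; apply: eq_bigr => i _; rewrite -/(a i) -/(b i).
by move: (q) (a i) (b i) q0 => Q A B Q0; field; rewrite !gt_eqF.
Qed.

Lemma normc_transform_le z :
  normc (transform z) <= Lp_norm P p xi * expR (growth z).
Proof.
apply: le_trans (kernel_holder z); apply: (le_trans (normc_cE_le (xi_kernel_integrable z))).
by under eq_Rintegral do rewrite normcM.
Qed.

Lemma transform_order2 : exists C c : R, [/\ 0 < C, 0 < c & forall z,
  normc (transform z) <= C * expR (c * \sum_(i < d) normc (z ord0 i) ^+ 2)].
Proof.
have qm : 0 <= q - 1.
  have -> : q - 1 = (p - 1)^-1 by rewrite /q; field; rewrite gt_eqF.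
  by rewrite invr_ge0 ltW.
exists (Lp_norm P p xi + 1), (q / (2 * T)); split.
- by rewrite ltr_wpDl ?Lp_norm_ge0.
- by rewrite divr_gt0 // mulr_gt0.
move=> z; apply: (le_trans (normc_transform_le z)).
rewrite ler_pM ?Lp_norm_ge0 ?expR_ge0 ?lerDl // ler_expR mulr_sumr; apply: ler_sum => i _.
have qE : q = (q - 1) + 1 by rewrite subrK.
have -> : normc (z ord0 i) ^+ 2 = complex.Re (z ord0 i) ^+ 2 + complex.Im (z ord0 i) ^+ 2.
  by rewrite normcE2 sqr_sqrtr ?addr_ge0 ?sqr_ge0.
have iT : 0 <= (2 * T)^-1 by rewrite invr_ge0 mulr_ge0 // ltW.
rewrite -mulrDl [leRHS]mulrAC ler_wpM2r //.
rewrite mulrDr lerD //.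
  by rewrite ler_wpM2r ?sqr_ge0 // lerBlDr lerDl.
by rewrite -[leLHS]mul1r ler_wpM2r ?sqr_ge0 // qE lerDr.
Qed.
End transform.

(** * Unordered sums and complex differentiability *)

Section unordered_sums.
Context {R : realType}.

Lemma big_subset_split (V : zmodType) (I : eqType) (A B : seq I) (F : I -> V) :
  uniq A -> uniq B -> {subset A <= B} ->
  \sum_(i <- B) F i = \sum_(i <- A) F i + \sum_(i <- B | i \notin A) F i.
Proof.
move=> uA uB AB; rewrite (bigID (mem A)) /=; congr (_ + _).
rewrite -big_filter; apply: perm_big; apply: uniq_perm => //; first exact: filter_uniq.
by move=> i; rewrite mem_filter; case: (boolP (i \in A)) => // /AB ->.
Qed.

Lemma near_subset (I : eqType) (J : nat -> seq I) (A : seq I) :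
  (forall i, \forall n \near \oo, i \in J n) ->
  \forall n \near \oo, {subset A <= J n}.
Proof.
move=> HJ; elim: A => [|i A IH]; first by near=> n => j.
near=> n => j; rewrite inE => /orP[/eqP ->|]; first by near: n; exact: HJ.
by move: j; near: n.
Unshelve. all: by end_near. Qed.

(** Convergence of the sums over one exhausting sequence of finite sets, together with
absolute boundedness, is convergence along the net of all finite sets. *)
Lemma has_sum_exhaust (I : choiceType) (a : I -> R[i]) (J : nat -> seq I) s (B : R) :
  (forall n, uniq (J n)) -> (forall i, \forall n \near \oo, i \in J n) ->
  (forall n, \sum_(i <- J n) normc (a i) <= B) ->
  ccvg (fun n => \sum_(i <- J n) a i) s -> has_sum a s.
Proof.
move=> uJ HJ JB cJ.
have AB (A : seq I) : uniq A -> \sum_(i <- A) normc (a i) <= B.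
  move=> uA; have [n _ nJ] := near_subset A HJ.
  have AJ := nJ n (leqnn n).
  apply: le_trans (JB n); rewrite (big_subset_split _ uA (uJ n) AJ) lerDl.
  by apply: sumr_ge0 => i _; exact: normc_ge0.
split.
  apply: le_lt_trans (ltry B); apply: ge_ereal_sup => _ [A [fA _] <-].
  rewrite fsbig_finite //=.
  under eq_bigr do rewrite ger0_norm ?normc_ge0 //.
  by rewrite sumEFin lee_fin AB.
pose E := [set \sum_(i <- A) normc (a i) | A in [set A : seq I | uniq A]].
have hE : has_sup E.
  split; first by exists (\sum_(i <- [::]) normc (a i)), [::].
  by exists B => _ [A /= uA <-]; exact: AB.
have EB A : uniq A -> \sum_(i <- A) normc (a i) <= sup E.
  by move=> uA; apply: ub_le_sup; [exact: hE.2|exists A].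
have FT : ProperFilter (@totally I) := totally_filter.
apply/cvgrPdist_lt => eps eps0.
have [e0 epsE] : 0 < complex.Re eps /\ eps = (complex.Re eps)%:C.
  by move: eps0; case: eps => x y; rewrite ltcE /= => /andP[/eqP -> x0].
set e := complex.Re eps in e0 epsE.
have [_ [A1 uA1 <-] hA1] := sup_adherent (divr_gt0 e0 (ltr0Sn R 1)) hE.
have cn : \forall n \near \oo, normc (s - \sum_(i <- J n) a i) < e / 2.
  have [cr ci] := cJ.
  near=> n; apply: le_lt_trans (normc_le_ReIm _) _; rewrite !(ReD, ReN, ImD, ImN).
  rewrite (splitr (e / 2)) ltrD //; near: n.
  - by move/cvgrPdist_lt : cr => /(_ (e / 2 / 2)); apply; rewrite !divr_gt0.
  - by move/cvgrPdist_lt : ci => /(_ (e / 2 / 2)); apply; rewrite !divr_gt0.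
have [n [An cJn]] : exists n, {subset A1 <= J n} /\ normc (s - \sum_(i <- J n) a i) < e / 2.
  have [n1 _ H1] := near_subset A1 HJ; have [n2 _ H2] := cn.
  by exists (maxn n1 n2); split; [apply: H1; exact: leq_maxl|apply: H2; exact: leq_maxr].
exists [fset i in J n]%fset => // A /= /fsubsetP JA.
have {}JA : {subset J n <= A} by move=> i iJ; apply: JA; rewrite inE.
rewrite epsE normr_normc ltcR /partial_sum -(big_seq_fsetE _ A predT a) /=.
have uA := fset_uniq A.
rewrite (big_subset_split _ (uJ n) uA JA) opprD addrA (splitr e).
apply: le_lt_trans (normcD _ _) _; rewrite normcN ltr_leD //.
apply: le_trans (normc_sum _ _ _) _.
rewrite -(lerD2l (\sum_(i <- J n) normc (a i))).
rewrite -(big_subset_split (fun i => normc (a i)) (uJ n) uA JA).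
apply: le_trans (EB _ uA) _; rewrite -lerBlDr.
apply/ltW/(lt_le_trans hA1).
rewrite (big_subset_split (fun i => normc (a i)) uA1 (uJ n) An) lerDl.
by apply: sumr_ge0 => i _; exact: normc_ge0.
Unshelve. all: by end_near. Qed.

Lemma differentiable_little (K : numFieldType) (V W : normedModType K) (g : V -> W) z :
  (forall eps : K, 0 < eps -> \forall h \near (0 : V), `|g (h + z) - g z| <= eps * `|h|) ->
  differentiable g z.
Proof.
move=> H.
have c0 : continuous (\0 : V -> W) by exact: cst_continuous.
have e0 : g \o shift z = cst (g z) + \0 +o_ 0 id.
  apply/eqaddoP => eps eps0; near=> h.
  rewrite /= !fctE addr0; near: h; exact: H.
by apply/diff_locallyP; rewrite (diff_unique c0 e0).
Unshelve. all: by end_near. Qed.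

(** A first-order expansion with quadratic error; subtracting the candidate differential
leaves a function with zero differential. *)
Lemma differentiable_quadratic (K : numFieldType) d (f : 'rV[K]_d -> K) z
    (D : 'I_d -> K) (C : K) : 0 < C ->
  (forall h : 'rV[K]_d, `|h| <= 1 ->
    `|f (h + z) - f z - \sum_(i < d) h ord0 i * D i| <= C * `|h| ^+ 2) ->
  differentiable f z.
Proof.
move=> C0 fC.
pose L (y : 'rV[K]_d) : K := \sum_(i < d) y ord0 i * D i.
have LD (y h : 'rV[K]_d) : L (h + y) = L h + L y.
  by rewrite /L -big_split /=; apply: eq_bigr => i _; rewrite mxE mulrDl.
have dL : differentiable L z.
  have -> : L = \sum_(i < d) (fun y : 'rV[K]_d => y ord0 i *: (D i : K)).
    by apply/funext => y; rewrite fct_sumE.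
  apply: differentiable_sum => i; apply: differentiableZl; exact: differentiable_coord.
have -> : f = (f - L) + L by rewrite subrK.
apply: differentiableD => //.
apply: differentiable_little => eps eps0; near=> h.
have h1a : `|h| <= 1 by near: h; apply: (@nbhs0_le K 'rV[K]_d); exact: ltr01.
have h1b : `|h| <= eps / C by near: h; apply: (@nbhs0_le K 'rV[K]_d); rewrite divr_gt0.
rewrite !fctE LD.
have -> : f (h + z) - (L h + L z) - (f z - L z) = f (h + z) - f z - L h by ring.
apply: le_trans (fC h h1a) _; rewrite expr2 mulrA ler_wpM2r //.
by rewrite mulrC -ler_pdivlMr.
Unshelve. all: by end_near. Qed.

Lemma normr_row_coord d (h : 'rV[R[i]]_d) : exists2 eta : R, `|h| = eta%:C &
  0 <= eta /\ forall i, normc (h ord0 i) <= eta.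
Proof.
have n0 := normr_ge0 h.
have e : `|h| = (complex.Re `|h|)%:C.
  by move: n0; case: `|h| => x y; rewrite lecE /= => /andP[/eqP ->].
exists (complex.Re `|h|) => //; split.
  by move: n0; rewrite e lecR.
move=> i; rewrite -lecR -e -normr_normc.
rewrite [leRHS]mx_normE -[leLHS]nngE num_le.
exact: (le_bigmax _ (fun j : 'I_1 * 'I_d => `|h j.1 j.2|%:nng) (ord0, i)).
Qed.

End unordered_sums.

Lemma normc_div_real (R : realType) (z : R[i]) (t : R) : 0 < t -> normc (z / t%:C) = normc z / t.
Proof.
move=> t0; have t1 : t%:C != 0 :> R[i] by rewrite (inj_eq (@complexI R)) gt_eqF.
apply: (mulIf (lt0r_neq0 t0)); rewrite divfK ?gt_eqF //.
by rewrite -{2}(gtr0_norm t0) -normc_real -normcM divfK.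
Qed.

Section transform_analytic.
Context {R : realType} {disp : measure_display} {Omega : measurableType disp}.
Variable P : probability Omega R.
Variables (d : nat) (T : R) (U : Omega -> 'rV[R]_d).
Hypothesis T_gt0 : 0 < T.
Hypothesis UG : forall i, gaussian P (fun w => U w ord0 i) T.
Hypothesis Uprod : forall h : 'I_d -> R -> R[i], (forall i, cmfun (h i)) ->
  (forall i, cintegrable P (fun w => h i (U w ord0 i))) ->
  cintegrable P (fun w => \prod_(i < d) h i (U w ord0 i)) /\
  cexpectation P (fun w => \prod_(i < d) h i (U w ord0 i)) =
  \prod_(i < d) cexpectation P (fun w => h i (U w ord0 i)).
Variables (p : R) (xi : Omega -> R[i]).
Hypotheses (p_gt1 : 1 < p) (xi_Lp : in_Lp P p xi).
Local Notation hc := hermite_coeff.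
Local Notation cE := (cexpectation P).
Implicit Types (z h : 'rV[R[i]]_d) (a : multi_index d).

Let mU i : measurable_fun setT (fun w => U w ord0 i).
Proof. exact: gaussian_measurable (UG i). Qed.
Let xiD := xi_dominated UG Uprod p_gt1 xi_Lp.

Definition mhermite_coeff a w : R := \prod_(i < d) hc T (U w ord0 i) (a i).

Definition multi_box n : seq (multi_index d) :=
  [seq [ffun i => nat_of_ord (g i)] | g : {ffun 'I_d -> 'I_n} <- enum {ffun 'I_d -> 'I_n}].

Lemma multi_box_uniq n : uniq (multi_box n).
Proof.
rewrite map_inj_uniq ?enum_uniq // => g g' /ffunP e; apply/ffunP => i.
by have := e i; rewrite !ffunE => /val_inj.
Qed.

Lemma multi_box_exhaust a : \forall n \near \oo, a \in multi_box n.
Proof.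
exists (\sum_(i < d) a i).+1 => // n /= an.
have ai i : (a i < n)%N by apply: leq_trans an; rewrite ltnS (bigD1 i) //= leq_addr.
apply/mapP; exists [ffun i => Ordinal (ai i)]; first by rewrite mem_enum.
by apply/ffunP => i; rewrite !ffunE.
Qed.

Lemma multi_box_sum (V : comNzRingType) n (F : 'I_d -> nat -> V) :
  \sum_(a <- multi_box n) \prod_(i < d) F i (a i) = \prod_(i < d) \sum_(k < n) F i k.
Proof.
rewrite big_map big_enum bigA_distr_bigA /=; apply: eq_bigr => g _.
by apply: eq_bigr => i _; rewrite ffunE.
Qed.

Definition hermite_monomial z a w : R[i] :=
  \prod_(i < d) ((z ord0 i / T%:C) ^+ a i * (hc T (U w ord0 i) (a i))%:C).

Lemma hermite_monomialE z a w : hermite_monomial z a w =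
  mpow z a / (T ^+ mabs a)%:C * (mhermite_coeff a w)%:C.
Proof.
rewrite /hermite_monomial big_split /= rmorph_prod /mpow; congr (_ * _).
under eq_bigr do rewrite expr_div_n.
by rewrite prodf_div rmorphXn /mabs -prodrXr.
Qed.

Lemma cmfun_hermite_monomial z a : cmfun (hermite_monomial z a).
Proof.
apply: cmfun_prod => i; apply: cmfunM; first exact: cmfun_cst.
by apply: cmfun_real; exact: measurable_hermite.
Qed.

Lemma sum_normc_hermite_monomial z n w :
  \sum_(a <- multi_box n) normc (hermite_monomial z a w) <=
  dominator U (fun i => normc (z ord0 i) / T) (fun i => normc (z ord0 i) ^+ 2 / (2 * T)) w.
Proof.
under eq_bigr do rewrite /hermite_monomial normc_prod.
rewrite (multi_box_sum n (fun i k => normc ((z ord0 i / T%:C) ^+ k * (hc T (U w ord0 i) k)%:C))).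
apply: ler_prod => i _; apply/andP; split; first by apply: sumr_ge0 => k _; exact: normc_ge0.
under eq_bigr do rewrite normcM normcX normc_real.
have r0 : 0 <= normc (z ord0 i / T%:C) by exact: normc_ge0.
apply: (le_trans (hermite_partial_sum_le T (U w ord0 i) n r0)).
rewrite normc_div_real // (gtr0_norm T_gt0) ler_expR le_eqVlt; apply/orP; left; apply/eqP; congr (_ + _).
by field; rewrite gt_eqF.
Qed.

Lemma hermite_monomial_sum z w :
  ccvg (fun n => \sum_(a <- multi_box n) hermite_monomial z a w) (kernel T U z w).
Proof.
have -> : (fun n => \sum_(a <- multi_box n) hermite_monomial z a w) =
  (fun n => \prod_(i < d) \sum_(k < n) ((z ord0 i / T%:C) ^+ k * (hc T (U w ord0 i) k)%:C)).
  apply/funext => n.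
  exact: (multi_box_sum n (fun i k => (z ord0 i / T%:C) ^+ k * (hc T (U w ord0 i) k)%:C)).
apply: ccvg_prod => i; rewrite /kernel1.
have := hermite_generating T (U w ord0 i) (z ord0 i / T%:C).
congr (ccvg _ (cexp _)).
have T0 : T%:C != 0 :> R[i] by rewrite (inj_eq (@complexI R)) gt_eqF.
rewrite rmorphM !rmorphV ?unitfE ?pnatr_eq0 ?gt_eqF //= rmorph_nat.
by move: (z ord0 i) (U w ord0 i)%:C (T%:C) T0 => Z V C C0; field; rewrite C0.
Qed.

Definition hermite_transform_coeff a : R[i] :=
  cE (fun w => xi w * (mhermite_coeff a w)%:C) / (T ^+ mabs a)%:C.

Lemma hermite_coeff_kernel_integrable a : cintegrable P (fun w => xi w * (mhermite_coeff a w)%:C).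
Proof.
pose c1 : 'rV[R[i]]_d := \row_(_ < d) T%:C.
have e w : (mhermite_coeff a w)%:C = hermite_monomial c1 a w.
  rewrite /hermite_monomial rmorph_prod; apply: eq_bigr => i _.
  by rewrite mxE divff ?expr1n ?mul1r // (inj_eq (@complexI R)) gt_eqF.
have -> : (fun w => xi w * (mhermite_coeff a w)%:C) = (fun w => xi w * hermite_monomial c1 a w).
  by apply/funext => w; rewrite e.
have [n _ /(_ n (leqnn n)) an] := multi_box_exhaust a.
apply: xiD (cmfun_hermite_monomial c1 a) _ => w.
apply: le_trans (sum_normc_hermite_monomial c1 n w).
rewrite (big_rem a an) /= lerDl; apply: sumr_ge0 => j _; exact: normc_ge0.
Qed.

Lemma hermite_transform_coeff_mpow z a : hermite_transform_coeff a * mpow z a =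
  cE (fun w => xi w * hermite_monomial z a w).
Proof.
have -> : (fun w => xi w * hermite_monomial z a w) =
    (fun w => mpow z a / (T ^+ mabs a)%:C * (xi w * (mhermite_coeff a w)%:C)).
  by apply/funext => w; rewrite hermite_monomialE mulrCA.
rewrite (cEZ _ (hermite_coeff_kernel_integrable a)) /hermite_transform_coeff.
by rewrite mulrAC [_ * mpow z a]mulrC -!mulrA [_^-1 * _]mulrC.
Qed.

(** The absolute sums over boxes of multi-indices factor over the coordinates, and there are
dominated by one exponential. *)
Lemma transform_has_sum z :
  has_sum (fun a => hermite_transform_coeff a * mpow z a) (transform P T U xi z).
Proof.
have mxi := in_Lp_cmfun xi_Lp.
pose A i : R := normc (z ord0 i) / T; pose C i : R := normc (z ord0 i) ^+ 2 / (2 * T).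
have eJ n w : \sum_(a <- multi_box n) xi w * hermite_monomial z a w =
  xi w * \sum_(a <- multi_box n) hermite_monomial z a w by rewrite mulr_sumr.
have mJ n : cmfun (fun w => \sum_(a <- multi_box n) hermite_monomial z a w).
  by apply: cmfun_sum => a; exact: cmfun_hermite_monomial.
have bJ n w : normc (\sum_(a <- multi_box n) hermite_monomial z a w) <= dominator U A C w.
  exact: le_trans (normc_sum _ _ _) (sum_normc_hermite_monomial z n w).
have iM a : cintegrable P (fun w => xi w * hermite_monomial z a w).
  have [n _ /(_ n (leqnn n)) an] := multi_box_exhaust a.
  apply: xiD (cmfun_hermite_monomial z a) _ => w.
  apply: le_trans (sum_normc_hermite_monomial z n w).
  rewrite (big_rem a an) /= lerDl; apply: sumr_ge0 => j _; exact: normc_ge0.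
have sumE (s : seq (multi_index d)) :
    cintegrable P (fun w => \sum_(a <- s) xi w * hermite_monomial z a w) /\
    cE (fun w => \sum_(a <- s) xi w * hermite_monomial z a w) =
    \sum_(a <- s) hermite_transform_coeff a * mpow z a.
  elim: s => [|a s [IHi IHe]].
    under eq_fun do rewrite big_nil.
    by rewrite big_nil cE_cst; split => //; exact: cintegrable_cst.
  under eq_fun do rewrite big_cons.
  split; first exact: cintegrableD.
  by rewrite cED // IHe big_cons hermite_transform_coeff_mpow.
have DI := xi_dominator_integrable UG Uprod p_gt1 xi_Lp A C.
apply: (@has_sum_exhaust _ _ _ multi_box _ (\int[P]_w (normc (xi w) * dominator U A C w))%R).
- exact: multi_box_uniq.
- exact: multi_box_exhaust.
- move=> n.
  apply: (@le_trans _ _ (\sum_(a <- multi_box n) (\int[P]_w normc (xi w * hermite_monomial z a w))%R)).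
    by apply: ler_sum => a _; rewrite hermite_transform_coeff_mpow; exact: normc_cE_le.
  rewrite -[X in X <= _](_ : (\int[P]_w (\sum_(a <- multi_box n) normc (xi w * hermite_monomial z a w)))%R = _); last first.
    elim: (multi_box n) => [|a s IH].
      by under eq_Rintegral do rewrite big_nil; rewrite big_nil Rintegral_cst // mul0r.
    under eq_Rintegral do rewrite big_cons.
    rewrite big_cons -IH RintegralD //; first exact: cintegrable_normc.
    elim: s {IH} => [|b s IH].
      by under eq_fun do rewrite /= big_nil; exact: integrable0.
    have := integrableD measurableT (cintegrable_normc (iM b)) IH.
    by apply: eq_integrable => // w _; rewrite /= big_cons EFinD.
  have Ib : P.-integrable setT (EFin \o (fun w => \sum_(a <- multi_box n) normc (xi w * hermite_monomial z a w))).
    elim: (multi_box n) => [|b s IH].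
      by under eq_fun do rewrite /= big_nil; exact: integrable0.
    have := integrableD measurableT (cintegrable_normc (iM b)) IH.
    by apply: eq_integrable => // w _; rewrite /= big_cons EFinD.
  apply: le_Rintegral => // w _.
  under eq_bigr do rewrite normcM.
  by rewrite -mulr_sumr ler_wpM2l ?normc_ge0 // sum_normc_hermite_monomial.
- have -> : (fun n => \sum_(a <- multi_box n) hermite_transform_coeff a * mpow z a) =
      (fun n => cE (fun w => xi w * \sum_(a <- multi_box n) hermite_monomial z a w)).
    by apply/funext => n; rewrite -(sumE _).2; congr cexpectation; apply/funext => w.
  exact: (transform_dominated UG Uprod p_gt1 xi_Lp mJ (hermite_monomial_sum z) bJ).
Qed.

Definition kernel_log_diff z i w : R[i] := ((U w ord0 i)%:C - z ord0 i) / T%:C.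

Definition log_growth z w : R := \sum_(i < d) (`|U w ord0 i| + (normc (z ord0 i) + 1)) / T.

Lemma normc_log_diff z i w : normc (kernel_log_diff z i w) <= (`|U w ord0 i| + normc (z ord0 i)) / T.
Proof.
rewrite normc_div_real // ler_wpM2r ?invr_ge0 ?(ltW T_gt0) //; apply: le_trans (normcD _ _) _.
by rewrite normcN normc_real.
Qed.

Lemma dominator_log_growth z w :
  dominator U (fun i => normc (z ord0 i) / T) (fun i => normc (z ord0 i) ^+ 2 / (2 * T)) w *
    expR (3 * log_growth z w) =
  dominator U (fun i => (normc (z ord0 i) + 3) / T)
    (fun i => normc (z ord0 i) ^+ 2 / (2 * T) + 3 * (normc (z ord0 i) + 1) / T) w.
Proof.
rewrite /dominator -!expR_sum -expRD; congr expR.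
rewrite mulr_sumr -big_split /=; apply: eq_bigr => i _.
by move: (normc _) (`|_|) => A B; field; rewrite gt_eqF.
Qed.

(** The kernel at z + h is the kernel at z times an exponential; the second-order Taylor
remainder of the latter is quadratic in h, up to one more exponential of the coordinates. *)
Lemma kernel_quadratic z h eta w : 0 <= eta -> eta <= 1 -> (forall i, normc (h ord0 i) <= eta) ->
  normc (kernel T U (h + z) w - kernel T U z w -
    kernel T U z w * \sum_(i < d) h ord0 i * kernel_log_diff z i w) <=
  eta ^+ 2 * (2 * dominator U (fun i => (normc (z ord0 i) + 3) / T)
    (fun i => normc (z ord0 i) ^+ 2 / (2 * T) + 3 * (normc (z ord0 i) + 1) / T) w).
Proof.
move=> e0 e1 he.
pose l := \sum_(i < d) h ord0 i * kernel_log_diff z i w.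
pose r := \sum_(i < d) h ord0 i ^+ 2 / (2 * T)%:C.
pose G := log_growth z w.
have T0 : T%:C != 0 :> R[i] by rewrite (inj_eq (@complexI R)) gt_eqF.
have E : kernel T U (h + z) w = kernel T U z w * cexp (l - r).
  rewrite !kernelE -cexpD; congr cexp.
  rewrite /cdot /csqr !mulr_suml /l /r /kernel_log_diff -!sumrB !mulr_sumr -big_split /=.
  apply: eq_bigr => i _; rewrite mxE rmorphM rmorph_nat rmorphV ?unitfE ?gt_eqF //=.
  by move: (z ord0 i) (h ord0 i) (U w ord0 i)%:C (T%:C) T0 => Z H' V C C0; field; rewrite C0.
have iT : 0 <= T^-1 by rewrite invr_ge0 ltW.
have G0 i : 0 <= (`|U w ord0 i| + (normc (z ord0 i) + 1)) / T.
  by rewrite mulr_ge0 // !addr_ge0 ?normc_ge0.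
have rterm i : normc (h ord0 i ^+ 2 / (2 * T)%:C) <= eta ^+ 2 / (2 * T).
  rewrite normc_div_real ?mulr_gt0 // normcX.
  by rewrite ler_wpM2r ?invr_ge0 ?mulr_ge0 // ?lerXn2r ?nnegrE ?normc_ge0 // ltW.
have Gp : 0 <= G by apply: sumr_ge0 => i _.
have rG : normc r <= eta ^+ 2 * G.
  apply: le_trans (normc_sum _ _ _) _; rewrite mulr_sumr; apply: ler_sum => i _.
  apply: le_trans (rterm i) _; rewrite ler_wpM2l ?sqr_ge0 // invfM mulrC mulrC ler_wpM2r //.
  have : 2^-1 <= 1 :> R by lra.
  have := normc_ge0 (z ord0 i); have := normr_ge0 (U w ord0 i); lra.
have lrG : normc (l - r) <= eta * G.
  rewrite /l /r -sumrB; apply: le_trans (normc_sum _ _ _) _; rewrite mulr_sumr; apply: ler_sum => i _.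
  apply: le_trans (normcD _ _) _; rewrite normcN normcM.
  apply: (@le_trans _ _ (eta * ((`|U w ord0 i| + normc (z ord0 i)) / T) + eta * T^-1)).
    apply: lerD; first by rewrite ler_pM ?normc_ge0 // normc_log_diff.
    apply: le_trans (rterm i) _; rewrite invfM mulrA ler_wpM2r //.
    rewrite expr2 -mulrA ler_piMr // mulr_ile1 ?invr_ge0 //; lra.
  by rewrite -mulrDr -{2}[T^-1]mul1r -mulrDl addrA.
have -> : kernel T U (h + z) w - kernel T U z w - kernel T U z w * l =
    kernel T U z w * ((cexp (l - r) - 1 - (l - r)) - r).
  by rewrite E; ring.
have lr1 : normc (cexp (l - r) - 1 - (l - r) - r) <= eta ^+ 2 * (2 * expR (3 * G)).
  apply: le_trans (normcD _ _) _; rewrite normcN.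
  apply: (@le_trans _ _ ((eta * G) ^+ 2 * expR G + eta ^+ 2 * G)).
    rewrite lerD //; apply: le_trans (cexp_taylor2 _) _.
    rewrite ler_pM ?expR_ge0 ?exprn_ge0 ?normc_ge0 //.
      by rewrite lerXn2r ?nnegrE ?normc_ge0 // mulr_ge0.
    by rewrite ler_expR; apply: le_trans lrG _; rewrite ler_piMl.
  rewrite exprMn -mulrA -mulrDr ler_wpM2l ?sqr_ge0 //.
  have GE : G <= expR G by apply: le_trans (expR_ge1Dx G); rewrite lerDr.
  have e3 : expR (3 * G) = expR G ^+ 2 * expR G by rewrite -exprSr -expRM_natl.
  rewrite e3 mulr_natl mulr2n lerD //.
    by rewrite ler_wpM2r ?expR_ge0 // lerXn2r ?nnegrE ?expR_ge0.
  apply: le_trans GE _; rewrite ler_peMl ?expR_ge0 // exprn_ege1 //.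
  by rewrite -[leLHS]expR0 ler_expR.
rewrite normcM; apply: le_trans (ler_pM (normc_ge0 _) (normc_ge0 _) (kernel_dominated U T_gt0 z w) lr1) _.
rewrite mulrCA ler_wpM2l ?sqr_ge0 // mulrCA ler_wpM2l //.
by rewrite dominator_log_growth.
Qed.

Lemma transform_entire : entire (transform P T U xi).
Proof.
move=> z.
have mxi := in_Lp_cmfun xi_Lp.
pose a0 i := (normc (z ord0 i) + 3) / T.
pose c0 i := normc (z ord0 i) ^+ 2 / (2 * T) + 3 * (normc (z ord0 i) + 1) / T.
pose C := (2 * \int[P]_w (normc (xi w) * dominator U a0 c0 w))%R + 1.
have DI := xi_dominator_integrable UG Uprod p_gt1 xi_Lp a0 c0.
have I0 : 0 <= (\int[P]_w (normc (xi w) * dominator U a0 c0 w))%R.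
  by apply: Rintegral_ge0 => w _; rewrite mulr_ge0 ?normc_ge0 ?dominator_ge0.
have C0 : 0 < C by rewrite /C; lra.
pose Kd i w := kernel T U z w * kernel_log_diff z i w.
have mKd i : cmfun (Kd i).
  apply: cmfunM; first exact: cmfun_kernel.
  apply: cmfunM; last exact: cmfun_cst.
  by apply: cmfunB; [exact: cmfun_real|exact: cmfun_cst].
have iKd i : cintegrable P (fun w => xi w * Kd i w).
  apply: (@xiD _ a0 c0 (mKd i)) => w; rewrite /a0 /c0 -dominator_log_growth normcM.
  rewrite ler_pM ?normc_ge0 ?kernel_dominated //; apply: le_trans (normc_log_diff z i w) _.
  have G0 j : 0 <= (`|U w ord0 j| + (normc (z ord0 j) + 1)) / T.
    by rewrite mulr_ge0 ?invr_ge0 ?(ltW T_gt0) // !addr_ge0 ?normc_ge0.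
  have GE : log_growth z w <= expR (log_growth z w).
    by apply: le_trans (expR_ge1Dx _); rewrite lerDr.
  have Gp : 0 <= log_growth z w by apply: sumr_ge0 => j _.
  apply: (@le_trans _ _ (log_growth z w)).
    rewrite /log_growth (bigD1 i) //=; apply: ler_wpDr; first by apply: sumr_ge0 => j _.
    by rewrite ler_wpM2r ?invr_ge0 ?(ltW T_gt0) // lerD2l lerDl.
  by apply: le_trans GE _; rewrite ler_expR ler_peMl //; lra.
have iK z' := xi_kernel_integrable T_gt0 UG Uprod p_gt1 xi_Lp z'.
apply: (@differentiable_quadratic _ _ _ _ (fun i => cE (fun w => xi w * Kd i w)) C%:C).
  by rewrite ltcR.
move=> h; have [eta -> [e0 he]] := normr_row_coord h; rewrite lecR => e1.
rewrite -rmorphXn -rmorphM.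
have sumE (s : seq 'I_d) : cintegrable P (fun w => \sum_(i <- s) h ord0 i * (xi w * Kd i w)) /\
   cE (fun w => \sum_(i <- s) h ord0 i * (xi w * Kd i w)) = \sum_(i <- s) h ord0 i * cE (fun w => xi w * Kd i w).
  elim: s => [|i s [IHi IHe]].
    under eq_fun do rewrite big_nil.
    by rewrite big_nil cE_cst; split => //; exact: cintegrable_cst.
  under eq_fun do rewrite big_cons.
  split; first by apply: cintegrableD => //; exact: cintegrableZ.
  by rewrite cED ?cEZ ?IHe ?big_cons //; exact: cintegrableZ.
have [iS eS] := sumE (index_enum 'I_d).
rewrite -eS /transform -!cEB //; last by apply: cintegrableB.
rewrite normr_normc lecR.
apply: le_trans (normc_cE_le _) _; first by apply: cintegrableB => //; exact: cintegrableB.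
apply: (@le_trans _ _ (\int[P]_w (eta ^+ 2 * 2 * (normc (xi w) * dominator U a0 c0 w)))%R).
  apply: le_Rintegral => //.
  - by apply: cintegrable_normc; apply: cintegrableB => //; exact: cintegrableB.
  - exact: rintegrableZ.
  - move=> w _.
    have -> : xi w * kernel T U (h + z) w - xi w * kernel T U z w - \sum_(i < d) h ord0 i * (xi w * Kd i w) =
      xi w * (kernel T U (h + z) w - kernel T U z w -
        kernel T U z w * \sum_(i < d) h ord0 i * kernel_log_diff z i w).
      rewrite !mulrBr; congr (_ - _); rewrite !mulr_sumr; apply: eq_bigr => i _.
      by rewrite /Kd; ring.
    rewrite normcM mulrCA ler_wpM2l ?normc_ge0 // -mulrA.
    exact: kernel_quadratic.
rewrite RintegralZl // [leRHS]mulrC -mulrA ler_wpM2l ?sqr_ge0 // /C; lra.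
Qed.
End transform_analytic.

(** * Conditional expectations *)

Section conditional.
Context {R : realType} {disp : measure_display} {Omega : measurableType disp}.
Variable P : probability Omega R.
Implicit Types (G : set (set Omega)) (A C : set Omega).
Local Notation cE := (cexpectation P).

(** The events orthogonal to an integrable variable form a Dynkin class. *)
Lemma orthogonal_pi_system G (dl : Omega -> R) : G `<=` measurable ->
  setI_closed G -> G setT -> P.-integrable setT (EFin \o dl) ->
  (forall C, G C -> (\int[P]_w (\1_C w * dl w))%R = 0) ->
  forall C, <<s G >> C -> (\int[P]_w (\1_C w * dl w))%R = 0.
Proof.
move=> GM GI GT Idl Gdl.
have GsM := g_sigma_measurable GM.
have iE C : <<s G >> C -> (\int[P]_w (\1_C w * dl w))%R = 0 <->
    (\int[P]_(w in C) (dl w)%:E)%E = 0%E.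
  move=> /GsM mC; rewrite Rintegral_indicM //.
  by split=> [->|[]].
have T0 : (\int[P]_w dl w)%R = 0.
  rewrite -(Gdl _ GT); apply: eq_Rintegral => w _.
  by rewrite indicE in_setT mul1r.
refine (@dynkin_induction _ (g_sigma_algebraType G) G
  (fun C => (\int[P]_w (\1_C w * dl w))%R = 0) erefl GI (Gdl _ GT) Gdl _ _).
- move=> C mC HC.
  have -> : (fun w => \1_(~` C) w * dl w) = (fun w => dl w - \1_C w * dl w).
    apply/funext => w; rewrite !indicE in_setC; by case: (w \in C) => /=; rewrite ?mul1r ?mul0r ?subr0 ?subrr.
  rewrite RintegralB //; first by rewrite T0 HC subrr.
  exact: integrable_indicM (GsM _ mC) Idl.
- move=> F mF tF HF; apply/iE; first exact: (@bigcup_measurable _ (g_sigma_algebraType G)).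
  have mF' k : @measurable _ Omega (F k) := GsM _ (mF k).
  rewrite (@integral_bigcup _ Omega R P F _ tF mF'); last first.
    by apply: integrableS Idl => //; exact: bigcup_measurable.
  rewrite (eq_eseriesr (g := fun=> 0%E)) ?eseries0 // => i _.
  by apply/iE; [exact: mF|exact: HF].
Qed.

Lemma cE_indicE (f : Omega -> R[i]) A :
  cE (fun w => (\1_A w)%:C * f w) =
  (\int[P]_w (\1_A w * complex.Re (f w)))%R +i* (\int[P]_w (\1_A w * complex.Im (f w)))%R.
Proof.
rewrite cexpectationE; apply: complexP => /=; apply: eq_Rintegral => w _.
  by rewrite ReM /= mul0r subr0.
by rewrite ImM /= mul0r addr0.
Qed.

Lemma cmeasurableP G (V : Omega -> R[i]) :
  cmeasurable setT <<s G >> V <-> cmfun (V : g_sigma_algebraType G -> R[i]).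
Proof.
split=> [[mr mi]|[mr mi]].
  by split=> _ B mB; [apply: mr|apply: mi]; exists B.
split=> _ [B mB <-].
  exact: (mr measurableT B mB).
exact: (mi measurableT B mB).
Qed.

Lemma is_cond_expectationP G (f V : Omega -> R[i]) : G `<=` measurable ->
  is_cond_expectation P G f V <->
  [/\ cintegrable P f, cintegrable P V, cmeasurable setT G V &
    forall A, G A -> cE (fun w => (\1_A w)%:C * V w) = cE (fun w => (\1_A w)%:C * f w)].
Proof.
move=> GM; split=> -[cf cV mV H]; split=> // A GA; have mA := GM _ GA.
  have [hr hi] := H A GA; rewrite !cE_indicE.
  rewrite !Rintegral_indicM // in hr hi; try by [exact: cf.1|exact: cf.2|exact: cV.1|exact: cV.2].
  by case: hr => ->; case: hi => ->.
have := H A GA; rewrite !cE_indicE => -[hr hi].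
by rewrite !Rintegral_indicM ?hr ?hi //; [exact: cf.2|exact: cV.2|exact: cf.1|exact: cV.1].
Qed.

Lemma zero_of_orthogonal G (D : Omega -> R) : <<s G >> `<=` measurable ->
  measurable_fun setT (D : g_sigma_algebraType G -> R) -> P.-integrable setT (EFin \o D) ->
  (forall A, <<s G >> A -> (\int[P]_w (\1_A w * D w))%R = 0) ->
  {ae P, forall w, D w = 0}.
Proof.
move=> GM mD ID HD.
pose A := D @^-1` `[0, +oo[%classic.
have GA : <<s G >> A by rewrite -[A]setTI; apply: mD => //; exact: measurable_itv.
have GB : <<s G >> (~` A) by exact: (@measurableC _ (g_sigma_algebraType G)).
have e : (fun w => `|D w|) = (fun w => \1_A w * D w - \1_(~` A) w * D w).
  apply/funext => w; rewrite !indicE in_setC; case: (boolP (w \in A)).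
    by rewrite inE /A /= in_itv /= andbT => D0; rewrite ger0_norm // mul1r mul0r subr0.
  rewrite notin_setE /A /= in_itv /= andbT => /negP; rewrite -ltNge => D0.
  by rewrite ltr0_norm // mul0r mul1r sub0r.
have I0 : (\int[P]_w `|D w|)%R = 0.
  rewrite e RintegralB //; try by [apply: integrable_indicM => //; exact: GM].
  by rewrite !HD // subrr.
have : (\int[P]_w `|(EFin \o D) w|)%E = 0%E.
  have /integrable_fin_num h := integrable_norm ID.
  have := congr1 EFin I0; rewrite /Rintegral fineK //.
  exact: h.
have mE : measurable_fun setT (EFin \o D) by exact: measurable_int ID.
move/(ae_eq_integral_abs P measurableT mE); apply: filterS => w /(_ I) /=.
by move=> [].
Qed.

(** Apply [orthogonal_sub_sigma] to the four products of real and imaginary parts. *)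
Lemma cE_orthogonal G (dl psi : Omega -> R[i]) : <<s G >> `<=` measurable ->
  cintegrable P dl ->
  (forall C, <<s G >> C -> cE (fun w => (\1_C w)%:C * dl w) = 0) ->
  cmfun (psi : g_sigma_algebraType G -> R[i]) ->
  P.-integrable setT (EFin \o (fun w => normc (psi w) * normc (dl w))) ->
  cE (fun w => psi w * dl w) = 0.
Proof.
move=> GM [Ir Ii] H [mr mi] I.
have [Hr Hi] : (forall C, <<s G >> C -> (\int[P]_w (\1_C w * complex.Re (dl w)))%R = 0) /\
    (forall C, <<s G >> C -> (\int[P]_w (\1_C w * complex.Im (dl w)))%R = 0).
  by split=> C GC; have := H C GC; rewrite cE_indicE => -[].
have part (a : R[i] -> R) (b : R[i] -> R) : (forall z, `|a z| <= normc z) -> (forall z, `|b z| <= normc z) ->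
    measurable_fun setT ((a \o psi) : g_sigma_algebraType G -> R) ->
    P.-integrable setT (EFin \o (b \o dl)) ->
    P.-integrable setT (EFin \o (fun w => (a (psi w) * b (dl w)))).
  move=> ha hb ma Ib; apply: (le_integrable measurableT _ _ I).
    apply/measurable_EFinP; apply: measurable_funM; first exact: measurable_sub_fun ma.
    by apply/measurable_EFinP; exact: measurable_int Ib.
  move=> w _; rewrite /= lee_fin normrM [leRHS]ger0_norm ?mulr_ge0 ?normc_ge0 //.
  by rewrite ler_pM.
have Irr := part _ _ (@norm_Re R) (@norm_Re R) mr Ir.
have Iii := part _ _ (@norm_Im R) (@norm_Im R) mi Ii.
have Iri := part _ _ (@norm_Re R) (@norm_Im R) mr Ii.
have Iir := part _ _ (@norm_Im R) (@norm_Re R) mi Ir.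
rewrite cexpectationE; apply: complexP => /=.
  under eq_Rintegral do rewrite ReM.
  rewrite RintegralB //.
  rewrite (orthogonal_sub_sigma GM Ir Hr mr Irr) (orthogonal_sub_sigma GM Ii Hi mi Iii).
  by rewrite subrr.
under eq_Rintegral do rewrite ImM.
rewrite RintegralD //.
rewrite (orthogonal_sub_sigma GM Ii Hi mr Iri) (orthogonal_sub_sigma GM Ir Hr mi Iir).
by rewrite addr0.
Qed.

Lemma cond_expectation_unique G (V W : Omega -> R[i]) : <<s G >> `<=` measurable ->
  cmeasurable setT <<s G >> V -> cmeasurable setT <<s G >> W ->
  cintegrable P V -> cintegrable P W ->
  (forall A, <<s G >> A -> cE (fun w => (\1_A w)%:C * V w) = cE (fun w => (\1_A w)%:C * W w)) ->
  {ae P, forall w, V w = W w}.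
Proof.
move=> GM /cmeasurableP mV /cmeasurableP mW cV cW H.
have cD := cintegrableB cV cW.
have [mr mi] := cmfunB mV mW.
have HD A : <<s G >> A -> cE (fun w => (\1_A w)%:C * (V w - W w)) = 0.
  move=> GA; have mA := GM _ GA.
  have -> : (fun w => (\1_A w)%:C * (V w - W w)) = (fun w => (\1_A w : R)%:C * V w - (\1_A w)%:C * W w).
    by apply/funext => w; rewrite mulrBr.
  by rewrite cEB ?H ?subrr //; exact: cintegrable_indic.
have Hr : {ae P, forall w, complex.Re (V w - W w) = 0}.
  apply: (zero_of_orthogonal GM mr cD.1) => A GA.
  by have := HD A GA; rewrite cE_indicE => -[].
have Hi : {ae P, forall w, complex.Im (V w - W w) = 0}.
  apply: (zero_of_orthogonal GM mi cD.2) => A GA.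
  by have := HD A GA; rewrite cE_indicE => -[].
apply: filterS2 Hr Hi => w hr hi; apply/eqP; rewrite -subr_eq0; apply/eqP.
exact: complexP.
Qed.

End conditional.

(** * Gaussian averages of the kernels *)

Section parameter_integrals.
Context {R : realType} {d1 d2 : measure_display}.
Context {T1 : measurableType d1} {T2 : measurableType d2}.
Variable Q : probability T2 R.

Lemma measurable_Rintegral_param (F : T1 * T2 -> R) : measurable_fun setT F ->
  measurable_fun setT (fun x => (\int[Q]_y F (x, y))%R).
Proof.
move=> mF; have mF' : measurable_fun setT (EFin \o F) by exact/measurable_EFinP.
apply: (measurableT_comp (f := fine)); first exact: fine_measurable.
have hp : measurable_fun setT (fubini_F Q (EFin \o F)^\+%E).
  by apply: measurable_fun_fubini_tonelli_F => //; exact: measurable_funepos.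
have hn : measurable_fun setT (fubini_F Q (EFin \o F)^\-%E).
  by apply: measurable_fun_fubini_tonelli_F => //; exact: measurable_funeneg.
have -> : (fun x => (\int[Q]_y (F (x, y))%:E)%E) =
    (fun x => (fubini_F Q (EFin \o F)^\+ x - fubini_F Q (EFin \o F)^\- x)%E).
  apply/funext => x; rewrite integralE; congr (_ - _)%E; rewrite /fubini_F; apply: eq_integral => y _; by rewrite ?funeposE ?funenegE.
exact: emeasurable_funB.
Qed.

Lemma cmfun_cE_param (F : T1 * T2 -> R[i]) : cmfun F ->
  cmfun (fun x => cexpectation Q (fun y => F (x, y))).
Proof.
move=> [mr mi]; split.
  under eq_fun do rewrite Re_cE.
  exact: (measurable_Rintegral_param mr).
under eq_fun do rewrite Im_cE.
exact: (measurable_Rintegral_param mi).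
Qed.
End parameter_integrals.

Section joint_measurability.
Context {R : realType} {disp : measure_display} {S : measurableType disp}.

Lemma cmfun_kernel1_joint T (Zf : S -> R[i]) (Uf : S -> R) : cmfun Zf -> measurable_fun setT Uf ->
  cmfun (fun x => kernel1 T (Zf x) (Uf x)).
Proof.
move=> mZ mU; apply: cmfun_cexp; apply: cmfunM; first exact: cmfun_cst.
apply: cmfunB; first by apply: cmfunM => //; exact: cmfun_real.
by apply: cmfunM; [exact: cmfunX|exact: cmfun_cst].
Qed.

Lemma measurable_bridge1_joint T s (Xf Uf : S -> R) : measurable_fun setT Xf ->
  measurable_fun setT Uf -> measurable_fun setT (fun x => bridge1 T s (Xf x) (Uf x)).
Proof.
move=> mX mU; apply: measurable_funM => //; apply: measurableT_comp => //.
apply: measurable_funB; apply: measurable_funM => //; apply: measurable_funX => //.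
exact: measurable_funB.
Qed.
End joint_measurability.

Section gaussian_averages.
Context {R : realType} {disp : measure_display} {Omega : measurableType disp}.
Variable P : probability Omega R.

Lemma bridge_exp V T s u a : gaussian P V s -> 0 <= s < T ->
  P.-integrable setT (EFin \o (fun w => expR (a * V w) * bridge1 T s (V w) u)) /\
  (\int[P]_w (expR (a * V w) * bridge1 T s (V w) u))%R =
  expR (a * u * s / T + a ^+ 2 * s * (T - s) / (2 * T)).
Proof.
move=> HV sT; have [s0 s1] := andP sT; have T0 : 0 < T by apply: le_lt_trans s1.
have Ts : 0 < T - s by rewrite subr_gt0.
have k0 : 0 < 1 - 2 * (- (1 / (2 * (T - s)))) * s by rewrite tilt_bridge // divr_gt0.
have I := gaussian_exp_integrable (u / (T - s) + a) HV k0.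
have E := gaussian_expR (u / (T - s) + a) HV k0.
pose c0 := (Num.sqrt (1 - s / T))^-1 * expR (u ^+ 2 * (1 / (2 * T) - 1 / (2 * (T - s)))).
have -> : (fun w => expR (a * V w) * bridge1 T s (V w) u) = (fun w => c0 *
    expR ((u / (T - s) + a) * V w + - (1 / (2 * (T - s))) * V w ^+ 2)).
  apply/funext => w; rewrite bridge1_quadratic_x // mulrCA; congr (_ * _).
  by rewrite -expRD; congr expR; ring.
split; first exact: rintegrableZ.
rewrite RintegralZl // E /c0 /gaussian_tilt tilt_bridge //.
rewrite mulrACA -invfM sqrt_bridge // invr1 [LHS]mul1r -expRD; congr expR.
by field; rewrite !gt_eqF.
Qed.

(** The bridge kernel turns exponential growth in x into exponential growth in u. *)
Lemma bridge_expabs V T s u c : gaussian P V s -> 0 <= s < T ->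
  P.-integrable setT (EFin \o (fun w => expR (`|V w| + c) * bridge1 T s (V w) u)) /\
  (\int[P]_w (expR (`|V w| + c) * bridge1 T s (V w) u))%R <=
  expR (1 * `|u| + (c + 1 + T)).
Proof.
move=> HV sT; have [s0 s1] := andP sT; have T0 : 0 < T by apply: le_lt_trans s1.
have mV := gaussian_measurable HV.
have [I1 E1] := bridge_exp u 1 HV sT; have [I2 E2] := bridge_exp u (-1) HV sT.
have I := rintegrableD (rintegrableZ (expR c) I1) (rintegrableZ (expR c) I2).
have le w : expR (`|V w| + c) * bridge1 T s (V w) u <=
    expR c * (expR (1 * V w) * bridge1 T s (V w) u) + expR c * (expR (-1 * V w) * bridge1 T s (V w) u).
  have := bridge1_ge0 T s (V w) u; move: (bridge1 _ _ _ _) => b b0.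
  rewrite !mulrA -mulrDl ler_wpM2r // -mulrDr [ `|V w| + c]addrC expRD ler_wpM2l ?expR_ge0 //.
  rewrite mul1r mulN1r; case: (ger0P (V w)) => _; rewrite ?lerDl ?lerDr ?expR_ge0 //.
have J : P.-integrable setT (EFin \o (fun w => expR (`|V w| + c) * bridge1 T s (V w) u)).
  apply: (le_integrable measurableT _ _ I).
    apply/measurable_EFinP; apply: measurable_funM.
      apply: measurableT_comp => //; apply: measurable_funD => //.
      by apply: (measurableT_comp _ mV); exact: normr_measurable.
    exact: measurable_bridge1_joint.
  move=> w _; rewrite /= lee_fin ger0_norm ?mulr_ge0 ?expR_ge0 ?bridge1_ge0 //.
  exact: le_trans (le w) (ler_norm _).
split=> //; apply: (@le_trans _ _ (expR c * expR (`|u| + T / 2) + expR c * expR (`|u| + T / 2))); last first.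
  have e1 : 2 <= expR 1 :> R by apply: le_trans (expR_ge1Dx 1); lra.
  rewrite -expRD mul1r; apply: (@le_trans _ _ (expR 1 * expR (c + (`|u| + T / 2)))).
    have -> : expR (c + (`|u| + T / 2)) + expR (c + (`|u| + T / 2)) = 2 * expR (c + (`|u| + T / 2)) by ring.
    by rewrite ler_wpM2r ?expR_ge0.
  rewrite -expRD ler_expR; lra.
apply: (@le_trans _ _ (\int[P]_w (expR c * (expR (1 * V w) * bridge1 T s (V w) u) +
    expR c * (expR (-1 * V w) * bridge1 T s (V w) u)))%R).
  exact: le_Rintegral.
have us (e : R) : `|e| = 1 -> e * u * s / T + e ^+ 2 * s * (T - s) / (2 * T) <= `|u| + T / 2.
  move=> e1; have e2 : e ^+ 2 = 1 by rewrite -real_normK ?num_real // e1 expr1n.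
  have sT1 : s / T <= 1 by rewrite ler_pdivrMr // mul1r ltW.
  have sT0 : 0 <= s / T by rewrite divr_ge0 // ltW.
  rewrite e2 mul1r lerD //.
    rewrite -mulrA; apply: le_trans (ler_norm _) _.
    by rewrite normrM (ger0_norm sT0) normrM e1 mul1r ler_piMr.
  have -> : s * (T - s) / (2 * T) = (s / T) * ((T - s) / 2) by field; rewrite gt_eqF.
  apply: (@le_trans _ _ ((T - s) / 2)); last by lra.
  by apply: ler_piMl; [lra|exact: sT1].
rewrite RintegralD //; try exact: rintegrableZ.
rewrite !RintegralZl // E1 E2 lerD // ler_wpM2l ?expR_ge0 // ler_expR; apply: us.
  by rewrite normr1.
by rewrite normrN normr1.
Qed.

(** Average over W first: this gives the bridge kernel at z + V, whose average over V is the
kernel again. *)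
Lemma kernel_pair_expectation V W T v z u : gaussian P V v -> gaussian P W v -> v < T ->
  (forall A B, measurable A -> measurable B ->
    P (V @^-1` A `&` W @^-1` B) = (P (V @^-1` A) * P (W @^-1` B))%E) ->
  cintegrable P (fun w => kernel1 T (z + (V w)%:C + 'i * (W w)%:C) u) /\
  cexpectation P (fun w => kernel1 T (z + (V w)%:C + 'i * (W w)%:C) u) = kernel1 T z u.
Proof.
move=> HV HW vT VW.
have [mV mW] := (gaussian_measurable HV, gaussian_measurable HW).
have v0 : 0 <= v by case: HV.
have vT' : 0 <= v < T by rewrite v0.
have T0 : 0 < T by apply: le_lt_trans vT.
pose F (ab : R * R) := kernel1 T (z + ab.1%:C + 'i * ab.2%:C) u.
have mF : cmfun F.
  apply: cmfun_kernel1_joint => //; apply: cmfunD; first apply: cmfunD.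
  - exact: cmfun_cst.
  - by apply: cmfun_real; exact: measurable_fst.
  - by apply: cmfunM; [exact: cmfun_cst|apply: cmfun_real; exact: measurable_snd].
pose x := complex.Re z; pose y := complex.Im z.
pose f a := expR ((x * u - x ^+ 2 / 2) / T) * expR ((u / T - x / T) * a + (- (1 / (2 * T))) * a ^+ 2).
pose g b := expR (y ^+ 2 / 2 / T) * expR ((y / T) * b + (1 / (2 * T)) * b ^+ 2).
have Ffg a b : normc (F (a, b)) = f a * g b.
  have zab : z + a%:C + 'i * b%:C = (x + a) +i* (y + b).
    by apply: complexP; rewrite !(ReD, ImD, ReM, ImM) /= -/x -/y; ring.
  by rewrite /F zab normc_kernel1 /f /g -!expRD; congr expR; field; rewrite gt_eqF.
have kf : 0 < 1 - 2 * (- (1 / (2 * T))) * v.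
  have : 0 <= v / T by rewrite divr_ge0 // ltW.
  have -> : 1 - 2 * - (1 / (2 * T)) * v = 1 + v / T by field; rewrite gt_eqF.
  by move=> h; lra.
have kg : 0 < 1 - 2 * (1 / (2 * T)) * v.
  by rewrite tilt_kernel // subr_gt0 ltr_pdivrMr // mul1r.
have If : P.-integrable setT (EFin \o (fun w => f (V w))).
  exact: rintegrableZ (gaussian_exp_integrable _ HV kf).
have Ig : P.-integrable setT (EFin \o (fun w => g (W w))).
  exact: rintegrableZ (gaussian_exp_integrable _ HW kg).
have fin : (\int[P]_w \int[P]_v0 (normc (F (V w, W v0)))%:E < +oo)%E.
  have -> : (fun w => (\int[P]_v0 (normc (F (V w, W v0)))%:E)%E) =
      (fun w => ((\int[P]_v0 g (W v0))%R * f (V w))%:E).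
    apply/funext => w.
    under eq_integral do rewrite Ffg.
    rewrite mulrC -RintegralZl // /Rintegral fineK //.
    by apply: integrable_fin_num => //; exact: rintegrableZ.
  exact: integrable_lty (rintegrableZ (\int[P]_v0 g (W v0))%R If).
have sec a : cintegrable P (fun v => F (a, W v)) /\
    cexpectation P (fun v => F (a, W v)) = cbridge1 T v (z + a%:C) u.
  exact (cE_kernel1_imaginary (z + a%:C) u HW vT').
have [c1 _ e] := decouple mV mW VW mF fin (fun a => (sec a).1).
split; first exact: c1.
have [_ <-] := cE_cbridge1_real z u HV vT'.
rewrite -[LHS]/(cexpectation P (fun w => F (V w, W w))) e.
by apply: eq_cE => w; rewrite (sec (V w)).2.
Qed.
End gaussian_averages.

(** * Decoupled averages along the Brownian motion *)

Section decouple_diagonal.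
Context {R : realType} {disp : measure_display} {Omega : measurableType disp}.
Variable P : probability Omega R.
Context {d1 d2 : measure_display} {T1 : measurableType d1} {T2 : measurableType d2}.
Variables (U1 : Omega -> T1) (U2 : Omega -> T2).
Hypotheses (mU1 : measurable_fun setT U1) (mU2 : measurable_fun setT U2).
Hypothesis U12 : forall A B, measurable A -> measurable B ->
  P (U1 @^-1` A `&` U2 @^-1` B) = (P (U1 @^-1` A) * P (U2 @^-1` B))%E.

(** Along independent arguments the diagonal average of |F| is its iterated average. *)
Lemma decouple_diag (F : T1 * T2 -> R[i]) : cmfun F ->
  cintegrable P (fun w => F (U1 w, U2 w)) ->
  (forall x, cintegrable P (fun v => F (x, U2 v))) ->
  cexpectation P (fun w => F (U1 w, U2 w)) =
  cexpectation P (fun w => cexpectation P (fun v => F (U1 w, U2 v))).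
Proof.
move=> mF cF sF; have [|//] := decouple mU1 mU2 U12 mF _ sF.
have mn : measurable_fun setT (fun x => (normc (F x))%:E).
  by apply/measurable_EFinP; exact: measurable_normc.
have n0 x : (0 <= (normc (F x))%:E)%E by rewrite lee_fin normc_ge0.
have <- := decouple_ge0 mU1 mU2 U12 mn n0.
exact: cintegrable_lty.
Qed.
End decouple_diagonal.

Section brownian_products.
Context {R : realType} {disp : measure_display} {Omega : measurableType disp}.
Variable P : probability Omega R.
Variables (d : nat) (X Y : R -> Omega -> 'rV[R]_d).
Hypotheses (X_BM : brownian_motion P X) (Y_BM : brownian_motion P Y).
Hypothesis XY_indep : independent_processes P X Y.
Local Notation cE := (cexpectation P).

Lemma coord_events_fun i b t : 0 <= t ->
  measurable_fun setT (coord X Y (i, b) t : g_sigma_algebraType (coord_events X Y i) -> R).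
Proof.
move=> t0 _ B mB; apply: sub_sigma_algebra.
by case: b; [left|right]; exists t; rewrite /= ?in_itv /= ?t0 //; exists B.
Qed.

Lemma cE_prod_events (z : 'I_d -> Omega -> R[i]) :
  (forall i, cmfun (z i : g_sigma_algebraType (coord_events X Y i) -> R[i])) ->
  (forall i, cintegrable P (z i)) ->
  cintegrable P (fun w => \prod_(i < d) z i w) /\
  cE (fun w => \prod_(i < d) z i w) = \prod_(i < d) cE (z i).
Proof.
apply: cE_prod_independent; first exact: (coord_events_measurable X_BM Y_BM).
exact: (coord_events_indep X_BM Y_BM XY_indep).
Qed.

Lemma Rintegral_prod_events (g : 'I_d -> Omega -> R) :
  (forall i, measurable_fun setT (g i : g_sigma_algebraType (coord_events X Y i) -> R)) ->
  (forall i, P.-integrable setT (EFin \o g i)) ->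
  P.-integrable setT (EFin \o (fun w => \prod_(i < d) g i w)) /\
  (\int[P]_w (\prod_(i < d) g i w))%R = \prod_(i < d) (\int[P]_w g i w)%R.
Proof.
move=> mg Ig.
have [c E] := cE_prod_events (z := fun i w => (g i w)%:C) (fun i => cmfun_real (mg i))
  (fun i => cintegrable_real (Ig i)).
have e : (fun w => \prod_(i < d) (g i w)%:C) = (fun w => (\prod_(i < d) g i w)%:C).
  by apply/funext => w; rewrite rmorph_prod.
rewrite e in c; split; first exact: c.1.
apply: (@complexI R); rewrite -cE_real -e E rmorph_prod; apply: eq_bigr => i _.
exact: cE_real.
Qed.

Lemma X_product t (h : 'I_d -> R -> R[i]) : 0 <= t -> (forall i, cmfun (h i)) ->
  (forall i, cintegrable P (fun w => h i (X t w ord0 i))) ->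
  cintegrable P (fun w => \prod_(i < d) h i (X t w ord0 i)) /\
  cE (fun w => \prod_(i < d) h i (X t w ord0 i)) =
  \prod_(i < d) cE (fun w => h i (X t w ord0 i)).
Proof.
move=> t0 mh Ih; apply: (cE_prod_events (z := fun i w => h i (X t w ord0 i))) => // i.
exact: (@cmfun_comp _ _ (g_sigma_algebraType (coord_events X Y i)) _ R (h i) (fun w => X t w ord0 i)
  (@coord_events_fun i true _ t0) (mh i)).
Qed.

Lemma X_gaussian t i : 0 <= t -> gaussian P (fun w => X t w ord0 i) t.
Proof. exact: (brownian_gaussian (X_BM.1 i)). Qed.
Lemma Y_gaussian t i : 0 <= t -> gaussian P (fun w => Y t w ord0 i) t.
Proof. exact: (brownian_gaussian (Y_BM.1 i)). Qed.
Lemma X_measurable t i : 0 <= t -> measurable_fun setT (fun w => X t w ord0 i).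
Proof. by move=> t0; exact: gaussian_measurable (X_gaussian i t0). Qed.
Lemma Y_measurable t i : 0 <= t -> measurable_fun setT (fun w => Y t w ord0 i).
Proof. by move=> t0; exact: gaussian_measurable (Y_gaussian i t0). Qed.

Lemma XY_coord_indep i (V W : Omega -> R) :
  measurable_fun setT (V : g_sigma_algebraType (past (coord X Y (i, true)) `[0, +oo[) -> R) ->
  measurable_fun setT (W : g_sigma_algebraType (past (coord X Y (i, false)) `[0, +oo[) -> R) ->
  forall A B, measurable A -> measurable B ->
  P (V @^-1` A `&` W @^-1` B) = (P (V @^-1` A) * P (W @^-1` B))%E.
Proof.
move=> mV mW A B mA mB.
have hV : <<s past (coord X Y (i, true)) `[0, +oo[ >> (V @^-1` A).
  by rewrite -[V @^-1` A]setTI; exact: mV.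
have hW : <<s past (coord X Y (i, false)) `[0, +oo[ >> (W @^-1` B).
  by rewrite -[W @^-1` B]setTI; exact: mW.
exact: (coord_xy_indep X_BM Y_BM XY_indep hV hW).
Qed.

Lemma past_coord_fun c t : 0 <= t ->
  measurable_fun setT (coord X Y c t : g_sigma_algebraType (past (coord X Y c) `[0, +oo[) -> R).
Proof.
move=> t0 _ B mB; apply: sub_sigma_algebra.
by exists t; rewrite /= ?in_itv /= ?t0 //; exists B.
Qed.

Definition pkernel T (z : 'rV[R[i]]_d) (u : 'rV[R]_d) : R[i] :=
  \prod_(i < d) kernel1 T (z ord0 i) (u ord0 i).
Definition pbridge T s (x u : 'rV[R]_d) : R :=
  \prod_(i < d) bridge1 T s (x ord0 i) (u ord0 i).

Lemma pbridge_ge0 T s x u : 0 <= pbridge T s x u.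
Proof. by apply: prodr_ge0 => i _; exact: bridge1_ge0. Qed.

Local Notation Z t w := (cvec (X t w) (Y t w)).

Lemma kernel_increments s t T (z : 'rV[R[i]]_d) (u : 'rV[R]_d) : 0 <= s <= t -> t - s < T ->
  cintegrable P (fun v => \prod_(i < d) kernel1 T (z ord0 i +
    (X t v ord0 i - X s v ord0 i)%:C + 'i * (Y t v ord0 i - Y s v ord0 i)%:C) (u ord0 i)) /\
  cE (fun v => \prod_(i < d) kernel1 T (z ord0 i +
    (X t v ord0 i - X s v ord0 i)%:C + 'i * (Y t v ord0 i - Y s v ord0 i)%:C) (u ord0 i)) =
  pkernel T z u.
Proof.
move=> st tsT; have [s0 st'] := andP st; have t0 := le_trans s0 st'.
have K i := kernel_pair_expectation (z ord0 i) (u ord0 i)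
  (increment_gaussian (X_BM.1 i) st) (increment_gaussian (Y_BM.1 i) st) tsT
  (XY_coord_indep (measurable_funB (@past_coord_fun (i, true) _ t0) (@past_coord_fun (i, true) _ s0))
    (measurable_funB (@past_coord_fun (i, false) _ t0) (@past_coord_fun (i, false) _ s0))).
have [|c E] := cE_prod_events (z := fun i v => kernel1 T (z ord0 i +
    (X t v ord0 i - X s v ord0 i)%:C + 'i * (Y t v ord0 i - Y s v ord0 i)%:C) (u ord0 i))
    _ (fun i => (K i).1).
  move=> i; apply: cmfun_kernel1_joint => //; apply: cmfunD; first apply: cmfunD.
  - exact: cmfun_cst.
  - apply: cmfun_real.
    exact: (measurable_funB (@coord_events_fun i true _ t0) (@coord_events_fun i true _ s0)).
  - apply: cmfunM; first exact: cmfun_cst.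
    apply: cmfun_real.
    exact: (measurable_funB (@coord_events_fun i false _ t0) (@coord_events_fun i false _ s0)).
split; first exact: c.
by rewrite E; apply: eq_bigr => i _; rewrite (K i).2.
Qed.

Lemma pkernel_integrable t T u : 0 <= t < T -> cintegrable P (fun w => pkernel T (Z t w) u).
Proof.
move=> /andP[t0 tT].
have K i := kernel_pair_expectation 0 (u ord0 i) (X_gaussian i t0) (Y_gaussian i t0) tT
  (XY_coord_indep (@past_coord_fun (i, true) _ t0) (@past_coord_fun (i, false) _ t0)).
have e i w : (Z t w) ord0 i = 0 + (X t w ord0 i)%:C + 'i * (Y t w ord0 i)%:C.
  by rewrite mxE; apply: complexP; rewrite !(ReD, ImD, ReM, ImM) /=; ring.
apply: (cE_prod_events (z := fun i w => kernel1 T (Z t w ord0 i) (u ord0 i)) _ _).1.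
  move=> i; apply: cmfun_kernel1_joint => //.
  under eq_fun do rewrite mxE.
  exact: (cmfun_complex (@coord_events_fun i true _ t0) (@coord_events_fun i false _ t0)).
by move=> i; under eq_fun do rewrite e; exact: (K i).1.
Qed.

Definition gZ (s : R) : set (set Omega) :=
  history (fun t w => realify (Z t w)) `[0, s] `|` P.-negligible.
Definition gX (s : R) : set (set Omega) := history X `[0, s] `|` P.-negligible.

Lemma gZ_coord c r s : 0 <= r <= s ->
  measurable_fun setT (coord X Y c r : g_sigma_algebraType (gZ s) -> R).
Proof.
move=> rs _ B mB; apply: sub_sigma_algebra; left; apply: all_past_history.
by exists c => //; exists r; rewrite /= ?in_itv //; exists B.
Qed.

Lemma gX_coord i r s : 0 <= r <= s ->
  measurable_fun setT ((fun w => X r w ord0 i) : g_sigma_algebraType (gX s) -> R).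
Proof.
move=> rs _ B mB; apply: sub_sigma_algebra; left.
by exists r; rewrite /= ?in_itv //; exists i => //; exists B.
Qed.

Lemma gX_sub_gZ s : <<s gX s >> `<=` <<s gZ s >>.
Proof.
apply: smallest_sub; first exact: smallest_sigma_algebra.
move=> A [[r rs [i _ [B mB <-]]]|NA]; last by apply: sub_sigma_algebra; right.
by apply: (gZ_coord (i, true) (s := s)) => //; move: rs; rewrite /= in_itv.
Qed.

Hypothesis P_complete : measure_is_complete P.

Lemma gZ_measurable s : <<s gZ s >> `<=` measurable.
Proof.
apply: g_sigma_measurable => A [HA|NA]; last exact: P_complete.
have h := g_sigma_measurable (@all_past_measurable _ _ _ P d X Y X_BM Y_BM s).
by apply: h; exact: history_all_past HA.
Qed.

Lemma gX_measurable s : <<s gX s >> `<=` measurable.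
Proof. by move=> A /gX_sub_gZ /gZ_measurable. Qed.

Lemma increments_fun s t c : measurable_fun setT
  ((fun v => coord X Y c t v - coord X Y c s v) : g_sigma_algebraType (all_increments X Y s t) -> R).
Proof.
move=> _ B mB; apply: sub_sigma_algebra; exists c => //; by exists B.
Qed.

(** For fixed u the kernel is a martingale along the complex Brownian motion. *)
Lemma kernel_martingale s t T A u : 0 <= s -> s <= t -> t < T -> <<s gZ s >> A ->
  cE (fun w => (\1_A w)%:C * pkernel T (Z t w) u) =
  cE (fun w => (\1_A w)%:C * pkernel T (Z s w) u).
Proof.
move=> s0 st tT GA; have t0 := le_trans s0 st.
have st' : 0 <= s <= t by rewrite s0.
have ss : 0 <= s <= s by rewrite s0 lexx.
have tsT : t - s < T by apply: le_lt_trans tT; rewrite gerBl.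
have mA := gZ_measurable GA.
pose D1 := g_sigma_algebraType (gZ s); pose D2 := g_sigma_algebraType (all_increments X Y s t).
pose F (x : D1 * D2) := (\1_A x.1 : R)%:C * \prod_(i < d) kernel1 T (Z s x.1 ord0 i +
    (X t x.2 ord0 i - X s x.2 ord0 i)%:C + 'i * (Y t x.2 ord0 i - Y s x.2 ord0 i)%:C) (u ord0 i).
have mI2 : <<s all_increments X Y s t >> `<=` measurable.
  exact: g_sigma_measurable (all_increments_measurable X_BM Y_BM st').
have mU1 : measurable_fun setT (id : Omega -> D1) by exact: measurable_sub_id (@gZ_measurable s).
have mU2 : measurable_fun setT (id : Omega -> D2) by exact: measurable_sub_id.
have ind := filtration_increments_indep X_BM Y_BM XY_indep P_complete st'.
have mF : cmfun F.
  apply: cmfunM.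
    apply: cmfun_real; apply: (measurableT_comp (f := \1_A : D1 -> R)); last exact: measurable_fst.
    exact: measurable_indic.
  apply: cmfun_prod => i; apply: cmfun_kernel1_joint => //; apply: cmfunD; first apply: cmfunD.
  - apply: (cmfun_comp (f := fun w : D1 => Z s w ord0 i) measurable_fst).
    under eq_fun do rewrite mxE.
    exact: (cmfun_complex (gZ_coord (i, true) ss) (gZ_coord (i, false) ss)).
  - apply: cmfun_real.
    apply: (measurableT_comp (f := fun v : D2 => coord X Y (i, true) t v - coord X Y (i, true) s v) _ measurable_snd).
    exact: increments_fun.
  - apply: cmfunM; first exact: cmfun_cst.
    apply: cmfun_real.
    apply: (measurableT_comp (f := fun v : D2 => coord X Y (i, false) t v - coord X Y (i, false) s v) _ measurable_snd).
    exact: increments_fun.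
have diag w : F (w, w) = (\1_A w)%:C * pkernel T (Z t w) u.
  have zi i : Z s w ord0 i + (X t w ord0 i - X s w ord0 i)%:C + 'i * (Y t w ord0 i - Y s w ord0 i)%:C =
      Z t w ord0 i.
    by rewrite !mxE; apply: complexP; rewrite !(ReD, ImD, ReM, ImM) /=; ring.
  rewrite /F; congr (_ * _); apply: eq_bigr => i _.
  exact (f_equal (fun z => kernel1 T z (u ord0 i)) (zi i)).
have cK := pkernel_integrable u (introT andP (conj t0 tT)).
have cF : cintegrable P (fun w => F (id w, id w)).
  by rewrite (funext diag); exact: cintegrable_indic.
have sF x : cintegrable P (fun v => F (x, id v)).
  exact (cintegrableZ (\1_A x : R)%:C (kernel_increments (Z s x) u st' tsT).1).
rewrite -(funext diag) (decouple_diag mU1 mU2 ind mF cF sF).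
apply: eq_cE => w; rewrite /F /=.
by rewrite cEZ ?(kernel_increments (Z s w) u st' tsT).2 //; exact: (kernel_increments (Z s w) u st' tsT).1.
Qed.

Lemma filtration_Y_indep s : indep2 P <<s gX s >> (sigma_of Y `[0, +oo[).
Proof.
apply: indep2_augmented.
- by move=> A HA; apply: (@gX_measurable s); apply: sub_sigma_algebra; left.
- apply: g_sigma_measurable => A [r rs [i _ [B mB <-]]]; apply: Y_measurable => //.
  by move: rs; rewrite /= in_itv /= andbT.
- by move=> A; exact: P_complete.
apply: indep2S (XY_indep2 XY_indep) => //; apply: sub_sigma_algebra2.
move=> A [r rs HA]; exists r => //; move: rs; rewrite /= !in_itv /= andbT.
by move=> /andP[].
Qed.

(** Y is independent of the X-filtration, and in each coordinate the Gaussian average over the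
imaginary part is the bridge kernel. *)
Lemma kernel_bridge s T A u : 0 <= s < T -> <<s gX s >> A ->
  cE (fun w => (\1_A w)%:C * pkernel T (Z s w) u) =
  cE (fun w => (\1_A w * pbridge T s (X s w) u)%:C).
Proof.
move=> sT GA; have [s0 s1] := andP sT.
have ss : 0 <= s <= s by rewrite s0 lexx.
have mA := gX_measurable GA.
pose D1 := g_sigma_algebraType (gX s); pose D2 := g_sigma_algebraType (history Y `[0, +oo[).
pose F (x : D1 * D2) := (\1_A x.1 : R)%:C *
  \prod_(i < d) kernel1 T ((X s x.1 ord0 i)%:C + 'i * (Y s x.2 ord0 i)%:C) (u ord0 i).
have mH : history Y `[0, +oo[ `<=` measurable.
  move=> A' [r rs [i _ [B mB <-]]]; apply: Y_measurable => //.
  by move: rs; rewrite /= in_itv /= andbT.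
have mU1 : measurable_fun setT (id : Omega -> D1) by exact: measurable_sub_id (@gX_measurable s).
have mU2 : measurable_fun setT (id : Omega -> D2) by apply: measurable_sub_id; exact: g_sigma_measurable.
have mY i : measurable_fun setT ((fun w => Y s w ord0 i) : D2 -> R).
  move=> _ B mB; apply: sub_sigma_algebra; exists s; rewrite /= ?in_itv /= ?s0 //.
  by exists i => //; exists B.
have mF : cmfun F.
  apply: cmfunM.
    apply: cmfun_real; apply: (measurableT_comp (f := \1_A : D1 -> R)); last exact: measurable_fst.
    exact: measurable_indic.
  apply: cmfun_prod => i; apply: cmfun_kernel1_joint => //; apply: cmfunD.
    by apply: cmfun_real; exact: (measurableT_comp (gX_coord i ss) measurable_fst).
  apply: cmfunM; first exact: cmfun_cst.
  by apply: cmfun_real; exact: (measurableT_comp (mY i) measurable_snd).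
have diag w : F (w, w) = (\1_A w)%:C * pkernel T (Z s w) u.
  have zi i : (X s w ord0 i)%:C + 'i * (Y s w ord0 i)%:C = Z s w ord0 i.
    by rewrite !mxE; apply: complexP; rewrite !(ReD, ImD, ReM, ImM) /=; ring.
  rewrite /F; congr (_ * _); apply: eq_bigr => i _.
  exact (f_equal (fun z => kernel1 T z (u ord0 i)) (zi i)).
have cK := pkernel_integrable u sT.
have K x : cintegrable P (fun v => \prod_(i < d) kernel1 T ((X s x ord0 i)%:C + 'i * (Y s v ord0 i)%:C) (u ord0 i)) /\
   cE (fun v => \prod_(i < d) kernel1 T ((X s x ord0 i)%:C + 'i * (Y s v ord0 i)%:C) (u ord0 i)) =
   (pbridge T s (X s x) u)%:C.
  have k i := cE_kernel1_imaginary ((X s x ord0 i)%:C) (u ord0 i) (Y_gaussian i s0) sT.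
  have [|c E] := cE_prod_events (z := fun i v => kernel1 T ((X s x ord0 i)%:C + 'i * (Y s v ord0 i)%:C) (u ord0 i))
    _ (fun i => (k i).1).
    move=> i; apply: cmfun_kernel1_joint => //; apply: cmfunD; first exact: cmfun_cst.
    apply: cmfunM; first exact: cmfun_cst.
    by apply: cmfun_real; exact: (@coord_events_fun i false _ s0).
  split; first exact: c.
  by rewrite E /pbridge rmorph_prod; apply: eq_bigr => i _; rewrite (k i).2 cbridge1_real.
have cF : cintegrable P (fun w => F (id w, id w)).
  by rewrite (funext diag); exact: cintegrable_indic.
have sF x : cintegrable P (fun v => F (x, id v)) by exact (cintegrableZ (\1_A x : R)%:C (K x).1).
rewrite -(funext diag) (decouple_diag mU1 mU2 (@filtration_Y_indep s) mF cF sF).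
apply: eq_cE => w; rewrite /F /= rmorphM.
by rewrite cEZ ?(K w).2 //; exact: (K w).1.
Qed.

End brownian_products.

(** * The terminal value seen through the bridge kernel *)

Section integrability_helpers.
Context {R : realType}.

Lemma iterated_finite d1 d2 (T1 : measurableType d1) (T2 : measurableType d2)
    (P1 : probability T1 R) (P2 : probability T2 R) (F : T1 * T2 -> R[i]) (g : T1 -> R) :
  cmfun F -> P1.-integrable setT (EFin \o g) ->
  (forall x, cintegrable P2 (fun y => F (x, y))) ->
  (forall x, (\int[P2]_y normc (F (x, y)))%R <= g x) ->
  (\int[P1]_x \int[P2]_y (normc (F (x, y)))%:E < +oo)%E.
Proof.
move=> mF Ig sF Fg.
have mn : measurable_fun setT (fun x => (normc (F x))%:E).
  by apply/measurable_EFinP; exact: measurable_normc.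
have n0 x : (0 <= (normc (F x))%:E)%E by rewrite lee_fin normc_ge0.
have Fg' x : (\int[P2]_y (normc (F (x, y)))%:E <= (g x)%:E)%E.
  have := Fg x; rewrite -lee_fin /Rintegral fineK //.
  by apply: integrable_fin_num => //; exact: cintegrable_normc.
have g0 x : (0 <= (g x)%:E)%E.
  by apply: le_trans (Fg' x); apply: integral_ge0 => y _; exact: n0.
apply: (@le_lt_trans _ _ (\int[P1]_x (g x)%:E)%E); last exact: integrable_lty Ig.
apply: ge0_le_integral => //.
- by move=> x _; apply: integral_ge0 => y _; exact: n0.
- have hm : measurable_fun setT (fubini_F P2 (fun x => (normc (F x))%:E)).
    by apply: measurable_fun_fubini_tonelli_F.
  exact: hm.
- exact: measurable_int Ig.
Qed.

Context {disp : measure_display} {Omega : measurableType disp}.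
Variable P : probability Omega R.

Lemma bounded_cintegrable (f : Omega -> R[i]) c : cmfun f -> (forall w, normc (f w) <= c) ->
  cintegrable P f.
Proof.
move=> mf fc; apply: (@cintegrable_le _ _ _ P f (fun=> c) mf) => //.
exact: finite_measure_integrable_cst.
Qed.
End integrability_helpers.

Section bridge_representation.
Context {R : realType} {disp : measure_display} {Omega : measurableType disp}.
Variable P : probability Omega R.
Variables (d : nat) (X Y : R -> Omega -> 'rV[R]_d).
Hypotheses (X_BM : brownian_motion P X) (Y_BM : brownian_motion P Y).
Hypothesis XY_indep : independent_processes P X Y.
Hypothesis P_complete : measure_is_complete P.
Variables (p T : R) (xi : Omega -> R[i]).
Hypotheses (p_gt1 : 1 < p) (T_gt0 : 0 < T) (xi_Lp : in_Lp P p xi).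
Local Notation cE := (cexpectation P).
Local Notation Z t w := (cvec (X t w) (Y t w)).
Local Notation q := (p / (p - 1)).
Local Notation gZ := (gZ P X Y).
Local Notation gX := (gX P X).

Let T0 : 0 <= T. Proof. exact: ltW. Qed.
Let UG i : gaussian P (fun w => X T w ord0 i) T. Proof. exact: (X_gaussian X_BM). Qed.
Let Uprod := fun h : 'I_d -> R -> R[i] => @X_product _ _ _ P d X Y X_BM Y_BM XY_indep T h T0.
Let mxi : cmfun xi. Proof. exact: in_Lp_cmfun xi_Lp. Qed.
Let mXT i : measurable_fun setT (fun w => X T w ord0 i). Proof. exact: (X_measurable X_BM). Qed.

Definition f_of := transform P T (X T) xi.
Definition bridge_transform s (x : 'rV[R]_d) : R[i] :=
  cE (fun v => xi v * (pbridge T s x (X T v))%:C).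

Let p0 : 0 < p. Proof. exact: lt_trans p_gt1. Qed.
Let q1 : 1 < q.
Proof. by rewrite ltr_pdivlMr ?subr_gt0 // mul1r gtrBl. Qed.

Lemma growth_integrable t r : 0 <= t -> 0 <= r -> r * (q - 1) * t < T -> r * t < T ->
  P.-integrable setT (EFin \o (fun w => expR (r * growth T p (Z t w)))).
Proof.
move=> t0 r0 h1 h2.
pose a := r * (q - 1) / (2 * T); pose b := r / (2 * T).
have ka : 0 < 1 - 2 * a * t.
  have -> : 1 - 2 * a * t = (T - r * (q - 1) * t) / T.
    by rewrite /a; move: (q - 1) => Q; field; rewrite gt_eqF.
  by rewrite divr_gt0 // subr_gt0.
have kb : 0 < 1 - 2 * b * t.
  have -> : 1 - 2 * b * t = (T - r * t) / T by rewrite /b; field; rewrite gt_eqF.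
  by rewrite divr_gt0 // subr_gt0.
pose g i w := expR (0 * X t w ord0 i + a * X t w ord0 i ^+ 2) * expR (0 * Y t w ord0 i + b * Y t w ord0 i ^+ 2).
have -> : (fun w => expR (r * growth T p (Z t w))) = (fun w => \prod_(i < d) g i w).
  apply/funext => w; rewrite /growth mulr_sumr expR_sum; apply: eq_bigr => i _.
  rewrite /g -expRD mxE /=; congr expR; rewrite /a /b !mul0r !add0r.
  by move: (q - 1) => Q; field; rewrite gt_eqF.
have mq c : measurable_fun setT (fun x : R => expR (0 * x + c * x ^+ 2)).
  by apply: measurableT_comp => //; exact: (measurable_quadratic _ _ (@measurable_id _ _ setT)).
apply: (Rintegral_prod_events X_BM Y_BM XY_indep _ _).1.
  move=> i; apply: measurable_funM.
    exact: (measurableT_comp (mq a) (@coord_events_fun _ _ _ _ X Y i true _ t0)).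
  exact: (measurableT_comp (mq b) (@coord_events_fun _ _ _ _ X Y i false _ t0)).
move=> i.
have ind := XY_coord_indep X_BM Y_BM XY_indep (@past_coord_fun _ _ _ _ X Y (i, true) _ t0)
  (@past_coord_fun _ _ _ _ X Y (i, false) _ t0).
have Ia := gaussian_exp_integrable 0 (X_gaussian X_BM i t0) ka.
have Ib := gaussian_exp_integrable 0 (Y_gaussian Y_BM i t0) kb.
have [[I _] _] := decouple_prod (X_measurable X_BM i t0) (Y_measurable Y_BM i t0) ind
  (cmfun_real (mq a)) (cmfun_real (mq b)) (cintegrable_real Ia) (cintegrable_real Ib).
apply: eq_integrable I => // w _.
by rewrite /= mulr0 subr0.
Qed.

Lemma Z_fun r s i : 0 <= r <= s ->
  cmfun ((fun w => Z r w ord0 i) : g_sigma_algebraType (gZ s) -> R[i]).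
Proof.
move=> rs; under eq_fun do rewrite mxE.
exact: (cmfun_complex (@gZ_coord _ _ _ P _ X Y (i, true) _ _ rs) (@gZ_coord _ _ _ P _ X Y (i, false) _ _ rs)).
Qed.

Lemma cmfun_xi_kernel d' (S : measurableType d') (zeta : S -> 'rV[R[i]]_d) :
  (forall i, cmfun (fun x => zeta x ord0 i)) ->
  cmfun (fun x : S * Omega => xi x.2 * pkernel T (zeta x.1) (X T x.2)).
Proof.
move=> mz; apply: cmfunM; first exact: (cmfun_comp measurable_snd mxi).
apply: cmfun_prod => i; apply: cmfun_kernel1_joint.
  exact: (cmfun_comp measurable_fst (mz i)).
exact: (measurableT_comp (mXT i) measurable_snd).
Qed.

Lemma cmfun_xi_bridge d' (S : measurableType d') (zeta : S -> 'rV[R]_d) s :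
  (forall i, measurable_fun setT (fun x => zeta x ord0 i)) ->
  measurable_fun setT (fun x : S * Omega => pbridge T s (zeta x.1) (X T x.2)).
Proof.
move=> mz; apply: measurable_prod => i _; apply: measurable_bridge1_joint.
  exact: (measurableT_comp (mz i) measurable_fst).
exact: (measurableT_comp (mXT i) measurable_snd).
Qed.

Lemma f_of_fun r s : 0 <= r <= s ->
  cmfun ((fun w => f_of (Z r w)) : g_sigma_algebraType (gZ s) -> R[i]).
Proof.
move=> rs.
exact: (cmfun_cE_param P (cmfun_xi_kernel (S := g_sigma_algebraType (gZ s)) (fun i => Z_fun i rs))).
Qed.

Lemma bridge_transform_fun r s t : 0 <= r <= s ->
  cmfun ((fun w => bridge_transform t (X r w)) : g_sigma_algebraType (gX s) -> R[i]).
Proof.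
move=> rs.
have mb := cmfun_xi_bridge (S := g_sigma_algebraType (gX s)) t (fun i => @gX_coord _ _ _ P _ X i _ _ rs).
have := cmfun_cE_param P (cmfunM (cmfun_comp (@measurable_snd _ _ (g_sigma_algebraType (gX s)) _) mxi) (cmfun_real mb)).
exact.
Qed.

Lemma cmfun_sub G (f : Omega -> R[i]) : <<s G >> `<=` measurable ->
  cmfun (f : g_sigma_algebraType G -> R[i]) -> cmfun f.
Proof. by move=> GM [a b]; split; [exact: measurable_sub_fun a|exact: measurable_sub_fun b]. Qed.

Lemma normc_f_of_le z : normc (f_of z) <= Lp_norm P p xi * expR (growth T p z).
Proof. exact: (normc_transform_le T_gt0 UG Uprod p_gt1 xi_Lp). Qed.

Lemma max_bounds t : 0 <= t -> t * Num.max p q < T ->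
  [/\ t < T, 1 * (q - 1) * t < T, 1 * t < T, p * (q - 1) * t < T & p * t < T].
Proof.
move=> t0 h.
have hp : p * t < T by apply: le_lt_trans h; rewrite mulrC ler_wpM2l // le_max lexx.
have hq : q * t < T by apply: le_lt_trans h; rewrite mulrC ler_wpM2l // le_max lexx orbT.
have pq1 : p * (q - 1) = q by field; rewrite subr_eq0 gt_eqF.
have t1 : t < T by apply: le_lt_trans hp; rewrite ler_peMl // ltW.
split=> //; rewrite ?pq1 ?mul1r //.
by apply: le_lt_trans hq; rewrite ler_wpM2r // gerBl.
Qed.

Lemma f_of_Lp t : 0 <= t -> t * Num.max p q < T -> in_Lp P p (fun w => f_of (Z t w)).
Proof.
move=> t0 h; have [tT _ _ h1 h2] := max_bounds t0 h.
have tt : 0 <= t <= t by rewrite t0 lexx.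
have mf : cmfun (fun w => f_of (Z t w)).
  exact: cmfun_sub (gZ_measurable X_BM Y_BM P_complete (s := t)) (f_of_fun tt).
have I := growth_integrable t0 (ltW p0) h1 h2.
split.
  split=> _ [B mB <-]; [exact: (mf.1 measurableT B mB)|exact: (mf.2 measurableT B mB)].
have mn := measurable_normc mf.
rewrite inE; apply/andP; split; rewrite inE; first exact: mn.
suff : ('N[P]_p%:E[EFin \o (fun w => normc (f_of (Z t w)))] < +oo)%E by [].
rewrite unlock; apply: poweR_lty.
apply: (@le_lt_trans _ _ (\int[P]_w (Lp_norm P p xi `^ p * expR (p * growth T p (Z t w)))%:E)%E); last first.
  exact: integrable_lty (rintegrableZ (Lp_norm P p xi `^ p) I).
rewrite (eq_integral (fun w => ((normc (f_of (Z t w))) `^ p)%:E)); last first.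
  move=> w _; rewrite -[LHS]/((`|normc (f_of (Z t w))|%:E `^ p)%E) poweR_EFin ger0_norm //.
  exact: normc_ge0.
apply: ge0_le_integral => //.
- by move=> w _; rewrite lee_fin powR_ge0.
- by apply/measurable_EFinP; exact: (measurableT_comp (measurable_powR p) mn).
- exact: measurable_int (rintegrableZ (Lp_norm P p xi `^ p) I).
move=> w _; rewrite lee_fin.
have -> : Lp_norm P p xi `^ p * expR (p * growth T p (Z t w)) =
   (Lp_norm P p xi * expR (growth T p (Z t w))) `^ p.
  by rewrite powRM ?Lp_norm_ge0 ?expR_ge0 // -expRM [growth _ _ _ * p]mulrC.
apply: ge0_ler_powR; rewrite ?nnegrE ?normc_ge0 ?mulr_ge0 ?Lp_norm_ge0 ?expR_ge0 ?(ltW p0) //.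
exact: normc_f_of_le.
Qed.

Lemma f_of_integrable t : 0 <= t -> t * Num.max p q < T -> cintegrable P (fun w => f_of (Z t w)).
Proof.
move=> t0 h; have [tT h1 h2 _ _] := max_bounds t0 h.
have tt : 0 <= t <= t by rewrite t0 lexx.
have I := growth_integrable t0 ler01 h1 h2.
apply: (cintegrable_le _ (rintegrableZ (Lp_norm P p xi) I)).
  exact: cmfun_sub (gZ_measurable X_BM Y_BM P_complete (s := t)) (f_of_fun tt).
by move=> w; rewrite mul1r; exact: normc_f_of_le.
Qed.

Lemma f_of_swap t A : 0 <= t -> t * Num.max p q < T -> measurable A ->
  cE (fun w => (\1_A w)%:C * f_of (Z t w)) =
  cE (fun v => xi v * cE (fun w => (\1_A w)%:C * pkernel T (Z t w) (X T v))).
Proof.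
move=> t0 h mA; have [tT h1 h2 _ _] := max_bounds t0 h.
have tt : 0 <= t <= t by rewrite t0 lexx.
have mZ i : cmfun (fun w => Z t w ord0 i).
  exact: cmfun_sub (gZ_measurable X_BM Y_BM P_complete (s := t)) (Z_fun i tt).
pose F (x : Omega * Omega) := (\1_A x.1 : R)%:C * (xi x.2 * pkernel T (Z t x.1) (X T x.2)).
have mF : cmfun F.
  apply: (cmfunM _ (cmfun_xi_kernel (S := Omega) mZ)).
  by apply: cmfun_real; apply: (measurableT_comp (measurable_indic mA)); exact: measurable_fst.
have s1 w : cintegrable P (fun v => F (w, v)).
  exact (cintegrableZ (\1_A w : R)%:C (xi_kernel_integrable T_gt0 UG Uprod p_gt1 xi_Lp (Z t w))).
have cK u : cintegrable P (fun w => (\1_A w)%:C * pkernel T (Z t w) u).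
  by apply: cintegrable_indic => //; apply: (pkernel_integrable X_BM Y_BM XY_indep); rewrite t0.
have Fe v w : F (w, v) = xi v * ((\1_A w)%:C * pkernel T (Z t w) (X T v)) by rewrite /F mulrCA.
have s2 v : cintegrable P (fun w => F (w, v)).
  have := cintegrableZ (xi v) (cK (X T v)).
  by congr (cintegrable P); apply/funext => w; rewrite Fe.
have I := growth_integrable t0 ler01 h1 h2.
have fin : (\int[P]_w \int[P]_v (normc (F (w, v)))%:E < +oo)%E.
  apply: (iterated_finite mF (rintegrableZ (Lp_norm P p xi) I) s1) => w.
  rewrite mul1r; apply: le_trans (kernel_holder T_gt0 UG Uprod p_gt1 xi_Lp (Z t w)).
  apply: le_Rintegral => //.
  - exact: cintegrable_normc (s1 w).
  - have := cintegrable_normc (xi_kernel_integrable T_gt0 UG Uprod p_gt1 xi_Lp (Z t w)).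
    by apply: eq_integrable => // v _; rewrite /= normcM.
  move=> v _; rewrite /F normcM normc_real normcM indicE.
  case: (w \in A) => /=; first by rewrite normr1 mul1r.
  by rewrite normr0 mul0r mulr_ge0 ?normc_ge0.
have [_ _ e] := fubini_swap mF fin s1 s2.
transitivity (cE (fun w => cE (fun v => F (w, v)))).
  apply: eq_cE => w.
  by rewrite -[LHS](cEZ _ (xi_kernel_integrable T_gt0 UG Uprod p_gt1 xi_Lp (Z t w))).
rewrite e; apply: eq_cE => v; rewrite -(cEZ _ (cK (X T v))).
by apply: eq_cE => w; rewrite Fe.
Qed.

Lemma pbridge_weight s c u : 0 <= s < T ->
  P.-integrable setT (EFin \o (fun w => (\prod_(i < d) expR (`|X s w ord0 i| + c)) * pbridge T s (X s w) u)) /\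
  (\int[P]_w ((\prod_(i < d) expR (`|X s w ord0 i| + c)) * pbridge T s (X s w) u))%R <=
  \prod_(i < d) expR (1 * `|u ord0 i| + (c + 1 + T)).
Proof.
move=> sT; have [s0 s1] := andP sT.
have b i := bridge_expabs (u ord0 i) c (X_gaussian X_BM i s0) sT.
have -> : (fun w => (\prod_(i < d) expR (`|X s w ord0 i| + c)) * pbridge T s (X s w) u) =
  (fun w => \prod_(i < d) (expR (`|X s w ord0 i| + c) * bridge1 T s (X s w ord0 i) (u ord0 i))).
  by apply/funext => w; rewrite big_split.
have [|I E] := Rintegral_prod_events X_BM Y_BM XY_indep
  (g := fun i w => expR (`|X s w ord0 i| + c) * bridge1 T s (X s w ord0 i) (u ord0 i)) _ (fun i => (b i).1).
  move=> i; have mX := @coord_events_fun _ _ _ _ X Y i true _ s0.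
  apply: measurable_funM; last exact: measurable_bridge1_joint mX (measurable_cst _).
  apply: measurableT_comp => //; apply: measurable_funD => //.
  by apply: (measurableT_comp _ mX); exact: normr_measurable.
split=> //; rewrite E; apply: ler_prod => i _.
rewrite (b i).2 andbT; apply: Rintegral_ge0 => w _.
by rewrite mulr_ge0 ?expR_ge0 ?bridge1_ge0.
Qed.

Lemma xi_bridge_integrable s x : 0 <= s < T ->
  cintegrable P (fun v => xi v * (pbridge T s x (X T v))%:C).
Proof.
move=> sT; have [s0 s1] := andP sT.
pose K := (Num.sqrt (1 - s / T))^-1.
have K0 : 0 < K.
  by rewrite invr_gt0 sqrtr_gt0 subr_gt0 ltr_pdivrMr // mul1r.
apply: (xi_dominated UG Uprod p_gt1 xi_Lp (a := fun i => `|x ord0 i| / (T - s)) (c := fun=> ln K)).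
  apply: cmfun_real; apply: measurable_prod => i _; exact: measurable_bridge1_joint.
move=> w; rewrite normc_real ger0_norm ?pbridge_ge0 //; apply: ler_prod => i _.
rewrite bridge1_ge0 expRD lnK ?posrE // mulrC.
by apply: bridge1_le => //; rewrite s0 lexx.
Qed.

(** Fubini. The weight h may grow exponentially in X_s: the bridge kernel turns this into
exponential growth in X_T, which xi in L^p absorbs. *)
Lemma bridge_swap s (h : Omega -> R) c : 0 <= s < T -> measurable_fun setT h ->
  (forall w, `|h w| <= \prod_(i < d) expR (`|X s w ord0 i| + c)) ->
  cintegrable P (fun w => (h w)%:C * bridge_transform s (X s w)) /\
  cE (fun w => (h w)%:C * bridge_transform s (X s w)) =
  cE (fun v => xi v * ((\int[P]_w (h w * pbridge T s (X s w) (X T v)))%R)%:C).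
Proof.
move=> sT mh hc; have [s0 s1] := andP sT.
have mX i : measurable_fun setT (fun w => X s w ord0 i) by exact: (X_measurable X_BM).
have mpb : measurable_fun setT (fun x : Omega * Omega => pbridge T s (X s x.2) (X T x.1)).
  apply: measurable_prod => i _; apply: measurable_bridge1_joint.
    exact: (measurableT_comp (mX i) measurable_snd).
  exact: (measurableT_comp (mXT i) measurable_fst).
pose F (x : Omega * Omega) := xi x.1 * (h x.2 * pbridge T s (X s x.2) (X T x.1))%:C.
have mF : cmfun F.
  apply: cmfunM; first exact: (cmfun_comp measurable_fst mxi).
  by apply: cmfun_real; apply: measurable_funM => //; exact: (measurableT_comp mh measurable_snd).
have I v : P.-integrable setT (EFin \o (fun w => h w * pbridge T s (X s w) (X T v))).
  apply: (le_integrable measurableT _ _ (pbridge_weight c (X T v) sT).1).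
    apply/measurable_EFinP; apply: measurable_funM => //.
    by apply: measurable_prod => i _; exact: measurable_bridge1_joint.
  move=> w _; rewrite /= lee_fin normrM (ger0_norm (pbridge_ge0 _ _ _ _)).
  by apply: le_trans (ler_norm _); rewrite ler_wpM2r ?pbridge_ge0.
have s1' v : cintegrable P (fun w => F (v, w)).
  exact (cintegrableZ (xi v) (cintegrable_real (I v))).
have Fe w v : F (v, w) = (h w)%:C * (xi v * (pbridge T s (X s w) (X T v))%:C).
  by rewrite /F rmorphM mulrCA.
have s2 w : cintegrable P (fun v => F (v, w)).
  have := cintegrableZ (h w)%:C (xi_bridge_integrable (X s w) sT).
  by congr (cintegrable P); apply/funext => v; rewrite Fe.
have fin : (\int[P]_v \int[P]_w (normc (F (v, w)))%:E < +oo)%E.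
  have D := xi_dominator_integrable UG Uprod p_gt1 xi_Lp (fun=> 1) (fun=> c + 1 + T).
  apply: (iterated_finite mF D s1') => v.
  have [J Jle] := pbridge_weight c (X T v) sT.
  apply: (@le_trans _ _ (\int[P]_w (normc (xi v) * ((\prod_(i < d) expR (`|X s w ord0 i| + c)) * pbridge T s (X s w) (X T v))))%R).
    apply: le_Rintegral => //.
    - exact: cintegrable_normc (s1' v).
    - exact: rintegrableZ.
    move=> w _; rewrite /F normcM ler_wpM2l ?normc_ge0 // normc_real normrM.
    by rewrite (ger0_norm (pbridge_ge0 _ _ _ _)) ler_wpM2r ?pbridge_ge0.
  by rewrite RintegralZl // ler_wpM2l ?normc_ge0.
have [_ c2 e] := fubini_swap mF fin s1' s2.
have E w : (h w)%:C * bridge_transform s (X s w) = cE (fun v => F (v, w)).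
  rewrite /bridge_transform -(cEZ _ (xi_bridge_integrable (X s w) sT)).
  by apply: eq_cE => v; rewrite Fe.
split; first by rewrite (funext E).
rewrite (eq_cE _ E) -e; apply: eq_cE => v.
rewrite -cE_real; exact (cEZ (xi v) (cintegrable_real (I v))).
Qed.

End bridge_representation.

Section terminal_value.
Context {R : realType} {disp : measure_display} {Omega : measurableType disp}.
Variable P : probability Omega R.
Variables (d : nat) (X Y : R -> Omega -> 'rV[R]_d).
Hypotheses (X_BM : brownian_motion P X) (Y_BM : brownian_motion P Y).
Hypothesis XY_indep : independent_processes P X Y.
Hypothesis P_complete : measure_is_complete P.
Variables (p T : R) (xi : Omega -> R[i]).
Hypotheses (p_gt1 : 1 < p) (T_gt0 : 0 < T) (xi_Lp : in_Lp P p xi).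
Hypothesis xi_X : cmeasurable setT (sigma_of X [set T]) xi.
Local Notation cE := (cexpectation P).
Local Notation Z t w := (cvec (X t w) (Y t w)).
Local Notation q := (p / (p - 1)).
Local Notation gZ := (gZ P X Y).
Local Notation gX := (gX P X).
Local Notation f_of := (f_of P X T xi).
Local Notation bridge_transform := (bridge_transform P X T xi).

Let T0 : 0 <= T. Proof. exact: ltW. Qed.
Let mxi : cmfun xi. Proof. exact: in_Lp_cmfun xi_Lp. Qed.
Let mXT i : measurable_fun setT (fun w => X T w ord0 i). Proof. exact: (X_measurable X_BM). Qed.

Lemma xi_integrable : cintegrable P xi.
Proof.
have h := xi_kernel_integrable T_gt0 (fun i => X_gaussian X_BM i T0)
  (fun h => @X_product _ _ _ P d X Y X_BM Y_BM XY_indep T h T0) p_gt1 xi_Lp 0.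
move: h; congr (cintegrable P); apply/funext => w.
rewrite /kernel big1 ?mulr1 // => i _.
by rewrite kernel1E mxE expr2 !mul0r subrr cexp0.
Qed.

Lemma indic_le1 (A : set Omega) w : `|\1_A w| <= 1 :> R.
Proof. by rewrite indicE; case: (w \in A); rewrite ?normr1 ?normr0. Qed.

Lemma indic_weight s (A : set Omega) w :
  `|\1_A w| <= \prod_(i < d) expR (`|X s w ord0 i| + 0).
Proof.
apply: le_trans (indic_le1 A w) _; rewrite -expR_sum -[leLHS]expR0 ler_expR.
by apply: sumr_ge0 => i _; rewrite addr0.
Qed.

(** Reweighting by the bridge kernel moves X_T to the law of x plus the increment. *)
Lemma box_transition s (x : 'rV[R]_d) (B : 'I_d -> set R) : 0 <= s < T ->
  (forall i, measurable (B i)) ->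
  P.-integrable setT (EFin \o (fun v => \prod_(i < d) (\1_(B i) (X T v ord0 i) * bridge1 T s (x ord0 i) (X T v ord0 i)))) /\
  (\int[P]_v (\prod_(i < d) (\1_(B i) (X T v ord0 i) * bridge1 T s (x ord0 i) (X T v ord0 i))))%R =
  (\int[P]_v (\prod_(i < d) \1_(B i) (x ord0 i + (X T v ord0 i - X s v ord0 i))))%R.
Proof.
move=> sT mB; have [s0 s1] := andP sT.
have sT' : 0 <= s <= T by rewrite s0 ltW.
have bt i := bridge_transition (x ord0 i) (X_gaussian X_BM i T0) (increment_gaussian (X_BM.1 i) sT') sT (mB i).
pose gb i v : R := \1_(B i) (X T v ord0 i) * bridge1 T s (x ord0 i) (X T v ord0 i).
pose gi i v : R := \1_(B i) (x ord0 i + (X T v ord0 i - X s v ord0 i)).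
have mgb i : measurable_fun setT (gb i : g_sigma_algebraType (coord_events X Y i) -> R).
  have mX := @coord_events_fun _ _ _ _ X Y i true _ T0.
  apply: measurable_funM; last exact: measurable_bridge1_joint (measurable_cst _) mX.
  exact: (measurableT_comp (measurable_indic (mB i)) mX).
have mgi i : measurable_fun setT (gi i : g_sigma_algebraType (coord_events X Y i) -> R).
  have mX := @coord_events_fun _ _ _ _ X Y i true _ T0.
  have mX' := @coord_events_fun _ _ _ _ X Y i true _ s0.
  apply: (measurableT_comp (measurable_indic (mB i))); apply: measurable_funD => //.
  exact: (measurable_funB mX mX').
have sub i : <<s coord_events X Y i >> `<=` measurable.
  exact: g_sigma_measurable (@coord_events_measurable _ _ _ P d X Y X_BM Y_BM i).
have gi01 i v : 0 <= gi i v <= 1.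
  by rewrite /gi indicE; case: (_ \in _); rewrite /= ?ler01 ?lexx.
have Igi i : P.-integrable setT (EFin \o gi i).
  have h : cintegrable P (fun v => (gi i v)%:C).
    apply: (@bounded_cintegrable _ _ _ P _ 1).
      by apply: cmfun_real; exact: (measurable_sub_fun (sub i) (mgi i)).
    by move=> v; rewrite normc_real; have /andP[a b] := gi01 i v; rewrite ger0_norm.
  exact: h.1.
have gb0 i v : 0 <= gb i v by rewrite mulr_ge0 ?bridge1_ge0 // indicE ler0n.
have giE i : (\int[P]_v (gi i v)%:E)%E = P [set w | B i (x ord0 i + (X T w ord0 i - X s w ord0 i))].
  have mS : measurable [set w | B i (x ord0 i + (X T w ord0 i - X s w ord0 i))].
    have mW : measurable_fun setT (fun w => x ord0 i + (X T w ord0 i - X s w ord0 i)).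
      apply: measurable_funD => //; apply: measurable_funB; exact: (X_measurable X_BM).
    by have := mW measurableT _ (mB i); rewrite setTI.
  rewrite -[X in _ = _ X]setIT -(integral_indic P measurableT mS).
  by apply: eq_integral => v _; rewrite /gi !indicE; congr ((_ : nat)%:R%:E); apply: asbool_equiv_eq.
have Igb i : P.-integrable setT (EFin \o gb i).
  apply/integrableP; split.
    by apply/measurable_EFinP; exact: (measurable_sub_fun (sub i) (mgb i)).
  have -> : (\int[P]_v `|(EFin \o gb i) v| = \int[P]_v (gb i v)%:E)%E.
    by apply: eq_integral => v _; rewrite /= ger0_norm.
  by rewrite /gb bt -giE; exact: integrable_lty (Igi i).
have [J1 E1] := Rintegral_prod_events X_BM Y_BM XY_indep mgb Igb.
have [_ E2] := Rintegral_prod_events X_BM Y_BM XY_indep mgi Igi.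
split; first exact: J1.
rewrite E1 E2; apply: eq_bigr => i _; rewrite /Rintegral giE.
by rewrite /gb bt.
Qed.

Definition boxes : set (set Omega) :=
  [set C | exists2 B : 'I_d -> set R, (forall i, measurable (B i)) &
     C = [set w | forall i, B i (X T w ord0 i)]].

Lemma boxes_measurable : boxes `<=` measurable.
Proof.
move=> _ [B mB ->].
have -> : [set w | forall i, B i (X T w ord0 i)] = \bigcap_(i in [set: 'I_d]) ((fun w => X T w ord0 i) @^-1` B i).
  by apply/seteqP; split=> w h; [move=> i _; exact: h|move=> i; exact: (h i I)].
apply: fin_bigcap_measurable; first exact: finite_finset.
by move=> i _; rewrite -[X in measurable X]setTI; exact: mXT.
Qed.

Lemma boxes_setI : setI_closed boxes.
Proof.
move=> _ _ [B mB ->] [C mC ->]; exists (fun i => B i `&` C i).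
  by move=> i; exact: measurableI.
apply/seteqP; split => w.
  by move=> [h1 h2] i; split; [exact: h1|exact: h2].
by move=> h; split=> i; have [] := h i.
Qed.

Lemma boxes_setT : boxes setT.
Proof. by exists (fun=> setT) => //; apply/seteqP; split => w. Qed.

Lemma sigma_boxes : sigma_of X [set T] `<=` <<s boxes >>.
Proof.
apply: smallest_sub; first exact: smallest_sigma_algebra.
move=> _ [_ -> [i _ [B mB <-]]]; apply: sub_sigma_algebra.
exists (fun j => if j == i then B else setT).
  by move=> j; case: ifP.
apply/seteqP; split => w /=.
  by move=> [_ h] j; case: eqP => [->|].
by move=> /(_ i); rewrite eqxx.
Qed.

Lemma indic_box (B : 'I_d -> set R) w :
  \1_[set w | forall i, B i (X T w ord0 i)] w = \prod_(i < d) \1_(B i) (X T w ord0 i) :> R.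
Proof.
rewrite indicE; case: (boolP (w \in _)) => [|hw].
  rewrite inE => hw; rewrite big1 // => i _; rewrite indicE mem_set //; exact: hw.
have [i hi] : exists i, ~ B i (X T w ord0 i).
  by apply/existsNP; move: hw; rewrite notin_setE.
by rewrite (bigD1 i) //= indicE memNset // mul0r.
Qed.

(** Split X_T into X_s and the increment, which is independent of A; [box_transition] then
replaces the increment by a reweighted copy of X_T. *)
Lemma terminal_box s A B : 0 <= s < T -> <<s gZ s >> A -> (forall i, measurable (B i)) ->
  let C := [set w | forall i, B i (X T w ord0 i)] in
  (\int[P]_v (\1_C v * \1_A v))%R =
  (\int[P]_v (\1_C v * (\int[P]_w (\1_A w * pbridge T s (X s w) (X T v)))))%R.
Proof.
move=> sT GA mB C; have [s0 s1] := andP sT.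
have sT' : 0 <= s <= T by rewrite s0 ltW.
have ss : 0 <= s <= s by rewrite s0 lexx.
have mA := gZ_measurable X_BM Y_BM P_complete GA.
have mC : measurable C by apply: boxes_measurable; exists B.
have i01 (D : set Omega) w : 0 <= (\1_D w : R) <= 1.
  by rewrite indicE; case: (w \in D); rewrite /= ?ler01 ?lexx.
have j01 (D : set R) w : 0 <= (\1_D w : R) <= 1.
  by rewrite indicE; case: (w \in D); rewrite /= ?ler01 ?lexx.
pose D1 := g_sigma_algebraType (gZ s); pose D2 := g_sigma_algebraType (all_increments X Y s T).
pose phi (x : D1 * D2) : R := \prod_(i < d) \1_(B i) (X s x.1 ord0 i + (X T x.2 ord0 i - X s x.2 ord0 i)).
pose F (x : D1 * D2) : R[i] := (\1_A x.1 : R)%:C * (phi x)%:C.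
have mI2 : <<s all_increments X Y s T >> `<=` measurable.
  exact: g_sigma_measurable (all_increments_measurable X_BM Y_BM sT').
have mU1 : measurable_fun setT (id : Omega -> D1).
  exact: measurable_sub_id (gZ_measurable X_BM Y_BM P_complete (s := s)).
have mU2 : measurable_fun setT (id : Omega -> D2) by exact: measurable_sub_id.
have ind := filtration_increments_indep X_BM Y_BM XY_indep P_complete sT'.
have mphi : measurable_fun setT phi.
  apply: measurable_prod => i _; apply: (measurableT_comp (measurable_indic (mB i))).
  apply: measurable_funD.
    exact: (measurableT_comp (@gZ_coord _ _ _ P _ X Y (i, true) _ _ ss) measurable_fst).
  apply: (measurableT_comp (f := fun v : D2 => coord X Y (i, true) T v - coord X Y (i, true) s v) _ measurable_snd).
  exact: increments_fun.
have phi01 x : 0 <= phi x <= 1.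
  rewrite /phi; apply/andP; split.
    by apply: prodr_ge0 => i _; have /andP[] := j01 (B i) (X s x.1 ord0 i + (X T x.2 ord0 i - X s x.2 ord0 i)).
  apply: (@le_trans _ _ (\prod_(i < d) (1 : R))); last by rewrite big1.
  by apply: ler_prod => i _; exact: j01.
have mF : cmfun F.
  apply: cmfunM; last exact: cmfun_real.
  apply: cmfun_real; apply: (measurableT_comp (f := \1_A : D1 -> R)); last exact: measurable_fst.
  exact: measurable_indic.
have nF x : normc (F x) <= 1.
  rewrite normcM !normc_real; have /andP[a b] := phi01 x; rewrite (ger0_norm a).
  by rewrite mulr_ile1 // indic_le1.
have cF : cintegrable P (fun w => F (id w, id w)).
  apply: (@bounded_cintegrable _ _ _ P _ 1) => //.
  exact: (cmfun_comp (measurable_fun_pair mU1 mU2) mF).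
have sphi x : cintegrable P (fun v => (phi (x, v))%:C).
  apply: (@bounded_cintegrable _ _ _ P _ 1).
    by apply: cmfun_real; apply: (measurableT_comp mphi); exact: (measurable_fun_pair (measurable_cst _) mU2).
  by move=> v; rewrite normc_real; have /andP[a b] := phi01 (x, v); rewrite ger0_norm.
have sF x : cintegrable P (fun v => F (x, id v)) by exact (cintegrableZ (\1_A x : R)%:C (sphi x)).
have Cpb x v : \1_C v * pbridge T s x (X T v) =
    \prod_(i < d) (\1_(B i) (X T v ord0 i) * bridge1 T s (x ord0 i) (X T v ord0 i)).
  by rewrite indic_box -big_split.
have Iphi x : P.-integrable setT (EFin \o (fun v => \1_C v * pbridge T s (X s x) (X T v))) /\
   (\int[P]_v (\1_C v * pbridge T s (X s x) (X T v)))%R = (\int[P]_v phi (x, v))%R.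
  by rewrite (funext (Cpb (X s x))); exact: box_transition.
have L : (\int[P]_v (\1_C v * \1_A v))%R =
    (\int[P]_w (\1_A w * \int[P]_v (\1_C v * pbridge T s (X s w) (X T v))))%R.
  apply: (@complexI R); rewrite -!cE_real.
  transitivity (cE (fun w => F (id w, id w))).
    apply: eq_cE => w.
    have e : \1_C w * \1_A w = \1_A w * phi (w, w) :> R.
      rewrite mulrC; congr (_ * _); rewrite /C indic_box /phi; apply: eq_bigr => i _.
      by rewrite addrC subrK.
    by rewrite e rmorphM.
  rewrite (decouple_diag mU1 mU2 ind mF cF sF); apply: eq_cE => w.
  rewrite (Iphi w).2 [RHS]rmorphM.
  transitivity ((\1_A w : R)%:C * cE (fun v => (phi (w, v))%:C)); last by rewrite cE_real.
  exact (cEZ (\1_A w : R)%:C (sphi w)).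
pose G (x : Omega * Omega) : R[i] := (\1_A x.1 : R)%:C * (\1_C x.2 * pbridge T s (X s x.1) (X T x.2))%:C.
have mpb : measurable_fun setT (fun x : Omega * Omega => pbridge T s (X s x.1) (X T x.2)).
  apply: measurable_prod => i _; apply: measurable_bridge1_joint.
    exact: (measurableT_comp (X_measurable X_BM i s0) measurable_fst).
  exact: (measurableT_comp (mXT i) measurable_snd).
have mG : cmfun G.
  apply: cmfunM; apply: cmfun_real; first exact: (measurableT_comp (measurable_indic mA) measurable_fst).
  by apply: measurable_funM => //; exact: (measurableT_comp (measurable_indic mC) measurable_snd).
have s1' w : cintegrable P (fun v => G (w, v)).
  exact (cintegrableZ (\1_A w : R)%:C (cintegrable_real (Iphi w).1)).
have Ipb u : P.-integrable setT (EFin \o (fun w => \1_A w * pbridge T s (X s w) u)).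
  have := (pbridge_weight X_BM Y_BM XY_indep 0 u sT).1.
  apply: le_integrable => //.
    apply/measurable_EFinP; apply: measurable_funM; first exact: measurable_indic.
    by apply: measurable_prod => i _; apply: measurable_bridge1_joint => //; exact: (X_measurable X_BM).
  move=> w _; rewrite /= lee_fin normrM (ger0_norm (pbridge_ge0 _ _ _ _)).
  by apply: le_trans (ler_norm _); rewrite ler_wpM2r ?pbridge_ge0 // indic_weight.
have Ge w v : G (w, v) = (\1_C v : R)%:C * (\1_A w * pbridge T s (X s w) (X T v))%:C.
  by rewrite /G -!rmorphM mulrCA.
have s2 v : cintegrable P (fun w => G (w, v)).
  have := cintegrableZ (\1_C v : R)%:C (cintegrable_real (Ipb (X T v))).
  by congr (cintegrable P); apply/funext => w; rewrite Ge.
have fin : (\int[P]_w \int[P]_v (normc (G (w, v)))%:E < +oo)%E.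
  apply: (@iterated_finite _ _ _ _ _ P P G (fun=> 1) mG _ s1').
    exact: finite_measure_integrable_cst.
  move=> w; apply: (@le_trans _ _ (\int[P]_v (\1_C v * pbridge T s (X s w) (X T v)))%R).
    apply: le_Rintegral => //.
    - exact: cintegrable_normc (s1' w).
    - exact: (Iphi w).1.
    move=> v _; rewrite /G normcM !normc_real (ger0_norm (_ : 0 <= \1_C v * _)).
      by rewrite ler_piMl ?indic_le1 // mulr_ge0 ?pbridge_ge0 //; have /andP[] := i01 C v.
    by rewrite mulr_ge0 ?pbridge_ge0 //; have /andP[] := i01 C v.
  rewrite (Iphi w).2.
  have h : (\int[P]_v phi (w, v) <= \int[P]_v 1)%R.
    apply: le_Rintegral => //.
    - exact: (sphi w).1.
    - exact: finite_measure_integrable_cst.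
    - by move=> v _; have /andP[] := phi01 (w, v).
  apply: le_trans h _.
  by rewrite Rintegral_cst // [X in fine X](probability_setT P) mul1r.
have [_ _ e] := fubini_swap mG fin s1' s2.
rewrite L; apply: (@complexI R); rewrite -[LHS]cE_real -[RHS]cE_real.
transitivity (cE (fun w => cE (fun v => G (w, v)))).
  apply: eq_cE => w.
  transitivity ((\1_A w : R)%:C * cE (fun v => (\1_C v * pbridge T s (X s w) (X T v))%:C)).
    by rewrite cE_real; exact: rmorphM.
  exact (esym (cEZ (\1_A w : R)%:C (cintegrable_real (Iphi w).1))).
rewrite e; apply: eq_cE => v.
transitivity ((\1_C v : R)%:C * cE (fun w => (\1_A w * pbridge T s (X s w) (X T v))%:C)); last first.
  by rewrite cE_real; exact: (esym (rmorphM _ _ _)).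
rewrite -(cEZ (\1_C v : R)%:C (cintegrable_real (Ipb (X T v)))).
by apply: eq_cE => w; exact: Ge.
Qed.

Lemma bridge_average_integrable s A u : 0 <= s < T -> <<s gZ s >> A ->
  0 <= (\int[P]_w (\1_A w * pbridge T s (X s w) u))%R <= 1.
Proof.
move=> sT GA; have [s0 s1] := andP sT; have mA := gZ_measurable X_BM Y_BM P_complete GA.
have b i := bridge_expectation (u ord0 i) (X_gaussian X_BM i s0) sT.
have [|I E] := Rintegral_prod_events X_BM Y_BM XY_indep
  (g := fun i w => bridge1 T s (X s w ord0 i) (u ord0 i)) _ (fun i => (b i).1).
  by move=> i; exact: measurable_bridge1_joint (@coord_events_fun _ _ _ _ X Y i true _ s0) (measurable_cst _).
have E1 : (\int[P]_w pbridge T s (X s w) u)%R = 1.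
  by rewrite E big1 // => i _; rewrite (b i).2.
apply/andP; split.
  by apply: Rintegral_ge0 => w _; rewrite mulr_ge0 ?pbridge_ge0 // indicE ler0n.
rewrite -E1; apply: le_Rintegral => //.
- exact: integrable_indicM.
- by move=> w _; rewrite ler_piMl ?pbridge_ge0 // (le_trans (ler_norm _)) // indic_le1.
Qed.

(** On boxes in X_T both sides agree by [terminal_box]; the Dynkin argument extends this to all
events of X_T, and pulling out the function xi of X_T concludes. *)
Lemma terminal_bridge s A : 0 <= s < T -> <<s gZ s >> A ->
  cE (fun w => (\1_A w)%:C * xi w) = cE (fun w => (\1_A w)%:C * bridge_transform s (X s w)).
Proof.
move=> sT GA; have [s0 s1] := andP sT; have mA := gZ_measurable X_BM Y_BM P_complete GA.
have [_ ->] := bridge_swap X_BM Y_BM XY_indep p_gt1 T_gt0 xi_Lp sT (measurable_indic mA) (indic_weight s A).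
pose gA v := (\int[P]_w (\1_A w * pbridge T s (X s w) (X T v)))%R.
have gA01 v : 0 <= gA v <= 1 by exact: bridge_average_integrable.
have mgA : measurable_fun setT gA.
  apply: (measurable_Rintegral_param P (F := fun x : Omega * Omega => \1_A x.2 * pbridge T s (X s x.2) (X T x.1))).
  apply: measurable_funM; first exact: (measurableT_comp (measurable_indic mA) measurable_snd).
  apply: measurable_prod => i _; apply: measurable_bridge1_joint.
    exact: (measurableT_comp (X_measurable X_BM i s0) measurable_snd).
  exact: (measurableT_comp (mXT i) measurable_fst).
have Ib (h : Omega -> R) : measurable_fun setT h -> (forall w, `|h w| <= 1) -> P.-integrable setT (EFin \o h).
  move=> mh h1; have c : cintegrable P (fun w => (h w)%:C).
    by apply: (@bounded_cintegrable _ _ _ P _ 1); [exact: cmfun_real|move=> w; rewrite normc_real].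
  exact: c.1.
have IA : P.-integrable setT (EFin \o (\1_A : Omega -> R)).
  by apply: Ib; [exact: measurable_indic|move=> w; exact: indic_le1].
have Ig : P.-integrable setT (EFin \o gA).
  by apply: Ib => // v; have /andP[a b] := gA01 v; rewrite ger0_norm.
pose dl v := \1_A v - gA v.
have Idl : P.-integrable setT (EFin \o dl) by exact: rintegrableB.
have Hdl C : <<s boxes >> C -> (\int[P]_w (\1_C w * dl w))%R = 0.
  apply: (orthogonal_pi_system boxes_measurable boxes_setI boxes_setT Idl) => _ [B mB ->].
  have mC : measurable [set w | forall i, B i (X T w ord0 i)] by apply: boxes_measurable; exists B.
  under eq_Rintegral do rewrite mulrBr.
  rewrite RintegralB //; [|exact: integrable_indicM mC IA|exact: integrable_indicM mC Ig].
  by rewrite (terminal_box sT GA mB) subrr.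
have bM : <<s boxes >> `<=` measurable by exact: g_sigma_measurable boxes_measurable.
have mxi' : cmfun (xi : g_sigma_algebraType boxes -> R[i]).
  apply/cmeasurableP; have [a b] := xi_X; split; [move=> S /a|move=> S /b]; exact: sigma_boxes.
have dl2 v : `|dl v| <= 2.
  rewrite /dl; have /andP[a b] := gA01 v; have := indic_le1 A v; have := ler_normB (\1_A v) (gA v).
  rewrite (ger0_norm a); lra.
have O : cE (fun v => xi v * (dl v)%:C) = 0.
  apply: (cE_orthogonal bM (cintegrable_real Idl) _ mxi').
    move=> C GC.
    have -> : (fun w => (\1_C w : R)%:C * (dl w)%:C) = (fun w => (\1_C w * dl w)%:C).
      by apply/funext => w; rewrite rmorphM.
    by rewrite cE_real Hdl.
  apply: (le_integrable measurableT _ _ (rintegrableZ 2 (cintegrable_normc xi_integrable))).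
    apply/measurable_EFinP; apply: measurable_funM; first exact: measurable_normc.
    by apply: measurable_normc; apply: cmfun_real; apply/measurable_EFinP; exact: measurable_int Idl.
  move=> w _.
  have n2 : normc (dl w)%:C <= 2 by rewrite normc_real.
  suff : normc (xi w) * normc (dl w)%:C <= 2 * normc (xi w).
    move=> h; rewrite -lee_fin in h; apply: (le_trans _ (le_trans h (lee_abs _))).
    by rewrite gee0_abs ?lee_fin // mulr_ge0 ?normc_ge0.
  by rewrite mulrC ler_wpM2r ?normc_ge0.
have c1 : cintegrable P (fun v => xi v * (\1_A v)%:C).
  have := cintegrable_indic mA xi_integrable.
  by congr (cintegrable P); apply/funext => w; rewrite mulrC.
have c2 : cintegrable P (fun v => xi v * (gA v)%:C).
  apply: (cintegrable_le _ (cintegrable_normc xi_integrable)).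
    by apply: cmfunM => //; exact: cmfun_real.
  move=> w; rewrite normcM normc_real; have /andP[a b] := gA01 w.
  by rewrite ger0_norm // ler_piMr ?normc_ge0.
apply/eqP; rewrite -subr_eq0 -[X in _ == X]O; apply/eqP.
transitivity (cE (fun v => xi v * (\1_A v)%:C) - cE (fun v => xi v * (gA v)%:C)).
  by congr (_ - _); apply: eq_cE => w; rewrite mulrC.
rewrite -(cEB c1 c2); apply: eq_cE => v.
by rewrite /dl rmorphB mulrBr.
Qed.

End terminal_value.

(** * The Markovian martingale and its Hermite coefficients *)

Section markov_martingale.
Context {R : realType} {disp : measure_display} {Omega : measurableType disp}.
Variable P : probability Omega R.
Variables (d : nat) (X Y : R -> Omega -> 'rV[R]_d).
Hypotheses (X_BM : brownian_motion P X) (Y_BM : brownian_motion P Y).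
Hypothesis XY_indep : independent_processes P X Y.
Hypothesis P_complete : measure_is_complete P.
Variables (p T : R) (M : R -> Omega -> R[i]).
Hypotheses (p_gt1 : 1 < p) (T_gt0 : 0 < T).
Local Notation cE := (cexpectation P).
Local Notation Z t w := (cvec (X t w) (Y t w)).
Local Notation q := (p / (p - 1)).
Local Notation gZ := (gZ P X Y).
Local Notation gX := (gX P X).
Hypothesis M_martingale :
  Lp_martingale P (augmented_filtration P (fun t w => realify (Z t w))) p T M.
Hypothesis M_X : forall t, 0 <= t <= T -> cmeasurable setT (sigma_of X [set t]) (M t).
Local Notation f := (f_of P X T (M T)).
Local Notation bridge := (bridge_transform P X T (M T)).
Local Notation hc := hermite_coeff.

Let T0 : 0 <= T. Proof. exact: ltW. Qed.
Let MT_Lp : in_Lp P p (M T).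
Proof. by have [_ h _] := M_martingale; apply: h; rewrite T0 lexx. Qed.
Let MT_X : cmeasurable setT (sigma_of X [set T]) (M T).
Proof. by apply: M_X; rewrite T0 lexx. Qed.

Lemma martingale_cE s t A : 0 <= s -> s <= t -> t <= T -> <<s gZ s >> A ->
  cE (fun w => (\1_A w)%:C * M s w) = cE (fun w => (\1_A w)%:C * M t w).
Proof.
move=> s0 st tT; have [_ _ h] := M_martingale.
have /(is_cond_expectationP P _ _ (gZ_measurable X_BM Y_BM P_complete (s := s))) [_ _ _ H] := h s t s0 st tT.
exact: H.
Qed.

Lemma M_integrable t : 0 <= t <= T -> cintegrable P (M t).
Proof.
by move=> /andP[t0 tT]; have [_ _ h] := M_martingale; have [_ c _ _] := h t t t0 (lexx _) tT.
Qed.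

Lemma bridge_integrable s : 0 <= s < T -> cintegrable P (fun w => bridge s (X s w)).
Proof.
move=> sT.
have [h _] := bridge_swap X_BM Y_BM XY_indep p_gt1 T_gt0 MT_Lp sT (measurable_indic (@measurableT _ Omega))
  (indic_weight X s setT).
move: h; congr (cintegrable P); apply/funext => w.
by rewrite indicE in_setT mul1r.
Qed.

Lemma M_bridge s : 0 <= s < T -> {ae P, forall w, M s w = bridge s (X s w)}.
Proof.
move=> sT; have [s0 s1] := andP sT; have s1' := ltW s1.
have sT' : 0 <= s <= T by rewrite s0.
have ss : 0 <= s <= s by rewrite s0 lexx.
have [mM _ _] := M_martingale.
apply: (cond_expectation_unique (gZ_measurable X_BM Y_BM P_complete (s := s)) (mM s sT')).
- apply/cmeasurableP.
  have [a b] := bridge_transform_fun X_BM T_gt0 MT_Lp s ss.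
  by split; [exact: sub_measurable_mono (@gX_sub_gZ _ _ _ P _ X Y s) a|exact: sub_measurable_mono (@gX_sub_gZ _ _ _ P _ X Y s) b].
- exact: M_integrable.
- exact: bridge_integrable.
move=> A GA; rewrite (martingale_cE s0 s1' (lexx _) GA).
exact: (terminal_bridge X_BM Y_BM XY_indep P_complete p_gt1 T_gt0 MT_Lp MT_X).
Qed.

Lemma bridge_X_projection s A : 0 <= s -> s * Num.max p q < T -> <<s gX s >> A ->
  cE (fun w => (\1_A w)%:C * f (Z s w)) = cE (fun w => (\1_A w)%:C * bridge s (X s w)).
Proof.
move=> s0 sm GA; have [sT _ _ _ _] := max_bounds p_gt1 s0 sm.
have sT' : 0 <= s < T by rewrite s0.
have mA := gX_measurable X_BM Y_BM P_complete GA.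
rewrite (f_of_swap X_BM Y_BM XY_indep P_complete p_gt1 T_gt0 MT_Lp s0 sm mA).
have [_ ->] := bridge_swap X_BM Y_BM XY_indep p_gt1 T_gt0 MT_Lp sT' (measurable_indic mA) (indic_weight X s A).
apply: eq_cE => v.
by rewrite (kernel_bridge X_BM Y_BM XY_indep P_complete (X T v) sT' GA) cE_real.
Qed.

Lemma f_martingale s t A : 0 <= s -> s <= t -> t * Num.max p q < T -> <<s gZ s >> A ->
  cE (fun w => (\1_A w)%:C * f (Z s w)) = cE (fun w => (\1_A w)%:C * f (Z t w)).
Proof.
move=> s0 st tm GA; have t0 := le_trans s0 st.
have [tT _ _ _ _] := max_bounds p_gt1 t0 tm.
have mA := gZ_measurable X_BM Y_BM P_complete GA.
have mx0 : 0 <= Num.max p q by rewrite le_max ltW // (lt_trans _ p_gt1).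
have sm : s * Num.max p q < T by apply: le_lt_trans tm; rewrite ler_wpM2r.
rewrite !(f_of_swap X_BM Y_BM XY_indep P_complete p_gt1 T_gt0 MT_Lp) //.
apply: eq_cE => v.
by rewrite (kernel_martingale X_BM Y_BM XY_indep P_complete (X T v) s0 st tT GA).
Qed.

Lemma hermite_coeff_weight s x n : 0 <= s <= T -> `|hc s x n| <= expR (`|x| + T).
Proof.
move=> /andP[s0 sT]; have := hermite_partial_sum_le s x n.+1 (@ler01 R).
rewrite big_ord_recr /= expr1n mul1r => h.
apply: (@le_trans _ _ (expR (1 * `|x| + 1 ^+ 2 * (`|s| / 2)))).
  apply: le_trans h; rewrite lerDr; apply: sumr_ge0 => k _; rewrite expr1n mul1r //.
rewrite ler_expR mul1r expr1n mul1r lerD // ger0_norm //; lra.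
Qed.

Lemma mhermite_coeff_weight s (a : multi_index d) w : 0 <= s <= T ->
  `|mhermite_coeff s (X s) a w| <= \prod_(i < d) expR (`|X s w ord0 i| + T).
Proof.
move=> sT; rewrite normr_prod; apply: ler_prod => i _.
by rewrite normr_ge0 hermite_coeff_weight.
Qed.

Lemma measurable_mhermite_coeff s (a : multi_index d) : 0 <= s ->
  measurable_fun setT (fun w => mhermite_coeff s (X s) a w).
Proof.
move=> s0; apply: measurable_prod => i _; apply: measurable_hermite.
exact: (X_measurable X_BM).
Qed.

(** The bridge kernel maps Hermite polynomials to Hermite polynomials. *)
Lemma pbridge_hermite s (a : multi_index d) u : 0 <= s < T ->
  (\int[P]_w (mhermite_coeff s (X s) a w * pbridge T s (X s w) u))%R =
  (s / T) ^+ mabs a * \prod_(i < d) hc T (u ord0 i) (a i).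
Proof.
move=> sT; have [s0 s1] := andP sT.
have b i := bridge_hermite (u ord0 i) (a i) (X_gaussian X_BM i s0) sT.
have [|I E] := Rintegral_prod_events X_BM Y_BM XY_indep
  (g := fun i w => hc s (X s w ord0 i) (a i) * bridge1 T s (X s w ord0 i) (u ord0 i)) _ (fun i => (b i).1).
  move=> i; have mX := @coord_events_fun _ _ _ _ X Y i true _ s0.
  apply: measurable_funM; last exact: measurable_bridge1_joint mX (measurable_cst _).
  exact: measurable_hermite.
transitivity (\int[P]_w (\prod_(i < d) (hc s (X s w ord0 i) (a i) * bridge1 T s (X s w ord0 i) (u ord0 i))))%R.
  by apply: eq_Rintegral => w _; rewrite big_split.
rewrite E /mabs -prodrXr -big_split /=; apply: eq_bigr => i _.
exact: (b i).2.
Qed.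

(** Replace M_s by the bridge transform and apply [pbridge_hermite] under the integral. *)
Lemma M_hermite s (a : multi_index d) : 0 < s <= T ->
  cE (fun w => M s w * (mhermite_coeff s (X s) a w)%:C) =
  ((s / T) ^+ mabs a)%:C * cE (fun w => M T w * (mhermite_coeff T (X T) a w)%:C).
Proof.
move=> /andP[s0 sT]; have [->|sT1] := eqVneq s T.
  by rewrite divff ?gt_eqF // expr1n mul1r.
have s1 : s < T by rewrite lt_neqAle sT1.
have s0' := ltW s0.
have sT' : 0 <= s < T by rewrite s0'.
have sT'' : 0 <= s <= T by rewrite s0'.
have mh := measurable_mhermite_coeff a s0'.
have [c e] := bridge_swap X_BM Y_BM XY_indep p_gt1 T_gt0 MT_Lp sT' mh
  (fun w => mhermite_coeff_weight a w sT'').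
transitivity (cE (fun w => (mhermite_coeff s (X s) a w)%:C * bridge s (X s w))).
  apply: ae_eq_cE.
  - by apply: cmfunM; [exact: cintegrable_cmfun (M_integrable sT'')|exact: cmfun_real].
  - exact: cintegrable_cmfun c.
  - by apply: filterS (M_bridge sT') => w ->; rewrite mulrC.
rewrite e.
have cT : cintegrable P (fun w => M T w * (mhermite_coeff T (X T) a w)%:C).
  exact: (hermite_coeff_kernel_integrable T_gt0 (fun i => X_gaussian X_BM i T0)
   (fun h => @X_product _ _ _ P d X Y X_BM Y_BM XY_indep T h T0) p_gt1 MT_Lp).
rewrite -(cEZ _ cT); apply: eq_cE => v.
by rewrite pbridge_hermite // rmorphM mulrCA.
Qed.

Lemma M_transform_coeff s (a : multi_index d) : 0 < s <= T ->
  hermite_transform_coeff P s (X s) (M s) a = hermite_transform_coeff P T (X T) (M T) a.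
Proof.
move=> sT; have [s0 _] := andP sT; rewrite /hermite_transform_coeff M_hermite //.
have h (t : R) : 0 < t -> (t ^+ mabs a)%:C != 0 :> R[i].
  by move=> t0; rewrite (inj_eq (@complexI R)) expf_neq0 // gt_eqF.
have e : ((s / T) ^+ mabs a)%:C = (s ^+ mabs a)%:C / (T ^+ mabs a)%:C :> R[i].
  by rewrite expr_div_n rmorphM fmorphV.
rewrite e; move: (h s s0) (h T T_gt0).
move: (cE _) ((s ^+ mabs a)%:C) ((T ^+ mabs a)%:C) => E u v u0 v0.
by field; rewrite u0 v0.
Qed.

Lemma sums_to_unique (I : choiceType) (a : I -> R[i]) s s' : sums_to a s -> sums_to a s' -> s = s'.
Proof.
move=> h h'; have FT : ProperFilter (@totally I) := totally_filter.
exact: (cvg_unique _ h h').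
Qed.

Lemma transform_eq s z : 0 < s <= T -> transform P s (X s) (M s) z = f z.
Proof.
move=> sT; have [s0 s1] := andP sT; have s0' := ltW s0.
have Ms_Lp : in_Lp P p (M s).
  by have [_ h _] := M_martingale; apply: h; rewrite s0'.
have [_ h1] := transform_has_sum s0 (fun i => X_gaussian X_BM i s0')
   (fun h => @X_product _ _ _ P d X Y X_BM Y_BM XY_indep s h s0') p_gt1 Ms_Lp z.
have [_ h2] := transform_has_sum T_gt0 (fun i => X_gaussian X_BM i T0)
   (fun h => @X_product _ _ _ P d X Y X_BM Y_BM XY_indep T h T0) p_gt1 MT_Lp z.
apply: sums_to_unique h2.
have e : (fun a => hermite_transform_coeff P s (X s) (M s) a * mpow z a) =
  (fun a => hermite_transform_coeff P T (X T) (M T) a * mpow z a).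
  by apply/funext => a; rewrite M_transform_coeff.
by rewrite -e.
Qed.

(** The coordinates are independent, so the one-dimensional norms multiply. *)
Lemma mhermite_norm t (a : multi_index d) : 0 <= t ->
  (\int[P]_w ((mhermite_coeff t (X t) a w ^+ 2)%:E) =
   (\prod_(i < d) (t ^+ a i / (a i)`!%:R))%:E)%E.
Proof.
move=> t0; have b i := hermite_orthogonal (a i) (X_gaussian X_BM i t0).
have [|I E] := Rintegral_prod_events X_BM Y_BM XY_indep
  (g := fun i w => hc t (X t w ord0 i) (a i) ^+ 2) _ (fun i => (b i).1).
  move=> i; apply: measurable_funX; apply: measurable_hermite.
  exact: (@coord_events_fun _ _ _ _ X Y i true _ t0).
have -> : (fun w => ((mhermite_coeff t (X t) a w) ^+ 2)%:E) =
   (EFin \o (fun w => \prod_(i < d) hc t (X t w ord0 i) (a i) ^+ 2)).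
  by apply/funext => w; rewrite /= /mhermite_coeff prodrXl.
rewrite -[LHS]fineK; last exact: integrable_fin_num.
congr (_%:E); rewrite -[LHS]/(Rintegral P setT _) E.
by apply: eq_bigr => i _; exact: (b i).2.
Qed.

End markov_martingale.

(** * Predictable sets and times *)

Section grids.
Context {R : realType}.
Variable S : R.
Hypothesis S_ge0 : 0 <= S.

Definition grid (n k : nat) : R := S * k%:R / n.+1%:R.
Definition in_cell n (k : nat) (r : R) : bool := (grid n k < r) && (r <= grid n k.+1).

Lemma grid_ge0 n k : 0 <= grid n k.
Proof. by rewrite /grid !mulr_ge0 // invr_ge0. Qed.
Lemma grid0 n : grid n 0 = 0. Proof. by rewrite /grid mulr0 mul0r. Qed.
Lemma grid_last n : grid n n.+1 = S. Proof. by rewrite /grid mulfK // pnatr_eq0. Qed.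
Lemma grid_le n j k : (j <= k)%N -> grid n j <= grid n k.
Proof. by move=> jk; rewrite /grid ler_wpM2r ?invr_ge0 // ler_wpM2l // ler_nat. Qed.
Lemma grid_leS n k : (k <= n.+1)%N -> 0 <= grid n k <= S.
Proof. by move=> kn; rewrite grid_ge0 -(grid_last n) grid_le. Qed.
Lemma gridS n k : grid n k.+1 = grid n k + S / n.+1%:R.
Proof. by rewrite /grid -natr1 mulrDr mulr1 mulrDl. Qed.

Lemma cell_unique n j k r : in_cell n j r -> in_cell n k r -> j = k.
Proof.
wlog jk : j k / (j <= k)%N.
  by move=> h a b; case/orP: (leq_total j k) => jk; [exact: h|apply/esym; exact: h].
move=> /andP[_ h1] /andP[h2 _]; apply/eqP; rewrite eqn_leq jk /= leqNgt; apply/negP => lt.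
by have := lt_le_trans h2 h1; rewrite ltNge (grid_le n lt).
Qed.

Lemma cell_exists n r : 0 < r <= S -> exists k : 'I_n.+1, in_cell n k r.
Proof.
move=> /andP[r0 rS].
have ex : exists k, r <= grid n k.+1 by exists n; rewrite grid_last.
case: (ex_minnP ex) => m rm mmin.
have mn : (m < n.+1)%N by rewrite ltnS mmin // grid_last.
exists (Ordinal mn); rewrite /in_cell /= rm andbT.
case: m rm mmin mn => [|m] rm mmin mn; first by rewrite grid0.
rewrite ltNge; apply/negP => /mmin; by rewrite ltnn.
Qed.

(** The value 0 of r lies in no cell and is its own sample; outside [0, S] both steps vanish. *)
Definition right_step (V : zmodType) n r (g : R -> V) : V :=
  (if r == 0 then g 0 else 0) +
  \sum_(k < n.+1) (if in_cell n k r then g (grid n k.+1) else 0).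
Definition left_step (V : zmodType) n r (g : R -> V) : V :=
  (if r == 0 then g 0 else 0) +
  \sum_(k < n.+1) (if in_cell n k r then g (grid n k) else 0).

Lemma cell_pos n k r : in_cell n k r -> 0 < r.
Proof. by move=> /andP[h _]; apply: le_lt_trans h; exact: grid_ge0. Qed.

Lemma step_outside (V : zmodType) n r (h : nat -> V) (v : V) : ~~ (0 <= r <= S) ->
  (if r == 0 then v else 0) + \sum_(k < n.+1) (if in_cell n k r then h k else 0) = 0.
Proof.
move=> hr; case: eqP => [r0|_]; first by move: hr; rewrite r0 lexx S_ge0.
rewrite add0r big1 // => k _; case: ifP => // ck; exfalso; move: hr.
rewrite (ltW (cell_pos ck)) /=; have /andP[_ h1] := ck.
by rewrite (le_trans h1) //; have /andP[] := grid_leS (ltn_ord k).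
Qed.

Lemma step_inside n r : 0 <= r <= S -> exists c : R * R,
  [/\ 0 <= c.1 <= S, 0 <= c.2 <= S, `|c.1 - r| <= S / n.+1%:R, `|c.2 - r| <= S / n.+1%:R &
   forall (V : zmodType) (g : R -> V), right_step n r g = g c.1 /\ left_step n r g = g c.2].
Proof.
move=> /andP[r0 rS]; have Sn : 0 <= S / n.+1%:R by rewrite divr_ge0.
have [->|rn] := eqVneq r 0.
  exists (0, 0); rewrite /= !subrr normr0 lexx S_ge0; split=> // V g.
  by split; rewrite /right_step /left_step eqxx big1 ?addr0 // => k _;
    case: ifP => // /cell_pos; rewrite ltxx.
have rp : 0 < r by rewrite lt_neqAle eq_sym rn.
have [|k ck] := @cell_exists n r; first by rewrite rp.
exists (grid n k.+1, grid n k); have /andP[h1 h2] := ck; rewrite /=; split.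
- exact: grid_leS.
- by apply: grid_leS; exact: ltnW.
- by rewrite ger0_norm ?subr_ge0 // gridS; rewrite lerBlDr addrC lerD2l ltW.
- have h1' := ltW h1; rewrite ler0_norm ?subr_le0 // opprB lerBlDr addrC.
  by move: h2; rewrite gridS.
move=> V g; rewrite /right_step /left_step (negbTE rn) !add0r.
by split; rewrite (bigD1 k) //= ck big1 ?addr0 // => j jk; case: ifP => // cj;
  have /val_inj e := cell_unique cj ck; rewrite e eqxx in jk.
Qed.

Lemma step_sequence r : 0 <= r <= S -> exists c : nat -> R * R,
  [/\ forall n, 0 <= (c n).1 <= S, forall n, 0 <= (c n).2 <= S,
   (fun n => (c n).1) @ \oo --> r, (fun n => (c n).2) @ \oo --> r &
   forall n (V : zmodType) (g : R -> V),
     right_step n r g = g (c n).1 /\ left_step n r g = g (c n).2].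
Proof.
move=> rS.
have [c Hc] := choice (fun n => step_inside n rS).
have cv (u : nat -> R) : (forall n, `|u n - r| <= S / n.+1%:R) -> u @ \oo --> r.
  move=> h; have h0 : (fun n : nat => S / n.+1%:R) @ \oo --> (0 : R).
    rewrite -(mulr0 S); apply: cvgM; first exact: cvg_cst.
    exact: cvg_harmonic.
  apply/cvgrPdist_le => e e0; move/cvgrPdist_le : h0 => /(_ e e0).
  apply: filterS => n; rewrite sub0r normrN => h1.
  rewrite distrC; apply: le_trans (h n) _; exact: le_trans (ler_norm _) h1.
exists c; split.
- by move=> n; have [] := Hc n.
- by move=> n; have [] := Hc n.
- by apply: cv => n; have [] := Hc n.
- by apply: cv => n; have [] := Hc n.
- by move=> n V g; have [_ _ _ _ h] := Hc n; exact: h.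
Qed.
End grids.

Section predictable_sets.
Context {R : realType} {disp : measure_display} {Omega : measurableType disp}.
Variables (S : R) (g : R -> set (set Omega)).
Hypothesis S_ge0 : 0 <= S.
Hypothesis g_mono : forall s t, 0 <= s -> s <= t -> <<s g s >> `<=` <<s g t >>.
Local Notation G := (fun t => <<s g t >>).
Local Notation D := (`[0, S]%classic `*` [set: Omega]).

Let GC t A : G t A -> G t (~` A).
Proof. exact: (@measurableC _ (g_sigma_algebraType (g t))). Qed.
Let GU t (F : nat -> set Omega) : (forall n, G t (F n)) -> G t (\bigcup_n F n).
Proof. by move=> h; apply: (@bigcup_measurable _ (g_sigma_algebraType (g t)) F setT) => n _; exact: h. Qed.
Let GI t A B : G t A -> G t B -> G t (A `&` B).
Proof. exact: (@measurableI _ (g_sigma_algebraType (g t))). Qed.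
Let G0 t : G t set0.
Proof. exact: (@measurable0 _ (g_sigma_algebraType (g t))). Qed.
Let GT t : G t setT.
Proof. exact: (@measurableT _ (g_sigma_algebraType (g t))). Qed.

(** Sections of predictable sets are adapted; this makes predictable times stopping times. *)
Lemma predictable_section t B : 0 <= t <= S -> predictable_sigma S G B ->
  G t [set w | B (t, w)].
Proof.
move=> /andP[t0 tS].
suff : predictable_sigma S G `<=` [set B | G t [set w | B (t, w)]] by exact.
apply: smallest_sub; first split.
- exact: G0.
- move=> A GA; have e : ~` [set w | A (t, w)] = [set w | (D `\` A) (t, w)].
    apply/seteqP; split => w /=; last by case.
    by move=> h; split => //=; split => //; rewrite /= in_itv /= t0.
  exact (eq_ind _ (G t) (GC GA) _ e).
- by move=> A GA; exact: (GU GA).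
move=> B' [[A GA <-]|[s [u [A [s0 su uS GA ->]]]]] /=.
  have [t00|tn] := eqVneq t 0.
    have -> : [set w | ([set 0 : R] `*` A) (t, w)] = A.
      by apply/seteqP; split => w /=; [case|rewrite t00].
    by rewrite t00.
  have -> : [set w | ([set 0 : R] `*` A) (t, w)] = set0; last exact: G0.
  by apply/seteqP; split => w //= -[/= e]; rewrite e eqxx in tn.
have [tin|tn] := orP (orbN (t \in `]s, u])).
  have e : A = [set w | (`]s, u]%classic `*` A) (t, w)].
    by apply/seteqP; split => w /=; [move=> Aw; split|case].
  have hA : G t A by apply: g_mono GA => //; move: tin; rewrite in_itv /= => /andP[/ltW].
  exact (eq_ind _ (G t) hA _ e).
have e : set0 = [set w | (`]s, u]%classic `*` A) (t, w)].
  by apply/seteqP; split => w //= -[/= e]; move: tn; rewrite e.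
exact (eq_ind _ (G t) (@G0 t) _ e).
Qed.

Variable tau : Omega -> \bar R.
Hypothesis tau_range : forall w, (0 <= tau w <= S%:E)%E \/ tau w = +oo%E.

Lemma predictable_stopping t : predictable_time S G tau -> 0 <= t <= S ->
  G t [set w | (tau w <= t%:E)%E].
Proof.
move=> [_ h] tS; have := predictable_section tS h.
congr (G t); apply/seteqP; split => w /=; first by case.
by move=> h'; split.
Qed.

Local Notation SB := (sigma_before S G tau).
Let SBC A : SB A -> SB (~` A).
Proof. exact: (@measurableC _ (g_sigma_algebraType _)). Qed.
Let SBU (F : nat -> set Omega) : (forall n, SB (F n)) -> SB (\bigcup_n F n).
Proof. by move=> h; apply: (@bigcup_measurable _ (g_sigma_algebraType _) F setT) => n _; exact: h. Qed.
Let SBI A B : SB A -> SB B -> SB (A `&` B).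
Proof. exact: (@measurableI _ (g_sigma_algebraType _)). Qed.
Let SB0 : SB set0.
Proof. exact: (@measurable0 _ (g_sigma_algebraType _)). Qed.

Lemma sigma_before_gt t : 0 <= t <= S -> SB [set w | (t%:E < tau w)%E].
Proof.
move=> /andP[t0 tS]; apply: sub_sigma_algebra; right; exists t, setT.
by split=> //; rewrite setTI.
Qed.

Lemma sigma_before_le t : 0 <= t <= S -> SB [set w | (tau w <= t%:E)%E].
Proof.
move=> tS; have := SBC (sigma_before_gt tS); congr (SB).
by apply/seteqP; split => w /=; [move=> /negP; rewrite -leNgt|move=> h; apply/negP; rewrite -leNgt].
Qed.

Lemma tau_finite w : (tau w < +oo)%E = (tau w <= S%:E)%E.
Proof.
have [/andP[_ h]|->] := tau_range w; last by rewrite ltxx.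
by rewrite h (le_lt_trans h) ?ltry.
Qed.

Lemma tau_fineK w : (tau w < +oo)%E -> tau w = (fine (tau w))%:E /\ 0 <= fine (tau w) <= S.
Proof.
have [/andP[h1 h2] _|->] := tau_range w; last by rewrite ltxx.
have e : tau w = (fine (tau w))%:E.
  by rewrite fineK // ge0_fin_numE // (le_lt_trans h2) ?ltry.
by split => //; move: h1 h2; rewrite e !lee_fin => -> ->.
Qed.

Lemma sigma_before_finite : SB [set w | (tau w < +oo)%E].
Proof.
have := @sigma_before_le S; rewrite S_ge0 lexx => /(_ isT).
by congr (SB); apply/seteqP; split => w /=; rewrite tau_finite.
Qed.

(** On the generating rectangle ]s, u] x A the event is A with s < tau, minus u < tau. *)
Lemma predictable_graph B : predictable_sigma S G B ->
  SB [set w | (tau w < +oo)%E /\ B (fine (tau w), w)].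
Proof.
suff : predictable_sigma S G `<=` [set B | SB [set w | (tau w < +oo)%E /\ B (fine (tau w), w)]] by exact.
apply: smallest_sub; first split.
- by have := SB0; congr (SB); apply/seteqP; split => w //= -[].
- move=> A GA.
  have := SBI sigma_before_finite (SBC GA); congr (SB); apply/seteqP; split => w /=.
    move=> [h1 h2]; split => //; split; last by move=> h; apply: h2.
    by split => //; rewrite /= in_itv /=; have [_] := tau_fineK h1.
  by move=> [h1 [_ h2]]; split => // -[_ h].
- move=> A GA; have := SBU GA; congr (SB); apply/seteqP; split => w /=.
    by move=> [k _ [h1 h2]]; split => //; exists k.
  by move=> [h1 [k _ h2]]; exists k.
move=> B' [[A GA <-]|[s [u [A [s0 su uS GA ->]]]]] /=.
  have h0 : SB [set w | (tau w <= 0%:E)%E] by apply: sigma_before_le; rewrite lexx.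
  have hA : SB A by apply: sub_sigma_algebra; left.
  have := SBI h0 hA; congr (SB); apply/seteqP; split => w /=.
    move=> [h1 Aw]; have h2 : (tau w < +oo)%E by rewrite (le_lt_trans h1) ?ltry.
    split => //; split => //=; have [e /andP[f0 _]] := tau_fineK h2.
    by apply/eqP; rewrite eq_le f0 andbT; move: h1; rewrite {1}e lee_fin.
  by move=> [h1 [/= e Aw]]; split => //; have [-> _] := tau_fineK h1; rewrite e.
have hs : SB (A `&` [set w | (s%:E < tau w)%E]).
  apply: sub_sigma_algebra; right; exists s, A; split => //.
  exact: le_trans (ltW su) uS.
have hu : SB [set w | (tau w <= u%:E)%E].
  by apply: sigma_before_le; rewrite uS (le_trans s0) // ltW.
have := SBI hs hu; congr (SB); apply/seteqP; split => w /=.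
  move=> [[Aw h1] h2]; have h3 : (tau w < +oo)%E by rewrite (le_lt_trans h2) ?ltry.
  split => //; split => //=; have [e _] := tau_fineK h3.
  by move: h1 h2; rewrite e lte_fin lee_fin in_itv /= => -> ->.
move=> [h3 [/= + Aw]]; have [e _] := tau_fineK h3.
by rewrite e lte_fin lee_fin in_itv /= => /andP[-> ->].
Qed.

Hypothesis tau_stopping : forall t, 0 <= t <= S -> G t [set w | (tau w <= t%:E)%E].

Lemma sigma_before_stopped A : SB A ->
  forall t, 0 <= t <= S -> G t (A `&` [set w | (tau w <= t%:E)%E]).
Proof.
suff : SB `<=` [set A | forall t, 0 <= t <= S -> G t (A `&` [set w | (tau w <= t%:E)%E])] by exact.
apply: smallest_sub; first split.
- by move=> t _; rewrite set0I; exact: G0.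
- move=> B HB t tS; have := GI (tau_stopping tS) (GC (HB t tS)).
  congr (G t); apply/seteqP; split => w /=.
    by move=> [h1 h2]; split => //; split => // Bw; apply: h2.
  by move=> [[_ h1] h2]; split => // -[].
- by move=> F HF t tS; rewrite setI_bigcupl; apply: GU => n; exact: HF.
move=> B [GB|[s [A' [s0 sS GA ->]]]] t tS; have [t0 tS'] := andP tS.
  by apply: GI; [exact: g_mono GB|exact: tau_stopping].
have [st|ts] := leP s t.
  have hs : G t [set w | (tau w <= s%:E)%E].
    by apply: (g_mono s0 st); apply: tau_stopping; rewrite s0.
  have := GI (GI (g_mono s0 st GA) (GC hs)) (tau_stopping tS).
  congr (G t); apply/seteqP; split => w /=.
    by move=> [[h1 /negP]]; rewrite -ltNge.
  by move=> [[h1 h2] h3]; split => //; split => //; apply/negP; rewrite -ltNge.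
have -> : A' `&` [set w | (s%:E < tau w)%E] `&` [set w | (tau w <= t%:E)%E] = set0; last exact: G0.
apply/seteqP; split => w //= -[[_ h1] h2].
by have := lt_le_trans h1 h2; rewrite lte_fin ltNge ltW.
Qed.

End predictable_sets.

Section left_limits.
Context {R : realType} {disp : measure_display} {Omega : measurableType disp}.
Variables (S : R) (g : R -> set (set Omega)).
Hypothesis S_ge0 : 0 <= S.
Local Notation G := (fun t => <<s g t >>).
Local Notation D := (`[0, S]%classic `*` [set: Omega]).

Let gens : set (set (R * Omega)) := [set [set 0] `*` A | A in G 0] `|`
  [set B | exists s t A, [/\ 0 <= s, s < t, t <= S, G s A & B = `]s, t] `*` A]].

Lemma predictable_trace B : <<s gens >> B -> predictable_sigma S G (D `&` B).
Proof.
have sD : sigma_algebra D (predictable_sigma S G) by exact: smallest_sigma_algebra.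
have [h0 hC hU] := sD.
suff : <<s gens >> `<=` [set B | predictable_sigma S G (D `&` B)] by exact.
apply: smallest_sub; first split.
- by rewrite /= setI0.
- move=> A /= /hC; congr (predictable_sigma S G _); apply/seteqP; split => x /=.
    by move=> [h1 h2]; split => //; split => // Ax; apply: h2.
  by move=> [h1 [_ h2]]; split => // -[].
- by move=> A HA /=; rewrite setI_bigcupr; exact: hU.
move=> B' HB; have BD : B' `<=` D.
  case: HB => [[A _ <-]|[s [t [A [s0 st tS _ ->]]]]] x /= [h1 h2]; split => //=.
    by rewrite h1 /= in_itv /= lexx.
  move: h1; rewrite /= !in_itv /= => /andP[h1 h3].
  by rewrite (le_trans s0 (ltW h1)) (le_trans h3).
have e : B' = D `&` B' by apply/esym/setIidPr.
have hB : predictable_sigma S G B' by exact: sub_sigma_algebra.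
exact (eq_ind _ (predictable_sigma S G) hB _ e).
Qed.

Lemma rectangle_fun (I : pred R) (h : Omega -> R) (s : R) :
  (forall A, G s A -> <<s gens >> [set x | I x.1 /\ A x.2]) ->
  measurable_fun setT (h : g_sigma_algebraType (g s) -> R) ->
  measurable_fun setT ((fun x => if I x.1 then h x.2 else 0) : g_sigma_algebraType gens -> R).
Proof.
move=> HI mh _ B mB; rewrite setTI.
have h1 : <<s gens >> [set x | I x.1 /\ B (h x.2)].
  by apply: (HI [set w | B (h w)]); have := mh measurableT B mB; rewrite setTI.
have h2 : <<s gens >> [set x | I x.1 /\ [set: Omega] x.2].
  by apply: HI; exact: (@measurableT _ (g_sigma_algebraType (g s))).
have [B0|nB0] := pselect (B 0).
  have := @measurableU _ (g_sigma_algebraType gens) _ _ h1 (@measurableC _ (g_sigma_algebraType gens) _ h2).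
  congr (<<s gens >> _); apply/seteqP; split => x /=.
    by case: ifP => Ix [[_ //]|h3] //; exfalso; apply: h3.
  by case: ifP => Ix h3; [left|right => -[]].
move: h1; congr (<<s gens >> _); apply/seteqP; split => x /=.
  by move=> [-> h3].
by case: ifP.
Qed.

Lemma rectangle_cmfun (I : pred R) (h : Omega -> R[i]) (s : R) :
  (forall A, G s A -> <<s gens >> [set x | I x.1 /\ A x.2]) ->
  cmfun (h : g_sigma_algebraType (g s) -> R[i]) ->
  cmfun ((fun x => if I x.1 then h x.2 else 0) : g_sigma_algebraType gens -> R[i]).
Proof.
move=> HI [mr mi]; split.
  have := rectangle_fun HI mr; congr (measurable_fun _ _).
  by apply/funext => x; case: ifP.
have := rectangle_fun HI mi; congr (measurable_fun _ _).
by apply/funext => x; case: ifP.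
Qed.

(** The process is the pointwise limit of its samples at left grid points, each a finite sum
of processes carried by predictable rectangles. *)
Lemma predictable_left_continuous (N : R -> Omega -> R[i]) :
  (forall s, 0 <= s <= S -> cmfun (N s : g_sigma_algebraType (g s) -> R[i])) ->
  (forall w (u : nat -> R) r, (forall n, 0 <= u n <= S) -> 0 <= r <= S ->
     u @ \oo --> r -> ccvg (fun n => N (u n) w) (N r w)) ->
  cmeasurable D (predictable_sigma S G) (fun x => N x.1 x.2).
Proof.
move=> mN cN.
pose N' (x : R * Omega) : R[i] := if 0 <= x.1 <= S then N x.1 x.2 else 0.
have mN' : cmfun (N' : g_sigma_algebraType gens -> R[i]).
  apply: (cmfun_cvg (T := g_sigma_algebraType gens) (F := fun n (x : R * Omega) => left_step S n x.1 (fun t => N t x.2))).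
    move=> n; apply: cmfunD.
      apply: (rectangle_cmfun (I := fun r => r == 0)); last by apply: mN; rewrite lexx.
      move=> A GA; apply: sub_sigma_algebra; left; exists A => //.
      by apply/seteqP; split => x /= [h1 h2]; split => //; apply/eqP.
    apply: cmfun_sum => k.
    apply: (rectangle_cmfun (I := fun r => in_cell S n k r)); last by apply: mN; apply: grid_leS => //; exact: ltnW.
    move=> A GA; have [lt|ge] := ltP (grid S n k) (grid S n k.+1).
      apply: sub_sigma_algebra; right; exists (grid S n k), (grid S n k.+1), A; split.
      - exact: grid_ge0.
      - exact: lt.
      - by have /andP[] := grid_leS S_ge0 (ltn_ord k).
      - exact: GA.
      - by apply/seteqP; split => x /= [h1 h2]; split => //; move: h1; rewrite /in_cell in_itv.
    have -> : [set x : R * Omega | in_cell S n k x.1 /\ A x.2] = set0.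
      apply/seteqP; split => x //= -[/andP[h1 h2] _].
      by have := lt_le_trans h1 h2; rewrite ltNge ge.
    exact: (@measurable0 _ (g_sigma_algebraType gens)).
  move=> x; rewrite /N'; have [xS|xS] := boolP (0 <= x.1 <= S).
    have [c [_ c2 _ cv h]] := step_sequence S_ge0 xS.
    have -> : (fun n => left_step S n x.1 (fun t => N t x.2)) = (fun n => N (c n).2 x.2).
      by apply/funext => n; have [_ ->] := h n _ (fun t => N t x.2).
    exact: cN.
  have -> : (fun n => left_step S n x.1 (fun t => N t x.2)) = (fun=> 0).
    by apply/funext => n; exact: (step_outside S_ge0 n (fun k => N (grid S n k) x.2)).
  exact: ccvg_cst.
have [mr mi] := mN'.
split=> _ [B mB <-].
  have := predictable_trace (mr measurableT B mB); congr (predictable_sigma S G _).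
  rewrite setTI; apply/seteqP; split => x /= [h1 h2]; split => //; move: h2; rewrite /N';
    by case: h1 => /=; rewrite in_itv /= => ->.
have := predictable_trace (mi measurableT B mB); congr (predictable_sigma S G _).
rewrite setTI; apply/seteqP; split => x /= [h1 h2]; split => //; move: h2; rewrite /N';
  by case: h1 => /=; rewrite in_itv /= => ->.
Qed.
End left_limits.

(** * Optional sampling *)

Section optional_sampling.
Context {R : realType} {disp : measure_display} {Omega : measurableType disp}.
Variable P : probability Omega R.
Variables (S : R) (g : R -> set (set Omega)).
Hypothesis S_ge0 : 0 <= S.
Hypothesis gM : forall t, <<s g t >> `<=` measurable.
Hypothesis g_mono : forall s t, 0 <= s -> s <= t -> <<s g s >> `<=` <<s g t >>.
Variable tau : Omega -> \bar R.
Hypothesis tau_range : forall w, (0 <= tau w <= S%:E)%E \/ tau w = +oo%E.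
Hypothesis tau_stopping : forall t, 0 <= t <= S -> <<s g t >> [set w | (tau w <= t%:E)%E].
Variable xi : R -> Omega -> R.
Hypothesis mxi : forall s, 0 <= s <= S -> measurable_fun setT (xi s : g_sigma_algebraType (g s) -> R).
Hypothesis Ixi : forall s, 0 <= s <= S -> P.-integrable setT (EFin \o xi s).
Hypothesis xi_martingale : forall s A, 0 <= s <= S -> <<s g s >> A ->
  (\int[P]_w (\1_A w * xi s w))%R = (\int[P]_w (\1_A w * xi S w))%R.
Hypothesis xi_continuous : forall w (u : nat -> R) r, (forall n, 0 <= u n <= S) -> 0 <= r <= S ->
  u @ \oo --> r -> (fun n => xi (u n) w) @ \oo --> xi r w.

Definition stopped_value w : R := if (tau w < +oo)%E then xi (fine (tau w)) w else 0.

Let SS : 0 <= S <= S. Proof. by rewrite S_ge0 lexx. Qed.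
Let rt w : R := if (tau w < +oo)%E then fine (tau w) else -1.

Let rt_in w : (tau w < +oo)%E -> 0 <= rt w <= S.
Proof. by move=> h; rewrite /rt h; have [_] := tau_fineK tau_range h. Qed.
Let rt_out w : ~~ (tau w < +oo)%E -> ~~ (0 <= rt w <= S).
Proof. by move=> /negbTE h; rewrite /rt h ler0N1. Qed.

Let rt_le w t : 0 <= t <= S -> (tau w < +oo)%E && (rt w <= t) = (tau w <= t%:E)%E.
Proof.
move=> /andP[t0 tS]; have [h|h] := boolP (tau w < +oo)%E.
  by have [e _] := tau_fineK tau_range h; rewrite /rt h {2}e lee_fin.
apply/esym/negbTE; apply: contra h => h; exact: le_lt_trans h (ltry t).
Qed.

Lemma Rintegral_sum0 (I : Type) (r : seq I) (F : I -> Omega -> R) :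
  (forall i, P.-integrable setT (EFin \o F i) /\ (\int[P]_w F i w)%R = 0) ->
  P.-integrable setT (EFin \o (fun w => \sum_(i <- r) F i w)) /\
  (\int[P]_w (\sum_(i <- r) F i w))%R = 0.
Proof.
move=> HF; elim: r => [|i r [IH1 IH2]].
  have -> : (fun w => \sum_(i <- [::]) F i w) = cst 0 by apply/funext => w; rewrite big_nil.
  by split; [exact: finite_measure_integrable_cst|rewrite Rintegral_cst // mul0r].
have -> : (fun w => \sum_(j <- i :: r) F j w) = (fun w => F i w + \sum_(j <- r) F j w).
  by apply/funext => w; rewrite big_cons.
have [h1 h2] := HF i.
by split; [exact: rintegrableD|rewrite RintegralD // h2 IH2 addr0].
Qed.

Section weights.
Variables (chi : R -> R) (K : R).
Hypotheses (chi_cont : continuous chi) (chi1 : forall x, `|chi x| <= 1).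
Hypothesis chiK : forall x, `|chi x * x| <= K.

Let mchi : measurable_fun setT chi. Proof. exact: continuous_measurable_fun. Qed.

Let piece t E : 0 <= t <= S -> <<s g t >> E ->
  P.-integrable setT (EFin \o (fun w => \1_E w * chi (xi t w) * (xi t w - xi S w))) /\
  (\int[P]_w (\1_E w * chi (xi t w) * (xi t w - xi S w)))%R = 0.
Proof.
move=> tS GE.
have Idl : P.-integrable setT (EFin \o (fun w => xi t w - xi S w)).
  by apply: rintegrableB; exact: Ixi.
have mpsi : measurable_fun setT ((fun w => \1_E w * chi (xi t w)) : g_sigma_algebraType (g t) -> R).
  apply: measurable_funM; first exact: measurable_indic.
  exact: (measurableT_comp mchi (mxi tS)).
have I : P.-integrable setT (EFin \o (fun w => \1_E w * chi (xi t w) * (xi t w - xi S w))).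
  apply: (le_integrable measurableT _ _ Idl).
    apply/measurable_EFinP; apply: measurable_funM; first exact: measurable_sub_fun (gM (t := t)) mpsi.
    by apply/measurable_EFinP; exact: measurable_int Idl.
  move=> w _; rewrite /= lee_fin normrM ler_piMl // normrM mulr_ile1 //.
  by rewrite indicE; case: (w \in E); rewrite ?normr1 ?normr0.
split=> //; apply: (orthogonal_sub_sigma (gM (t := t)) Idl _ mpsi I) => C GC.
under eq_Rintegral do rewrite mulrBr.
rewrite RintegralB //; try by apply: integrable_indicM; [exact: gM GC|exact: Ixi].
by rewrite xi_martingale // subrr.
Qed.

(** At a grid time above tau the weight is measurable, so the martingale property applies cell
by cell; boundedness of chi x * x lets the grid be refined by dominated convergence. *)
Lemma weighted_sampling A : (forall t, 0 <= t <= S -> <<s g t >> (A `&` [set w | (tau w <= t%:E)%E])) ->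
  (\int[P]_w (\1_(A `&` [set w | (tau w < +oo)%E]) w * chi (stopped_value w) *
     (stopped_value w - xi S w)))%R = 0.
Proof.
move=> HA.
pose h w t := \1_A w * chi (xi t w) * (xi t w - xi S w).
pose H n w := right_step S n (rt w) (h w).
have Hcell n k : (k < n.+1)%N -> <<s g (grid S n k.+1) >>
   [set w | A w /\ in_cell S n k (rt w) /\ (tau w < +oo)%E].
  move=> kn; have g1 := grid_leS S_ge0 kn; have g0 := grid_leS S_ge0 (ltnW kn : (k <= n.+1)%N).
  have h1 := HA _ g1.
  have h0 : <<s g (grid S n k.+1) >> (A `&` [set w | (tau w <= (grid S n k)%:E)%E]).
    have := HA _ g0; apply: g_mono; first exact: grid_ge0.
    exact: grid_le.
  have := @measurableD _ (g_sigma_algebraType (g (grid S n k.+1))) _ _ h1 h0.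
  congr (<<s _ >> _); apply/seteqP; split => w /=.
    move=> [[Aw t1] nt]; have := t1; rewrite -rt_le // => /andP[fin r1].
    split => //; split => //; rewrite /in_cell r1 andbT ltNge; apply/negP => r0.
    by apply: nt; split => //; rewrite -rt_le // fin.
  move=> [Aw [/andP[r0 r1] fin]]; split; first by split => //; rewrite -rt_le // fin.
  by move=> [_]; rewrite -rt_le // => /andP[_]; rewrite leNgt r0.
have piece0 : P.-integrable setT (EFin \o (fun w => if rt w == 0 then h w 0 else 0)) /\
    (\int[P]_w (if rt w == 0 then h w 0 else 0))%R = 0.
  have z0 : 0 <= (0 : R) <= S by rewrite lexx.
  have -> : (fun w => if rt w == 0 then h w 0 else 0) =
      (fun w => \1_(A `&` [set w | (tau w <= 0%:E)%E]) w * chi (xi 0 w) * (xi 0 w - xi S w)).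
    apply/funext => w; rewrite /h !indicE in_setI; have [h0|h0] := boolP (tau w <= 0%:E)%E.
      have := h0; rewrite -rt_le // => /andP[fin r0].
      have -> : rt w = 0 by apply/eqP; rewrite eq_le r0; have /andP[->] := rt_in fin.
      by rewrite eqxx (_ : w \in [set w | (tau w <= 0%:E)%E]) ?andbT // inE.
    rewrite (_ : (w \in [set w | (tau w <= 0%:E)%E]) = false) ?andbF ?mul0r; last first.
      by apply/negbTE; rewrite notin_setE; exact/negP.
    case: eqP => // r0; move: h0; rewrite -rt_le // r0 lexx andbT.
    by rewrite /rt in r0; move: r0; case: ifP => // _ /eqP; rewrite oppr_eq0 oner_eq0.
  by apply: piece => //; exact: HA.
have piecek n (k : 'I_n.+1) : P.-integrable setT (EFin \o (fun w => if in_cell S n k (rt w) then h w (grid S n k.+1) else 0)) /\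
    (\int[P]_w (if in_cell S n k (rt w) then h w (grid S n k.+1) else 0))%R = 0.
  have -> : (fun w => if in_cell S n k (rt w) then h w (grid S n k.+1) else 0) =
      (fun w => \1_[set w | A w /\ in_cell S n k (rt w) /\ (tau w < +oo)%E] w *
         chi (xi (grid S n k.+1) w) * (xi (grid S n k.+1) w - xi S w)).
    apply/funext => w; rewrite /h !indicE; case: ifP => ck.
      have fin : (tau w < +oo)%E.
        have := cell_pos S_ge0 ck; rewrite /rt; case: ifP => // _.
        by rewrite ltNge lerN10.
      congr (_ %:R * _ * _); congr nat_of_bool; apply/idP/idP; rewrite !inE //=.
      by case.
    rewrite memNset ?mul0r //= => -[_ [ck' _]]; by rewrite ck' in ck.
  by apply: piece; [exact: grid_leS|exact: Hcell].
have IH n : P.-integrable setT (EFin \o H n) /\ (\int[P]_w H n w)%R = 0.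
  have [i1 e1] := Rintegral_sum0 (index_enum 'I_n.+1) (piecek n).
  have [i0 e0] := piece0.
  by split; [exact: rintegrableD i0 i1|rewrite /H /right_step RintegralD // e0 e1 addr0].
have cvH w : (fun n => H n w) @ \oo --> \1_(A `&` [set w | (tau w < +oo)%E]) w * chi (stopped_value w) *
     (stopped_value w - xi S w).
  rewrite indicE in_setI /stopped_value; have [fin|nfin] := boolP (tau w < +oo)%E; last first.
    rewrite (_ : (w \in [set w | (tau w < +oo)%E]) = false) ?andbF ?mul0r; last first.
      by apply/negbTE; rewrite notin_setE; exact/negP.
    have -> : (fun n => H n w) = (fun=> 0).
      by apply/funext => n; apply: (step_outside S_ge0 n (fun k => h w (grid S n k.+1))); exact: rt_out.
    exact: cvg_cst.
  rewrite (_ : w \in [set w | (tau w < +oo)%E]) ?andbT; last by rewrite inE.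
  have [c [c1 _ cv _ hc]] := step_sequence S_ge0 (rt_in fin).
  have -> : (fun n => H n w) = (fun n => h w (c n).1).
    by apply/funext => n; exact (hc n _ (h w)).1.
  have cx : (fun n => xi (c n).1 w) @ \oo --> xi (fine (tau w)) w.
    have := @xi_continuous w _ _ c1 (rt_in fin) cv; by rewrite /rt fin.
  rewrite /h indicE; apply: cvgM; last by apply: cvgB => //; exact: cvg_cst.
  apply: cvgM; first exact: cvg_cst.
  by apply: continuous_cvg => //; exact: chi_cont.
have bH n w : `|H n w| <= K + `|xi S w|.
  have K0 : 0 <= K by apply: le_trans (chiK 0).
  have [fin|nfin] := boolP (tau w < +oo)%E; last first.
    have -> : H n w = 0 by exact: (step_outside S_ge0 n (fun k => h w (grid S n k.+1)) _ (rt_out nfin)).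
    by rewrite normr0 addr_ge0.
  have [c [_ _ _ _ hc]] := step_inside S_ge0 n (rt_in fin).
  have -> : H n w = h w c.1 by exact: (hc _ (h w)).1.
  rewrite /h -mulrA normrM.
  apply: (@le_trans _ _ (1 * `|chi (xi c.1 w) * (xi c.1 w - xi S w)|)).
    by rewrite ler_wpM2r // indicE; case: (w \in A); rewrite ?normr1 ?normr0.
  rewrite mul1r mulrBr; apply: le_trans (ler_normB _ _) _; rewrite lerD //.
  by rewrite normrM ler_piMl.
have IS : P.-integrable setT (EFin \o (fun w => K + `|xi S w|)).
  apply: rintegrableD; first exact: finite_measure_integrable_cst.
  exact: integrable_norm (Ixi SS).
have mH n : measurable_fun setT (H n) by apply/measurable_EFinP; exact: measurable_int (IH n).1.
have := Rintegral_dominated mH cvH IS bH.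
have -> : (fun n => (\int[P]_w H n w)%R) = (fun=> 0) by apply/funext => n; exact: (IH n).2.
move=> h1; apply/esym; exact: (cvg_unique _ (cvg_cst (0 : R)) h1).
Qed.
End weights.

Lemma measurable_stopped_value : measurable_fun setT stopped_value.
Proof.
apply: (@measurable_fun_cvg _ _ _ _ (fun n w => right_step S n (rt w) (fun t => xi t w))).
  move=> n; have mr (Q : pred R) t : measurable [set w | Q (rt w)] -> 0 <= t <= S ->
      measurable_fun setT (fun w => if Q (rt w) then xi t w else 0).
    move=> mQ tS; have -> : (fun w => if Q (rt w) then xi t w else 0) = (fun w => \1_[set w | Q (rt w)] w * xi t w).
      apply/funext => w; rewrite indicE; case: ifP => h.
        by rewrite mem_set // mul1r.
      by rewrite memNset ?mul0r //=; rewrite h.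
    apply: measurable_funM; first exact: measurable_indic.
    exact: measurable_sub_fun (gM (t := t)) (mxi tS).
  have mle t : 0 <= t <= S -> measurable [set w | (tau w < +oo)%E && (rt w <= t)].
    move=> tS; have := gM (tau_stopping tS); congr measurable.
    by apply/seteqP; split => w /=; rewrite rt_le.
  apply: measurable_funD.
    apply: (mr (fun r => r == 0)); last by rewrite lexx.
    have := mle 0; rewrite lexx => /(_ S_ge0); congr measurable; apply/seteqP; split => w /=.
      by move=> /andP[fin r0]; rewrite eq_le r0; have /andP[->] := rt_in fin.
    move=> /eqP r0; rewrite r0 lexx andbT; move: r0; rewrite /rt; case: ifP => // _ /eqP.
    by rewrite oppr_eq0 oner_eq0.
  apply: measurable_sum => k.
  apply: (mr (in_cell S n k)); last exact: grid_leS.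
  have g1 := grid_leS S_ge0 (ltn_ord k); have g0 := grid_leS S_ge0 (ltnW (ltn_ord k)).
  have := measurableD (mle _ g1) (mle _ g0); congr measurable; apply/seteqP; split => w /=.
    move=> [/andP[fin r1] /negP]; rewrite fin /= -ltNge => r0.
    by rewrite /in_cell r0 r1.
  move=> ck; have fin : (tau w < +oo)%E.
    by have := cell_pos S_ge0 ck; rewrite /rt; case: ifP => // _; rewrite ltNge lerN10.
  by move: ck => /andP[r0 r1]; rewrite fin r1; split => //; apply/negP; rewrite -ltNge.
move=> w _; rewrite /stopped_value; have [fin|nfin] := boolP (tau w < +oo)%E.
  have [c [c1 _ cv _ hc]] := step_sequence S_ge0 (rt_in fin).
  have -> : (fun n => right_step S n (rt w) (fun t => xi t w)) = (fun n => xi (c n).1 w).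
    by apply/funext => n; exact (hc n _ (fun t => xi t w)).1.
  by have := @xi_continuous w _ _ c1 (rt_in fin) cv; rewrite /rt fin.
have -> : (fun n => right_step S n (rt w) (fun t => xi t w)) = (fun=> 0).
  by apply/funext => n; apply: (step_outside S_ge0 n (fun k => xi (grid S n k.+1) w)); exact: rt_out.
exact: cvg_cst.
Qed.

Let damp (n : nat) (x : R) : R := (1 + `|x| / n.+1%:R)^-1.
Let denom_gt0 n (x : R) : 0 < 1 + `|x| / n.+1%:R.
Proof. by rewrite ltr_pwDl // divr_ge0. Qed.

Let damp_continuous n : continuous (damp n).
Proof.
move=> x; apply: cvgV; first by rewrite gt_eqF.
apply: cvgD; first exact: cvg_cst.
apply: cvgM; last exact: cvg_cst.
by apply: cvg_norm; exact: cvg_id.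
Qed.

Let damp01 n x : 0 <= damp n x <= 1.
Proof.
rewrite invr_ge0 ltW //= invf_le1 // lerDl divr_ge0 //.
Qed.

Let dampK n x : `|damp n x * x| <= n.+1%:R.
Proof.
have /andP[d0 _] := damp01 n x.
rewrite normrM ger0_norm // /damp mulrC ler_pdivrMr // mulrDr mulr1.
by rewrite mulrC divfK ?pnatr_eq0 // lerDr.
Qed.

Let damp_cvg x : (fun n => damp n x) @ \oo --> (1 : R).
Proof.
have h : (fun n : nat => 1 + `|x| / n.+1%:R) @ \oo --> (1 : R).
  rewrite -[X in _ --> X]addr0; apply: cvgD; first exact: cvg_cst.
  rewrite -(mulr0 `|x|); apply: cvgM; first exact: cvg_cst.
  exact: cvg_harmonic.
rewrite /damp -[X in _ --> X]invr1; apply: cvgV => //; exact: oner_neq0.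
Qed.

Let damp_mono n m x : (n <= m)%N -> damp n x <= damp m x.
Proof.
move=> nm; rewrite lef_pV2 ?posrE // lerD2l ler_wpM2l // lef_pV2 ?posrE //.
by rewrite ler_nat ltnS.
Qed.

Lemma integrable_monotone_limit (h : nat -> Omega -> R) (f : Omega -> R) C :
  (forall n, measurable_fun setT (h n)) -> (forall n w, 0 <= h n w) ->
  (forall n m w, (n <= m)%N -> h n w <= h m w) ->
  (forall w, (fun n => h n w) @ \oo --> f w) ->
  (forall n, P.-integrable setT (EFin \o h n)) ->
  (forall n, (\int[P]_w h n w)%R <= C) -> P.-integrable setT (EFin \o f).
Proof.
move=> mh h0 hm hf Ih hC.
have mf : measurable_fun setT f by apply: (@measurable_fun_cvg _ _ _ _ h) => // w _; exact: hf.
have hf' w : (fun n => (h n w)%:E) @ \oo --> (f w)%:E by apply: cvg_EFin; [exact: nearW|exact: hf].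
have f0 w : 0 <= f w.
  rewrite -lee_fin -(cvg_lim (@ereal_hausdorff R) (hf' w)); apply: lime_ge; first by apply/cvg_ex; exists (f w)%:E; exact: hf'.
  by apply: nearW => n; rewrite lee_fin.
apply/integrableP; split; first exact/measurable_EFinP.
have e : (\int[P]_w `|(EFin \o f) w| = \int[P]_w (limn (fun n => (h n w)%:E)))%E.
  apply: eq_integral => w _; rewrite /= ger0_norm //; apply/esym.
  by apply: cvg_lim => //; exact: hf'.
rewrite e.
have cv : (\int[P]_w (h n w)%:E)%E @[n --> \oo] --> (\int[P]_w (limn (fun n => (h n w)%:E)))%E.
  apply: (@cvg_monotone_convergence _ _ _ P setT measurableT (fun n w => (h n w)%:E)).
  - by move=> n; exact/measurable_EFinP.
  - by move=> n w _; rewrite lee_fin.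
  - by move=> w _ n m nm; rewrite lee_fin; exact: hm.
apply: (@le_lt_trans _ _ C%:E); last exact: ltry.
rewrite -(cvg_lim (@ereal_hausdorff R) cv); apply: lime_le.
  by apply/cvg_ex; eexists; exact: cv.
apply: nearW => n; have := hC n; rewrite -lee_fin /Rintegral fineK //.
by apply: integrable_fin_num => //; exact: Ih.
Qed.

(** With the weight x / (1 + |x|), damped, the sampling identity bounds the integrals of
x^2 / (1 + |x|) at the stopped value by E|xi_S|. *)
Lemma stopped_value_integrable : P.-integrable setT (EFin \o stopped_value).
Proof.
have mx := measurable_stopped_value.
pose fin := [set w | (tau w < +oo)%E].
have HT t : 0 <= t <= S -> <<s g t >> (setT `&` [set w | (tau w <= t%:E)%E]).
  by move=> tS; rewrite setTI; exact: tau_stopping.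
have mfin : measurable fin.
  have -> : fin = [set w | (tau w <= S%:E)%E].
    by apply/seteqP; split => w; rewrite /fin /= (tau_finite tau_range).
  exact: gM (tau_stopping SS).
pose chi n x := x * (1 + `|x|)^-1 * damp n x.
have sgn x : `|x * (1 + `|x|)^-1| <= 1 :> R.
  rewrite normrM normfV (ger0_norm (_ : 0 <= 1 + `|x|)) ?addr_ge0 //.
  by rewrite ler_pdivrMr ?mul1r ?lerDr // ltr_pwDl.
have chi_cont n : continuous (chi n).
  move=> x; apply: cvgM; last exact: damp_continuous.
  apply: cvgM; first exact: cvg_id.
  apply: cvgV; first by rewrite gt_eqF // ltr_pwDl.
  by apply: cvgD; [exact: cvg_cst|apply: cvg_norm; exact: cvg_id].
have chi1 n x : `|chi n x| <= 1.
  by have /andP[a b] := damp01 n x; rewrite normrM mulr_ile1 // ger0_norm.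
have chiK n x : `|chi n x * x| <= n.+1%:R.
  by rewrite -mulrA normrM; apply: le_trans (dampK n x); rewrite ler_piMl.
pose h n w := chi n (stopped_value w) * stopped_value w.
have mh n : measurable_fun setT (h n).
  apply: measurable_funM => //; apply: measurableT_comp => //; exact: continuous_measurable_fun.
have sq0 x : 0 <= x * (1 + `|x|)^-1 * x :> R.
  by rewrite mulrAC divr_ge0 ?addr_ge0 // -expr2 sqr_ge0.
have hE n w : h n w = damp n (stopped_value w) * (stopped_value w * (1 + `|stopped_value w|)^-1 * stopped_value w).
  by rewrite /h /chi; ring.
have h0 n w : 0 <= h n w by rewrite hE mulr_ge0 //; have /andP[] := damp01 n (stopped_value w).
have bd n w : `|h n w| <= n.+1%:R by exact: chiK.
have bI (k : Omega -> R) c : measurable_fun setT k -> (forall w, `|k w| <= c) -> P.-integrable setT (EFin \o k).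
  move=> mk kc.
  have Ic : P.-integrable setT (EFin \o (fun _ : Omega => c)) by exact: finite_measure_integrable_cst.
  apply: (le_integrable measurableT _ _ Ic).
    exact/measurable_EFinP.
  by move=> w _; rewrite /= lee_fin (le_trans (kc w)) // ler_norm.
have Ih n : P.-integrable setT (EFin \o h n) by exact: bI (bd n).
have ISabs := integrable_norm (Ixi SS).
have I2 n : P.-integrable setT (EFin \o (fun w => \1_fin w * (chi n (stopped_value w) * xi S w))).
  apply: (le_integrable measurableT _ _ (Ixi SS)).
    apply/measurable_EFinP; apply: measurable_funM; first exact: measurable_indic.
    apply: measurable_funM; last by apply/measurable_EFinP; exact: measurable_int (Ixi SS).
    by apply: measurableT_comp => //; exact: continuous_measurable_fun.
  move=> w _; rewrite /= lee_fin normrM normrM mulrA ler_piMl // mulr_ile1 ?chi1 //.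
  by rewrite indicE; case: (w \in fin); rewrite ?normr1 ?normr0.
have hC n : (\int[P]_w h n w)%R <= (\int[P]_w `|xi S w|)%R.
  have := weighted_sampling (chi_cont n) (chi1 n) (chiK n) HT; rewrite setTI -/fin => W.
  have e : (fun w => \1_fin w * chi n (stopped_value w) * (stopped_value w - xi S w)) =
     (fun w => h n w - \1_fin w * (chi n (stopped_value w) * xi S w)).
    apply/funext => w; rewrite /h; have [fw|fw] := boolP (w \in fin).
      by rewrite indicE fw !mul1r mulrBr.
    have s0 : stopped_value w = 0.
      by move: fw; rewrite notin_setE /fin /= => /negP/negbTE fw; rewrite /stopped_value fw.
    by rewrite indicE (negbTE fw) s0 !mul0r mulr0 subrr.
  rewrite e RintegralB // in W.
  move/eqP: W; rewrite subr_eq0 => /eqP ->.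
  apply: le_Rintegral => // w _; apply: le_trans (ler_norm _) _.
  rewrite normrM normrM mulrA ler_piMl // mulr_ile1 ?chi1 //.
  by rewrite indicE; case: (w \in fin); rewrite ?normr1 ?normr0.
have If : P.-integrable setT (EFin \o (fun w => stopped_value w * (1 + `|stopped_value w|)^-1 * stopped_value w)).
  apply: (integrable_monotone_limit mh h0 _ _ Ih hC).
    by move=> n m w nm; rewrite !hE ler_wpM2r // damp_mono.
  move=> w; rewrite -[X in _ --> X]mul1r; under eq_fun do rewrite hE.
  by apply: cvgM; [exact: damp_cvg|exact: cvg_cst].
have Ic : P.-integrable setT (EFin \o (fun _ : Omega => 1 : R)) by exact: finite_measure_integrable_cst.
apply: (le_integrable measurableT _ _ (rintegrableD Ic If)).
  exact/measurable_EFinP.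
move=> w _; rewrite /= lee_fin [leRHS]ger0_norm ?addr_ge0 //.
set x := stopped_value w; have d0 : 0 < 1 + `|x| by rewrite ltr_pwDl.
have -> : x * (1 + `|x|)^-1 * x = `|x| ^+ 2 / (1 + `|x|) by rewrite real_normK ?num_real // expr2 mulrAC.
rewrite -lerBlDl ler_pdivlMr //; have := normr_ge0 x; nra.
Qed.

(** Optional sampling for a closed continuous martingale; damping by bounded weights
replaces uniform integrability. *)
Lemma optional_sampling A :
  (forall t, 0 <= t <= S -> <<s g t >> (A `&` [set w | (tau w <= t%:E)%E])) ->
  (\int[P]_w (\1_(A `&` [set w | (tau w < +oo)%E]) w * stopped_value w))%R =
  (\int[P]_w (\1_(A `&` [set w | (tau w < +oo)%E]) w * xi S w))%R.
Proof.
move=> HA; set E := A `&` _.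
have mE : measurable E.
  have := gM (HA S SS); congr measurable; rewrite /E; congr (_ `&` _).
  by apply/seteqP; split => w /=; rewrite (tau_finite tau_range).
have Isv := stopped_value_integrable.
have mdl : measurable_fun setT (fun w => stopped_value w - xi S w).
  by apply: measurable_funB; [exact: measurable_stopped_value|apply/measurable_EFinP; exact: measurable_int (Ixi SS)].
have damp1 n x : `|damp n x| <= 1 by have /andP[a b] := damp01 n x; rewrite ger0_norm.
have W n := weighted_sampling (damp_continuous (n := n)) (damp1 n) (dampK n) HA.
have mF n : measurable_fun setT (fun w => \1_E w * damp n (stopped_value w) * (stopped_value w - xi S w)).
  apply: measurable_funM => //; apply: measurable_funM; first exact: measurable_indic.
  apply: (measurableT_comp _ measurable_stopped_value).
  exact: continuous_measurable_fun (@damp_continuous n).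
have cF w : (fun n => \1_E w * damp n (stopped_value w) * (stopped_value w - xi S w)) @ \oo -->
    \1_E w * (stopped_value w - xi S w).
  apply: cvgM; last exact: cvg_cst.
  rewrite -[X in _ --> X]mulr1; apply: cvgM; first exact: cvg_cst.
  exact: damp_cvg.
have Iabs : P.-integrable setT (EFin \o (fun w => `|stopped_value w - xi S w|)).
  exact: (integrable_norm (rintegrableB Isv (Ixi SS))).
have bF n w : `|\1_E w * damp n (stopped_value w) * (stopped_value w - xi S w)| <=
    `|stopped_value w - xi S w|.
  rewrite normrM ler_piMl // normrM mulr_ile1 //.
  by rewrite indicE; case: (w \in E); rewrite ?normr1 ?normr0.
have := Rintegral_dominated mF cF Iabs bF.
have -> : (fun n => (\int[P]_w (\1_E w * damp n (stopped_value w) * (stopped_value w - xi S w)))%R) = (fun=> 0).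
  by apply/funext => n; exact: W.
move=> h; have : (\int[P]_w (\1_E w * (stopped_value w - xi S w)))%R = 0.
  by apply/esym; exact: (cvg_unique _ (cvg_cst (0 : R)) h).
under eq_Rintegral do rewrite mulrBr.
rewrite RintegralB //; try by apply: integrable_indicM => //; exact: Ixi.
by move/eqP; rewrite subr_eq0 => /eqP.
Qed.

End optional_sampling.

(** * The predictable projection *)

Section sequential_continuity.
Context {R : realType}.

Lemma within_seq (h : R -> R) (u : nat -> R) (r : R) :
  {within `[0, +oo[, continuous h} -> (forall n, 0 <= u n) -> 0 <= r ->
  u @ \oo --> r -> (fun n => h (u n)) @ \oo --> h r.
Proof.
move=> /subspace_continuousP ch u0 r0 ur.
have r0' : [set` `[0, +oo[%R] r by rewrite /= in_itv /= r0.
move=> B HB; have h0 := ch r r0' B HB.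
have h1 : \forall n \near \oo, ([set` `[0, +oo[%R] (u n) -> B (h (u n))) := ur _ h0.
suff : \forall n \near \oo, B (h (u n)) by [].
by apply: filterS h1 => n h2; apply: h2; rewrite /= in_itv /= u0.
Qed.

Lemma cvg_bound (u : nat -> R) (l : R) : u @ \oo --> l -> exists B, forall n, `|u n| <= B.
Proof.
move=> ul; have cu : cvgn u by apply/cvg_ex; exists l.
have [B [_ HB]] := cvg_seq_bounded cu.
by exists (B + 1) => n; apply: (HB (B + 1)) => //; rewrite ltrDl.
Qed.

Lemma ccvg_cexp (u : nat -> R[i]) l : ccvg u l -> ccvg (fun n => cexp (u n)) (cexp l).
Proof.
move=> [a b]; apply: ccvgM.
  split; last exact: cvg_cst.
  exact: (continuous_cvg _ (@continuous_expR R _) a).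
split; first exact: (continuous_cvg _ (@continuous_cos R _) b).
exact: (continuous_cvg _ (@continuous_sin R _) b).
Qed.

Lemma ccvg_kernel1 T (z : nat -> R[i]) l x : ccvg z l ->
  ccvg (fun n => kernel1 T (z n) x) (kernel1 T l x).
Proof.
move=> zl.
have hq : ccvg (fun n => z n ^+ 2 / 2%:R) (l ^+ 2 / 2%:R) by exact (ccvgM (ccvgM zl zl) (ccvg_cst _)).
have hN : ccvg (fun n => - (z n ^+ 2 / 2%:R)) (- (l ^+ 2 / 2%:R)).
  case: hq => a b; split.
    by rewrite ReN; under eq_fun do rewrite ReN; exact: cvgN.
  by rewrite ImN; under eq_fun do rewrite ImN; exact: cvgN.
exact (ccvg_cexp (ccvgM (ccvg_cst _) (ccvgD (ccvgM zl (ccvg_cst _)) hN))).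
Qed.

Lemma cvg_bridge1 (T : R) (s x : nat -> R) (r l y : R) : 0 < T -> r < T -> s @ \oo --> r -> x @ \oo --> l ->
  (fun n => bridge1 T (s n) (x n) y) @ \oo --> bridge1 T r l y.
Proof.
move=> T0 rT sr xl; apply: cvgM.
  apply: cvgV.
    by rewrite gt_eqF // sqrtr_gt0 subr_gt0 ltr_pdivrMr // mul1r.
  apply: (continuous_cvg _ (@sqrt_continuous R _)).
  by apply: cvgB; [exact: cvg_cst|apply: cvgM => //; exact: cvg_cst].
apply: (continuous_cvg _ (@continuous_expR R _)).
apply: cvgB; first exact: cvg_cst.
apply: cvgM.
  have c : (fun n => y - x n) @ \oo --> y - l by apply: cvgB => //; exact: cvg_cst.
  rewrite expr2; under eq_fun do rewrite expr2; exact: cvgM.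
apply: cvgV; first by rewrite gt_eqF // mulr_gt0 // subr_gt0.
apply: cvgM; first exact: cvg_cst.
by apply: cvgB => //; exact: cvg_cst.
Qed.
End sequential_continuity.

Section complex_sampling.
Context {R : realType} {disp : measure_display} {Omega : measurableType disp}.
Variable P : probability Omega R.
Variables (S : R) (g : R -> set (set Omega)).
Hypothesis S_ge0 : 0 <= S.
Hypothesis gM : forall t, <<s g t >> `<=` measurable.
Hypothesis g_mono : forall s t, 0 <= s -> s <= t -> <<s g s >> `<=` <<s g t >>.
Variable tau : Omega -> \bar R.
Hypothesis tau_range : forall w, (0 <= tau w <= S%:E)%E \/ tau w = +oo%E.
Hypothesis tau_stopping : forall t, 0 <= t <= S -> <<s g t >> [set w | (tau w <= t%:E)%E].
Local Notation cE := (cexpectation P).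
Variable xi : R -> Omega -> R[i].
Hypothesis mxi : forall s, 0 <= s <= S -> cmfun (xi s : g_sigma_algebraType (g s) -> R[i]).
Hypothesis Ixi : forall s, 0 <= s <= S -> cintegrable P (xi s).
Hypothesis xi_martingale : forall s A, 0 <= s <= S -> <<s g s >> A ->
  cE (fun w => (\1_A w)%:C * xi s w) = cE (fun w => (\1_A w)%:C * xi S w).
Hypothesis xi_continuous : forall w (u : nat -> R) r, (forall n, 0 <= u n <= S) -> 0 <= r <= S ->
  u @ \oo --> r -> ccvg (fun n => xi (u n) w) (xi r w).

Definition cstopped w : R[i] := if (tau w < +oo)%E then xi (fine (tau w)) w else 0.

Lemma complex_sampling : cintegrable P cstopped /\
  forall A, (forall t, 0 <= t <= S -> <<s g t >> (A `&` [set w | (tau w <= t%:E)%E])) ->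
  cE (fun w => (\1_(A `&` [set w | (tau w < +oo)%E]) w)%:C * cstopped w) =
  cE (fun w => (\1_(A `&` [set w | (tau w < +oo)%E]) w)%:C * xi S w).
Proof.
have er : (fun w => complex.Re (cstopped w)) = stopped_value tau (fun t w => complex.Re (xi t w)).
  by apply/funext => w; rewrite /cstopped /stopped_value; case: ifP.
have ei : (fun w => complex.Im (cstopped w)) = stopped_value tau (fun t w => complex.Im (xi t w)).
  by apply/funext => w; rewrite /cstopped /stopped_value; case: ifP.
have martr s A : 0 <= s <= S -> <<s g s >> A ->
    (\int[P]_w (\1_A w * complex.Re (xi s w)))%R = (\int[P]_w (\1_A w * complex.Re (xi S w)))%R.
  by move=> sS GA; have := xi_martingale sS GA; rewrite !cE_indicE => -[].
have marti s A : 0 <= s <= S -> <<s g s >> A ->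
    (\int[P]_w (\1_A w * complex.Im (xi s w)))%R = (\int[P]_w (\1_A w * complex.Im (xi S w)))%R.
  by move=> sS GA; have := xi_martingale sS GA; rewrite !cE_indicE => -[].
have mr s (sS : 0 <= s <= S) := (mxi sS).1; have mi s (sS : 0 <= s <= S) := (mxi sS).2.
have Ir s (sS : 0 <= s <= S) := (Ixi sS).1; have Ii s (sS : 0 <= s <= S) := (Ixi sS).2.
have cr w u r h1 h2 h3 := (@xi_continuous w u r h1 h2 h3).1.
have ci w u r h1 h2 h3 := (@xi_continuous w u r h1 h2 h3).2.
have Jr := stopped_value_integrable S_ge0 gM g_mono tau_range tau_stopping
  (xi := fun t w => complex.Re (xi t w)) mr Ir martr cr.
have Ji := stopped_value_integrable S_ge0 gM g_mono tau_range tau_stopping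
  (xi := fun t w => complex.Im (xi t w)) mi Ii marti ci.
split; first by split; [rewrite -er in Jr|rewrite -ei in Ji].
move=> A HA; rewrite !cE_indicE; apply: complexP => /=.
  have := optional_sampling S_ge0 gM g_mono tau_range tau_stopping
    (xi := fun t w => complex.Re (xi t w)) mr Ir martr cr HA.
  by rewrite -er.
have := optional_sampling S_ge0 gM g_mono tau_range tau_stopping
  (xi := fun t w => complex.Im (xi t w)) mi Ii marti ci HA.
by rewrite -ei.
Qed.
End complex_sampling.

Section projection.
Context {R : realType} {disp : measure_display} {Omega : measurableType disp}.
Variable P : probability Omega R.
Variables (d : nat) (X Y : R -> Omega -> 'rV[R]_d).
Hypotheses (X_BM : brownian_motion P X) (Y_BM : brownian_motion P Y).
Hypothesis XY_indep : independent_processes P X Y.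
Hypothesis P_complete : measure_is_complete P.
Variables (p T : R) (M : R -> Omega -> R[i]).
Hypotheses (p_gt1 : 1 < p) (T_gt0 : 0 < T).
Local Notation cE := (cexpectation P).
Local Notation Z t w := (cvec (X t w) (Y t w)).
Local Notation q := (p / (p - 1)).
Local Notation gZ := (gZ P X Y).
Local Notation gX := (gX P X).
Hypothesis M_martingale :
  Lp_martingale P (augmented_filtration P (fun t w => realify (Z t w))) p T M.
Hypothesis M_X : forall t, 0 <= t <= T -> cmeasurable setT (sigma_of X [set t]) (M t).
Local Notation f := (f_of P X T (M T)).
Local Notation bridge := (bridge_transform P X T (M T)).
Variable S : R.
Hypotheses (S_ge0 : 0 <= S) (SM : S * Num.max p q < T).

Let T0 : 0 <= T. Proof. exact: ltW. Qed.
Let MT_Lp : in_Lp P p (M T).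
Proof. by have [_ h _] := M_martingale; apply: h; rewrite T0 lexx. Qed.
Let UG i : gaussian P (fun w => X T w ord0 i) T. Proof. exact: (X_gaussian X_BM). Qed.
Let Uprod := fun h : 'I_d -> R -> R[i] => @X_product _ _ _ P d X Y X_BM Y_BM XY_indep T h T0.
Let mXT i : measurable_fun setT (fun w => X T w ord0 i). Proof. exact: (X_measurable X_BM). Qed.
Let ST : S < T. Proof. by have [] := max_bounds p_gt1 S_ge0 SM. Qed.
Let mx0 : 0 <= Num.max p q.
Proof. by rewrite le_max ltW // (lt_trans _ p_gt1). Qed.
Let sM s : s <= S -> s * Num.max p q < T.
Proof. by move=> h; apply: le_lt_trans SM; rewrite ler_wpM2r. Qed.
Let sT s : 0 <= s <= S -> 0 <= s < T.
Proof. by move=> /andP[-> h]; exact: le_lt_trans h ST. Qed.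

(** The processes below are set to 0 off this almost sure event, which belongs to every
augmented sigma-field, so that continuity holds for every path. *)
Definition good_path : set Omega := [set w | forall i,
  {within `[0, +oo[, continuous (fun t => X t w ord0 i)} /\
  {within `[0, +oo[, continuous (fun t => Y t w ord0 i)}].

Lemma good_path_ae : {ae P, forall w, good_path w}.
Proof.
apply: filter_forall => i.
have [_ hX _ _] := X_BM.1 i; have [_ hY _ _] := Y_BM.1 i.
by apply: filterS2 hX hY => w [_ a] [_ b].
Qed.

Lemma good_path_sigma t : <<s gX t >> good_path.
Proof.
rewrite -(setCK good_path); apply: (@measurableC _ (g_sigma_algebraType (gX t))).
apply: sub_sigma_algebra; right; exact: good_path_ae.
Qed.

Lemma gX_mono s t : 0 <= s -> s <= t -> <<s gX s >> `<=` <<s gX t >>.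
Proof.
move=> s0 st; apply: sub_sigma_algebra2 => A [[r rs HA]|NA]; last by right.
by left; exists r => //; move: rs; rewrite /= !in_itv /= => /andP[-> h]; exact: le_trans st.
Qed.

Lemma gZ_mono s t : 0 <= s -> s <= t -> <<s gZ s >> `<=` <<s gZ t >>.
Proof.
move=> s0 st; apply: sub_sigma_algebra2 => A [[r rs HA]|NA]; last by right.
by left; exists r => //; move: rs; rewrite /= !in_itv /= => /andP[-> h]; exact: le_trans st.
Qed.

Let gXM t : <<s gX t >> `<=` measurable. Proof. exact: (gX_measurable X_BM Y_BM P_complete). Qed.
Let gZM t : <<s gZ t >> `<=` measurable. Proof. exact: (gZ_measurable X_BM Y_BM P_complete). Qed.

Definition f_process t w : R[i] := (\1_good_path w)%:C * f (Z t w).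
Definition bridge_process t w : R[i] := (\1_good_path w)%:C * bridge t (X t w).

Let good1 : {ae P, forall w, (\1_good_path w : R) = 1}.
Proof. by apply: filterS good_path_ae => w h; rewrite indicE mem_set. Qed.

Lemma f_process_fun s : 0 <= s <= S -> cmfun (f_process s : g_sigma_algebraType (gZ s) -> R[i]).
Proof.
move=> /andP[s0 sS]; apply: cmfunM.
  apply: cmfun_real; apply: (@measurable_indic _ (g_sigma_algebraType (gZ s))).
  by apply: gX_sub_gZ; exact: good_path_sigma.
have ss : 0 <= s <= s by rewrite s0 lexx.
exact: (f_of_fun Y X_BM T_gt0 MT_Lp ss).
Qed.

Lemma bridge_process_fun s : 0 <= s <= S ->
  cmfun (bridge_process s : g_sigma_algebraType (gX s) -> R[i]).
Proof.
move=> /andP[s0 sS]; apply: cmfunM.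
  apply: cmfun_real; apply: (@measurable_indic _ (g_sigma_algebraType (gX s))).
  exact: good_path_sigma.
by apply: (bridge_transform_fun X_BM T_gt0 MT_Lp); rewrite s0 lexx.
Qed.

Let mgood : measurable good_path. Proof.
have h := @good_path_sigma 0.
exact: (gX_measurable X_BM Y_BM P_complete h).
Qed.

Let f_int s : 0 <= s <= S -> cintegrable P (fun w => f (Z s w)).
Proof.
move=> /andP[s0 sS]; exact: (f_of_integrable X_BM Y_BM XY_indep P_complete p_gt1 T_gt0 MT_Lp s0 (sM sS)).
Qed.
Let bridge_int s : 0 <= s <= S -> cintegrable P (fun w => bridge s (X s w)).
Proof. by move=> /sT sT'; exact: (bridge_integrable X_BM Y_BM XY_indep p_gt1 T_gt0 M_martingale). Qed.

Let cE_good (h : Omega -> R[i]) A : measurable A -> cintegrable P h ->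
  cE (fun w => (\1_A w)%:C * ((\1_good_path w)%:C * h w)) = cE (fun w => (\1_A w)%:C * h w).
Proof.
move=> mA ch; apply: ae_eq_cE.
- exact: cintegrable_cmfun (cintegrable_indic mA (cintegrable_indic mgood ch)).
- exact: cintegrable_cmfun (cintegrable_indic mA ch).
- by apply: filterS good1 => w ->; rewrite mul1r.
Qed.

Lemma f_process_martingale s A : 0 <= s <= S -> <<s gZ s >> A ->
  cE (fun w => (\1_A w)%:C * f_process s w) = cE (fun w => (\1_A w)%:C * f_process S w).
Proof.
move=> sS GA; have mA := gZM GA; have [s0 sS'] := andP sS.
rewrite !cE_good //; [|by apply: f_int; rewrite S_ge0 lexx|exact: f_int].
exact: (f_martingale X_BM Y_BM XY_indep P_complete p_gt1 T_gt0 M_martingale).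
Qed.

Lemma bridge_process_martingale s A : 0 <= s <= S -> <<s gX s >> A ->
  cE (fun w => (\1_A w)%:C * bridge_process s w) = cE (fun w => (\1_A w)%:C * bridge_process S w).
Proof.
move=> sS GA; have mA := gXM GA; have [s0 sS'] := andP sS.
have SS : 0 <= S <= S by rewrite S_ge0 lexx.
rewrite !cE_good //; [|exact: bridge_int|exact: bridge_int].
have eM t : 0 <= t <= S -> cE (fun w => (\1_A w)%:C * bridge t (X t w)) = cE (fun w => (\1_A w)%:C * M t w).
  move=> tS; have [t0 tT] := andP (sT tS).
  apply: ae_eq_cE.
  - exact: cintegrable_cmfun (cintegrable_indic mA (bridge_int tS)).
  - apply: cintegrable_cmfun; apply: cintegrable_indic => //.
    by apply: (M_integrable M_martingale); rewrite t0 ltW.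
  - by apply: filterS (M_bridge X_BM Y_BM XY_indep P_complete p_gt1 T_gt0 M_martingale M_X (sT tS)) => w ->.
rewrite !eM //; apply: (martingale_cE X_BM Y_BM P_complete M_martingale) => //.
  exact: ltW.
exact: gX_sub_gZ GA.
Qed.

Lemma f_process_continuous w (u : nat -> R) (r : R) : (forall n, 0 <= u n <= S) -> 0 <= r <= S ->
  u @ \oo --> r -> ccvg (fun n => f_process (u n) w) (f_process r w).
Proof.
move=> uS /andP[r0 rS] ur; rewrite /f_process; have [gw|gw] := pselect (good_path w); last first.
  rewrite indicE memNset // mul0r; under eq_fun do rewrite mul0r; exact: ccvg_cst.
apply: ccvgM; first exact: ccvg_cst.
have u0 n : 0 <= u n by have /andP[] := uS n.
have cZ i : ccvg (fun n => Z (u n) w ord0 i) (Z r w ord0 i).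
  have [a b] := gw i; rewrite mxE; under eq_fun do rewrite mxE.
  by split; [exact: within_seq a u0 r0 ur|exact: within_seq b u0 r0 ur].
have /choice [B HB] : forall i, exists B, forall n, normc (Z (u n) w ord0 i) <= B.
  move=> i; have [a b] := cZ i; have [B1 H1] := cvg_bound a; have [B2 H2] := cvg_bound b.
  by exists (B1 + B2) => n; apply: le_trans (normc_le_ReIm _) _; exact: lerD.
apply: (transform_dominated UG Uprod p_gt1 MT_Lp (kap := fun n v => kernel T (X T) (Z (u n) w) v)
  (a := fun i => B i / T) (c := fun i => B i ^+ 2 / (2 * T))).
- by move=> n; exact: cmfun_kernel UG _.
- by move=> v; apply: ccvg_prod => i; exact: ccvg_kernel1.
move=> n v; rewrite normc_prod; apply: ler_prod => i _; rewrite normc_ge0 /=.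
apply: le_trans (normc_kernel1_le _ _ T_gt0) _; rewrite ler_expR.
have iT : 0 <= T^-1 by rewrite invr_ge0.
have B0 : 0 <= B i by apply: le_trans (HB i 0%N); exact: normc_ge0.
apply: lerD; first by rewrite ler_wpM2r // ler_wpM2r.
rewrite ler_wpM2r ?invr_ge0 ?mulr_ge0 //.
by rewrite lerXn2r ?nnegrE ?normc_ge0.
Qed.

Lemma bridge_process_continuous w (u : nat -> R) (r : R) : (forall n, 0 <= u n <= S) -> 0 <= r <= S ->
  u @ \oo --> r -> ccvg (fun n => bridge_process (u n) w) (bridge_process r w).
Proof.
move=> uS rS ur; have [r0 rS'] := andP rS.
rewrite /bridge_process; have [gw|gw] := pselect (good_path w); last first.
  rewrite indicE memNset // mul0r; under eq_fun do rewrite mul0r; exact: ccvg_cst.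
apply: ccvgM; first exact: ccvg_cst.
have u0 n : 0 <= u n by have /andP[] := uS n.
have cX i : (fun n => X (u n) w ord0 i) @ \oo --> X r w ord0 i.
  by have [a _] := gw i; exact: within_seq a u0 r0 ur.
have /choice [B HB] : forall i, exists B, forall n, `|X (u n) w ord0 i| <= B.
  by move=> i; exact: cvg_bound (cX i).
pose K := (Num.sqrt (1 - S / T))^-1.
have K0 : 0 < K by rewrite invr_gt0 sqrtr_gt0 subr_gt0 ltr_pdivrMr // mul1r.
apply: (transform_dominated UG Uprod p_gt1 MT_Lp (kap := fun n v => (pbridge T (u n) (X (u n) w) (X T v))%:C)
  (a := fun i => B i / (T - S)) (c := fun=> ln K)).
- by move=> n; apply: cmfun_real; apply: measurable_prod => i _; exact: measurable_bridge1_joint.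
- move=> v.
  have -> : (fun n => (pbridge T (u n) (X (u n) w) (X T v))%:C) =
     (fun n => \prod_(i < d) (bridge1 T (u n) (X (u n) w ord0 i) (X T v ord0 i))%:C).
    by apply/funext => n; rewrite /pbridge rmorph_prod.
  rewrite /pbridge rmorph_prod; apply: ccvg_prod => i; split; last exact: cvg_cst.
  apply: cvg_bridge1 => //; exact: le_lt_trans rS' ST.
move=> n v; rewrite normc_real ger0_norm ?pbridge_ge0 //; apply: ler_prod => i _.
rewrite bridge1_ge0 expRD lnK ?posrE // mulrC.
by apply: bridge1_le => //.
Qed.

(** Completeness: a function that agrees with a measurable one off a null set is measurable. *)
Lemma complete_cmfun (h k : Omega -> R[i]) : cmfun h -> (forall w, good_path w -> k w = h w) -> cmfun k.
Proof.
move=> [hr hi] hk.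
have key (a b : Omega -> R) : measurable_fun setT a -> (forall w, good_path w -> b w = a w) ->
    measurable_fun setT b.
  move=> ma ab _ B mB; rewrite setTI.
  have -> : b @^-1` B = (good_path `&` (a @^-1` B)) `|` (~` good_path `&` b @^-1` B).
    apply/seteqP; split => w /=.
      by move=> Bw; have [gw|gw] := pselect (good_path w); [left; rewrite -ab|right].
    by move=> [[gw Bw]|[]//]; rewrite ab.
  apply: measurableU; first by apply: measurableI => //; rewrite -[X in measurable X]setTI; exact: ma.
  by apply: P_complete; apply: negligibleS good_path_ae => w [].
by split; [apply: key hr _ => w /hk ->|apply: key hi _ => w /hk ->].
Qed.

(** Both sampled processes are replaced by their values at S, where the X-projection of f(Z_S)
is known. The sampled f(Z) is measurable by completeness only, since paths are continuous off a
null set. *)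
Lemma sampled_projection tau : predictable_time S (augmented_filtration P X) tau ->
  is_cond_expectation P (sigma_before S (augmented_filtration P X) tau)
    (fun w => if (tau w < +oo)%E then f (Z (fine (tau w)) w) else 0)
    (cstopped tau bridge_process).
Proof.
move=> tauP; have [tau_range _] := tauP.
have stX t : 0 <= t <= S -> <<s gX t >> [set w | (tau w <= t%:E)%E].
  by move=> tS; exact: (predictable_stopping (g := gX) gX_mono tauP tS).
have stZ t : 0 <= t <= S -> <<s gZ t >> [set w | (tau w <= t%:E)%E].
  by move=> tS; apply: gX_sub_gZ; exact: stX.
have fpi s : 0 <= s <= S -> cintegrable P (f_process s).
  by move=> sS; apply: cintegrable_indic => //; exact: f_int.
have bpi s : 0 <= s <= S -> cintegrable P (bridge_process s).
  by move=> sS; apply: cintegrable_indic => //; exact: bridge_int.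
have [cb Eb] := complex_sampling S_ge0 gXM gX_mono tau_range stX bridge_process_fun bpi
  bridge_process_martingale bridge_process_continuous.
have [cf Ef] := complex_sampling S_ge0 gZM gZ_mono tau_range stZ f_process_fun fpi
  f_process_martingale f_process_continuous.
pose fs w := if (tau w < +oo)%E then f (Z (fine (tau w)) w) else 0.
have fsE w : good_path w -> fs w = cstopped tau f_process w.
  by move=> gw; rewrite /fs /cstopped /f_process indicE mem_set //; case: ifP => // _; rewrite mul1r.
have mfs : cmfun fs := complete_cmfun (cintegrable_cmfun cf) fsE.
have aefs : {ae P, forall w, fs w = cstopped tau f_process w}.
  by apply: filterS good_path_ae => w /fsE.
have cfs : cintegrable P fs.
  apply: cintegrableP => //.
  have -> : (\int[P]_w (normc (fs w))%:E = \int[P]_w (normc (cstopped tau f_process w))%:E)%E.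
    apply: ae_eq_integral => //.
    - by apply/measurable_EFinP; exact: measurable_normc.
    - by apply/measurable_EFinP; apply: measurable_normc; exact: cintegrable_cmfun cf.
    - by apply: filterS aefs => w -> _.
  exact: cintegrable_lty.
have SBM : sigma_before S (augmented_filtration P X) tau `<=` measurable.
  apply: g_sigma_measurable => A [GA|[t [A' [t0 tS GA ->]]]]; first exact: gXM GA.
  apply: measurableI; first exact: gXM GA.
  have -> : [set w | (t%:E < tau w)%E] = ~` [set w | (tau w <= t%:E)%E].
    by apply/seteqP; split => w /=; [move=> h; apply/negP; rewrite -ltNge|move=> /negP; rewrite -ltNge].
  by apply: measurableC; apply: (gXM (t := t)); apply: stX; rewrite t0.
apply/(is_cond_expectationP P _ _ SBM); split => //.
- have [pr pi] := predictable_left_continuous S_ge0 bridge_process_fun bridge_process_continuous.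
  have key (a : R[i] -> R) B : a 0 = 0 ->
      predictable_sigma S (fun t => <<s gX t >>) ((`[0, S]%classic `*` setT) `&`
         (fun x => a (bridge_process x.1 x.2)) @^-1` B) ->
      sigma_before S (augmented_filtration P X) tau (setT `&` (fun w => a (cstopped tau bridge_process w)) @^-1` B).
    move=> a0 hB.
    have h1 := predictable_graph S_ge0 tau_range hB.
    have h2 := sigma_before_finite S_ge0 tau_range (g := gX).
    rewrite setTI.
    have [B0|nB0] := pselect (B 0).
      have := @measurableU _ (g_sigma_algebraType _) _ _ h1 (@measurableC _ (g_sigma_algebraType _) _ h2).
      congr (sigma_before _ _ _ _); apply/seteqP; split => w /=; rewrite /cstopped.
        by move=> [[-> [_]]//|/negP/negbTE ->]; rewrite a0.
      case: ifPn => [fin h|/negP fin h]; [left; split => //; split => //|by right].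
      by split => //=; rewrite in_itv /=; have [_] := tau_fineK tau_range fin.
    move: h1; congr (sigma_before _ _ _ _); apply/seteqP; split => w /=; rewrite /cstopped.
      by move=> [-> [_]].
    case: ifP => [fin h|_]; last by rewrite a0.
    by split => //; split => //; split => //=; rewrite in_itv /=; have [_] := tau_fineK tau_range fin.
  split=> _ [B mB <-].
    by apply: (key (@complex.Re R)) => //; apply: pr; exists B.
  by apply: (key (@complex.Im R)) => //; apply: pi; exists B.
move=> A SA; have mA := SBM _ SA.
have HA := sigma_before_stopped (g := gX) gX_mono stX SA.
have HAZ t : 0 <= t <= S -> <<s gZ t >> (A `&` [set w | (tau w <= t%:E)%E]).
  by move=> tS; apply: gX_sub_gZ; exact: HA.
set E := A `&` [set w | (tau w < +oo)%E].
have SS : 0 <= S <= S by rewrite S_ge0 lexx.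
have GE : <<s gX S >> E.
  have := HA _ SS; congr (<<s gX S >> _); rewrite /E; congr (_ `&` _).
  by apply/seteqP; split => w /=; rewrite (tau_finite tau_range).
have mE := gXM GE.
have cut (h : Omega -> R[i]) : (forall w, ~~ (tau w < +oo)%E -> h w = 0) ->
    cE (fun w => (\1_A w)%:C * h w) = cE (fun w => (\1_E w)%:C * h w).
  move=> h0; apply: eq_cE => w; rewrite !indicE /E in_setI.
  have [fin|nfin] := boolP (tau w < +oo)%E; last by rewrite h0 // !mulr0.
  by rewrite (_ : w \in [set w | (tau w < +oo)%E]) ?andbT // inE.
rewrite cut; last by move=> w /negbTE h; rewrite /cstopped h.
rewrite (Eb A HA) cE_good //; last exact: bridge_int.
rewrite -(bridge_X_projection X_BM Y_BM XY_indep P_complete p_gt1 T_gt0 M_martingale S_ge0 SM GE).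
rewrite -cE_good //; last exact: f_int.
rewrite -(Ef A HAZ) (cut fs); last by move=> w /negbTE h; rewrite /fs h.
apply: ae_eq_cE.
- exact: cintegrable_cmfun (cintegrable_indic mE cf).
- exact: cintegrable_cmfun (cintegrable_indic mE cfs).
- by apply: filterS aefs => w ->.
Qed.

Lemma projection_exists :
  is_predictable_projection P S (augmented_filtration P X) (fun s w => f (Z s w)) bridge_process.
Proof.
split; first exact: (predictable_left_continuous S_ge0 bridge_process_fun bridge_process_continuous).
move=> tau tauP; exists (cstopped tau bridge_process); first exact: sampled_projection.
by apply: aeW => w h; rewrite /cstopped h.
Qed.

(** The time coordinate itself is a continuous adapted process. *)
Lemma constant_predictable s : 0 <= s <= S ->
  predictable_time S (augmented_filtration P X) (fun=> s%:E).
Proof.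
move=> /andP[s0 sS]; split; first by move=> w; left; rewrite !lee_fin s0.
have [h _] := predictable_left_continuous S_ge0 (g := gX) (N := fun t _ => t%:C)
  (fun t _ => cmfun_cst _) (fun w u r _ _ ur => conj ur (cvg_cst 0)).
have := h _ (ex_intro2 _ _ `[s, +oo[%classic (measurable_itv _) erefl).
congr (predictable_sigma _ _ _); apply/seteqP; split => x /=.
  by rewrite !in_itv /= andbT lee_fin => -[[-> _] ->].
by rewrite !in_itv /= andbT lee_fin => -[-> ->].
Qed.

(** A constant time is predictable, and there the projection of [projection_exists] is M_s. *)
Lemma projection_value N :
  is_predictable_projection P S (augmented_filtration P X) (fun s w => f (Z s w)) N ->
  forall s, 0 <= s <= S -> {ae P, forall w, N s w = M s w}.
Proof.
move=> [_ HN] s sS.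
have tauP := constant_predictable sS.
have [V HV VN] := HN _ tauP.
have HB := sampled_projection tauP.
have SBM : sigma_before S (augmented_filtration P X) (fun=> s%:E) `<=` measurable.
  apply: g_sigma_measurable => A [GA|[t [A' [t0 tS GA ->]]]]; first exact: gXM GA.
  apply: measurableI; first exact: gXM GA.
  have [lt|ge] := boolP (t%:E < s%:E)%E.
    have -> : [set _ : Omega | true] = setT by apply/seteqP; split.
    exact: measurableT.
  have -> : [set _ : Omega | false] = set0 by apply/seteqP; split.
  exact: measurable0.
have [_ cV mV EV] := (is_cond_expectationP P _ _ SBM).1 HV.
have [_ cB mB EB] := (is_cond_expectationP P _ _ SBM).1 HB.
have VB : {ae P, forall w, V w = cstopped (fun=> s%:E) bridge_process w}.
  apply: (cond_expectation_unique SBM mV mB cV cB) => A SA.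
  by rewrite EV // EB.
have Mb := M_bridge X_BM Y_BM XY_indep P_complete p_gt1 T_gt0 M_martingale M_X (sT sS).
have fin : (s%:E < +oo :> \bar R)%E by exact: ltry.
have NB : {ae P, forall w, N s w = cstopped (fun=> s%:E) bridge_process w}.
  by apply: filterS2 VN VB => w /(_ fin) <-.
have BM : {ae P, forall w, cstopped (fun=> s%:E) bridge_process w = M s w}.
  by apply: filterS2 good1 Mb => w g1 ->; rewrite /cstopped fin /bridge_process g1 mul1r.
by apply: filterS2 NB BM => w -> ->.
Qed.
End projection.

(** * The representation theorem *)

Lemma mhermite_familyE (R : realType) (H : nat -> R -> R -> R) d (a : multi_index d) (t : R)
    (x : 'rV[R]_d) : hermite_family H ->
  mhermite H a t x = (mfact a)%:R * \prod_(i < d) hermite_coeff t (x ord0 i) (a i).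
Proof.
move=> HH; rewrite /mhermite /mfact natr_prod -big_split /=; apply: eq_bigr => i _.
exact: hermite_familyE.
Qed.

Lemma mhermite_L2_norm (R : realType) (disp : measure_display) (Omega : measurableType disp)
    (P : probability Omega R) (d : nat) (X Y : R -> Omega -> 'rV[R]_d)
    (H : nat -> R -> R -> R) (a : multi_index d) (t : R) :
  brownian_motion P X -> brownian_motion P Y -> independent_processes P X Y ->
  hermite_family H -> 0 <= t ->
  ('N[P]_2%:E[EFin \o (fun w => mhermite H a t (X t w))])%E =
  (Num.sqrt ((mfact a)%:R * t ^+ mabs a))%:E.
Proof.
move=> X_BM Y_BM XY_indep HH t0; pose Ha w := mhermite H a t (X t w).
pose mh w := mhermite_coeff t (X t) a w.
have HaE w : Ha w = (mfact a)%:R * mh w by rewrite /Ha (mhermite_familyE _ _ _ HH).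
pose v : R := (mfact a)%:R * t ^+ mabs a.
have v0 : 0 <= v by rewrite mulr_ge0 // exprn_ge0.
have mmh : measurable_fun setT (fun w => (mh w ^+ 2)%:E).
  by apply/measurable_EFinP; apply: measurable_funX; exact: (measurable_mhermite_coeff X_BM a t0).
have sq0 w : (0 <= (mh w ^+ 2)%:E)%E by rewrite lee_fin sqr_ge0.
have c0 : (0 <= ((mfact a)%:R ^+ 2 : R)%:E)%E by rewrite lee_fin sqr_ge0.
have e : (\int[P]_w ((Ha w ^+ 2)%:E) = v%:E)%E.
  have -> : (fun w => (Ha w ^+ 2)%:E) = (fun w => (((mfact a)%:R ^+ 2)%:E * (mh w ^+ 2)%:E)%E).
    by apply/funext => w; rewrite HaE exprMn EFinM.
  rewrite (ge0_integralZl P measurableT mmh (fun w _ => sq0 w) c0).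
  rewrite (mhermite_norm X_BM Y_BM XY_indep a t0) -EFinM; congr (_%:E).
  rewrite /v /mfact natr_prod /mabs -prodrXr expr2 -mulrA; congr (_ * _).
  rewrite -big_split /=; apply: eq_bigr => i _.
  by rewrite mulrC divfK // pnatr_eq0 -lt0n fact_gt0.
rewrite unlock -[X in _ = X%:E]powR12_sqrt // -poweR_EFin; congr (_ `^ _)%E.
rewrite -e; apply: eq_integral => w _; rewrite -[LHS]/((`|Ha w|%:E `^ 2)%E) poweR_EFin.
by rewrite -[2]/(2%:R) powR_mulrn // real_normK ?num_real.
Qed.

Theorem theorem3p4 (R : realType) (disp : measure_display)
    (Omega : measurableType disp) (P : probability Omega R)
    (P_complete : measure_is_complete P)
    (d : nat) (X Y : R -> Omega -> 'rV[R]_d)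
    (X_BM : brownian_motion P X) (Y_BM : brownian_motion P Y)
    (XY_indep : independent_processes P X Y)
    (H : nat -> R -> R -> R) (H_hermite : hermite_family H)
    (p T : R) (p_gt1 : 1 < p) (T_gt0 : 0 < T) (M : R -> Omega -> R[i]) :
  let Z := fun t w => cvec (X t w) (Y t w) in
  let F := augmented_filtration P (fun t w => realify (Z t w)) in
  let FX := augmented_filtration P X in
  Lp_martingale P F p T M ->
  (forall t, 0 <= t <= T -> cmeasurable setT (sigma_of X [set t]) (M t)) ->
  exists (b : multi_index d -> R[i]) (f : 'rV[R[i]]_d -> R[i]),
  [/\ forall (a : multi_index d) (t : R), 0 < t <= T ->
        let Ha := fun w => mhermite H a t (X t w) in
        let MH := fun w => M t w * (Ha w)%:C in
        let norm2 := ('N[P]_2%:E[EFin \o Ha])%E in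
        [/\ cintegrable P MH,
            b a = cexpectation P MH / ((fine norm2) ^+ 2)%:C,
            (norm2 ^+ 2 = ((mfact a)%:R * t ^+ mabs a)%:E)%E
          & b a = cexpectation P MH / ((mfact a)%:R * t ^+ mabs a)%:C],
      forall z, has_sum (fun a => b a * mpow z a) (f z),
      analytic_of_order2 f,
      forall (z : 'rV[R[i]]_d) (t : R), 0 < t <= T ->
        let ME := fun w =>
          M t w * cexp ((t^-1)%:C * (cdot z (X t w) - csqr z / 2%:R)) in
        cintegrable P ME /\ f z = cexpectation P ME
    & forall S : R, 0 <= S -> S < (Num.max p (p / (p - 1)))^-1 * T ->
        let fZ := fun s w => f (Z s w) in
        [/\ Lp_martingale P F p S fZ,
            exists N, is_predictable_projection P S FX fZ N
          & forall N, is_predictable_projection P S FX fZ N ->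
              forall s, 0 <= s <= S -> {ae P, forall w, N s w = M s w}]].
Proof.
Proof.
move=> Z F FX M_mart M_X.
have T0 : 0 <= T by exact: ltW.
have SS : 0 < T <= T by rewrite T_gt0 lexx.
have MLp t : 0 <= t <= T -> in_Lp P p (M t) by have [_ h _] := M_mart; exact: h.
have G t (t0 : 0 <= t) i := X_gaussian X_BM i t0.
have Pr t (t0 : 0 <= t) := fun h : 'I_d -> R -> R[i] => @X_product _ _ _ P d X Y X_BM Y_BM XY_indep t h t0.
pose b := hermite_transform_coeff P T (X T) (M T).
have fE z t : 0 < t <= T -> transform P t (X t) (M t) z = f_of P X T (M T) z.
  exact: (transform_eq X_BM Y_BM XY_indep P_complete p_gt1 T_gt0 M_mart M_X).
exists b, (f_of P X T (M T)); split.
- move=> a t tT Ha MH norm2; have [t0 tT'] := andP tT; have t0' := ltW t0.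
  have tT0 : 0 <= t <= T by rewrite t0'.
  pose mh w := mhermite_coeff t (X t) a w.
  have HaE w : Ha w = (mfact a)%:R * mh w by rewrite /Ha (mhermite_familyE _ _ _ H_hermite).
  have MHE : MH = (fun w => ((mfact a)%:R : R)%:C * (M t w * (mh w)%:C)).
    by apply/funext => w; rewrite /MH HaE rmorphM mulrCA.
  have cm : cintegrable P (fun w => M t w * (mh w)%:C).
    exact: (hermite_coeff_kernel_integrable t0 (G t t0') (Pr t t0') p_gt1 (MLp t tT0)).
  have bE : b a = hermite_transform_coeff P t (X t) (M t) a.
    by rewrite (M_transform_coeff X_BM Y_BM XY_indep P_complete p_gt1 T_gt0 M_mart M_X).
  have EMH : cexpectation P MH = ((mfact a)%:R : R)%:C * cexpectation P (fun w => M t w * (mh w)%:C).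
    by rewrite MHE cEZ.
  have f0 : 0 < (mfact a)%:R :> R by rewrite ltr0n prodn_gt0 // => i; exact: fact_gt0.
  pose v : R := (mfact a)%:R * t ^+ mabs a.
  have v0 : 0 < v by rewrite mulr_gt0 // exprn_gt0.
  have nE : norm2 = (Num.sqrt v)%:E.
    exact: (mhermite_L2_norm a X_BM Y_BM XY_indep H_hermite t0').
  have vC : v%:C != 0 :> R[i] by rewrite (inj_eq (@complexI R)) gt_eqF.
  have bv : b a = cexpectation P MH / v%:C.
    have fC : ((mfact a)%:R : R)%:C != 0 :> R[i] by rewrite (inj_eq (@complexI R)) gt_eqF.
    have tC : (t ^+ mabs a)%:C != 0 :> R[i] by rewrite (inj_eq (@complexI R)) gt_eqF // exprn_gt0.
    rewrite bE EMH /hermite_transform_coeff /v rmorphM.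
    by rewrite invfM mulrACA divff // mul1r.
  split.
  + by rewrite MHE; exact: cintegrableZ.
  + by rewrite nE /= sqr_sqrtr ?(ltW v0).
  + by rewrite nE -EFin_expe sqr_sqrtr ?(ltW v0).
  + exact: bv.
- move=> z; exact: (transform_has_sum T_gt0 (G T T0) (Pr T T0) p_gt1 (MLp T (introT andP (conj T0 (lexx T)))) z).
- have L := MLp T (introT andP (conj T0 (lexx T))).
  split; first exact: (transform_entire T_gt0 (G T T0) (Pr T T0) p_gt1 L).
  exact: (transform_order2 T_gt0 (G T T0) (Pr T T0) p_gt1 L).
- move=> z t tT ME; have [t0 tT'] := andP tT; have t0' := ltW t0.
  have L : in_Lp P p (M t) by apply: MLp; rewrite t0'.
  have e : ME = (fun w => M t w * kernel t (X t) z w).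
    by apply/funext => w; rewrite kernelE.
  rewrite e -(fE z t tT); split => //.
  exact: (xi_kernel_integrable t0 (G t t0') (Pr t t0') p_gt1 L).
move=> S S0 Slt fZ.
have mx0 : 0 < Num.max p (p / (p - 1)) by rewrite lt_max (lt_trans _ p_gt1).
have SM : S * Num.max p (p / (p - 1)) < T by rewrite -ltr_pdivlMr // mulrC.
have sM s : s <= S -> s * Num.max p (p / (p - 1)) < T.
  by move=> h; apply: le_lt_trans SM; rewrite ler_wpM2r // ltW.
have L := MLp T (introT andP (conj T0 (lexx T))).
split.
- split.
  + move=> t /andP[t0 tS]; apply/cmeasurableP.
    have tt : 0 <= t <= t by rewrite t0 lexx.
    exact: (f_of_fun Y X_BM T_gt0 L tt).
  + move=> t /andP[t0 tS].
    exact: (f_of_Lp X_BM Y_BM XY_indep P_complete p_gt1 T_gt0 L t0 (sM t tS)).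
  + move=> s t s0 st tS; have t0 := le_trans s0 st.
    have ss : 0 <= s <= s by rewrite s0 lexx.
    apply/(is_cond_expectationP P _ _ (gZ_measurable X_BM Y_BM P_complete (s := s))); split.
    * exact: (f_of_integrable X_BM Y_BM XY_indep P_complete p_gt1 T_gt0 L t0 (sM t tS)).
    * exact: (f_of_integrable X_BM Y_BM XY_indep P_complete p_gt1 T_gt0 L s0 (sM s (le_trans st tS))).
    * by apply/cmeasurableP; exact: (f_of_fun Y X_BM T_gt0 L ss).
    * move=> A GA.
      exact: (f_martingale X_BM Y_BM XY_indep P_complete p_gt1 T_gt0 M_mart s0 st (sM t tS) GA).
- exists (bridge_process P X Y T M).
  exact: (projection_exists X_BM Y_BM XY_indep P_complete p_gt1 T_gt0 M_mart M_X S0 SM).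
- move=> N HN s sS.
  exact: (projection_value X_BM Y_BM XY_indep P_complete p_gt1 T_gt0 M_mart M_X S0 SM HN sS).
Qed.
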